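(* The following identities hold. Values $\mathscr A_{3,n}$: $$\mathscr A_{3,0}=-\tfrac{2^2\zeta_3}{3}+\tfrac{2\pi\operatorname{Im}\mu_2}{3},\qquad \mathscr A_{3,1}=-2(\operatorname{Im}\mu_2)^2,\qquad \mathscr A_{3,2}=-\tfrac{2^2\cdot11\zeta_5}{3^2}+\tfrac{2^2\pi^2\zeta_3}{3^2}+\tfrac{2^3\pi^3\operatorname{Im}\mu_2}{3^3},$$ $$\mathscr A_{3,3}=-2^3\cdot3^2(\operatorname{Re}\mu_{4,2}+\operatorname{Im}\mu_4\operatorname{Im}\mu_2)+2^4\zeta_3^2+2\pi^2(\operatorname{Im}\mu_2)^2-\tfrac{6691\pi^6}{2^3\cdot3^6\cdot5\cdot7},$$ $$\begin{aligned}\mathscr A_{3,4}={}&-\tfrac{6037\zeta_7}{3^3}-2^6\cdot3\operatorname{Re}\mu_{4,1,2}+2^5\cdot5\pi\operatorname{Im}\mu_6+\tfrac{2^2\cdot127\pi^2\zeta_5}{3^3}-2^6\cdot3\operatorname{Im}\mu_2\operatorname{Im}\mu_{4,1}-\tfrac{2^4\pi^3\operatorname{Im}\mu_4}{3^3}\\&-2^5\cdot3\zeta_3(\operatorname{Im}\mu_2)^2-\tfrac{2\cdot491\pi^4\zeta_3}{3^4\cdot5}+\tfrac{2^2\cdot67\pi^5\operatorname{Im}\mu_2}{3^5},\end{aligned}$$ $$\begin{aligned}\mathscr A_{3,5}={}&-2^5\cdot3^3\cdot5(\operatorname{Re}\mu_{6,2}+\operatorname{Im}\mu_6\operatorname{Im}\mu_2)-\tfrac{2^8\cdot5\zeta_{5,3}}{3}+2^5\cdot5\cdot19\zeta_5\zeta_3+2^4\cdot3\cdot5\pi^2(\operatorname{Re}\mu_{4,2}+\operatorname{Im}\mu_4\operatorname{Im}\mu_2)\\&-\tfrac{2^5\cdot5\pi^2\zeta_3^2}{3}+2\cdot3\pi^4(\operatorname{Im}\mu_2)^2-\tfrac{443\cdot1231\pi^8}{2^4\cdot3^7\cdot5\cdot7}.\end{aligned}$$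 Values $\mathscr A_{5,n}$: $$\mathscr A_{5,0}=-\tfrac{19\zeta_5}{3}+2\pi\operatorname{Im}\mu_4+\tfrac{\pi^2\zeta_3}{3^2},\qquad \mathscr A_{5,1}=2^2\cdot3\operatorname{Re}\mu_{4,2}-\tfrac{2^4\zeta_3^2}{3}+\tfrac{6691\pi^6}{2^4\cdot3^7\cdot5\cdot7},$$ $$\mathscr A_{5,2}=-\tfrac{1423\zeta_7}{2^2\cdot3^2}+\tfrac{19\pi^2\zeta_5}{3^2}+\tfrac{2^3\pi^3\operatorname{Im}\mu_4}{3^2}+\tfrac{31\pi^4\zeta_3}{2\cdot3^3\cdot5},$$ $$\mathscr A_{5,3}=-2^2\cdot3^3(\operatorname{Im}\mu_4)^2-2^2\cdot19\zeta_5\zeta_3-2^2\cdot3\pi^2\operatorname{Re}\mu_{4,2}+\tfrac{2^4\pi^2\zeta_3^2}{3}-\tfrac{6691\pi^8}{2^4\cdot3^7\cdot5\cdot7}.$$ Values $\mathscr A_{6,n}$: $$\mathscr A_{6,0}=-\tfrac{2^2\pi\operatorname{Im}\mu_{4,1}}{3}-\tfrac{2^2\zeta_3^2}{3}+\tfrac{13\cdot257\pi^6}{2^4\cdot3^7\cdot5\cdot7},$$ $$\mathscr A_{6,1}=-\tfrac{6037\zeta_7}{2^3\cdot3^4}-2^3\operatorname{Re}\mu_{4,1,2}+\tfrac{2^2\cdot5\pi\operatorname{Im}\mu_6}{3}+\tfrac{61\pi^2\zeta_5}{2\cdot3^4}-\tfrac{2\pi^3\operatorname{Im}\mu_4}{3^4}-\tfrac{653\pi^4\zeta_3}{2^2\cdot3^5\cdot5},$$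 $$\mathscr A_{6,2}=-\tfrac{2^4\pi^3\operatorname{Im}\mu_{4,1}}{3^3}-\tfrac{2^3\cdot11\zeta_{5,3}}{3^2\cdot5}-\tfrac{2^3\cdot11\zeta_5\zeta_3}{3^2}+\tfrac{2^2\pi^2\zeta_3^2}{3^2}+\tfrac{3970097\pi^8}{2^6\cdot3^9\cdot5^3\cdot7}.$$ Values $\mathscr A_{7,n}$: $$\mathscr A_{7,0}=-\tfrac{17\cdot29\zeta_7}{2^3\cdot3}+2\cdot3\pi\operatorname{Im}\mu_6+\tfrac{\pi^2\zeta_5}{3}+\tfrac{17\pi^4\zeta_3}{2^2\cdot3^4\cdot5},$$ $$\mathscr A_{7,1}=2^2\cdot3^2\operatorname{Re}\mu_{6,2}+\tfrac{2^5\zeta_{5,3}}{3^2}-\tfrac{2^3\cdot43\zeta_5\zeta_3}{3^2}+\tfrac{679153\pi^8}{2^7\cdot3^8\cdot5^2\cdot7}.$$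
   Context: For real $x>0$ put $\binom{2x}{x}:=\frac{\Gamma(2x+1)}{[\Gamma(x+1)]^2}$, and for integers $s\ge1$, $n\ge0$ define $$\mathscr A_{s,n}:=\sum_{k=1}^\infty\left.\frac{\partial^n}{\partial x^n}\frac{1}{x^s\binom{2x}{x}}\right|_{x=k}.$$ Multiple zeta values are $\zeta_{a_1,\dots,a_m}:=\sum_{\ell_1>\dots>\ell_m>0}\prod_{j=1}^m\ell_j^{-a_j}$ (so $\zeta_a=\sum_{k\ge1}k^{-a}$, $\zeta_{5,3}=\sum_{m>n>0}m^{-5}n^{-3}$). For positive integers $a_1,\dots,a_n$, the multiple Clausen value (MCV) is $$\mu_{a_1,\dots,a_n}:=\sum_{\ell_1>\dots>\ell_n>0}\frac{e^{\ell_1\pi i/3}}{\ell_1^{a_1}}\prod_{j=2}^n\frac1{\ell_j^{a_j}}$$ (limit as $L\to\infty$ of partial sums over $\ell_1\le L$). *)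

(* Defs.v *)
From Stdlib Require Export Reals List.
From Coquelicot Require Export Coquelicot.
Export ListNotations.
Open Scope R_scope.

(* Euler's integral; it converges for x > 0, the only range that is used. *)
Definition Gamma (x : R) : R :=
  RInt_gen (fun t => Rpower t (x - 1) * exp (- t))
           (at_right 0) (Rbar_locally p_infty).

Definition central_binom (x : R) : R := Gamma (2 * x + 1) / (Gamma (x + 1)) ^ 2.

Definition summand (s : nat) (x : R) : R := 1 / (x ^ s * central_binom x).

(* [is_A s n v] says that A_{s,n} = v: the n-th derivatives d k of the summand
   at x = k exist for all k >= 1, and the sum of the d k over k >= 1 converges
   to v. *)
Definition is_A (s n : nat) (v : R) : Prop :=
  exists d : nat -> R,
    (forall k : nat, (1 <= k)%nat -> is_derive_n (summand s) n (INR k) (d k)) /\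
    is_series (fun k : nat => d (S k)) v.

(* [mhs [a_1; ...; a_m] L] is the sum of prod_j l_j^(-a_j) over
   L >= l_1 > ... > l_m > 0. *)
Fixpoint mhs (a : list nat) (L : nat) : R :=
  match a with
  | [] => 1
  | a1 :: a' => sum_n_m (fun l : nat => / INR l ^ a1 * mhs a' (l - 1)) 1 L
  end.

Definition mzv (a : list nat) : R := real (Lim_seq (mhs a)).

Definition zeta (a : nat) : R := mzv [a].

Definition expi (theta : R) : C := (cos theta, sin theta).

(* The empty index list is never used; its value is the empty product. *)
Definition mcv_partial (a : list nat) (L : nat) : C :=
  match a with
  | [] => RtoC 1
  | a1 :: a' =>
      sum_n_m (fun l : nat =>
        (expi (INR l * PI / 3) * RtoC (/ INR l ^ a1 * mhs a' (l - 1)))%C) 1 L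
  end.

(* The limit of the partial sums over l_1 <= L as L tends to infinity. *)
Definition mu (a : list nat) : C :=
  iota (T := C_CompleteNormedModule)
       (fun z : C => filterlim (mcv_partial a) eventually (locally z)).

(* Main.v *)
(** Put alpha = sqrt 3 dt / (1+t+t^2) and beta = (3/2) (1+t) dt / (1-t^3) on [0,1], and let V(w) be the
    iterated integral from 0 to 1 of a word w in a = alpha, b = beta that does not begin (outermost) with b.
    - Taylor coefficients. With e^theta = (1-t)^2/(1+t+t^2), so that d theta = -2 beta, the sum over k of the
      y^j-coefficients of (k+y)^(-s) times the rational part of 1/binom(2k+2y, k+y) is
      (-1)^j 2^(s-2+j) V(a (b^j sh a b^(s-2))). What remains is Gamma(1+y)^2/Gamma(1+2y), the exponential of a
      power series whose coefficients are zeta values. So A_{s,n} is a polynomial in zeta values and V's.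
    - Clausen values. Along z = u(t) = (1-t) ((1-t)/2 + i sqrt 3/2 (1+t)) / (1+t+t^2), which runs from e^(i pi/3)
      to 0, the forms dz/z and dz/(1-z) are -beta + (i/2) alpha and -i alpha. So the iterated integrals of
      words in these forms up to e^(i pi/3), in particular the mu's, are combinations of V's over Q(i).
    - Relations between the V's: shuffles; multiple zeta values by composing paths along Re z = 1/2 and using
      z -> 1-z; the distribution relation for Re mu_s; stuffles of double zeta values; and, in weights 7 and 8,
      four relations which come from multiplying nested sums by harmonic numbers restricted to a residue class
      mod 3 and letting t -> 1. Gaussian elimination with these relations gives the fifteen values. *)

Require Import Defs.
From Stdlib Require Import Lra Lia Psatz ZArith ZifyNat Factorial.
Open Scope R_scope.
Set Bullet Behavior "Strict Subproofs".
Ltac Zify.zify_post_hook ::= Z.to_euclidean_division_equations.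
Ltac eqR := match goal with |- @eq _ ?x ?y => change (@eq R x y) end.

(** The circle of radius 1 about 1 ties the two sides together. For z = 1 - e^(i phi) one has |z|^2
    = 4 sin^2(phi/2), the substitution of the classical arcsine series for inverse central binomial
    coefficients, and dz/(1-z) is purely imaginary there. The path u is an arc of this circle and t
    is a rational parameter on it. The obstacle is the end t = 1, where beta has a pole and words
    beginning with b diverge. No regularization is set up. Every identity is proved for t < 1 and
    then passed to the limit with two classes of functions: [small] (at most a constant times a
    positive power of 1-t) and [slow] (at most a constant times every negative power). A small
    function times a slow one is small, so a divergent factor does no harm next to one that tends to
    0. A word beginning with a converges because the signs of its Taylor coefficients oscillate mod
    3. The factors sqrt 3 and 3/2 in alpha and beta keep the pullbacks along the arc rational over
    Q(i). The elimination can therefore be run on polynomials with rational coefficients; a common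
    factor pi may be cancelled there, since V(a) = pi/3 is not 0. *)

Definition cderiv (f : R -> C) (t : R) (d : C) :=
  is_derive (fun s => Re (f s)) t (Re d) /\ is_derive (fun s => Im (f s)) t (Im d).

Lemma cderiv_const (c : C) t : cderiv (fun _ => c) t 0.
Proof. split; apply @is_derive_const. Qed.

Lemma cderiv_ext (f g : R -> C) t d : (forall s, f s = g s) -> cderiv f t d -> cderiv g t d.
Proof.
intros E [H1 H2]; split; [apply (is_derive_ext (fun s => Re (f s)))|apply (is_derive_ext (fun s => Im (f s)))]; auto;
intros s; rewrite E; reflexivity.
Qed.

Lemma cderiv_plus f g t d e : cderiv f t d -> cderiv g t e -> cderiv (fun s => f s + g s)%C t (d + e)%C.
Proof.
intros [H1 H2] [H3 H4]; split.
- apply (is_derive_plus (fun s => Re (f s)) (fun s => Re (g s))); assumption.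
- apply (is_derive_plus (fun s => Im (f s)) (fun s => Im (g s))); assumption.
Qed.

Lemma is_derive_mulR (f g : R -> R) t d e :
  is_derive f t d -> is_derive g t e -> is_derive (fun s => f s * g s) t (d * g t + f t * e).
Proof. intros H1 H2; apply (is_derive_mult f g t d e H1 H2); intros; apply Rmult_comm. Qed.

Lemma cderiv_mult f g t d e :
  cderiv f t d -> cderiv g t e -> cderiv (fun s => f s * g s)%C t (d * g t + f t * e)%C.
Proof.
intros [H1 H2] [H3 H4]; split.
- replace (Re _) with ((Re d * Re (g t) + Re (f t) * Re e) - (Im d * Im (g t) + Im (f t) * Im e))
   by (unfold Re, Im; simpl; ring).
  apply (is_derive_minus (fun s => Re (f s) * Re (g s)) (fun s => Im (f s) * Im (g s)));
  apply is_derive_mulR; assumption.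
- replace (Im _) with ((Re d * Im (g t) + Re (f t) * Im e) + (Im d * Re (g t) + Im (f t) * Re e))
   by (unfold Re, Im; simpl; ring).
  apply (is_derive_plus (fun s => Re (f s) * Im (g s)) (fun s => Im (f s) * Re (g s)));
  apply is_derive_mulR; assumption.
Qed.

Lemma cderiv_scal c g t e : cderiv g t e -> cderiv (fun s => c * g s)%C t (c * e)%C.
Proof.
intros H; generalize (cderiv_mult (fun _ => c) g t 0 e (cderiv_const c t) H).
replace (0 * g t + c * e)%C with (c * e)%C by ring; auto.
Qed.

Lemma cderiv_eq f t d e : d = e -> cderiv f t d -> cderiv f t e.
Proof. intros ->; auto. Qed.

Lemma cderiv_RtoC (f : R -> R) t d : is_derive f t d -> cderiv (fun s => RtoC (f s)) t (RtoC d).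
Proof. intros H; split; [exact H|exact (is_derive_const (V := R_NormedModule) 0 t)]. Qed.

Lemma cderiv_zero_const (f : R -> C) a b :
  (forall t, a <= t <= b -> cderiv f t 0) -> a < b -> f a = f b.
Proof.
intros H Hab. apply injective_projections.
- apply (eq_is_derive (fun s => Re (f s)) a b); auto. intros t Ht; apply (H t Ht).
- apply (eq_is_derive (fun s => Im (f s)) a b); auto. intros t Ht; apply (H t Ht).
Qed.

(** Disposes of second-order remainders: in [cderiv_cps] the bound [B] is a constant times |u(s) -
    u(t)|^2, which vanishes at t together with its derivative. *)
Lemma is_derive_squeeze (g B : R -> R) t :
  locally t (fun s => Rabs (g s) <= B s) -> B t = 0 -> is_derive B t 0 -> is_derive g t 0.
Proof.
intros Hl HB HD.
assert (G0 : g t = 0).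
{ assert (H : Rabs (g t) <= B t) by exact (locally_singleton _ _ Hl); rewrite HB in H.
  generalize (Rabs_pos (g t)); intros; apply Rabs_eq_0; lra. }
apply is_derive_Reals; apply is_derive_Reals in HD.
intros eps Heps; destruct (HD eps Heps) as [d Hd], Hl as [d' Hd'].
assert (Hm : 0 < Rmin d d') by (apply Rmin_pos; apply cond_pos).
exists (mkposreal _ Hm); intros h Hh0 Hh; simpl in Hh.
assert (h1 : Rabs h < d) by (eapply Rlt_le_trans; [exact Hh|apply Rmin_l]).
assert (h2 : Rabs h < d') by (eapply Rlt_le_trans; [exact Hh|apply Rmin_r]).
specialize (Hd h Hh0 h1).
assert (Hb : Rabs (g (t + h)) <= B (t + h)).
{ apply Hd'. change (Rabs (t + h - t) < d'). replace (t + h - t) with h by ring; exact h2. }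
eapply Rle_lt_trans; [|exact Hd].
rewrite G0, HB, !Rminus_0_r. unfold Rdiv; rewrite !Rabs_mult.
apply Rmult_le_compat_r; [apply Rabs_pos|].
eapply Rle_trans; [exact Hb|apply Rle_abs].
Qed.

Lemma Cmod_sqr z : Cmod z * Cmod z = Re z * Re z + Im z * Im z.
Proof.
unfold Cmod; rewrite sqrt_sqrt; [unfold Re, Im; ring|].
generalize (pow2_ge_0 (fst z)) (pow2_ge_0 (snd z)); lra.
Qed.

Lemma im_le_Cmod c : Rabs (Im c) <= Cmod c.
Proof.
rewrite <- (Rabs_pos_eq (Cmod c)) by apply Cmod_ge_0.
apply Rsqr_le_abs_0. unfold Rsqr; rewrite Cmod_sqr.
generalize (Rle_0_sqr (Re c)); unfold Rsqr; lra.
Qed.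

(** * Complex power series with real coefficients *)

Definition rad (a : nat -> R) := Rbar_le 1 (CV_radius a).

Lemma rad_abs a r : rad a -> 0 <= r < 1 -> ex_series (fun n => Rabs (a n) * r ^ n).
Proof.
intros Ha Hr.
assert (H : CV_disk a r).
{ apply CV_disk_inside. rewrite Rabs_pos_eq by lra.
  eapply Rbar_lt_le_trans; [|exact Ha]; simpl; lra. }
unfold CV_disk in H; revert H; apply ex_series_ext; intros n.
rewrite Rabs_mult, (Rabs_pos_eq (r ^ n)); auto; apply pow_le; lra.
Qed.

Lemma rad_bounded a M : (forall n, Rabs (a n) <= M) -> rad a.
Proof.
intros H; unfold rad. destruct (CV_radius_bounded a) as [H1 _]. apply H1.
exists M; intros n; rewrite pow1, Rmult_1_r; apply H.
Qed.

Lemma rad_derive a : rad a -> rad (PS_derive a).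
Proof. unfold rad; rewrite CV_radius_derive; auto. Qed.

Lemma rad_incr_1 a : rad a -> rad (PS_incr_1 a).
Proof. unfold rad; rewrite CV_radius_incr_1; auto. Qed.

Lemma rad_opp a : rad a -> rad (PS_opp a).
Proof. unfold rad; rewrite CV_radius_opp; auto. Qed.

(** Two real series instead of one complex series, so that only the convergence theory of real
    series is used. *)
Definition cps (a : nat -> R) (z : C) : C :=
  (Series (fun n => a n * Re (z ^ n)%C), Series (fun n => a n * Im (z ^ n)%C)).

Section Terms.
Variables (a : nat -> R) (z : C).
Hypotheses (Ha : rad a) (Hz : Cmod z < 1).

Lemma cps_abs : ex_series (fun n => Rabs (a n) * Cmod z ^ n).
Proof. apply rad_abs; auto; split; auto; apply Cmod_ge_0. Qed.

Lemma cps_re : ex_series (fun n => a n * Re (z ^ n)%C).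
Proof.
apply @ex_series_le with (2 := cps_abs); intros n; change (norm ?x) with (Rabs x).
rewrite Rabs_mult, <- Cmod_pow; apply Rmult_le_compat_l; [apply Rabs_pos|apply re_le_Cmod].
Qed.

Lemma cps_im : ex_series (fun n => a n * Im (z ^ n)%C).
Proof.
apply @ex_series_le with (2 := cps_abs); intros n; change (norm ?x) with (Rabs x).
rewrite Rabs_mult, <- Cmod_pow; apply Rmult_le_compat_l; [apply Rabs_pos|apply im_le_Cmod].
Qed.
End Terms.

Lemma cps_ext a b z : (forall n, a n = b n) -> cps a z = cps b z.
Proof. intros H; unfold cps; f_equal; apply Series_ext; intros n; rewrite H; auto. Qed.

Lemma cps_plus a b z : rad a -> rad b -> Cmod z < 1 ->
  cps (PS_plus a b) z = (cps a z + cps b z)%C.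
Proof.
intros Ha Hb Hz; unfold cps, Cplus, PS_plus; simpl. f_equal; rewrite <- Series_plus;
try (apply cps_re; assumption); try (apply cps_im; assumption);
apply Series_ext; intros n; change plus with Rplus; simpl; ring.
Qed.

Lemma cps_scal c a z : cps (PS_scal c a) z = (c * cps a z)%C.
Proof.
unfold cps, Cmult, PS_scal; simpl. rewrite !Rmult_0_l, Rminus_0_r, Rplus_0_r.
f_equal; rewrite <- Series_scal_l; apply Series_ext; intros n; change scal with Rmult; simpl; ring.
Qed.

Lemma cps_opp a z : cps (PS_opp a) z = (- cps a z)%C.
Proof.
replace (- cps a z)%C with (RtoC (-1) * cps a z)%C.
- rewrite <- cps_scal; apply cps_ext; intros n. unfold PS_opp, PS_scal.
  change scal with Rmult; change opp with Ropp; simpl; ring.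
- unfold Cmult, Copp; simpl; f_equal; ring.
Qed.

Lemma cps_incr_1 a z : rad a -> Cmod z < 1 -> cps (PS_incr_1 a) z = (z * cps a z)%C.
Proof.
intros Ha Hz; unfold cps at 1.
rewrite (Series_incr_1 (fun n => PS_incr_1 a n * Re (z ^ n)%C)) by
  (apply cps_re; auto; apply rad_incr_1; auto).
rewrite (Series_incr_1 (fun n => PS_incr_1 a n * Im (z ^ n)%C)) by
  (apply cps_im; auto; apply rad_incr_1; auto).
unfold cps, Cmult; simpl PS_incr_1; cbn [fst snd].
change zero with 0; rewrite !Rmult_0_l, !Rplus_0_l.
assert (H1 := cps_re a z Ha Hz); assert (H2 := cps_im a z Ha Hz).
f_equal; rewrite <- !Series_scal_l; [rewrite <- Series_minus|rewrite <- Series_plus];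
 try (apply ex_series_scal_l with (1 := H1)); try (apply ex_series_scal_l with (1 := H2));
 try (apply Series_ext; intros n; rewrite Cpow_S; unfold Cmult, Re, Im; simpl; ring);
 apply (ex_series_scal_l (V := R_NormedModule)); auto.
Qed.

Lemma Cmod_le_Rabs z : Cmod z <= Rabs (Re z) + Rabs (Im z).
Proof.
destruct z as [x y]. replace (x, y) with (RtoC x + Ci * y)%C by
    (unfold Cplus, Cmult, RtoC, Ci; simpl; f_equal; ring).
eapply Rle_trans; [apply Cmod_triangle|]. rewrite Cmod_mult, !Cmod_R, Cmod_Ci.
unfold Re, Im; simpl. rewrite Rmult_1_l; replace (x + (0 * y - 1 * 0)) with x by ring.
replace (0 + (0 * 0 + 1 * y)) with y by ring; lra.
Qed.

Lemma Rabs_Series_le u B : (forall n, Rabs (u n) <= B n) -> ex_series B ->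
  Rabs (Series u) <= Series B.
Proof.
intros H Hs. eapply Rle_trans; [apply Series_Rabs|].
- apply @ex_series_le with (2 := Hs); intros n; change (norm ?x) with (Rabs x).
  rewrite Rabs_Rabsolu; apply H.
- apply Series_le; auto; intros n; split; auto using Rabs_pos.
Qed.

Lemma Series_nonneg B : (forall n, 0 <= B n) -> ex_series B -> 0 <= Series B.
Proof.
intros H Hs. eapply Rle_trans; [apply (Rabs_pos (Series B))|].
apply Rabs_Series_le; auto; intros n; rewrite Rabs_pos_eq; auto; lra.
Qed.

Lemma ex_series_dom u B : (forall n, Rabs (u n) <= B n) -> ex_series B -> ex_series u.
Proof. intros H Hs; apply @ex_series_le with (2 := Hs); exact H. Qed.

Lemma Cmod_Series_le (a : nat -> R) (e : nat -> C) B :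
  (forall n, Rabs (a n) * Cmod (e n) <= B n) -> ex_series B ->
  Cmod (Series (fun n => a n * Re (e n)), Series (fun n => a n * Im (e n))) <= 2 * Series B.
Proof.
intros H Hs; eapply Rle_trans; [apply Cmod_le_Rabs|].
unfold Re at 1, Im at 2; cbn [fst snd].
assert (Rabs (Series (fun n => a n * Re (e n))) <= Series B).
{ apply Rabs_Series_le; auto; intros n; rewrite Rabs_mult; eapply Rle_trans; [|apply H].
  apply Rmult_le_compat_l; [apply Rabs_pos|apply re_le_Cmod]. }
assert (Rabs (Series (fun n => a n * Im (e n))) <= Series B).
{ apply Rabs_Series_le; auto; intros n; rewrite Rabs_mult; eapply Rle_trans; [|apply H].
  apply Rmult_le_compat_l; [apply Rabs_pos|apply im_le_Cmod]. }
lra.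
Qed.

(** The remainder for n+1 is w times the remainder for n plus n z^(n-1) (w-z)^2. The factor n(n-1)
    is twice the optimal one; with it the bound is a term of the second derivative of the series at
    r, hence summable for r < 1. *)
Lemma pow_quadratic (z w : C) r n : Cmod z <= r -> Cmod w <= r ->
  Cmod (w ^ n - z ^ n - INR n * (z ^ (pred n)) * (w - z))%C
   <= INR n * INR (pred n) * r ^ (pred (pred n)) * (Cmod (w - z) * Cmod (w - z)).
Proof.
intros Hz Hw.
assert (Hr : 0 <= r) by (eapply Rle_trans; [apply Cmod_ge_0|exact Hz]).
set (D := Cmod (w - z)). assert (HD : 0 <= D * D) by (apply Rmult_le_pos; apply Cmod_ge_0).
destruct n as [|n].
{ simpl. replace (1 - 1 - 0 * 1 * (w - z))%C with (RtoC 0) by ring. rewrite Cmod_0; lra. }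
induction n as [|n IH].
{ simpl. replace (w * 1 - z * 1 - 1 * 1 * (w - z))%C with (RtoC 0) by ring. rewrite Cmod_0; lra. }
replace (w ^ S (S n) - z ^ S (S n) - INR (S (S n)) * z ^ pred (S (S n)) * (w - z))%C with
  (w * (w ^ S n - z ^ S n - INR (S n) * z ^ pred (S n) * (w - z)) + INR (S n) * z ^ n * ((w - z) * (w - z)))%C.
2:{ rewrite (S_INR (S n)), RtoC_plus. cbn [pred]. rewrite !Cpow_S; generalize (z ^ n)%C (w ^ n)%C (RtoC (INR (S n))); intros p q m. ring. }
eapply Rle_trans; [apply Cmod_triangle|].
rewrite !Cmod_mult, Cmod_pow, Cmod_R, (Rabs_pos_eq (INR (S n))) by apply pos_INR.
fold D.
assert (E1 : Cmod w * Cmod (w ^ S n - z ^ S n - INR (S n) * z ^ pred (S n) * (w - z)) <=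
   r * (INR (S n) * INR (pred (S n)) * r ^ pred (pred (S n)) * (D * D))).
{ apply Rmult_le_compat; auto using Cmod_ge_0. }
assert (E2 : INR (S n) * Cmod z ^ n * (D * D) <= INR (S n) * r ^ n * (D * D)).
{ apply Rmult_le_compat_r; auto; apply Rmult_le_compat_l; [apply pos_INR|].
  apply pow_incr; split; auto using Cmod_ge_0. }
eapply Rle_trans; [apply Rplus_le_compat; [exact E1|exact E2]|].
cbn [pred].
assert (H0 : 0 <= INR (S n) * r ^ n * (D * D)).
{ apply Rmult_le_pos; auto; apply Rmult_le_pos; [apply pos_INR|apply pow_le; auto]. }
assert (E3 : r * (INR (S n) * INR n * r ^ pred n * (D * D)) = INR (S n) * INR n * r ^ n * (D * D)).
{ destruct n as [|n]; [simpl; ring|cbn [pred]; simpl pow; ring]. }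
rewrite E3, (S_INR (S n)).
assert (H1 : INR (S n) = INR n + 1) by apply S_INR.
replace ((INR (S n) + 1) * INR (S n) * r ^ n * (D * D)) with
  (INR (S n) * INR n * r ^ n * (D * D) + 2 * (INR (S n) * r ^ n * (D * D))) by (rewrite H1; ring).
lra.
Qed.

Lemma Re_RCC x p h : Re (RtoC x * p * h)%C = x * (Re h * Re p - Im h * Im p).
Proof. unfold Re, Im, Cmult, RtoC; simpl; ring. Qed.

Lemma Im_RCC x p h : Im (RtoC x * p * h)%C = x * (Re h * Im p + Im h * Re p).
Proof. unfold Re, Im, Cmult, RtoC; simpl; ring. Qed.

(** Sums [pow_quadratic] over the terms, at a radius [r] halfway between |z| and 1. The factor 2 in
    [K] comes from bounding a modulus by the sum of its two parts. *)
Lemma cps_derive_at (a : nat -> R) (z : C) : rad a -> Cmod z < 1 ->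
  exists K r : R, 0 <= K /\ Cmod z < r < 1 /\ forall w, Cmod w <= r ->
   Cmod (cps a w - cps a z - (w - z) * cps (PS_derive a) z) <= K * (Cmod (w - z) * Cmod (w - z)).
Proof.
intros Ha Hz. set (r := (1 + Cmod z) / 2).
assert (Hr : Cmod z < r < 1) by (unfold r; lra).
assert (Hr0 : 0 <= r) by (generalize (Cmod_ge_0 z); lra).
set (B := fun n => Rabs (a n) * (INR n * INR (pred n) * r ^ pred (pred n))).
assert (HB : ex_series B).
{ apply ex_series_incr_n with (n := 2%nat).
  assert (H := rad_abs _ r (rad_derive _ (rad_derive _ Ha)) (conj Hr0 (proj2 Hr))).
  revert H; apply ex_series_ext; intros n. unfold B, PS_derive.
  replace (2 + n)%nat with (S (S n)) by lia. cbn [pred].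
  rewrite !Rabs_mult, (Rabs_pos_eq (INR (S (S n)))), (Rabs_pos_eq (INR (S n))) by apply pos_INR. eqR; ring. }
exists (2 * Series B), r. split; [|split; auto].
{ apply Rmult_le_pos; [lra|]. apply Series_nonneg; auto. intros n; unfold B.
  repeat apply Rmult_le_pos; auto using Rabs_pos, pos_INR, pow_le. }
intros w Hw. assert (Hw1 : Cmod w < 1) by lra.
set (D := Cmod (w - z) * Cmod (w - z)). assert (HD : 0 <= D) by (apply Rmult_le_pos; apply Cmod_ge_0).
assert (S1 : cps a w = (Series (fun n => a n * Re (w ^ n)%C), Series (fun n => a n * Im (w ^ n)%C))) by reflexivity.
assert (Hd := rad_derive _ Ha).
assert (S3 : ((w - z) * cps (PS_derive a) z)%C =
  (Series (fun n => a n * Re (INR n * z ^ pred n * (w - z))%C),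
   Series (fun n => a n * Im (INR n * z ^ pred n * (w - z))%C))).
{ rewrite (Series_incr_1_aux (fun n => a n * Re _)) by (unfold Re; simpl; ring).
  rewrite (Series_incr_1_aux (fun n => a n * Im _)) by (unfold Im; simpl; ring).
  assert (H1 := cps_re _ z Hd Hz); assert (H2 := cps_im _ z Hd Hz).
  unfold cps, Cmult at 1; cbn [fst snd].
  f_equal; rewrite <- !Series_scal_l; [rewrite <- Series_minus|rewrite <- Series_plus];
  try (apply Series_ext; intros n; unfold PS_derive; cbn [pred];
       rewrite ?Re_RCC, ?Im_RCC; fold (Re (w - z)%C); fold (Im (w - z)%C); ring);
  apply (ex_series_scal_l (V := R_NormedModule)); auto. }
rewrite S3; clear S3.
assert (H1 := cps_re _ z Ha Hz); assert (H2 := cps_im _ z Ha Hz).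
assert (H3 := cps_re _ w Ha Hw1); assert (H4 := cps_im _ w Ha Hw1).
assert (K : forall (p : C -> R), (forall x, Rabs (p x) <= Cmod x) ->
   ex_series (fun n => a n * p (INR n * z ^ pred n * (w - z))%C)).
{ intros p Hp. assert (H := rad_abs _ _ Hd (conj (Cmod_ge_0 z) Hz)).
  apply ex_series_incr_1.
  apply (ex_series_dom _ (fun n => Cmod (w - z) * (Rabs (PS_derive a n) * Cmod z ^ n))).
  - intros n; rewrite Rabs_mult. eapply Rle_trans.
    + apply Rmult_le_compat_l; [apply Rabs_pos|apply Hp].
    + apply Req_le; rewrite !Cmod_mult, Cmod_pow, Cmod_R; unfold PS_derive; cbn [pred].
      rewrite Rabs_mult; ring.
  - apply (ex_series_scal_l (V := R_NormedModule)); auto. }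
assert (K1 := K Re re_le_Cmod); assert (K2 := K Im im_le_Cmod).
replace (2 * Series B * D) with (2 * Series (fun n => B n * D)) by (rewrite Series_scal_r; ring).
match goal with |- Cmod ?x <= _ => replace x with
 (Series (fun n => a n * Re (w ^ n - z ^ n - INR n * z ^ pred n * (w - z))%C),
  Series (fun n => a n * Im (w ^ n - z ^ n - INR n * z ^ pred n * (w - z))%C)) end.
- apply Cmod_Series_le.
  + intros n. unfold B. rewrite Rmult_assoc. apply Rmult_le_compat_l; [apply Rabs_pos|].
    apply pow_quadratic; lra.
  + apply ex_series_scal_r; auto.
- assert (Q : forall p : C -> R, (forall x y, p (x - y)%C = p x - p y) ->
    ex_series (fun n => a n * p (w ^ n)%C) -> ex_series (fun n => a n * p (z ^ n)%C) ->
    ex_series (fun n => a n * p (INR n * z ^ pred n * (w - z))%C) ->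
    Series (fun n => a n * p (w ^ n - z ^ n - INR n * z ^ pred n * (w - z))%C) =
    Series (fun n => a n * p (w ^ n)%C) - Series (fun n => a n * p (z ^ n)%C) -
    Series (fun n => a n * p (INR n * z ^ pred n * (w - z))%C)).
  { intros p Hp G1 G2 G3.
    rewrite <- (Series_minus _ _ G1 G2). rewrite <- (fun G => Series_minus _ _ G G3).
    - apply Series_ext; intros n; rewrite !Hp; ring.
    - apply (ex_series_minus (V := R_NormedModule)) ; assumption. }
  rewrite (Q Re), (Q Im); auto; intros; unfold cps, Re, Im, Cminus, Cplus, Copp; cbn [fst snd]; reflexivity.
Qed.

Lemma cderiv_cps (a : nat -> R) (u : R -> C) t d : rad a -> Cmod (u t) < 1 -> cderiv u t d ->
  cderiv (fun s => cps a (u s)) t (d * cps (PS_derive a) (u t))%C.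
Proof.
intros Ha Hu Hd. destruct (cps_derive_at a (u t) Ha Hu) as (K & r & HK & Hr & Hq).
set (c := cps (PS_derive a) (u t)) in *.
set (lin := fun s => (cps a (u t) + (u s - u t) * c)%C).
assert (Hlin : cderiv lin t (d * c)%C).
{ apply (cderiv_eq _ _ (0 + ((d + - (0)) * c + (u t - u t) * 0))%C); [ring|].
  apply cderiv_plus; [apply cderiv_const|]. apply cderiv_mult; [|apply cderiv_const].
  apply cderiv_plus; auto. apply (cderiv_eq _ _ 0); [ring|apply cderiv_const]. }
set (B := fun s => K * ((Re (u s) - Re (u t)) * (Re (u s) - Re (u t)) +
                        (Im (u s) - Im (u t)) * (Im (u s) - Im (u t)))).
assert (EB : forall s, B s = K * (Cmod (u s - u t) * Cmod (u s - u t))).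
{ intros s; unfold B; rewrite Cmod_sqr; unfold Re, Im, Cminus, Cplus, Copp; simpl; ring. }
assert (HB : is_derive B t 0).
{ destruct Hd as [D1 D2]. unfold B.
  assert (M : forall f : R -> R, forall e, is_derive f t e -> is_derive (fun s => f s - f t) t e).
  { intros f e H. replace e with (e - 0) by ring.
    apply (is_derive_minus f (fun _ => f t)); auto. exact (is_derive_const (V := R_NormedModule) (f t) t). }
  assert (D3 := is_derive_mulR _ _ _ _ _ (M _ _ D1) (M _ _ D1)).
  assert (D4 := is_derive_mulR _ _ _ _ _ (M _ _ D2) (M _ _ D2)).
  assert (D5 := is_derive_scal _ _ K _ (is_derive_plus _ _ _ _ _ D3 D4)).
  simpl in D5. revert D5. match goal with |- is_derive _ _ ?x -> _ => replace x with 0 end; [auto|].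
  change plus with Rplus. change mult with Rmult. cbn. ring. }
assert (L : locally t (fun s => Cmod (u s) <= r)).
{ destruct Hd as [D1 D2].
  assert (C1 : continuous (fun s => Re (u s)) t) by (apply @ex_derive_continuous; eexists; exact D1).
  assert (C2 : continuous (fun s => Im (u s)) t) by (apply @ex_derive_continuous; eexists; exact D2).
  assert (He : 0 < (r - Cmod (u t)) / 2) by lra.
  assert (L1 := C1 _ (locally_ball _ (mkposreal _ He))).
  assert (L2 := C2 _ (locally_ball _ (mkposreal _ He))).
  unfold filtermap in L1, L2. generalize (filter_and _ _ L1 L2). apply filter_imp; intros s [B1 B2].
  change (Rabs (Re (u s) - Re (u t)) < (r - Cmod (u t)) / 2) in B1.
  change (Rabs (Im (u s) - Im (u t)) < (r - Cmod (u t)) / 2) in B2.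
  assert (Cmod (u s - u t) <= r - Cmod (u t)).
  { eapply Rle_trans; [apply Cmod_le_Rabs|].
    replace (Re (u s - u t)) with (Re (u s) - Re (u t)) by (unfold Re, Cminus, Cplus, Copp; simpl; ring).
    replace (Im (u s - u t)) with (Im (u s) - Im (u t)) by (unfold Im, Cminus, Cplus, Copp; simpl; ring).
    lra. }
  replace (u s) with (u t + (u s - u t))%C by ring.
  eapply Rle_trans; [apply Cmod_triangle|]. lra. }
assert (Hrem : cderiv (fun s => cps a (u s) - lin s)%C t 0).
{ split; apply (is_derive_squeeze _ B); auto; try (unfold B; ring);
  revert L; apply filter_imp; intros s Hs; rewrite EB.
  - eapply Rle_trans; [apply re_le_Cmod|].
    replace (cps a (u s) - lin s)%C with (cps a (u s) - cps a (u t) - (u s - u t) * c)%C by (unfold lin; ring).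
    apply Hq; auto.
  - eapply Rle_trans; [apply im_le_Cmod|].
    replace (cps a (u s) - lin s)%C with (cps a (u s) - cps a (u t) - (u s - u t) * c)%C by (unfold lin; ring).
    apply Hq; auto. }
apply (cderiv_ext (fun s => (cps a (u s) - lin s) + lin s)%C); [intros s; ring|].
apply (cderiv_eq _ _ (0 + d * c)%C); [ring|]. apply cderiv_plus; auto.
Qed.

(* The letters stand for the forms dt/(1-t^3), t dt/(1-t^3), t^2 dt/(1-t^3), dt/t and dt/(1-t); the head of a
   word is the outermost integration, and [cw w n] is the coefficient of t^n of the iterated integral. *)
Inductive letter := LX | LY | LS | LT | L1.
Definition word := list letter.

Definition lval (l : letter) : nat := match l with LX => 1 | LY => 2 | _ => 0 end.

(** The residue mod 3 of all exponents that carry a nonzero coefficient, for words without [L1] (see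
    [cw_support]): integration against t^(i-1) dt/(1-t^3) moves exponents by i modulo 3. For words
    with [L1] the value has no meaning. *)
Fixpoint cls (w : word) : nat :=
  match w with [] => 0 | l :: w' => (lval l + cls w') mod 3 end.

Fixpoint psum (a : nat -> R) (n : nat) : R :=
  match n with O => 0 | S k => psum a k + a k end.

(** Dividing a series by 1-t^3 adds up coefficients at distances divisible by 3. As the inner series
    lives in a single class mod 3, this is the full partial sum [psum a n] on the class [r] of the
    new word and 0 elsewhere. *)
Definition ext (l : letter) (r : nat) (a : nat -> R) (n : nat) : R :=
  match n with
  | O => 0
  | S _ => match l with
      | LT => a n / INR n
      | L1 => psum a n / INR n
      | _ => if Nat.eqb (n mod 3) r then psum a n / INR n else 0
      end
  end.

Fixpoint cw (w : word) : nat -> R :=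
  match w with
  | [] => fun n => match n with O => 1 | S _ => 0 end
  | l :: w' => ext l (cls w) (cw w')
  end.

Definition pure (w : word) := forallb (fun l => match l with L1 => false | _ => true end) w.

(** [LT] must not be innermost, because dt/t diverges at 0. The letters with denominator 1-t^3 need
    an inner series supported on one class mod 3, hence a word without [L1]. *)
Fixpoint wf (w : word) : bool :=
  match w with
  | [] => true
  | l :: w' => andb (match l with L1 => true | LT => match w' with [] => false | _ => true end | _ => pure w' end)
                    (wf w')
  end.

Lemma psum_ext a b n : (forall m, (m < n)%nat -> a m = b m) -> psum a n = psum b n.
Proof. induction n as [|n IH]; simpl; intros H; auto. rewrite IH, H; auto; intros; apply H; lia. Qed.

Lemma psum_le a b n : (forall m, (m < n)%nat -> a m <= b m) -> psum a n <= psum b n.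
Proof.
induction n as [|n IH]; simpl; intros H; [lra|]. apply Rplus_le_compat; [apply IH; intros; apply H; lia|apply H; lia].
Qed.

Lemma psum_nonneg a n : (forall m, 0 <= a m) -> 0 <= psum a n.
Proof. intros H; induction n as [|n IH]; simpl; [lra|]. specialize (H n); lra. Qed.

Lemma psum_const c n : psum (fun _ => c) n = c * INR n.
Proof. induction n as [|n IH]; [simpl; ring|]. rewrite S_INR; simpl psum; rewrite IH; ring. Qed.

Lemma psum_sum_n a n : psum a (S n) = sum_n a n.
Proof.
induction n as [|n IH]; [simpl; rewrite sum_O; ring|].
rewrite sum_Sn, <- IH. reflexivity.
Qed.

Lemma cls_lt w : (cls w < 3)%nat.
Proof. destruct w as [|l w]; cbn [cls]; lia. Qed.

Lemma INR_S_pos n : 0 < INR (S n).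
Proof. apply lt_0_INR; lia. Qed.

(** An average of numbers from [0,1]: [psum a n] has n terms and is divided by n. *)
Lemma cw_bounds w n : 0 <= cw w n <= 1.
Proof.
revert n; induction w as [|l w IH]; intros n; simpl; [destruct n; lra|].
unfold ext; destruct n as [|n]; [lra|].
assert (Hn := INR_S_pos n).
assert (H : 0 <= psum (cw w) (S n) / INR (S n) <= 1).
{ split.
  - apply Rdiv_le_0_compat; auto; apply psum_nonneg; apply IH.
  - apply (Rmult_le_reg_r (INR (S n))); auto. unfold Rdiv; rewrite Rmult_assoc, Rinv_l by lra.
    rewrite Rmult_1_r, <- psum_const. apply psum_le; intros; apply IH. }
destruct l; try (match goal with |- context [Nat.eqb ?x ?y] => destruct (Nat.eqb x y) end; lra); auto; try lra.
destruct (IH (S n)); split; [apply Rdiv_le_0_compat; auto|].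
apply (Rmult_le_reg_r (INR (S n))); auto. unfold Rdiv; rewrite Rmult_assoc, Rinv_l by lra.
assert (1 <= INR (S n)) by (rewrite S_INR; generalize (pos_INR n); lra). lra.
Qed.

Lemma cw_rad w : rad (cw w).
Proof. apply (rad_bounded _ 1); intros n; destruct (cw_bounds w n); rewrite Rabs_pos_eq; auto. Qed.

Lemma cw_0 w : w <> [] -> cw w 0 = 0.
Proof. destruct w; [congruence|reflexivity]. Qed.

Lemma cw_support w n : pure w = true -> cw w n <> 0 -> n mod 3 = cls w.
Proof.
revert n; induction w as [|l w IH]; intros n Hp Hn.
- destruct n; [reflexivity|simpl in Hn; lra].
- simpl in Hp; apply andb_prop in Hp; destruct Hp as [Hl Hp].
  destruct n as [|n]; [simpl in Hn; lra|].
  cbn [cw] in Hn; unfold ext in Hn.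
  destruct l; try discriminate Hl;
    try (destruct (Nat.eqb_spec (S n mod 3) (cls (LX :: w))); [auto|lra]);
    try (destruct (Nat.eqb_spec (S n mod 3) (cls (LY :: w))); [auto|lra]);
    try (destruct (Nat.eqb_spec (S n mod 3) (cls (LS :: w))); [auto|lra]).
  cbn [cls lval]. rewrite Nat.add_0_l, (Nat.mod_small _ _ (cls_lt w)). apply IH; auto.
  intros E; apply Hn; rewrite E; unfold Rdiv; ring.
Qed.

Definition phi (l : letter) (z : C) : C :=
  match l with
  | LX => / (1 - z ^ 3)
  | LY => z / (1 - z ^ 3)
  | LS => z ^ 2 / (1 - z ^ 3)
  | LT => / z
  | L1 => / (1 - z)
  end%C.

Lemma PS_derive_ext l r a n : PS_derive (ext l r a) n =
  match l with LT => a (S n) | L1 => psum a (S n)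
  | _ => if Nat.eqb (S n mod 3) r then psum a (S n) else 0 end.
Proof.
unfold PS_derive, ext. assert (H := INR_S_pos n).
destruct l; try (match goal with |- context [Nat.eqb ?x ?y] => destruct (Nat.eqb x y) end); eqR; try (field; lra); ring.
Qed.

Lemma one_minus_pow_neq z n : (0 < n)%nat -> Cmod z < 1 -> (1 - z ^ n)%C <> 0.
Proof.
intros Hn Hz E. assert (z ^ n = 1)%C by (replace (z ^ n)%C with (1 - (1 - z ^ n))%C by ring; rewrite E; ring).
assert (H1 : Cmod (z ^ n)%C = 1) by (rewrite H; apply Cmod_1).
rewrite Cmod_pow in H1.
assert (Cmod z ^ n < 1).
{ destruct n as [|n]; [lia|]. simpl.
  assert (H2 : Cmod z ^ n <= 1) by (rewrite <- (pow1 n); apply pow_incr; split; [apply Cmod_ge_0|lra]).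
  assert (0 <= Cmod z ^ n) by (apply pow_le, Cmod_ge_0).
  generalize (Cmod_ge_0 z); nra. }
lra.
Qed.

(** The coefficients of (1-t^3) A = t^(d-1) a. Partial sums of [a] three steps apart differ by three
    consecutive terms, of which the support of [a] leaves only the one with index n+1-d. *)
Lemma deriv_three a r A d :
  (forall n, A n = if Nat.eqb (S n mod 3) r then psum a (S n) else 0) -> (r < 3)%nat ->
  (forall n, a n <> 0 -> (n + d) mod 3 = r) -> (1 <= d <= 3)%nat ->
  forall n, A n - PS_incr_1 (PS_incr_1 (PS_incr_1 A)) n =
    match d with 1 => a n | 2 => PS_incr_1 a n | _ => PS_incr_1 (PS_incr_1 a) n end.
Proof.
intros HA Hr Hs Hd.
assert (Z : forall n, (n + d) mod 3 <> r -> a n = 0).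
{ intros n H; destruct (Req_dec (a n) 0); auto; elim H; auto. }
intros n. destruct n as [|[|[|n]]]; cbn [PS_incr_1]; change (@zero R_NormedModule) with 0; rewrite !HA; cbn [psum];
 repeat (match goal with |- context [Nat.eqb ?x r] => destruct (Nat.eqb_spec x r) end); try lia;
 (destruct d as [|[|[|[|d]]]]; try lia);
 repeat match goal with |- context [a ?k] => rewrite (Z k) by lia end; lra.
Qed.

Lemma cps_PS_derive_cw l w z : wf (l :: w) = true -> Cmod z < 1 -> (l = LT -> z <> 0) ->
  cps (PS_derive (cw (l :: w))) z = (phi l z * cps (cw w) z)%C.
Proof.
intros Hwf Hz Hl. set (A := PS_derive (cw (l :: w))).
assert (RA : rad A) by apply rad_derive, cw_rad.
assert (Ra := cw_rad w).
assert (EA : forall n, A n = match l with LT => cw w (S n) | L1 => psum (cw w) (S n)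
  | _ => if Nat.eqb (S n mod 3) (cls (l :: w)) then psum (cw w) (S n) else 0 end)
 by (intros n; apply PS_derive_ext).
simpl in Hwf; apply andb_prop in Hwf; destruct Hwf as [Hp _].
assert (N3 : (1 - z ^ 3)%C <> 0) by (apply one_minus_pow_neq; auto; lia).
assert (N1 : (1 - z)%C <> 0).
{ generalize (one_minus_pow_neq z 1 ltac:(lia) Hz); rewrite Cpow_1_r; auto. }
(* The form of the outermost letter is t^(d-1) dt/(1-t^3), with d = 1, 2, 3 for [LX], [LY], [LS]. *)
assert (Key : forall d, pure w = true -> (1 <= d <= 3)%nat -> (lval l + cls w) mod 3 = (d + cls w) mod 3 ->
   (l = LX \/ l = LY \/ l = LS) ->
  ((1 - z ^ 3) * cps A z = z ^ (pred d) * cps (cw w) z)%C).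
{ intros d Hpw Hd Hcl Hcase.
  assert (R3 : rad (PS_incr_1 (PS_incr_1 (PS_incr_1 A)))) by (repeat apply rad_incr_1; auto).
  transitivity (cps (PS_plus A (PS_opp (PS_incr_1 (PS_incr_1 (PS_incr_1 A))))) z).
  { rewrite cps_plus, cps_opp, !cps_incr_1; auto using rad_opp, rad_incr_1; ring. }
  transitivity (cps (match d with 1 => cw w | 2 => PS_incr_1 (cw w) | _ => PS_incr_1 (PS_incr_1 (cw w)) end) z).
  { apply cps_ext; intros n.
    assert (D := deriv_three (cw w) (cls (l :: w)) A d). unfold PS_plus, PS_opp.
    change (A n + - PS_incr_1 (PS_incr_1 (PS_incr_1 A)) n =
      (match d with 1 => cw w | 2 => PS_incr_1 (cw w) | _ => PS_incr_1 (PS_incr_1 (cw w)) end) n).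
    specialize (fun x y z => D x y z Hd n). unfold Rminus in D; rewrite D.
    - destruct d as [|[|[|d]]]; auto.
    - intros m; rewrite EA; destruct Hcase as [->|[->| ->]]; auto.
    - apply cls_lt.
    - intros m Hm. assert (E := cw_support w m Hpw Hm). cbn [cls]. lia. }
  destruct d as [|[|[|[|d]]]]; try lia; cbn [pred]; rewrite ?cps_incr_1; auto using rad_incr_1; ring. }
assert (Div : forall d : C, ((1 - z ^ 3) * cps A z = d -> cps A z = d / (1 - z ^ 3))%C).
{ intros d <-; field; auto. }
destruct l; cbn [phi].
- rewrite (Div _ (Key 1%nat Hp ltac:(lia) eq_refl ltac:(auto))). cbn [pred Cpow]. unfold Cdiv; ring.
- rewrite (Div _ (Key 2%nat Hp ltac:(lia) eq_refl ltac:(auto))). cbn [pred Cpow]. unfold Cdiv; ring.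
- rewrite (Div _ (Key 3%nat Hp ltac:(lia) ltac:(cbn [lval]; lia) ltac:(auto))). cbn [pred]. unfold Cdiv; ring.
- assert (E : (z * cps A z = cps (cw w) z)%C).
  { rewrite <- cps_incr_1; auto. apply cps_ext; intros [|n]; cbn [PS_incr_1].
    - rewrite cw_0; [reflexivity|]. destruct w; congruence.
    - apply EA. }
  rewrite <- E. field; auto.
- assert (E : ((1 - z) * cps A z = cps (cw w) z)%C).
  { transitivity (cps (PS_plus A (PS_opp (PS_incr_1 A))) z).
    { rewrite cps_plus, cps_opp, cps_incr_1; auto using rad_opp, rad_incr_1; ring. }
    apply cps_ext; intros n. unfold PS_plus, PS_opp. change (A n + - PS_incr_1 A n = cw w n).
    destruct n as [|n]; cbn [PS_incr_1]; [change (@zero R_NormedModule) with 0|]; rewrite !EA; cbn [psum]; ring. }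
  rewrite <- E. field; auto.
Qed.

Definition Li (w : word) (z : C) : C := cps (cw w) z.

Lemma Li_nil z : Li [] z = 1.
Proof.
unfold Li, cps. rewrite (Series_incr_1_aux (fun n => cw [] n * Im _)) by (simpl; unfold Im; simpl; ring).
rewrite (Series_incr_1 (fun n => cw [] n * Re _)).
- assert (E : forall p : nat -> R, Series (fun k => cw [] (S k) * p k) = 0).
  { intros p; rewrite (Series_ext _ (fun k => 0 * p k)) by (intros; simpl; ring).
    rewrite Series_scal_l; ring. }
  rewrite (E (fun k => Re (z ^ S k)%C)), (E (fun k => Im (z ^ S k)%C)).
  unfold Re, RtoC; simpl; f_equal; ring.
- apply ex_series_incr_1. apply (ex_series_ext (fun n => 0 * 0 ^ n)); [intros n; eqR; simpl; ring|].
  apply (ex_series_scal_l (V := R_NormedModule)). apply ex_series_geom; rewrite Rabs_R0; lra.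
Qed.

Lemma Li_deriv l w u t d : wf (l :: w) = true -> Cmod (u t) < 1 -> (l = LT -> u t <> 0) -> cderiv u t d ->
  cderiv (fun s => Li (l :: w) (u s)) t (d * (phi l (u t) * Li w (u t)))%C.
Proof.
intros H1 H2 H3 H4. unfold Li. rewrite <- cps_PS_derive_cw; auto. apply cderiv_cps; auto using cw_rad.
Qed.

(** * Growth of coefficients *)

(** The scale (n+1)^(1/4). The coefficients of iterated integrals have size (log n)^k / n; the
    cruder bound n^(-3/4) absorbs all logarithms and is stable under further integration, since sums
    of n^(-3/4) grow like n^(1/4) and division by n leads back to n^(-3/4). *)
Definition q4 (n : nat) : R := sqrt (sqrt (INR n + 1)).

Lemma INR1_pos n : 0 < INR n + 1.
Proof. generalize (pos_INR n); lra. Qed.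

Lemma q4_pos n : 0 < q4 n.
Proof. unfold q4; apply sqrt_lt_R0, sqrt_lt_R0, INR1_pos. Qed.

Lemma q4_sqr n : q4 n * q4 n = sqrt (INR n + 1).
Proof. unfold q4; apply sqrt_sqrt, sqrt_pos. Qed.

Lemma q4_pow4 n : q4 n ^ 4 = INR n + 1.
Proof.
replace (q4 n ^ 4) with ((q4 n * q4 n) * (q4 n * q4 n)) by ring. rewrite q4_sqr.
apply sqrt_sqrt. generalize (INR1_pos n); lra.
Qed.

Lemma q4_le m n : (m <= n)%nat -> q4 m <= q4 n.
Proof. intros H; unfold q4; apply sqrt_le_1_alt, sqrt_le_1_alt; apply le_INR in H; lra. Qed.

Lemma q4_ge1 n : 1 <= q4 n.
Proof.
replace 1 with (q4 0); [apply q4_le; lia|]. unfold q4; simpl. rewrite Rplus_0_l, !sqrt_1; auto.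
Qed.

(** With a and b the two consecutive values, 1 = b^4 - a^4 is b-a times a sum of four terms, each at
    most b^3. *)
Lemma q4_step n : / q4 (S n) ^ 3 <= 4 * (q4 (S n) - q4 n).
Proof.
assert (H1 := q4_pow4 n); assert (H2 := q4_pow4 (S n)); rewrite S_INR in H2.
assert (P1 := q4_pos n); assert (P2 := q4_pos (S n)). assert (L := q4_le n (S n) ltac:(lia)).
set (a := q4 n) in *; set (b := q4 (S n)) in *.
assert (E : 1 = (b - a) * (b ^ 3 + b ^ 2 * a + b * a ^ 2 + a ^ 3)).
{ replace ((b - a) * (b ^ 3 + b ^ 2 * a + b * a ^ 2 + a ^ 3)) with (b ^ 4 - a ^ 4) by ring. lra. }
assert (B : b ^ 3 + b ^ 2 * a + b * a ^ 2 + a ^ 3 <= 4 * b ^ 3).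
{ assert (b ^ 2 * a <= b ^ 3) by (simpl; nra).
  assert (b * a ^ 2 <= b ^ 3) by (apply Rle_trans with (b * (b * b)); [apply Rmult_le_compat_l; nra|apply Req_le; ring]).
  assert (a ^ 3 <= b ^ 3) by (apply pow_incr; lra). lra. }
assert (P3 : 0 < b ^ 3) by (apply pow_lt; auto).
apply (Rmult_le_reg_r (b ^ 3)); auto. rewrite Rinv_l by lra.
rewrite E at 1. assert (0 <= b - a) by lra. nra.
Qed.

Lemma psum_q4 n : psum (fun m => / q4 m ^ 3) n <= 4 * q4 n.
Proof.
assert (H : forall n, psum (fun m => / q4 m ^ 3) (S n) <= 4 * q4 n).
{ induction n0 as [|m IH].
  - cbn [psum]. assert (E : q4 0 = 1) by (unfold q4; simpl; rewrite Rplus_0_l, !sqrt_1; auto).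
    rewrite E, pow1, Rinv_1; lra.
  - cbn [psum] in *. generalize (q4_step m); lra. }
destruct n as [|n]; [simpl psum; generalize (q4_pos 0); lra|].
eapply Rle_trans; [apply H|]. generalize (q4_le n (S n) ltac:(lia)); lra.
Qed.

Lemma psum_scal c a n : psum (fun m => c * a m) n = c * psum a n.
Proof. induction n as [|n IH]; simpl; [ring|rewrite IH; ring]. Qed.

Lemma psum_plus a b n : psum (fun m => a m + b m) n = psum a n + psum b n.
Proof. induction n as [|n IH]; simpl; [ring|rewrite IH; ring]. Qed.

Lemma cw_growth w : exists K, 0 <= K /\ forall n, cw w n <= K * / q4 n ^ 3.
Proof.
induction w as [|l w (K & HK & IH)].
- exists 1; split; [lra|]. intros [|n]; cbn [cw].
  + assert (E : q4 0 = 1) by (unfold q4; simpl; rewrite Rplus_0_l, !sqrt_1; auto). rewrite E, pow1; lra.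
  + generalize (Rinv_0_lt_compat _ (pow_lt _ 3 (q4_pos (S n)))); lra.
- exists (8 * K + K); split; [lra|]. intros n.
  assert (Hq := Rinv_0_lt_compat _ (pow_lt _ 3 (q4_pos n))).
  assert (H1 : psum (cw w) n <= 4 * K * q4 n).
  { eapply Rle_trans; [apply psum_le; intros; apply IH|]. rewrite psum_scal.
    generalize (psum_q4 n); nra. }
  destruct n as [|n]; cbn [cw]; unfold ext; [nra|].
  assert (Hn := INR_S_pos n).
  assert (H2 : psum (cw w) (S n) / INR (S n) <= 8 * K * / q4 (S n) ^ 3).
  { apply (Rmult_le_reg_r (INR (S n))); auto. unfold Rdiv; rewrite Rmult_assoc, Rinv_l, Rmult_1_r by lra.
    eapply Rle_trans; [exact H1|].
    assert (E := q4_pow4 (S n)). assert (P := q4_pos (S n)).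
    assert (1 <= INR (S n)) by (rewrite S_INR; generalize (pos_INR n); lra).
    (* For the index n in question, the fourth power of [q4] is n+1 <= 2n; hence the constant 8. *)
    replace (4 * K * q4 (S n)) with (4 * K * (q4 (S n) ^ 4) * / q4 (S n) ^ 3) by (field; lra).
    rewrite E. assert (0 <= K * / q4 (S n) ^ 3) by (apply Rmult_le_pos; lra). nra. }
  assert (H3 : 0 <= K * / q4 (S n) ^ 3) by (apply Rmult_le_pos; lra).
  assert (H4 : cw w (S n) / INR (S n) <= K * / q4 (S n) ^ 3).
  { eapply Rle_trans; [|apply IH]. apply (Rmult_le_reg_r (INR (S n))); auto.
    unfold Rdiv; rewrite Rmult_assoc, Rinv_l, Rmult_1_r by lra.
    assert (1 <= INR (S n)) by (rewrite S_INR; generalize (pos_INR n); lra).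
    generalize (proj1 (cw_bounds w (S n))); nra. }
  destruct l; try (match goal with |- context [Nat.eqb ?x ?y] => destruct (Nat.eqb x y) end); lra.
Qed.

Lemma psum_cw_growth w : exists K, 0 <= K /\ forall n, psum (cw w) n <= K * q4 n.
Proof.
destruct (cw_growth w) as (K & HK & H). exists (4 * K); split; [lra|]. intros n.
eapply Rle_trans; [apply psum_le; intros; apply H|]. rewrite psum_scal. generalize (psum_q4 n); nra.
Qed.

(** * Growth near [t = 1] *)

(* At most every power of [1/(1-t)], respectively at least some positive power of [1-t]. *)
Definition slow (f : R -> R) := forall d, 0 < d -> exists K, 0 <= K /\
  forall t, 0 <= t < 1 -> Rabs (f t) <= K * Rpower (1 - t) (- d).
Definition small (f : R -> R) := exists d K, 0 < d /\ 0 <= K /\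
  forall t, 0 <= t < 1 -> Rabs (f t) <= K * Rpower (1 - t) d.

Lemma Rpower_pos x y : 0 < Rpower x y.
Proof. apply exp_pos. Qed.

Lemma Rpower_le_exp x d e : 0 < x <= 1 -> d <= e -> Rpower x e <= Rpower x d.
Proof.
intros Hx H; unfold Rpower. destruct (Rle_lt_or_eq_dec (e * ln x) (d * ln x)) as [H1|H1].
- assert (ln x <= 0) by (rewrite <- ln_1; apply ln_le; lra). nra.
- left; apply exp_increasing; auto.
- rewrite H1; lra.
Qed.

Lemma slow_plus f g : slow f -> slow g -> slow (fun t => f t + g t).
Proof.
intros Hf Hg d Hd. destruct (Hf d Hd) as (K & HK & H), (Hg d Hd) as (L & HL & H').
exists (K + L); split; [lra|]. intros t Ht.
eapply Rle_trans; [apply Rabs_triang|]. generalize (H t Ht) (H' t Ht); lra.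
Qed.

Lemma slow_mult f g : slow f -> slow g -> slow (fun t => f t * g t).
Proof.
intros Hf Hg d Hd. destruct (Hf (d / 2)) as (K & HK & H); [lra|]. destruct (Hg (d / 2)) as (L & HL & H'); [lra|].
exists (K * L); split; [apply Rmult_le_pos; auto|]. intros t Ht. rewrite Rabs_mult.
replace (- d) with (- (d / 2) + - (d / 2)) by field. rewrite Rpower_plus.
replace (K * L * _) with ((K * Rpower (1 - t) (- (d / 2))) * (L * Rpower (1 - t) (- (d / 2)))) by ring.
apply Rmult_le_compat; auto using Rabs_pos.
Qed.

Lemma slow_const c : slow (fun _ => c).
Proof.
intros d Hd; exists (Rabs c); split; [apply Rabs_pos|]. intros t Ht.
assert (1 <= Rpower (1 - t) (- d)).
{ rewrite <- (Rpower_O (1 - t)) at 1 by lra. apply Rpower_le_exp; lra. }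
generalize (Rabs_pos c); nra.
Qed.

Lemma slow_le f g : (forall t, 0 <= t < 1 -> Rabs (f t) <= Rabs (g t)) -> slow g -> slow f.
Proof.
intros H Hg d Hd; destruct (Hg d Hd) as (K & HK & H'). exists K; split; auto; intros t Ht.
eapply Rle_trans; [apply H|apply H']; auto.
Qed.

Lemma small_le f g : (forall t, 0 <= t < 1 -> Rabs (f t) <= Rabs (g t)) -> small g -> small f.
Proof.
intros H (d & K & Hd & HK & H'). exists d, K; repeat split; auto; intros t Ht.
eapply Rle_trans; [apply H|apply H']; auto.
Qed.

Lemma small_ext f g : (forall t, 0 <= t < 1 -> f t = g t) -> small g -> small f.
Proof. intros H; apply small_le; intros t Ht; rewrite H; auto; lra. Qed.

Lemma small_0 : small (fun _ => 0).
Proof. exists 1, 0; repeat split; try lra. intros t Ht; rewrite Rabs_R0; lra. Qed.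

Lemma small_plus f g : small f -> small g -> small (fun t => f t + g t).
Proof.
intros (d & K & Hd & HK & H) (e & L & He & HL & H').
exists (Rmin d e), (K + L); repeat split; [apply Rmin_pos; auto|lra|]. intros t Ht.
eapply Rle_trans; [apply Rabs_triang|]. rewrite Rmult_plus_distr_r.
apply Rplus_le_compat; (eapply Rle_trans; [apply H || apply H'; auto|]);
apply Rmult_le_compat_l; auto; apply Rpower_le_exp; try lra; [apply Rmin_l|apply Rmin_r].
Qed.

Lemma small_slow_mult f g : small f -> slow g -> small (fun t => f t * g t).
Proof.
intros (d & K & Hd & HK & H) Hg. destruct (Hg (d / 2)) as (L & HL & H'); [lra|].
exists (d / 2), (K * L); repeat split; [lra|apply Rmult_le_pos; auto|]. intros t Ht. rewrite Rabs_mult.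
replace (Rpower (1 - t) (d / 2)) with (Rpower (1 - t) d * Rpower (1 - t) (- (d / 2))) by
  (rewrite <- Rpower_plus; f_equal; field).
replace (K * L * _) with ((K * Rpower (1 - t) d) * (L * Rpower (1 - t) (- (d / 2)))) by ring.
apply Rmult_le_compat; auto using Rabs_pos.
Qed.

Lemma small_scal c f : small f -> small (fun t => c * f t).
Proof.
intros H. apply (small_ext _ (fun t => f t * c)); [intros; ring|].
apply (small_slow_mult _ (fun _ => c)); auto using slow_const.
Qed.

Lemma small_eventually f : small f -> forall eps, 0 < eps -> exists t0, 0 <= t0 < 1 /\
  forall t, t0 <= t < 1 -> Rabs (f t) < eps.
Proof.
intros (d & K & Hd & HK & H) eps He.
set (x := Rpower (eps / (K + 1)) (/ d)).
assert (Hx : 0 < x) by apply Rpower_pos.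
exists (Rmax (1 - x / 2) 0). split.
- split; [apply Rmax_r|]. apply Rmax_lub_lt; lra.
- intros t [H1 H2]. assert (A := Rmax_l (1 - x / 2) 0); assert (B := Rmax_r (1 - x / 2) 0).
  eapply Rle_lt_trans; [apply H; lra|].
  assert (Q : Rpower (1 - t) d <= eps / (K + 1)).
  { replace (eps / (K + 1)) with (Rpower x d).
    - apply Rle_Rpower_l; lra.
    - unfold x; rewrite Rpower_mult, Rinv_l by lra. apply Rpower_1. apply Rdiv_lt_0_compat; lra. }
  assert (0 < Rpower (1 - t) d) by apply Rpower_pos.
  apply Rle_lt_trans with (K * (eps / (K + 1))); [apply Rmult_le_compat_l; auto|].
  apply (Rmult_lt_reg_r (K + 1)); [lra|]. unfold Rdiv; rewrite !Rmult_assoc, Rinv_l by lra. nra.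
Qed.

Lemma small_const_0 c : small (fun _ => c) -> c = 0.
Proof.
intros H; destruct (Req_dec c 0) as [|Hc]; auto.
destruct (small_eventually _ H (Rabs c)) as (t0 & H0 & H1); [apply Rabs_pos_lt; auto|].
specialize (H1 t0); lra.
Qed.

Lemma small_1mt : small (fun t => 1 - t).
Proof.
exists 1, 1; repeat split; try lra. intros t Ht. rewrite Rpower_1, Rabs_pos_eq by lra; lra.
Qed.

(* Split the sum at [N ~ (1-t)^(-1/2)]. *)
Lemma small_abel (eps : nat -> R) K : (forall n, Rabs (eps n) <= K * / q4 n) ->
  small (fun t => (1 - t) * Series (fun n => eps n * t ^ n)).
Proof.
intros H.
assert (HK : 0 <= K).
{ specialize (H 0%nat). generalize (Rabs_pos (eps 0%nat)) (Rinv_0_lt_compat _ (q4_pos 0)). nra. }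
exists (/ 8), (3 * K); repeat split; [lra|lra|]. intros t Ht.
(* In terms of s the cut [N] is about s^(-4). The terms below it contribute at most K (1-t) N <= 2 K
   s^4 <= 2 K s; for n >= N one has 1/[q4 n] <= s, so the rest contributes at most K s. Together
   this is the constant 3K. *)
set (s := Rpower (1 - t) (/ 8)).
assert (Hs : 0 < s) by apply Rpower_pos.
assert (Hs1 : s <= 1) by (rewrite <- (Rpower_O (1 - t)) by lra; apply Rpower_le_exp; lra).
assert (E8 : s ^ 8 = 1 - t).
{ unfold s; rewrite <- Rpower_pow by apply Rpower_pos. rewrite Rpower_mult.
  replace (/ 8 * INR 8) with 1 by (simpl; field). apply Rpower_1; lra. }
set (N := Z.to_nat (up (/ s ^ 4))).
assert (Hs4 : 0 < / s ^ 4) by (apply Rinv_0_lt_compat, pow_lt; auto).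
destruct (archimed (/ s ^ 4)) as [U1 U2].
assert (HN : INR N = IZR (up (/ s ^ 4))).
{ unfold N; rewrite INR_IZR_INZ, Z2Nat.id; auto. apply le_IZR; lra. }
assert (B1 : forall n, (N <= n)%nat -> / q4 n <= s).
{ intros n Hn. apply le_INR in Hn.
  assert (Q : / s <= q4 n).
  { apply Rnot_lt_le; intros C. assert (q4 n ^ 4 < (/ s) ^ 4).
    { assert (P := q4_pos n).
      assert (0 < / s) by (apply Rinv_0_lt_compat; auto).
      assert (q4 n * q4 n < / s * / s) by nra.
      replace (q4 n ^ 4) with (q4 n * q4 n * (q4 n * q4 n)) by ring.
      replace ((/ s) ^ 4) with (/ s * / s * (/ s * / s)) by ring. nra. }
    rewrite q4_pow4, pow_inv in H0. lra. }
  rewrite <- (Rinv_inv s). apply Rinv_le_contravar; auto. apply Rinv_0_lt_compat; auto. }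
assert (Htn : forall n, 0 <= t ^ n <= 1).
{ intros n; split; [apply pow_le; lra|rewrite <- (pow1 n); apply pow_incr; lra]. }
assert (G := ex_series_geom t ltac:(rewrite Rabs_pos_eq; lra)).
assert (Hq1 : forall n, / q4 n <= 1).
{ intros n; rewrite <- Rinv_1; apply Rinv_le_contravar; [lra|apply q4_ge1]. }
set (ind := fun n => if Nat.ltb n N then K else 0).
assert (Ei : is_series ind (K * INR N)).
{ rewrite <- psum_const.
  change (is_lim_seq (sum_n ind) (psum (fun _ => K) N)).
  apply (is_lim_seq_ext_loc (fun _ => psum (fun _ => K) N)); [|apply is_lim_seq_const].
  exists N; intros n Hn. rewrite <- psum_sum_n.
  assert (forall m, psum ind (N + m)%nat = psum (fun _ => K) N).
  { induction m as [|m IH]; [rewrite Nat.add_0_r; apply psum_ext; intros m Hm; unfold ind; rewrite (proj2 (Nat.ltb_lt m N)); auto|].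
    rewrite Nat.add_succ_r; cbn [psum]; rewrite IH; unfold ind at 1. rewrite (proj2 (Nat.ltb_ge (N + m) N)); [ring|lia]. }
  replace (S n) with (N + (S n - N))%nat by lia. symmetry; apply H0. }
assert (D : Rabs (Series (fun n => eps n * t ^ n)) <= Series (fun n => ind n + K * s * t ^ n)).
{ apply Rabs_Series_le.
  - intros n; rewrite Rabs_mult, (Rabs_pos_eq (t ^ n)) by apply Htn. specialize (Htn n). specialize (H n).
    assert (Hp := Rinv_0_lt_compat _ (q4_pos n)). unfold ind. destruct (Nat.ltb_spec n N) as [L|L].
    + specialize (Hq1 n). assert (Rabs (eps n) <= K) by nra. assert (0 <= K * s * t ^ n) by (repeat apply Rmult_le_pos; lra).
      generalize (Rabs_pos (eps n)); nra.
    + specialize (B1 n L). rewrite Rplus_0_l. apply Rmult_le_compat_r; [lra|]. nra.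
  - apply (ex_series_plus (V := R_NormedModule)); [eexists; exact Ei|].
    apply (ex_series_scal_l (V := R_NormedModule)); auto. }
rewrite Series_plus, (is_series_unique _ _ Ei), Series_scal_l, Series_geom in D.
- rewrite Rabs_mult, (Rabs_pos_eq (1 - t)) by lra.
  apply Rle_trans with ((1 - t) * (K * INR N + K * s * / (1 - t))); [apply Rmult_le_compat_l; lra|].
  replace ((1 - t) * (K * INR N + K * s * / (1 - t))) with (K * (INR N * (1 - t)) + K * s) by (field; lra).
  assert (INR N * (1 - t) <= 2 * s ^ 4).
  { rewrite <- E8, HN. apply Rle_trans with ((/ s ^ 4 + 1) * s ^ 8); [apply Rmult_le_compat_r; [apply pow_le; lra|lra]|].
    replace ((/ s ^ 4 + 1) * s ^ 8) with (s ^ 4 + s ^ 8) by (field; lra).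
    assert (s ^ 8 <= s ^ 4); [|lra]. replace (s ^ 8) with (s ^ 4 * s ^ 4) by ring.
    assert (s ^ 4 <= 1) by (rewrite <- (pow1 4); apply pow_incr; lra). assert (0 <= s ^ 4) by (apply pow_le; lra). nra. }
  assert (s ^ 4 <= s).
  { assert (s ^ 3 <= 1) by (rewrite <- (pow1 3); apply pow_incr; lra). replace (s ^ 4) with (s ^ 3 * s) by ring. nra. }
  fold s. nra.
- rewrite Rabs_pos_eq; lra.
- eexists; exact Ei.
- apply (ex_series_scal_l (V := R_NormedModule)); auto.
Qed.

Lemma rad_of_abs b : (forall r, 0 < r < 1 -> ex_series (fun n => Rabs (b n) * r ^ n)) -> rad b.
Proof.
intros H. assert (L : forall r, 0 < r < 1 -> Rbar_le r (CV_radius b)).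
{ intros r Hr. destruct (CV_radius_bounded b) as [H1 _]. apply H1.
  exists (Series (fun n => Rabs (b n) * r ^ n)); intros n.
  rewrite Rabs_mult, (Rabs_pos_eq (r ^ n)) by (apply pow_le; lra).
  assert (P : forall k, 0 <= Rabs (b k) * r ^ k) by (intros; apply Rmult_le_pos; [apply Rabs_pos|apply pow_le; lra]).
  eapply Rle_trans; [|apply (is_lim_seq_incr_compare (sum_n (fun n => Rabs (b n) * r ^ n))) with (n := n)].
  - destruct n as [|n]; [rewrite sum_O; lra|]. rewrite sum_Sn. change plus with Rplus; simpl.
    assert (0 <= sum_n (fun n => Rabs (b n) * r ^ n) n); [|lra].
    rewrite <- psum_sum_n; apply psum_nonneg; auto.
  - apply (Series_correct _ (H r Hr)).
  - intros k; rewrite sum_Sn. change plus with Rplus; simpl. specialize (P (S k)); simpl in P; lra. }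
unfold rad. assert (H0 := CV_radius_ge_0 b). destruct (CV_radius b) as [c| |] eqn:E; simpl in *; auto.
apply Rnot_lt_le; intros C. specialize (L ((c + 1) / 2)). simpl in L. lra.
Qed.

Lemma rad_dom a b : rad b -> (forall n, Rabs (a n) <= Rabs (b n)) -> rad a.
Proof.
intros Hb H; apply rad_of_abs; intros r Hr.
apply (ex_series_dom _ (fun n => Rabs (b n) * r ^ n)); [|apply rad_abs; auto; lra].
intros n; rewrite Rabs_mult, Rabs_Rabsolu, (Rabs_pos_eq (r ^ n)) by (apply pow_le; lra).
apply Rmult_le_compat_r; auto; apply pow_le; lra.
Qed.

Lemma rad_growth b K : (forall n, Rabs (b n) <= K * q4 n) -> rad b.
Proof.
intros H. assert (HK : 0 <= K).
{ specialize (H 0%nat). generalize (Rabs_pos (b 0%nat)) (q4_pos 0). nra. }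
apply (rad_dom _ (PS_derive (fun _ => K))); [apply rad_derive, (rad_bounded _ K); intros; rewrite Rabs_pos_eq; lra|].
intros n. unfold PS_derive. rewrite (Rabs_pos_eq (INR (S n) * K)) by (apply Rmult_le_pos; auto using pos_INR).
eapply Rle_trans; [apply H|]. rewrite Rmult_comm; apply Rmult_le_compat_r; auto.
rewrite S_INR, <- q4_pow4. generalize (q4_ge1 n); intros.
assert (1 <= q4 n ^ 3) by (apply pow_R1_Rle; auto). simpl in *; nra.
Qed.

(** * Iterated integrals on the real interval [0,1) *)

Definition zr (w : word) (t : R) : R := PSeries (cw w) t.

Lemma rad_in a t : rad a -> Rabs t < 1 -> Rbar_lt (Rabs t) (CV_radius a).
Proof. intros Ha Ht; eapply Rbar_lt_le_trans; [|exact Ha]; exact Ht. Qed.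

Lemma rad_ex a t : rad a -> Rabs t < 1 -> ex_series (fun n => a n * t ^ n).
Proof.
intros Ha Ht; apply (ex_series_dom _ (fun n => Rabs (a n) * Rabs t ^ n)).
- intros n; rewrite Rabs_mult, RPow_abs; lra.
- apply rad_abs; auto; split; auto using Rabs_pos.
Qed.

Lemma rad_exp a t : rad a -> Rabs t < 1 -> ex_pseries a t.
Proof. intros Ha Ht; apply CV_disk_correct, CV_disk_inside, rad_in; auto. Qed.

Lemma Li_RtoC w t : Li w (RtoC t) = RtoC (zr w t).
Proof.
unfold Li, cps, zr, PSeries. unfold RtoC at 3. f_equal.
- apply Series_ext; intros n. rewrite <- RtoC_pow; reflexivity.
- rewrite (Series_ext _ (fun n => 0 * 0)).
  + rewrite Series_scal_l; ring.
  + intros n; rewrite <- RtoC_pow; unfold Im, RtoC; simpl; ring.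
Qed.

Definition phiR (l : letter) (t : R) : R :=
  match l with
  | LX => / (1 - t ^ 3) | LY => t / (1 - t ^ 3) | LS => t ^ 2 / (1 - t ^ 3)
  | LT => / t | L1 => / (1 - t) end.

Lemma one_minus_pow3_pos t : Rabs t < 1 -> 0 < 1 - t ^ 3.
Proof.
intros H; apply Rabs_def2 in H. assert (0 < 1 + t + t ^ 2) by nra.
replace (1 - t ^ 3) with ((1 - t) * (1 + t + t ^ 2)) by ring. apply Rmult_lt_0_compat; lra.
Qed.

Lemma phi_RtoC l t : Rabs t < 1 -> (l = LT -> t <> 0) -> phi l (RtoC t) = RtoC (phiR l t).
Proof.
intros Ht Hl. assert (H3 := one_minus_pow3_pos t Ht). assert (H1 := Rabs_def2 _ _ Ht).
destruct l; cbn [phi phiR]; unfold Cdiv, Rdiv;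
rewrite ?RtoC_mult, ?RtoC_inv, ?RtoC_minus, ?RtoC_pow by (auto; lra); reflexivity.
Qed.

Lemma zr_deriv l w t : wf (l :: w) = true -> Rabs t < 1 -> (l = LT -> t <> 0) ->
  is_derive (zr (l :: w)) t (phiR l t * zr w t).
Proof.
intros H1 H2 H3.
assert (D : cderiv (fun s => RtoC s) t 1).
{ split; [apply (is_derive_id t)|exact (is_derive_const (V := R_NormedModule) 0 t)]. }
assert (D' : cderiv (fun s => Li (l :: w) (RtoC s)) t (1 * (phi l t * Li w t))%C).
{ apply (Li_deriv l w (fun s => RtoC s)); auto.
  - rewrite Cmod_R; auto.
  - intros E C; apply (H3 E). apply RtoC_inj; auto. }
rewrite phi_RtoC, Li_RtoC, <- !RtoC_mult, Rmult_1_l in D' by auto.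
destruct D' as [D' _]. apply (is_derive_ext (V := R_NormedModule) (fun s : R => Re (Li (l :: w) (RtoC s)))); auto.
intros s; rewrite Li_RtoC; reflexivity.
Qed.

Lemma zr_nil t : zr [] t = 1.
Proof. apply RtoC_inj. rewrite <- Li_RtoC, Li_nil; reflexivity. Qed.

Lemma zr_0 w : w <> [] -> zr w 0 = 0.
Proof. intros H; unfold zr; rewrite PSeries_0; apply cw_0; auto. Qed.

Lemma zr_nonneg w t : 0 <= t < 1 -> 0 <= zr w t.
Proof.
intros H; apply Series_nonneg; [|apply rad_ex; [apply cw_rad|rewrite Rabs_pos_eq; lra]].
intros n; apply Rmult_le_pos; [apply cw_bounds|apply pow_le; lra].
Qed.

Lemma zr_continuous w t : Rabs t < 1 -> continuous (zr w) t.
Proof. intros H; apply continuity_pt_filterlim; apply (PSeries_continuity (cw w)), rad_in; auto using cw_rad. Qed.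

Lemma derive_nonneg_le (f df : R -> R) (a b : R) : a <= b ->
  (forall t, a < t < b -> is_derive f t (df t)) -> (forall t, a <= t <= b -> continuous f t) ->
  (forall t, a < t < b -> 0 <= df t) -> f a <= f b.
Proof.
intros Hab Hd Hc Hp. destruct (Req_dec a b) as [->|Hne]; [lra|].
(* [MVT_gen] may return an endpoint, where nothing is known about [df]; the maximum with 0 is
   nonnegative there as well. *)
destruct (MVT_gen f a b (fun t => Rmax 0 (df t))) as (c & Hc1 & Hc2).
- rewrite Rmin_left, Rmax_right by lra. intros t Ht; rewrite Rmax_right; auto.
- rewrite Rmin_left, Rmax_right by lra. intros t Ht; apply continuity_pt_filterlim, Hc; auto.
- assert (0 <= Rmax 0 (df c)) by apply Rmax_l. nra.
Qed.

(** Derivatives are compared on the open interval only, because the form dt/t is singular at 0. *)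
Lemma derive_eq_open (f g df : R -> R) (a b : R) : a <= b ->
  (forall t, a < t < b -> is_derive f t (df t)) -> (forall t, a < t < b -> is_derive g t (df t)) ->
  (forall t, a <= t <= b -> continuous f t) -> (forall t, a <= t <= b -> continuous g t) ->
  f a = g a -> f b = g b.
Proof.
intros Hab Df Dg Cf Cg E.
assert (M : forall f1 g1 : R -> R, (forall t, a < t < b -> is_derive f1 t (df t)) -> (forall t, a < t < b -> is_derive g1 t (df t)) ->
  (forall t, a <= t <= b -> continuous f1 t) -> (forall t, a <= t <= b -> continuous g1 t) -> f1 a - g1 a <= f1 b - g1 b).
{ intros f1 g1 D1 D2 C1 C2. apply (derive_nonneg_le (fun t => f1 t - g1 t) (fun _ => 0)); auto; try (intros; lra).
  - intros t Ht. assert (D := is_derive_minus f1 g1 t _ _ (D1 t Ht) (D2 t Ht)).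
    rewrite minus_eq_zero in D. exact D.
  - intros t Ht; exact (continuous_minus f1 g1 t (C1 t Ht) (C2 t Ht)). }
assert (A := M f g Df Dg Cf Cg). assert (B := M g f Dg Df Cg Cf). lra.
Qed.

Lemma phiR_le l t : l <> LT -> 0 <= t < 1 -> 0 <= phiR l t <= / (1 - t).
Proof.
intros Hl Ht. assert (H3 := one_minus_pow3_pos t ltac:(rewrite Rabs_pos_eq; lra)).
assert (I3 := Rinv_0_lt_compat _ H3).
assert (t ^ 3 <= t) by (replace (t ^ 3) with (t * t * t) by ring; assert (t * t <= 1) by nra; nra).
assert (/ (1 - t ^ 3) <= / (1 - t)) by (apply Rinv_le_contravar; lra).
assert (0 < / (1 - t)) by (apply Rinv_0_lt_compat; lra).
destruct l; cbn [phiR]; try congruence; unfold Rdiv; try lra; split; try nra.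
assert (t ^ 2 <= 1) by (simpl; nra). nra.
Qed.

(** If the inner integral is at most K (1-t)^(-d), then integrating it against a form bounded by
    dt/(1-t) gives at most (K/d) (1-t)^(-d): the exponent stays and only the constant changes. [LT]
    divides coefficients by n and so only decreases the function. *)
Lemma zr_slow w : wf w = true -> slow (zr w).
Proof.
induction w as [|l w IH]; intros Hw.
- apply (slow_le _ (fun _ => 1)); [|apply slow_const]. intros t Ht; rewrite zr_nil; lra.
- assert (Hw' : wf w = true) by (simpl in Hw; apply andb_prop in Hw; apply Hw).
  assert (IH' := IH Hw'). destruct (match l with LT => true | _ => false end) eqn:El.
  { destruct l; try discriminate. apply (slow_le _ (zr w)); auto.
    intros t Ht; rewrite !Rabs_pos_eq by (apply zr_nonneg; auto).
    apply Series_le; [|apply rad_ex; [apply cw_rad|rewrite Rabs_pos_eq; lra]].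
    intros n; assert (0 <= t ^ n) by (apply pow_le; lra).
    split; [apply Rmult_le_pos; auto; apply cw_bounds|]. apply Rmult_le_compat_r; auto.
    cbn [cw]; unfold ext; destruct n as [|n]; [apply cw_bounds|].
    assert (1 <= INR (S n)) by (rewrite S_INR; generalize (pos_INR n); lra).
    generalize (proj1 (cw_bounds w (S n))); intros. apply (Rmult_le_reg_r (INR (S n))); [lra|].
    unfold Rdiv; rewrite Rmult_assoc, Rinv_l by lra. nra. }
  assert (Hl : l <> LT) by (intros ->; discriminate).
  intros d Hd. destruct (IH' d Hd) as (K & HK & H). exists (K / d).
  split; [apply Rdiv_le_0_compat; lra|]. intros t Ht. rewrite Rabs_pos_eq by (apply zr_nonneg; auto).
  set (g := fun s => K / d * Rpower (1 - s) (- d) - zr (l :: w) s).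
  assert (Dp : forall s, s < 1 -> is_derive (fun s => Rpower (1 - s) (- d)) s (d * / (1 - s) * Rpower (1 - s) (- d))).
  { intros s Hs. unfold Rpower. auto_derive; [lra|]. unfold Rminus; field; lra. }
  assert (g 0 <= g t).
  { apply (derive_nonneg_le g (fun s => K / d * (d * / (1 - s) * Rpower (1 - s) (- d)) - phiR l s * zr w s)); [lra| | |].
    - intros s Hs. apply (is_derive_minus (fun s => K / d * Rpower (1 - s) (- d)) (zr (l :: w))).
      + apply (is_derive_scal (fun s => Rpower (1 - s) (- d))). apply Dp; lra.
      + apply zr_deriv; [auto|rewrite Rabs_pos_eq; lra|congruence].
    - intros s Hs. apply (continuous_minus (fun s => K / d * Rpower (1 - s) (- d)) (zr (l :: w))).
      + apply (continuous_scal_r (K / d) (fun s => Rpower (1 - s) (- d))).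
        apply (ex_derive_continuous (fun s => Rpower (1 - s) (- d))). eexists; apply Dp; lra.
      + apply zr_continuous; rewrite Rabs_pos_eq; lra.
    - intros s Hs. specialize (H s ltac:(lra)). rewrite Rabs_pos_eq in H by (apply zr_nonneg; lra).
      destruct (phiR_le l s Hl ltac:(lra)) as [p1 p2].
      replace (K / d * (d * / (1 - s) * Rpower (1 - s) (- d))) with (/ (1 - s) * (K * Rpower (1 - s) (- d))) by (field; lra).
      assert (phiR l s * zr w s <= / (1 - s) * (K * Rpower (1 - s) (- d))); [|lra].
      apply Rmult_le_compat; auto. apply zr_nonneg; lra. }
  unfold g in H0. rewrite zr_0 in H0 by congruence.
  replace (1 - 0) with 1 in H0 by ring. unfold Rpower in H0 at 1. rewrite ln_1, Rmult_0_r, exp_0 in H0.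
  assert (0 <= K / d) by (apply Rdiv_le_0_compat; lra). lra.
Qed.

(** * Shuffle products *)

Definition lsum {A} (f : A -> R) (l : list A) : R := fold_right (fun w s => f w + s) 0 l.

Lemma lsum_app {A} (f : A -> R) l m : lsum f (l ++ m) = lsum f l + lsum f m.
Proof. induction l as [|x l IH]; simpl; [ring|rewrite IH; ring]. Qed.

Lemma lsum_map {A B} (f : B -> R) (g : A -> B) l : lsum f (map g l) = lsum (fun x => f (g x)) l.
Proof. induction l as [|x l IH]; simpl; [auto|rewrite IH; auto]. Qed.

Lemma lsum_ext {A} (f g : A -> R) l : (forall x, In x l -> f x = g x) -> lsum f l = lsum g l.
Proof. induction l as [|x l IH]; simpl; intros H; auto. rewrite IH, H; auto. Qed.

Lemma lsum_scal {A} c (f : A -> R) l : lsum (fun x => c * f x) l = c * lsum f l.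
Proof. induction l as [|x l IH]; simpl; [ring|rewrite IH; ring]. Qed.

Lemma lsum_plus {A} (f g : A -> R) l : lsum (fun x => f x + g x) l = lsum f l + lsum g l.
Proof. induction l as [|x l IH]; simpl; [ring|rewrite IH; ring]. Qed.

Fixpoint shuf {A} (u v : list A) : list (list A) :=
  match u with
  | [] => [v]
  | a :: u' =>
    (fix aux v := match v with
      | [] => [u]
      | b :: v' => map (cons a) (shuf u' v) ++ map (cons b) (aux v')
      end) v
  end.

Lemma shuf_cons {A} (a b : A) u v :
  shuf (a :: u) (b :: v) = map (cons a) (shuf u (b :: v)) ++ map (cons b) (shuf (a :: u) v).
Proof. reflexivity. Qed.

Lemma shuf_nil_r {A} (u : list A) : shuf u [] = [u].
Proof. destruct u; reflexivity. Qed.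

Lemma lsum_derive {A} (f : A -> R -> R) (df : A -> R) l t :
  (forall x, In x l -> is_derive (f x) t (df x)) ->
  is_derive (fun s => lsum (fun x => f x s) l) t (lsum df l).
Proof.
induction l as [|x l IH]; simpl; intros H.
- exact (is_derive_const (V := R_NormedModule) 0 t).
- apply (is_derive_plus (f x) (fun s => lsum (fun x => f x s) l)); auto.
Qed.

Lemma lsum_continuous {A} (f : A -> R -> R) l t :
  (forall x, In x l -> continuous (f x) t) -> continuous (fun s => lsum (fun x => f x s) l) t.
Proof.
induction l as [|x l IH]; simpl; intros H.
- apply continuous_const.
- apply (continuous_plus (f x) (fun s => lsum (fun x => f x s) l)); auto.
Qed.

(** Abstract in the alphabet, since it is applied both to the letters of [cw] and to the two letters
    a and b. *)
Section Shuffle.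
Variables (A : Type) (f : list A -> R -> R) (ph : A -> R -> R) (good : list A -> Prop).
Hypothesis good_tl : forall l w, good (l :: w) -> good w.
Hypothesis good_sh : forall u v w, good u -> good v -> In w (shuf u v) -> good w.
Hypothesis f_nil : forall t, f [] t = 1.
Hypothesis f_0 : forall l w, f (l :: w) 0 = 0.
Hypothesis f_d : forall l w t, good (l :: w) -> 0 < t < 1 -> is_derive (f (l :: w)) t (ph l t * f w t).
Hypothesis f_c : forall w t, good w -> 0 <= t < 1 -> continuous (f w) t.

(** Induction on the total length: by the product rule both sides have the same derivative, and both
    vanish at 0 when the two words are nonempty. *)
Theorem shuffle_product u v t : good u -> good v -> 0 <= t < 1 ->
  f u t * f v t = lsum (fun w => f w t) (shuf u v).
Proof.
remember (length u + length v)%nat as n eqn:Hn. assert (Hn' : (length u + length v <= n)%nat) by lia. clear Hn.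
revert u v t Hn'; induction n as [|n IH]; intros u v t Hn Hu Hv Ht.
{ destruct u; [|simpl in Hn; lia]. destruct v; [|simpl in Hn; lia]. simpl; rewrite !f_nil; ring. }
destruct u as [|a u]; [simpl; rewrite f_nil; ring|].
destruct v as [|b v]; [rewrite shuf_nil_r; simpl; rewrite f_nil; ring|].
assert (G : forall w, In w (shuf (a :: u) (b :: v)) -> good w) by (intros w; apply good_sh; auto).
assert (G1 : forall w, In w (shuf u (b :: v)) -> good (a :: w)).
{ intros w Hw; apply G; rewrite shuf_cons; apply in_or_app; left; apply in_map; auto. }
assert (G2 : forall w, In w (shuf (a :: u) v) -> good (b :: w)).
{ intros w Hw; apply G; rewrite shuf_cons; apply in_or_app; right; apply in_map; auto. }
set (df := fun s => ph a s * lsum (fun w => f w s) (shuf u (b :: v)) + ph b s * lsum (fun w => f w s) (shuf (a :: u) v)).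
apply (derive_eq_open (fun t => f (a :: u) t * f (b :: v) t)
  (fun t => lsum (fun w => f w t) (shuf (a :: u) (b :: v))) df 0 t); [lra| | | | |].
- intros s Hs. unfold df. rewrite <- !IH by (eauto; simpl in *; try lia; lra).
  replace (_ + _) with (ph a s * f u s * f (b :: v) s + f (a :: u) s * (ph b s * f v s)) by ring.
  apply is_derive_mulR; apply f_d; auto; lra.
- intros s Hs. unfold df. apply (is_derive_ext (fun t => lsum (fun w => f (a :: w) t) (shuf u (b :: v)) +
    lsum (fun w => f (b :: w) t) (shuf (a :: u) v))).
  { intros x; rewrite shuf_cons, lsum_app, !lsum_map; reflexivity. }
  rewrite <- !lsum_scal.
  apply (is_derive_plus (fun t => lsum (fun w => f (a :: w) t) (shuf u (b :: v)))
    (fun t => lsum (fun w => f (b :: w) t) (shuf (a :: u) v)));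
  apply (lsum_derive (fun w t => f (_ :: w) t)); intros x Hx; apply f_d; auto; lra.
- intros s Hs. apply (continuous_mult (f (a :: u)) (f (b :: v))); apply f_c; auto; lra.
- intros s Hs. apply lsum_continuous; intros w Hw; apply f_c; auto; lra.
- rewrite shuf_cons, lsum_app, !lsum_map, !f_0.
  assert (Z : forall c l, lsum (fun x => f (c :: x) 0) l = 0).
  { intros c l; rewrite (lsum_ext _ (fun _ => 0 * 0)) by (intros; rewrite f_0; ring). rewrite lsum_scal; ring. }
  rewrite !Z; ring.
Qed.
End Shuffle.

Definition goodw (w : word) := pure w = true /\ wf w = true.

Lemma in_shuf_cons {A} (a b : A) u v w : In w (shuf (a :: u) (b :: v)) ->
  exists w', (w = a :: w' /\ In w' (shuf u (b :: v))) \/ (w = b :: w' /\ In w' (shuf (a :: u) v)).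
Proof.
rewrite shuf_cons; intros H; apply in_app_or in H; destruct H as [H|H]; apply in_map_iff in H;
destruct H as (w' & <- & H); exists w'; auto.
Qed.

Lemma shuf_length {A} (u v w : list A) : In w (shuf u v) -> length w = (length u + length v)%nat.
Proof.
revert v w; induction u as [|a u IHu]; intros v w; [simpl; intros [<-|[]]; auto|].
revert w; induction v as [|b v IHv]; intros w H.
- rewrite shuf_nil_r in H; destruct H as [<-|[]]; simpl; lia.
- apply in_shuf_cons in H. destruct H as (w' & [[-> H]|[-> H]]); simpl.
  + rewrite (IHu _ _ H); simpl; lia.
  + rewrite (IHv _ H); simpl; lia.
Qed.

(** The innermost letter of a shuffle is the innermost letter of one of the factors, so no [LT]
    becomes innermost. *)
Lemma goodw_shuf u v w : goodw u -> goodw v -> In w (shuf u v) -> goodw w.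
Proof.
revert v w; induction u as [|a u IHu]; intros v w; [simpl; intros _ Hv [<-|[]]; auto|].
revert w; induction v as [|b v IHv]; intros w Hu Hv H.
- rewrite shuf_nil_r in H; destruct H as [<-|[]]; auto.
- assert (Tl : forall l x, goodw (l :: x) -> goodw x).
  { intros l x [H1 H2]; simpl in H1, H2; apply andb_prop in H1; apply andb_prop in H2; split; tauto. }
  assert (C : forall l x y, goodw (l :: x) -> goodw y -> y <> [] -> goodw (l :: y)).
  { intros l x y [H1 _] [H2 H3] Hy; simpl in *; apply andb_prop in H1; split; simpl; rewrite ?H2, ?H3;
    destruct l; try destruct y; intuition congruence. }
  apply in_shuf_cons in H. destruct H as (w' & [[-> H]|[-> H]]).
  + apply (C a u); auto; [eapply IHu; eauto|]. intros ->; apply shuf_length in H; simpl in H; lia.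
  + apply (C b v); auto; [apply (IHv w'); eauto|]. intros ->; apply shuf_length in H; simpl in H; lia.
Qed.

Lemma zr_shuffle u v t : goodw u -> goodw v -> 0 <= t < 1 ->
  zr u t * zr v t = lsum (fun w => zr w t) (shuf u v).
Proof.
apply (shuffle_product letter zr phiR goodw).
- intros l w [H1 H2]; simpl in H1, H2; apply andb_prop in H1; apply andb_prop in H2; split; tauto.
- apply goodw_shuf.
- apply zr_nil.
- intros; apply zr_0; congruence.
- intros l w s [H1 H2] Hs; apply zr_deriv; auto; [rewrite Rabs_pos_eq; lra|lra].
- intros w s _ Hs; apply zr_continuous; rewrite Rabs_pos_eq; lra.
Qed.

(** * Limits at [1] *)

(** Summation by parts on the level of generating functions: [b] is the sequence of partial sums of
    [a]. *)
Lemma telescoped_series (a b : nat -> R) t : rad b -> a O = b O -> (forall n, a (S n) = b (S n) - b n) ->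
  Rabs t < 1 -> Series (fun n => a n * t ^ n) = (1 - t) * Series (fun n => b n * t ^ n).
Proof.
intros Hb H0 HS Ht.
assert (E : PSeries (PS_plus b (PS_opp (PS_incr_1 b))) t = PSeries a t).
{ apply PSeries_ext; intros [|n]; unfold PS_plus, PS_opp, PS_incr_1.
  - change (b O + - 0 = a O). rewrite H0; ring.
  - change (b (S n) + - b n = a (S n)). rewrite HS; ring. }
change (PSeries a t = (1 - t) * PSeries b t). rewrite <- E.
rewrite PSeries_plus, PSeries_opp, PSeries_incr_1.
- change plus with Rplus; change opp with Ropp; ring.
- apply rad_exp; auto.
- apply rad_exp; auto. apply rad_opp, rad_incr_1; auto.
Qed.

(** Abel's theorem with a rate: partial sums that approach [F] like n^(-1/4) make the power series
    approach [F] like a power of 1-t. By summation by parts the difference is the function of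
    [small_abel]. *)
Lemma limit_small (a : nat -> R) F K : (forall n, Rabs (psum a (S n) - F) <= K * / q4 n) ->
  small (fun t => Series (fun n => a n * t ^ n) - F).
Proof.
intros H.
set (e := fun n => psum a (S n) - F).
apply (small_ext _ (fun t => (1 - t) * Series (fun n => e n * t ^ n))); [|apply (small_abel e K); auto].
intros t Ht. assert (Rt : Rabs t < 1) by (rewrite Rabs_pos_eq; lra).
assert (HK : 0 <= K).
{ specialize (H 0%nat). generalize (Rabs_pos (psum a 1 - F)) (Rinv_0_lt_compat _ (q4_pos 0)). nra. }
assert (Re : rad e).
{ apply (rad_bounded _ K); intros n; eapply Rle_trans; [apply H|].
  assert (/ q4 n <= 1) by (rewrite <- Rinv_1; apply Rinv_le_contravar; [lra|apply q4_ge1]).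
  assert (Hp := Rinv_0_lt_compat _ (q4_pos n)). nra. }
assert (G := ex_series_geom t Rt).
rewrite (telescoped_series a (fun n => psum a (S n))); auto.
- rewrite (Series_ext (fun n => psum a (S n) * t ^ n) (fun n => F * t ^ n + e n * t ^ n)) by (intros n; unfold e; ring).
  rewrite Series_plus, Series_scal_l, Series_geom by (auto; try (apply (ex_series_scal_l (V := R_NormedModule)); auto); apply rad_ex; auto).
  field; lra.
- apply (rad_bounded _ (K + Rabs F)); intros n. replace (psum a (S n)) with (e n + F) by (unfold e; ring).
  eapply Rle_trans; [apply Rabs_triang|]. specialize (H n). fold (e n) in H.
  assert (/ q4 n <= 1) by (rewrite <- Rinv_1; apply Rinv_le_contravar; [lra|apply q4_ge1]). nra.
- cbn [psum]; ring.
- intros n; cbn [psum]; ring.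
Qed.

(* A Dirichlet-type test: [chi] has partial sums bounded by 1 and [g] has summable variation. *)
Lemma dirichlet_bound (chi g : nat -> R) M N :
  (forall i j, (i <= j)%nat -> Rabs (psum chi j - psum chi i) <= 1) ->
  Rabs (psum (fun n => chi n * g n) (N + M) - psum (fun n => chi n * g n) N)
   <= Rabs (g (N + M)%nat) + psum (fun k => Rabs (g (N + S k)%nat - g (N + k)%nat)) M.
Proof.
intros H.
assert (E : psum (fun n => chi n * g n) (N + M) - psum (fun n => chi n * g n) N =
   (psum chi (N + M) - psum chi N) * g (N + M)%nat
   - psum (fun k => (psum chi (N + S k) - psum chi N) * (g (N + S k)%nat - g (N + k)%nat)) M).
{ induction M as [|M IH]; [rewrite Nat.add_0_r; simpl; ring|].
  rewrite Nat.add_succ_r in *; cbn [psum]; rewrite Nat.add_succ_r; cbn [psum] in *.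
  replace (psum (fun n => chi n * g n) (N + M) + chi (N + M)%nat * g (N + M)%nat - psum (fun n => chi n * g n) N)
   with (psum (fun n => chi n * g n) (N + M) - psum (fun n => chi n * g n) N + chi (N + M)%nat * g (N + M)%nat) by ring.
  rewrite IH. ring. }
rewrite E. unfold Rminus at 1. eapply Rle_trans; [apply Rabs_triang|]. rewrite Rabs_Ropp.
apply Rplus_le_compat.
- rewrite Rabs_mult. rewrite <- (Rmult_1_l (Rabs (g _))) at 2. apply Rmult_le_compat_r; [apply Rabs_pos|].
  apply H; lia.
- clear E; induction M as [|M IH]; cbn [psum]; [rewrite Rabs_R0; lra|].
  eapply Rle_trans; [apply Rabs_triang|]. apply Rplus_le_compat; auto.
  rewrite Rabs_mult. rewrite <- (Rmult_1_l (Rabs (g _ - _))) at 2. apply Rmult_le_compat_r; [apply Rabs_pos|].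
  apply H; lia.
Qed.

Definition cf (h : word) (n : nat) : R := cw (LX :: h) n - cw (LY :: h) n.

(** The nonprincipal character mod 3 evaluated at n - c. *)
Definition chi (c n : nat) : R :=
  (if Nat.eqb (n mod 3) ((1 + c) mod 3) then 1 else 0) - (if Nat.eqb (n mod 3) ((2 + c) mod 3) then 1 else 0).

Lemma psum_chi c n : (c < 3)%nat -> psum (chi c) n =
  match c with 0 => if Nat.eqb (n mod 3) 2 then 1 else 0
             | 1 => if Nat.eqb (n mod 3) 0 then 0 else -1
             | _ => if Nat.eqb (n mod 3) 1 then 1 else 0 end.
Proof.
intros Hc; induction n as [|n IH]; [destruct c as [|[|c]]; reflexivity|].
cbn [psum]; rewrite IH; unfold chi.
destruct c as [|[|[|c]]]; try lia; change ((1 + 0) mod 3) with 1%nat; change ((2 + 0) mod 3) with 2%nat;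
change ((1 + 1) mod 3) with 2%nat; change ((2 + 1) mod 3) with 0%nat;
change ((1 + 2) mod 3) with 0%nat; change ((2 + 2) mod 3) with 1%nat;
repeat (match goal with |- context [Nat.eqb ?x ?y] => destruct (Nat.eqb_spec x y) end); try lia; lra.
Qed.

Lemma psum_chi_bound c i j : (c < 3)%nat -> Rabs (psum (chi c) j - psum (chi c) i) <= 1.
Proof.
intros Hc; rewrite !psum_chi by auto. apply Rabs_le.
destruct c as [|[|c]]; repeat (match goal with |- context [Nat.eqb ?x ?y] => destruct (Nat.eqb x y) end); lra.
Qed.

Definition avg (h : word) (n : nat) := psum (cw h) n / INR n.

Lemma cf_chi h n : cf h n = chi (cls h) n * avg h n.
Proof.
unfold cf, avg, chi. cbn [cw]; unfold ext. cbn [cls lval]. destruct n as [|n].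
- simpl psum; unfold Rdiv; ring.
- destruct Nat.eqb, Nat.eqb; ring.
Qed.

Definition s2 (n : nat) : R := q4 n * q4 n.

Lemma s2_pos n : 0 < s2 n.
Proof. apply Rmult_lt_0_compat; apply q4_pos. Qed.

Lemma s2_sqr n : s2 n * s2 n = INR n + 1.
Proof. rewrite <- q4_pow4; unfold s2; ring. Qed.

(** Makes sums of n^(-3/2) telescope. With a and b the two consecutive square roots, (b-a)(a+b) = 1
    and a <= b <= 2a. *)
Lemma s2_tele n : / (s2 n ^ 3) <= 6 * (/ s2 n - / s2 (S n)).
Proof.
assert (Pa := s2_pos n); assert (Pb := s2_pos (S n)).
assert (Ea := s2_sqr n); assert (Eb := s2_sqr (S n)); rewrite S_INR in Eb.
assert (Hn := pos_INR n). set (a := s2 n) in *; set (b := s2 (S n)) in *.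
assert (a <= b) by nra. assert (b <= 2 * a) by nra.
assert (E : (b - a) * (a + b) = 1) by (ring_simplify; nra).
replace (/ a - / b) with ((b - a) / (a * b)) by (field; lra).
apply (Rmult_le_reg_r (a ^ 3 * b)); [apply Rmult_lt_0_compat; [apply pow_lt|]; auto|].
replace (/ a ^ 3 * (a ^ 3 * b)) with b by (field; lra).
replace (6 * ((b - a) / (a * b)) * (a ^ 3 * b)) with (6 * (b - a) * a ^ 2) by (field; lra).
apply (Rmult_le_reg_r (a + b)); [lra|].
replace (6 * (b - a) * a ^ 2 * (a + b)) with (6 * a ^ 2 * ((b - a) * (a + b))) by ring. rewrite E. nra.
Qed.

Lemma inv_INR_le n : (1 <= n)%nat -> / INR n <= 2 * / (INR n + 1).
Proof.
intros H. apply le_INR in H; simpl in H.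
apply (Rmult_le_reg_r (INR n * (INR n + 1))); [apply Rmult_lt_0_compat; lra|].
replace (/ INR n * (INR n * (INR n + 1))) with (INR n + 1) by (field; lra).
replace (2 * / (INR n + 1) * (INR n * (INR n + 1))) with (2 * INR n) by (field; lra). lra.
Qed.

(** The growth bounds in [q4] would give the sharper exponents 3/4 and 7/4; the exponents 1/2 and
    3/2 stated here suffice and fit the telescoping bound [s2_tele]. *)
Lemma avg_bounds h : exists K, 0 <= K /\ (forall n, 0 <= avg h n <= K * / s2 n) /\
  forall n, Rabs (avg h (S n) - avg h n) <= K * / s2 n ^ 3.
Proof.
destruct (cw_growth h) as (K1 & HK1 & H1). destruct (psum_cw_growth h) as (K2 & HK2 & H2).
exists (1 + K1 + 2 * K2); split; [lra|].
assert (S0 : forall n, 0 <= psum (cw h) n) by (intros; apply psum_nonneg; intros; apply cw_bounds).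
split.
- intros n; unfold avg. destruct n as [|n].
  { simpl psum; unfold Rdiv; rewrite Rmult_0_l. assert (Hp := Rinv_0_lt_compat _ (s2_pos 0)). split; [lra|].
    apply Rmult_le_pos; lra. }
  assert (Hn := INR_S_pos n). split; [apply Rdiv_le_0_compat; auto|].
  unfold Rdiv. apply Rle_trans with (K2 * q4 (S n) * (2 * / (INR (S n) + 1))).
  { apply Rmult_le_compat; auto; [left; apply Rinv_0_lt_compat; auto|apply inv_INR_le; lia]. }
  rewrite <- q4_pow4. unfold s2. assert (P := q4_pos (S n)). assert (G := q4_ge1 (S n)). set (q := q4 (S n)) in *.
  replace (K2 * q * (2 * / q ^ 4)) with (2 * K2 * / q * / (q * q)) by (field; lra).
  assert (/ q <= 1) by (rewrite <- Rinv_1; apply Rinv_le_contravar; lra).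
  assert (0 < / q) by (apply Rinv_0_lt_compat; lra).
  apply Rmult_le_compat_r; [left; apply Rinv_0_lt_compat, Rmult_lt_0_compat; auto|]. nra.
- intros n. destruct n as [|n].
  { unfold avg. cbn [psum]. replace ((0 + cw h 0) / INR 1 - 0 / INR 0) with (cw h 0) by (simpl INR; unfold Rdiv; rewrite Rinv_1; ring).
    assert (E : s2 0 = 1) by (unfold s2, q4; simpl; rewrite Rplus_0_l, !sqrt_1; ring). rewrite E, pow1, Rinv_1.
    destruct (cw_bounds h 0); rewrite Rabs_pos_eq; lra. }
  assert (Hn := INR_S_pos n). assert (Hn1 := INR_S_pos (S n)).
  assert (HI := inv_INR_le (S n) ltac:(lia)).
  unfold avg. cbn [psum]. change (psum (cw h) n + cw h n) with (psum (cw h) (S n)).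
  rewrite (S_INR (S n)).
  replace ((psum (cw h) (S n) + cw h (S n)) / (INR (S n) + 1) - psum (cw h) (S n) / INR (S n)) with
   (cw h (S n) * / (INR (S n) + 1) + - (psum (cw h) (S n) * / INR (S n) * / (INR (S n) + 1))) by (field; lra).
  eapply Rle_trans; [apply Rabs_triang|]. rewrite Rabs_Ropp.
  assert (Ip : 0 < / (INR (S n) + 1)) by (apply Rinv_0_lt_compat; lra).
  assert (Ip' : 0 < / INR (S n)) by (apply Rinv_0_lt_compat; lra).
  specialize (H1 (S n)). specialize (H2 (S n)). specialize (S0 (S n)). assert (C0 := proj1 (cw_bounds h (S n))).
  rewrite !Rabs_pos_eq by (repeat apply Rmult_le_pos; lra).
  assert (B1 : cw h (S n) * / (INR (S n) + 1) <= K1 * / q4 (S n) ^ 3 * / (INR (S n) + 1)) by (apply Rmult_le_compat_r; lra).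
  assert (B2 : psum (cw h) (S n) * / INR (S n) * / (INR (S n) + 1) <= K2 * q4 (S n) * (2 * / (INR (S n) + 1)) * / (INR (S n) + 1)).
  { apply Rmult_le_compat_r; [lra|]. apply Rmult_le_compat; lra. }
  rewrite <- q4_pow4 in B1, B2 |- *. unfold s2. assert (P := q4_pos (S n)). assert (G := q4_ge1 (S n)). set (q := q4 (S n)) in *.
  replace (K1 * / q ^ 3 * / q ^ 4) with (K1 * / q * / (q * q) ^ 3) in B1 by (field; lra).
  replace (K2 * q * (2 * / q ^ 4) * / q ^ 4) with (2 * K2 * / q * / (q * q) ^ 3) in B2 by (field; lra).
  assert (/ q <= 1) by (rewrite <- Rinv_1; apply Rinv_le_contravar; lra).
  assert (0 < / q) by (apply Rinv_0_lt_compat; lra).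
  assert (0 < / (q * q) ^ 3) by (apply Rinv_0_lt_compat, pow_lt, Rmult_lt_0_compat; auto).
  assert (K1 * / q * / (q * q) ^ 3 <= K1 * / (q * q) ^ 3) by (apply Rmult_le_compat_r; nra).
  assert (2 * K2 * / q * / (q * q) ^ 3 <= 2 * K2 * / (q * q) ^ 3) by (apply Rmult_le_compat_r; nra).
  nra.
Qed.

Definition Flim (h : word) : R := real (Lim_seq (psum (cf h))).

(** Dirichlet's test: blocks of the character have sums at most 1 in absolute value, and the
    averages have total variation at most 6K/[s2 N] beyond N. The rate n^(-1/2) matters, not just
    convergence: in [residue_stuffle_small] it must beat the growth n^(1/4) of a harmonic sum. *)
Lemma cf_limit h : exists K, 0 <= K /\ forall n, Rabs (psum (cf h) n - Flim h) <= K * / s2 n.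
Proof.
destruct (avg_bounds h) as (K & HK & H1 & H2).
assert (V : forall N M, psum (fun k => Rabs (avg h (N + S k)%nat - avg h (N + k)%nat)) M <= 6 * K * (/ s2 N - / s2 (N + M)%nat)).
{ intros N M; induction M as [|M IH]; [rewrite Nat.add_0_r; simpl psum; lra|]. cbn [psum].
  rewrite Nat.add_succ_r. specialize (H2 (N + M)%nat). generalize (s2_tele (N + M)). intros. nra. }
assert (B : forall N M, Rabs (psum (cf h) (N + M) - psum (cf h) N) <= 8 * K * / s2 N).
{ intros N M. rewrite !(psum_ext (cf h) (fun n => chi (cls h) n * avg h n)) by (intros; apply cf_chi).
  eapply Rle_trans; [apply dirichlet_bound; intros; apply psum_chi_bound, cls_lt|].
  specialize (V N M). destruct (H1 (N + M)%nat) as [G1 G2]. rewrite (Rabs_pos_eq _ G1).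
  assert (I1 := Rinv_0_lt_compat _ (s2_pos N)). assert (I2 := Rinv_0_lt_compat _ (s2_pos (N + M))).
  assert (/ s2 (N + M) <= / s2 N).
  { apply Rinv_le_contravar; [apply s2_pos|]. unfold s2. assert (L := q4_le N (N + M) ltac:(lia)). generalize (q4_pos N); nra. }
  nra. }
assert (Hs : is_lim_seq s2 p_infty).
{ apply (is_lim_seq_le_p_loc (fun n => sqrt (INR n))).
  - exists 0%nat; intros n _. unfold s2; rewrite q4_sqr; apply sqrt_le_1_alt; lra.
  - apply (is_lim_comp_seq sqrt INR p_infty p_infty); [apply is_lim_sqrt_p; apply is_lim_id|exists 0%nat; discriminate|apply is_lim_seq_INR]. }
assert (Hc : ex_finite_lim_seq (psum (cf h))).
{ apply ex_lim_seq_cauchy_corr. intros eps.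
  assert (H3 : Rbar_locally p_infty (fun x => 16 * K / eps < x)) by (exists (16 * K / eps); auto).
  destruct (Hs _ H3) as (N & HN). exists N; intros n m Hn Hm.
  assert (Hp : 0 < s2 N) by apply s2_pos. specialize (HN N (le_n N)). assert (He := cond_pos eps).
  assert (Q : 8 * K * / s2 N < eps / 2).
  { apply (Rmult_lt_reg_r (s2 N)); auto. rewrite Rmult_assoc, Rinv_l, Rmult_1_r by lra.
    apply (Rmult_lt_compat_r eps) in HN; auto. unfold Rdiv in HN; rewrite Rmult_assoc, Rinv_l in HN by lra. lra. }
  assert (Bn := B N (n - N)%nat). assert (Bm := B N (m - N)%nat).
  replace (N + (n - N))%nat with n in Bn by lia. replace (N + (m - N))%nat with m in Bm by lia.
  replace (psum (cf h) n - psum (cf h) m) with ((psum (cf h) n - psum (cf h) N) + - (psum (cf h) m - psum (cf h) N)) by ring.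
  eapply Rle_lt_trans; [apply Rabs_triang|]. rewrite Rabs_Ropp. lra. }
exists (8 * K); split; [lra|]. intros N.
assert (L := Lim_seq_correct' _ Hc). fold (Flim h) in L.
assert (L2 : is_lim_seq (fun M => psum (cf h) (M + N) - psum (cf h) N) (Flim h - psum (cf h) N)).
{ apply is_lim_seq_minus'; [apply is_lim_seq_incr_n; exact L|apply is_lim_seq_const]. }
apply is_lim_seq_abs in L2. rewrite Rabs_minus_sym.
assert (B' : forall M, Rabs (psum (cf h) (M + N) - psum (cf h) N) <= 8 * K * / s2 N).
{ intros M; rewrite Nat.add_comm; apply B. }
exact (is_lim_seq_le _ _ (Rbar_abs (Flim h - psum (cf h) N)) (8 * K * / s2 N) B' L2 (is_lim_seq_const _)).
Qed.

Lemma Flim_small h : small (fun t => zr (LX :: h) t - zr (LY :: h) t - Flim h).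
Proof.
destruct (cf_limit h) as (K & HK & H).
apply (small_ext _ (fun t => Series (fun n => cf h n * t ^ n) - Flim h)).
- intros t Ht. f_equal. unfold zr, PSeries, cf. rewrite <- Series_minus.
  + apply Series_ext; intros n; ring.
  + apply rad_ex; [apply cw_rad|rewrite Rabs_pos_eq; lra].
  + apply rad_ex; [apply cw_rad|rewrite Rabs_pos_eq; lra].
- apply (limit_small _ _ K). intros n; eapply Rle_trans; [apply H|]. apply Rmult_le_compat_l; auto.
  apply Rinv_le_contravar; [apply q4_pos|]. unfold s2.
  generalize (q4_le n (S n) ltac:(lia)) (q4_ge1 (S n)) (q4_pos n); intros; nra.
Qed.

(** * Words in the two real forms on the arc *)

Definition alpha (t : R) := sqrt 3 / (1 + t + t ^ 2).
Definition beta (t : R) := 3 / 2 * (1 + t) / (1 - t ^ 3).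
Definition abform (a : bool) (t : R) := if a then alpha t else beta t.

Definition lc (L : list (R * word)) (F : word -> R) : R := lsum (fun p => fst p * F (snd p)) L.

Definition cons_lc (c : R) (l : letter) (p : R * word) : R * word := (c * fst p, l :: snd p).

(* Up to the factors [sqrt 3] and [3/2], a = alpha is LX - LY and b = beta is LX + LY. *)
Fixpoint abexp (w : list bool) : list (R * word) :=
  match w with
  | [] => [(1, [])]
  | true :: w' => map (cons_lc (sqrt 3) LX) (abexp w') ++ map (cons_lc (- sqrt 3) LY) (abexp w')
  | false :: w' => map (cons_lc (3 / 2) LX) (abexp w') ++ map (cons_lc (3 / 2) LY) (abexp w')
  end.

Definition cab (w : list bool) (t : R) : R := lc (abexp w) (fun v => zr v t).

(* [true] is a and [false] is b; integrals that diverge at 1 get the value 0. *)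
Definition V (w : list bool) : R :=
  match w with [] => 1 | true :: w' => sqrt 3 * lc (abexp w') Flim | false :: _ => 0 end.

Lemma lc_app L M F : lc (L ++ M) F = lc L F + lc M F.
Proof. apply lsum_app. Qed.

Lemma lc_cons c l L F : lc (map (cons_lc c l) L) F = c * lc L (fun v => F (l :: v)).
Proof.
unfold lc; rewrite lsum_map, <- lsum_scal; apply lsum_ext; intros [d v] _; unfold cons_lc; simpl; ring.
Qed.

Lemma abexp_pure w p : In p (abexp w) -> goodw (snd p).
Proof.
revert p; induction w as [|a w IH]; intros p H; [destruct H as [<-|[]]; split; reflexivity|].
assert (G : forall c l, (l = LX \/ l = LY) -> In p (map (cons_lc c l) (abexp w)) -> goodw (snd p)).
{ intros c l Hl H0; apply in_map_iff in H0. destruct H0 as (p' & <- & Hp'). destruct (IH _ Hp') as [A B].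
  unfold cons_lc, goodw; simpl. destruct Hl as [-> | ->]; rewrite A, B; auto. }
destruct a; simpl in H; apply in_app_or in H; destruct H as [H|H];
(exact (G _ _ (or_introl eq_refl) H) || exact (G _ _ (or_intror eq_refl) H)).
Qed.

Lemma cab_nil t : cab [] t = 1.
Proof. unfold cab, lc; simpl. rewrite zr_nil; ring. Qed.

Lemma cab_0 a w : cab (a :: w) 0 = 0.
Proof.
assert (Z : forall l, lc (abexp w) (fun v => zr (l :: v) 0) = 0).
{ intros l; unfold lc; rewrite (lsum_ext _ (fun _ => 0 * 0)).
  - rewrite lsum_scal; ring.
  - intros; rewrite zr_0 by congruence; ring. }
unfold cab; destruct a; simpl; rewrite lc_app, !lc_cons, !Z; ring.
Qed.

Lemma lc_derive L (F : word -> R -> R) (D : word -> R) t :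
  (forall p, In p L -> is_derive (F (snd p)) t (D (snd p))) ->
  is_derive (fun s => lc L (fun v => F v s)) t (lc L D).
Proof.
intros H; unfold lc. apply (lsum_derive (fun p s => fst p * F (snd p) s)); intros p Hp.
apply (is_derive_scal (F (snd p))); auto.
Qed.

Lemma lc_scal c L F : lc L (fun v => c * F v) = c * lc L F.
Proof. unfold lc; rewrite <- lsum_scal; apply lsum_ext; intros; ring. Qed.

Lemma cab_deriv a w t : Rabs t < 1 -> is_derive (cab (a :: w)) t (abform a t * cab w t).
Proof.
intros Ht.
assert (D : forall l, (l = LX \/ l = LY) -> is_derive (fun s => lc (abexp w) (fun v => zr (l :: v) s)) t (phiR l t * cab w t)).
{ intros l Hl. unfold cab; rewrite <- lc_scal. apply (lc_derive _ (fun v => zr (l :: v))). intros p Hp.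
  destruct (abexp_pure _ _ Hp) as [A B]. apply zr_deriv; auto; [|destruct Hl; congruence].
  simpl; rewrite B; destruct Hl as [-> | ->]; rewrite A; auto. }
assert (H3 := one_minus_pow3_pos t Ht). apply Rabs_def2 in Ht.
assert (H4 : 0 < 1 + t + t ^ 2) by nra.
assert (E : forall c d, is_derive (fun s => c * lc (abexp w) (fun v => zr (LX :: v) s) + d * lc (abexp w) (fun v => zr (LY :: v) s)) t
   ((c * phiR LX t + d * phiR LY t) * cab w t)).
{ intros c d. replace ((c * phiR LX t + d * phiR LY t) * cab w t) with (c * (phiR LX t * cab w t) + d * (phiR LY t * cab w t)) by ring.
  apply (is_derive_plus (fun s => c * lc (abexp w) (fun v => zr (LX :: v) s))).
  - apply (is_derive_scal (fun s => lc (abexp w) (fun v => zr (LX :: v) s))); auto.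
  - apply (is_derive_scal (fun s => lc (abexp w) (fun v => zr (LY :: v) s))); auto. }
destruct a; simpl abform.
- replace (alpha t) with (sqrt 3 * phiR LX t + (- sqrt 3) * phiR LY t).
  + apply (is_derive_ext (fun s => sqrt 3 * lc (abexp w) (fun v => zr (LX :: v) s) + - sqrt 3 * lc (abexp w) (fun v => zr (LY :: v) s))); auto.
    intros s; unfold cab; simpl; rewrite lc_app, !lc_cons; reflexivity.
  + unfold alpha, phiR. replace (1 - t ^ 3) with ((1 - t) * (1 + t + t ^ 2)) by ring. field; lra.
- replace (beta t) with (3 / 2 * phiR LX t + 3 / 2 * phiR LY t).
  + apply (is_derive_ext (fun s => 3 / 2 * lc (abexp w) (fun v => zr (LX :: v) s) + 3 / 2 * lc (abexp w) (fun v => zr (LY :: v) s))); auto.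
    intros s; unfold cab; simpl; rewrite lc_app, !lc_cons; reflexivity.
  + unfold beta, phiR. field; lra.
Qed.

Lemma cab_continuous w t : Rabs t < 1 -> continuous (cab w) t.
Proof.
intros Ht; destruct w as [|a w].
- apply (continuous_ext (fun _ => 1)); [intros; rewrite cab_nil; auto|apply continuous_const].
- apply (ex_derive_continuous (cab (a :: w))); eexists; apply cab_deriv; auto.
Qed.

Lemma cab_shuffle u v t : 0 <= t < 1 -> cab u t * cab v t = lsum (fun w => cab w t) (shuf u v).
Proof.
intros Ht. apply (shuffle_product bool cab abform (fun _ => True)); auto using cab_nil, cab_0.
- intros l w s _ Hs; apply cab_deriv; rewrite Rabs_pos_eq; lra.
- intros w s _ Hs; apply cab_continuous; rewrite Rabs_pos_eq; lra.
Qed.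

Lemma lc_slow L : (forall p, In p L -> goodw (snd p)) -> slow (fun t => lc L (fun v => zr v t)).
Proof.
unfold lc; induction L as [|p L IH]; intros H; simpl.
- apply (slow_const 0).
- apply (slow_plus (fun t => fst p * zr (snd p) t)); [|apply IH; intros; apply H; right; auto].
  apply (slow_mult (fun _ => fst p)); [apply slow_const|]. apply zr_slow, H; left; auto.
Qed.

Lemma cab_slow w : slow (cab w).
Proof. apply lc_slow, abexp_pure. Qed.

Definition ga (w : list bool) := match w with false :: _ => false | _ => true end.

(** The outermost a is sqrt 3 times [LX] minus [LY], which is the difference whose limit is [Flim].
    All statements about V are derived from this approximation by functions on [0,1). *)
Lemma V_small w : ga w = true -> small (fun t => cab w t - V w).
Proof.
destruct w as [|[|] w]; intros H; [| |discriminate].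
- apply (small_ext _ (fun _ => 0)); [intros; rewrite cab_nil; simpl; ring|apply small_0].
- apply (small_ext _ (fun t => sqrt 3 * lc (abexp w) (fun v => zr (LX :: v) t - zr (LY :: v) t - Flim v))).
  + intros t Ht. unfold cab; simpl. rewrite lc_app, !lc_cons.
    transitivity (sqrt 3 * (lc (abexp w) (fun v => zr (LX :: v) t) + - lc (abexp w) (fun v => zr (LY :: v) t) - lc (abexp w) Flim)); [ring|].
    f_equal. unfold lc. induction (abexp w) as [|p L IH]; simpl; [ring|rewrite <- IH; ring].
  + apply small_scal. unfold lc. induction (abexp w) as [|p L IH]; simpl; [apply small_0|].
    apply (small_plus (fun t => fst p * (zr (LX :: snd p) t - zr (LY :: snd p) t - Flim (snd p)))); auto.
    apply (small_scal (fst p)), Flim_small.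
Qed.

From Stdlib Require Import QArith Qreals FMapPositive.
Close Scope Q_scope.
Open Scope R_scope.

Lemma small_minus f g : small f -> small g -> small (fun t => f t - g t).
Proof.
intros Hf Hg. apply (small_ext _ (fun t => f t + (-1) * g t)); [intros; ring|].
apply small_plus; auto. apply small_scal; auto.
Qed.

Lemma small_lsum {A} (F : A -> R -> R) l : (forall x, In x l -> small (F x)) ->
  small (fun t => lsum (fun x => F x t) l).
Proof.
induction l as [|x l IH]; simpl; intros H; [apply small_0|].
apply (small_plus (F x)); auto.
Qed.

Lemma small_unique f c d : small (fun t => f t - c) -> small (fun t => f t - d) -> c = d.
Proof.
intros H1 H2. assert (E : d - c = 0); [|lra]. apply small_const_0.
apply (small_ext _ (fun t => (f t - c) - (f t - d))); [intros; ring|]. apply (small_minus _ _ H1 H2).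
Qed.

Lemma lsum_minus {A} (f g : A -> R) l : lsum (fun x => f x - g x) l = lsum f l - lsum g l.
Proof. induction l as [|x l IH]; simpl; [ring|rewrite IH; ring]. Qed.

Lemma ga_shuf u v w : ga u = true -> ga v = true -> In w (shuf u v) -> ga w = true.
Proof.
destruct u as [|[|] u]; [simpl; intros _ H [<-|[]]; auto| |discriminate].
destruct v as [|[|] v]; [simpl; intros _ _ [<-|[]]; auto| |discriminate].
intros _ _ H; apply in_shuf_cons in H; destruct H as (w' & [[-> _]|[-> _]]); reflexivity.
Qed.

(** The error of one factor is small and the other factor is slow, so the product of the functions
    tends to the product of the values. On the other side, shuffles of words that do not begin with
    b do not begin with b either. *)
Lemma V_shuffle u v : ga u = true -> ga v = true -> V u * V v = lsum V (shuf u v).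
Proof.
intros Hu Hv. apply (small_unique (fun t => cab u t * cab v t)).
- apply (small_ext _ (fun t => (cab u t - V u) * cab v t + V u * (cab v t - V v))); [intros; ring|].
  apply small_plus; [apply (small_slow_mult (fun t => cab u t - V u)); auto using V_small, cab_slow|].
  apply small_scal, V_small; auto.
- apply (small_ext _ (fun t => lsum (fun w => cab w t - V w) (shuf u v))).
  + intros t Ht. rewrite cab_shuffle, lsum_minus; auto.
  + apply (small_lsum (fun w t => cab w t - V w)); intros w Hw; apply V_small. apply (ga_shuf u v); auto.
Qed.

Lemma sqrt3_sqr : sqrt 3 * sqrt 3 = 3.
Proof. apply sqrt_sqrt; lra. Qed.

Lemma sqrt3_pos : 0 < sqrt 3.
Proof. apply sqrt_lt_R0; lra. Qed.

Lemma small_limit_unique f g c : small (fun t => f t - c) -> (forall t, 0 <= t < 1 -> f t = g t) ->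
  continuous g 1 -> c = g 1.
Proof.
intros H E Hc. apply Rminus_diag_uniq. apply Rabs_eq_0.
destruct (Req_dec (Rabs (c - g 1)) 0) as [|Hn]; auto. exfalso.
assert (He : 0 < Rabs (c - g 1) / 2) by (generalize (Rabs_pos (c - g 1)); lra).
destruct (small_eventually _ H _ He) as (t0 & H0 & H1).
destruct (Hc _ (locally_ball (g 1) (mkposreal _ He))) as (d & Hd).
set (t := Rmax t0 (1 - Rmin d 1 / 2)).
assert (Hd0 := cond_pos d). assert (Hm : 0 < Rmin d 1) by (apply Rmin_pos; lra).
assert (Hm1 := Rmin_l d 1). assert (Hm2 := Rmin_r d 1).
assert (T1 : t0 <= t) by apply Rmax_l. assert (T2 : 1 - Rmin d 1 / 2 <= t) by apply Rmax_r.
assert (T3 : t < 1) by (apply Rmax_lub_lt; lra).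
specialize (H1 t (conj T1 T3)). rewrite E in H1 by lra.
assert (B : ball 1 d t). { change (Rabs (t - 1) < d). rewrite Rabs_left; lra. }
specialize (Hd t B). change (Rabs (g t - g 1) < Rabs (c - g 1) / 2) in Hd.
replace (c - g 1) with (- (g t - c) + (g t - g 1)) in Hd, H1, Hn, He by ring.
assert (Tr := Rabs_triang (- (g t - c)) (g t - g 1)). rewrite Rabs_Ropp in Tr. lra.
Qed.

Lemma V_a : V [true] = PI / 3.
Proof.
(* An antiderivative of [alpha]. The arctangent runs from pi/6 at t = 0 to pi/3 at t = 1, and the
   constant pi/3 makes [g] vanish at 0. *)
set (g := fun t => 2 * atan ((2 * t + 1) / sqrt 3) - PI / 3).
assert (S3 := sqrt3_sqr). assert (P3 := sqrt3_pos).
assert (D : forall t, is_derive g t (2 * (/ (1 + ((2 * t + 1) / sqrt 3) ^ 2) * (2 / sqrt 3)))).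
{ intros t; unfold g. auto_derive; [auto|]. unfold Rsqr; simpl. field.
  split; [lra|]. generalize (Rle_0_sqr (2 * t + 1)); unfold Rsqr; lra. }
replace (PI / 3) with (g 1).
2:{ unfold g. replace ((2 * 1 + 1) / sqrt 3) with (tan (PI / 3)).
  - rewrite atan_tan; [field|]. generalize PI_RGT_0; lra.
  - rewrite tan_PI3. apply (Rmult_eq_reg_r (sqrt 3)); [|lra]. transitivity 3; [lra|field; lra]. }
apply (small_limit_unique (cab [true])); [apply V_small; reflexivity| |].
2:{ apply (ex_derive_continuous g). eexists; apply D. }
intros t Ht. apply (derive_eq_open (cab [true]) g alpha 0 t); try lra.
- intros s Hs. replace (alpha s) with (alpha s * cab [] s) by (rewrite cab_nil; ring).
  apply (cab_deriv true); rewrite Rabs_pos_eq; lra.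
- intros s Hs. replace (alpha s) with (2 * (/ (1 + ((2 * s + 1) / sqrt 3) ^ 2) * (2 / sqrt 3))); [apply D|].
  unfold alpha. apply (Rmult_eq_reg_r (sqrt 3 * (1 + s + s ^ 2))); [|nra].
  replace (1 + ((2 * s + 1) / sqrt 3) ^ 2) with (4 / 3 * (1 + s + s ^ 2)).
  + transitivity (sqrt 3 * sqrt 3); [rewrite S3|]; field; nra.
  + replace (((2 * s + 1) / sqrt 3) ^ 2) with ((2 * s + 1) ^ 2 / (sqrt 3 * sqrt 3)) by (field; lra). rewrite S3; field.
- intros s Hs; apply cab_continuous; rewrite Rabs_pos_eq; lra.
- intros s Hs; apply (ex_derive_continuous g); eexists; apply D.
- rewrite cab_0. unfold g. replace ((2 * 0 + 1) / sqrt 3) with (tan (PI / 6)).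
  + rewrite atan_tan; [field|]. generalize PI_RGT_0; lra.
  + rewrite tan_PI6. f_equal; ring.
Qed.

(** * Telescoping products of iterated integrals *)

Section Tele.
Variables (F G : list bool -> R -> C).

(* When [F] integrates a word along a path and [G] integrates the reversed word along the rest of it, this sum
   over all ways to cut the word does not depend on the cutting point. *)
Fixpoint tele (R0 W : list bool) (t : R) : C :=
  (G R0 t * F W t + match W with [] => 0 | x :: U => tele (x :: R0) U t end)%C.

Variables (ph : bool -> C) (t : R) (okF okG : list bool -> Prop).
Hypothesis okF_tl : forall x U, okF (x :: U) -> okF U.
Hypothesis okG_cons : forall x S, okG S -> okG (x :: S).
Hypothesis F_nil : cderiv (F []) t 0.
Hypothesis F_cons : forall x U, okF (x :: U) -> cderiv (F (x :: U)) t (ph x * F U t)%C.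
Hypothesis G_cons : forall x S, okG (x :: S) -> cderiv (G (x :: S)) t (- (ph x * G S t))%C.

(** Differentiating the leading letter of the [F] word in one summand cancels against
    differentiating the same letter in the [G] word of the next; only the derivative of the first
    [G] factor is left over. *)
Lemma tele_deriv S W d : okF W -> okG S -> cderiv (G S) t d -> cderiv (tele S W) t (d * F W t)%C.
Proof.
revert S d; induction W as [|x U IH]; intros S d HW HS Hd; simpl.
- apply (cderiv_eq _ _ ((d * F [] t + G S t * 0) + 0)%C); [ring|].
  apply cderiv_plus; [apply cderiv_mult; auto|apply cderiv_const].
- apply (cderiv_eq _ _ ((d * F (x :: U) t + G S t * (ph x * F U t)) + - (ph x * G S t) * F U t)%C); [ring|].
  apply cderiv_plus; [apply cderiv_mult; auto|]. apply IH; eauto.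
Qed.

(** The admissibility of [G] words is required from [[x]] on, not from [[]]: a letter put before the
    empty word need not give a convergent integral. *)
Lemma tele_deriv_0 x U : okF (x :: U) -> okG [x] -> cderiv (G []) t 0 -> cderiv (tele [] (x :: U)) t 0.
Proof.
intros HW HS H0; simpl.
apply (cderiv_eq _ _ ((0 * F (x :: U) t + G [] t * (ph x * F U t)) + - (ph x * G [] t) * F U t)%C); [ring|].
apply cderiv_plus; [apply cderiv_mult; auto|]. apply tele_deriv; eauto.
Qed.
End Tele.

(* [true] is dz/(1-z) and [false] is dz/z. *)
Definition wl (W : list bool) : word := map (fun b : bool => if b then L1 else LT) W.

(** * The arc from e^(i pi/3) to 0 *)

Notation QC := (prod Q Q) (only parsing).

(* Pulled back along [uu], dz/(1-z) is -i alpha and dz/z is -beta + (i/2) alpha; the sign (-1)^|S| is that of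
   reversing the path. *)
Fixpoint gexp (S : list bool) : list (QC * list bool) :=
  match S with
  | [] => [((1%Q, 0%Q), [])]
  | true :: S' => map (fun p : QC * list bool => (((- snd (fst p))%Q, fst (fst p)), true :: snd p)) (gexp S')
  | false :: S' => map (fun p : QC * list bool => (fst p, false :: snd p)) (gexp S') ++
      map (fun p : QC * list bool => (((snd (fst p) * (1 # 2))%Q, (- fst (fst p) * (1 # 2))%Q), true :: snd p)) (gexp S')
  end.

Definition gsum (L : list (QC * list bool)) (F : list bool -> R) : C :=
  (lsum (fun p => Q2R (fst (fst p)) * F (snd p)) L, lsum (fun p => Q2R (snd (fst p)) * F (snd p)) L).

(** The iterated integral of [W] from 0 to e^(i pi/3). The arc runs the other way, and reversing a
    path reverses the word. *)
Definition ell (W : list bool) : C := gsum (gexp (rev W)) V.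

Definition GG (S : list bool) (t : R) : C := gsum (gexp S) (fun w => cab w t).

(** An arc of the unit circle about 1: |1-z| = 1 at t = 0, and dz/(1-z) is imaginary along it. Its
    squared modulus is [exp (thf t)], so the variable theta of the generating series is 2 ln |z|. *)
Definition uu (t : R) : C := ((1 - t) ^ 2 / (2 * (1 + t + t ^ 2)), sqrt 3 / 2 * (1 - t ^ 2) / (1 + t + t ^ 2)).
Definition du (t : R) : C :=
  (- (3 / 2) * (1 - t ^ 2) / (1 + t + t ^ 2) ^ 2, - sqrt 3 / 2 * (1 + 4 * t + t ^ 2) / (1 + t + t ^ 2) ^ 2).

Lemma uu_deriv t : 0 <= t < 1 -> cderiv uu t (du t).
Proof.
intros Ht. assert (H : 0 < 1 + t + t ^ 2) by nra. split; unfold uu, du, Re, Im; cbn [fst snd].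
- auto_derive; [nra|]. field; nra.
- auto_derive; [nra|]. field; nra.
Qed.

(** The negatives of the pulled back forms, that is, the forms for the arc traversed backwards. *)
Definition gform (b : bool) (t : R) : C := if b then (0, alpha t) else (beta t, - alpha t / 2).

Lemma uu_mod t : 0 < t < 1 -> 0 < Cmod (uu t) < 1.
Proof.
intros Ht. assert (S3 := sqrt3_sqr). assert (H : 0 < 1 + t + t ^ 2) by nra.
assert (E : Cmod (uu t) * Cmod (uu t) = (1 - t) ^ 2 / (1 + t + t ^ 2)).
{ rewrite Cmod_sqr. unfold uu, Re, Im; cbn [fst snd].
  transitivity (((1 - t) ^ 4 / 4 + (sqrt 3 * sqrt 3) / 4 * (1 - t ^ 2) ^ 2) / (1 + t + t ^ 2) ^ 2); [field; nra|].
  rewrite S3. field; nra. }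
assert (0 < Cmod (uu t) * Cmod (uu t)) by (rewrite E; apply Rdiv_lt_0_compat; nra).
assert (Cmod (uu t) * Cmod (uu t) < 1).
{ rewrite E. apply (Rmult_lt_reg_r (1 + t + t ^ 2)); auto. unfold Rdiv; rewrite Rmult_assoc, Rinv_l by lra. nra. }
generalize (Cmod_ge_0 (uu t)); nra.
Qed.

Lemma uu_form (b : bool) t : 0 < t < 1 ->
  (du t * phi (if b then L1 else LT) (uu t))%C = (- gform b t)%C.
Proof.
intros Ht. assert (S3 := sqrt3_sqr). assert (H : 0 < 1 + t + t ^ 2) by nra.
assert (H3 : 0 < 1 - t ^ 3) by (apply one_minus_pow3_pos; rewrite Rabs_pos_eq; lra).
assert (Hm := uu_mod t Ht).
assert (N1 : (1 - uu t)%C <> 0).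
{ generalize (one_minus_pow_neq (uu t) 1 ltac:(lia) ltac:(lra)); rewrite Cpow_1_r; auto. }
assert (N0 : uu t <> 0) by (intros E; rewrite E, Cmod_0 in Hm; lra).
destruct b; cbn [phi].
- assert (E : du t = (- gform true t * (1 - uu t))%C).
  { unfold du, uu, gform, alpha, Cmult, Cminus, Cplus, RtoC; cbn [fst snd]; unfold Copp; cbn [fst snd]. f_equal.
    - transitivity (- (sqrt 3 * sqrt 3) / 2 * (1 - t ^ 2) / (1 + t + t ^ 2) ^ 2); [rewrite S3; field; nra|field; nra].
    - field; nra. }
  rewrite E; field; auto.
- assert (E : du t = (- gform false t * uu t)%C).
  { unfold du, uu, gform, alpha, beta, Cmult, Cminus, Cplus, RtoC; cbn [fst snd]; unfold Copp; cbn [fst snd].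
    replace (1 - t ^ 3) with ((1 - t) * (1 + t + t ^ 2)) by ring. f_equal.
    - transitivity (- (3 / 4 * (1 + t) * (1 - t) / (1 + t + t ^ 2) ^ 2) - (sqrt 3 * sqrt 3) / 4 * (1 - t ^ 2) / (1 + t + t ^ 2) ^ 2).
      + rewrite S3; field; nra.
      + field; nra.
    - field; nra. }
  rewrite E; field; auto.
Qed.

Lemma gsum_derive L (F : list bool -> R -> R) (D : list bool -> R) t :
  (forall p, In p L -> is_derive (F (snd p)) t (D (snd p))) ->
  cderiv (fun s => gsum L (fun w => F w s)) t (gsum L D).
Proof.
intros H; split; cbn [gsum Re Im fst snd].
- apply (lsum_derive (fun p s => Q2R (fst (fst p)) * F (snd p) s)); intros p Hp. apply (is_derive_scal (F (snd p))); auto.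
- apply (lsum_derive (fun p s => Q2R (snd (fst p)) * F (snd p) s)); intros p Hp. apply (is_derive_scal (F (snd p))); auto.
Qed.

Lemma gsum_scal L c F : gsum L (fun w => c * F w) = (RtoC c * gsum L F)%C.
Proof.
unfold gsum, Cmult, RtoC; cbn [fst snd]; f_equal.
- match goal with |- _ = c * ?A - _ => transitivity (c * A); [|ring] end.
  rewrite <- lsum_scal; apply lsum_ext; intros; ring.
- match goal with |- _ = c * ?A + _ => transitivity (c * A); [|ring] end.
  rewrite <- lsum_scal; apply lsum_ext; intros; ring.
Qed.

Lemma gsum_true S F : gsum (gexp (true :: S)) F = (Ci * gsum (gexp S) (fun w => F (true :: w)))%C.
Proof.
simpl gexp; unfold gsum. rewrite !lsum_map. unfold Cmult, Ci; cbn [fst snd]; f_equal.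
- match goal with |- _ = _ - _ * ?B => transitivity (-1 * B); [|ring] end.
  rewrite <- lsum_scal; apply lsum_ext; intros p _. cbn [fst snd]. rewrite Q2R_opp; ring.
- ring.
Qed.

Lemma Q2R_half : Q2R (1 # 2) = / 2.
Proof. unfold Q2R; simpl; lra. Qed.

Lemma gsum_false S F : gsum (gexp (false :: S)) F =
  (gsum (gexp S) (fun w => F (false :: w)) + (- Ci / 2) * gsum (gexp S) (fun w => F (true :: w)))%C.
Proof.
simpl gexp; unfold gsum. rewrite !lsum_app, !lsum_map.
replace (- Ci / 2)%C with ((0, - / 2) : C).
2:{ unfold Cdiv, Cinv, Cmult, Copp, Ci, RtoC; simpl; f_equal; field. }
unfold Cmult, Cplus; cbn [fst snd]; f_equal; f_equal.
- match goal with |- _ = _ - _ * ?B => transitivity (/ 2 * B); [|ring] end.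
  rewrite <- lsum_scal; apply lsum_ext; intros p _. cbn [fst snd]. rewrite Q2R_mult, Q2R_half; ring.
- match goal with |- _ = _ + _ * ?B => transitivity (- / 2 * B); [|ring] end.
  rewrite <- lsum_scal; apply lsum_ext; intros p _. cbn [fst snd]. rewrite Q2R_mult, Q2R_opp, Q2R_half; ring.
Qed.

Lemma gexp_nonnil S p : In p (gexp S) -> S <> [] -> snd p <> [].
Proof.
intros H HS; destruct S as [|[|] S]; [congruence| |]; simpl in H.
- apply in_map_iff in H; destruct H as (q & <- & _); discriminate.
- apply in_app_or in H; destruct H as [H|H]; apply in_map_iff in H; destruct H as (q & <- & _); discriminate.
Qed.

Lemma GG_nil t : GG [] t = 1.
Proof. unfold GG, gsum; simpl. rewrite cab_nil, RMicromega.Q2R_1, RMicromega.Q2R_0. unfold RtoC; f_equal; ring. Qed.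

Lemma GG_deriv b S t : Rabs t < 1 -> cderiv (GG (b :: S)) t (gform b t * GG S t)%C.
Proof.
intros Ht.
assert (D : forall a, cderiv (fun s => gsum (gexp S) (fun w => cab (a :: w) s)) t (RtoC (abform a t) * GG S t)%C).
{ intros a. unfold GG; rewrite <- gsum_scal. apply (gsum_derive _ (fun w => cab (a :: w))). intros p _; apply cab_deriv; auto. }
destruct b.
- apply (cderiv_ext (fun s => Ci * gsum (gexp S) (fun w => cab (true :: w) s))%C); [intros; unfold GG; rewrite gsum_true; auto|].
  apply (cderiv_eq _ _ (Ci * (RtoC (alpha t) * GG S t))%C).
  + unfold gform. replace ((0, alpha t) : C) with (Ci * RtoC (alpha t))%C by (unfold Ci, Cmult, RtoC; simpl; f_equal; ring). ring.
  + apply cderiv_scal, (D true).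
- apply (cderiv_ext (fun s => gsum (gexp S) (fun w => cab (false :: w) s) + (- Ci / 2) * gsum (gexp S) (fun w => cab (true :: w) s))%C);
   [intros; unfold GG; rewrite gsum_false; auto|].
  apply (cderiv_eq _ _ (RtoC (beta t) * GG S t + (- Ci / 2) * (RtoC (alpha t) * GG S t))%C).
  + unfold gform. replace ((beta t, - alpha t / 2) : C) with (RtoC (beta t) + (- Ci / 2) * RtoC (alpha t))%C; [ring|].
    replace (- Ci / 2)%C with ((0, - / 2) : C).
    2:{ unfold Cdiv, Cinv, Cmult, Copp, Ci, RtoC; simpl; f_equal; field. }
    unfold Cplus, Cmult, RtoC; simpl; f_equal; field.
  + apply cderiv_plus; [apply (D false)|apply cderiv_scal, (D true)].
Qed.

Lemma tele_uu x U t : wf (wl (x :: U)) = true -> 0 < t < 1 ->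
  cderiv (tele (fun W s => Li (wl W) (uu s)) GG [] (x :: U)) t 0.
Proof.
intros Hw Ht. assert (Hm := uu_mod t Ht).
apply (tele_deriv_0 _ _ (fun b => - gform b t)%C t (fun W => wf (wl W) = true) (fun _ => True)); auto.
- intros y Y; simpl; intros H; apply andb_prop in H; tauto.
- apply (cderiv_ext (fun _ => RtoC 1)); [intros; simpl; rewrite Li_nil; auto|apply cderiv_const].
- intros y Y HY. rewrite <- uu_form by auto.
  apply (cderiv_eq _ _ (du t * (phi (if y then L1 else LT) (uu t) * Li (wl Y) (uu t)))%C); [ring|].
  apply (Li_deriv (if y then L1 else LT) (wl Y) uu); auto; [lra| |apply uu_deriv; lra].
  intros _ E; rewrite E, Cmod_0 in Hm; lra.
- intros y S _. apply (cderiv_eq _ _ (gform y t * GG S t)%C); [ring|]. apply GG_deriv; rewrite Rabs_pos_eq; lra.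
- apply (cderiv_ext (fun _ => RtoC 1)); [intros; rewrite GG_nil; auto|apply cderiv_const].
Qed.

Lemma mvt_C (f df : R -> C) M : (forall t, 0 <= t <= 1 -> cderiv f t (df t)) ->
  (forall t, 0 <= t <= 1 -> Cmod (df t) <= M) -> Cmod (f 1 - f 0) <= 2 * M.
Proof.
intros Hd Hb.
assert (K : forall p : C -> R, (forall x, Rabs (p x) <= Cmod x) ->
  (forall t, 0 <= t <= 1 -> is_derive (fun s => p (f s)) t (p (df t))) -> Rabs (p (f 1) - p (f 0)) <= M).
{ intros p Hp D. destruct (MVT_gen (fun s => p (f s)) 0 1 (fun t => p (df t))) as (c & Hc & E).
  - rewrite Rmin_left, Rmax_right by lra. intros x Hx; apply D; lra.
  - rewrite Rmin_left, Rmax_right by lra. intros x Hx. apply continuity_pt_filterlim.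
    apply (ex_derive_continuous (fun s => p (f s))). eexists; apply D; auto.
  - rewrite Rmin_left, Rmax_right in Hc by lra. rewrite E. replace (p (df c) * (1 - 0)) with (p (df c)) by ring.
    eapply Rle_trans; [apply Hp|auto]. }
assert (K1 := K Re re_le_Cmod (fun t Ht => proj1 (Hd t Ht))).
assert (K2 := K Im im_le_Cmod (fun t Ht => proj2 (Hd t Ht))).
eapply Rle_trans; [apply Cmod_le_Rabs|].
replace (Re (f 1 - f 0)) with (Re (f 1) - Re (f 0)) by (unfold Re, Cminus, Cplus, Copp; simpl; ring).
replace (Im (f 1 - f 0)) with (Im (f 1) - Im (f 0)) by (unfold Im, Cminus, Cplus, Copp; simpl; ring).
lra.
Qed.

Definition rho : C := (/ 2, sqrt 3 / 2).

Lemma Cmod_1_of z : Re z * Re z + Im z * Im z = 1 -> Cmod z = 1.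
Proof. intros H; rewrite <- Cmod_sqr in H. generalize (Cmod_ge_0 z); nra. Qed.

Lemma rho_mod : Cmod rho = 1.
Proof.
apply Cmod_1_of; unfold rho, Re, Im; cbn [fst snd]. generalize sqrt3_sqr; intros.
replace (sqrt 3 / 2 * (sqrt 3 / 2)) with (sqrt 3 * sqrt 3 / 4) by field. lra.
Qed.

Lemma one_minus_rho_mod : Cmod (1 - rho) = 1.
Proof.
apply Cmod_1_of; unfold rho, Re, Im, Cminus, Cplus, Copp, RtoC; cbn [fst snd]. generalize sqrt3_sqr; intros.
replace ((0 + - (sqrt 3 / 2)) * (0 + - (sqrt 3 / 2))) with (sqrt 3 * sqrt 3 / 4) by field. lra.
Qed.

(** A convex neighbourhood of e^(i pi/3) within the unit disc that keeps a distance of 1/2 from both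
    singular points 0 and 1. The arc, the radius and the line Re z = 1/2 all approach e^(i pi/3)
    inside it. *)
Definition rg (z : C) := Cmod z < 1 /\ Cmod (z - rho) < / 2.

Lemma Cmod_triangle_inv a b : Cmod a <= Cmod b + Cmod (a - b).
Proof. replace a with (b + (a - b))%C at 1 by ring. apply Cmod_triangle. Qed.

Lemma rg_far z : rg z -> / 2 <= Cmod z /\ / 2 <= Cmod (1 - z).
Proof.
intros [H1 H2]. split.
- generalize (Cmod_triangle_inv rho z). replace (rho - z)%C with (- (z - rho))%C by ring.
  rewrite Cmod_opp, rho_mod; lra.
- generalize (Cmod_triangle_inv (1 - rho) (1 - z)). replace (1 - rho - (1 - z))%C with (z - rho)%C by ring.
  rewrite one_minus_rho_mod; lra.
Qed.

Lemma rg_convex z w s : rg z -> rg w -> 0 <= s <= 1 -> rg (z + s * (w - z))%C.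
Proof.
intros [H1 H2] [H3 H4] Hs.
assert (K : forall a b r, Cmod a < r -> Cmod b < r -> Cmod (a + s * (b - a)) < r).
{ intros a b r Ha Hb. replace (a + s * (b - a))%C with ((1 - s)%R * a + s * b)%C by (rewrite RtoC_minus; ring).
  eapply Rle_lt_trans; [apply Cmod_triangle|]. rewrite !Cmod_mult, !Cmod_R, !Rabs_pos_eq by lra.
  destruct (Req_dec s 0) as [->|]; [lra|].
  assert (s * Cmod b < s * r) by (apply Rmult_lt_compat_l; lra).
  assert ((1 - s) * Cmod a <= (1 - s) * r) by (apply Rmult_le_compat_l; lra). lra. }
split; [apply K; auto|].
replace (z + s * (w - z) - rho)%C with ((z - rho) + s * ((w - rho) - (z - rho)))%C by ring. apply K; auto.
Qed.

(** Both forms are at most 2 in modulus on [rg], so the mean value bound along a segment, which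
    stays in the convex region, gives the Lipschitz constant 4B from a bound B for the shorter
    word. *)
Lemma Li_rg W : wf (wl W) = true -> exists B, 0 <= B /\ (forall z, rg z -> Cmod (Li (wl W) z) <= B) /\
  forall z w, rg z -> rg w -> Cmod (Li (wl W) w - Li (wl W) z) <= B * Cmod (w - z).
Proof.
induction W as [|x U IH]; intros Hw.
- exists 1. repeat split; try lra; simpl.
  + intros z _; rewrite Li_nil, Cmod_1; lra.
  + intros z w _ _; rewrite !Li_nil. replace (1 - 1)%C with (RtoC 0) by ring. rewrite Cmod_0.
    generalize (Cmod_ge_0 (w - z)); lra.
- assert (Hu : wf (wl U) = true) by (simpl in Hw; apply andb_prop in Hw; tauto).
  destruct (IH Hu) as (B & HB & H1 & _).
  assert (L : forall z w, rg z -> rg w -> Cmod (Li (wl (x :: U)) w - Li (wl (x :: U)) z) <= 4 * B * Cmod (w - z)).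
  { intros z w Hz Hww.
    set (c := fun s : R => (z + s * (w - z))%C).
    assert (Dc : forall s, cderiv c s (w - z)%C).
    { intros s; unfold c. apply (cderiv_eq _ _ (0 + (1 * (w - z) + s * 0))%C); [ring|].
      apply cderiv_plus; [apply cderiv_const|]. apply cderiv_mult; [|apply cderiv_const].
      apply (cderiv_RtoC (fun s => s) s 1). apply (is_derive_id s). }
    assert (E := mvt_C (fun s => Li (wl (x :: U)) (c s))
       (fun s => ((w - z) * (phi (if x then L1 else LT) (c s) * Li (wl U) (c s)))%C) (2 * B * Cmod (w - z))).
    replace (Li (wl (x :: U)) w) with (Li (wl (x :: U)) (c 1)) by (unfold c; f_equal; ring).
    replace (Li (wl (x :: U)) z) with (Li (wl (x :: U)) (c 0)) by (unfold c; f_equal; ring).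
    replace (4 * B * Cmod (w - z)) with (2 * (2 * B * Cmod (w - z))) by ring. apply E.
    + intros t Ht. assert (R := rg_convex z w t Hz Hww Ht). fold (c t) in R.
      apply (Li_deriv (if x then L1 else LT) (wl U) c); auto; [apply R|].
      intros _ E0. destruct (rg_far _ R) as [F _]. rewrite E0, Cmod_0 in F; lra.
    + intros t Ht. assert (R := rg_convex z w t Hz Hww Ht). fold (c t) in R.
      destruct (rg_far _ R) as [F1 F2].
      assert (P : Cmod (phi (if x then L1 else LT) (c t)) <= 2).
      { assert (Q : forall y, / 2 <= Cmod y -> Cmod (/ y) <= 2).
        { intros y Hy. rewrite Cmod_inv by (apply Cmod_gt_0; lra). rewrite <- (Rinv_inv 2). apply Rinv_le_contravar; lra. }
        destruct x; apply Q; auto. }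
      rewrite !Cmod_mult. specialize (H1 _ R).
      assert (0 <= Cmod (phi (if x then L1 else LT) (c t))) by apply Cmod_ge_0.
      assert (0 <= Cmod (Li (wl U) (c t))) by apply Cmod_ge_0.
      rewrite (Rmult_comm (2 * B)). apply Rmult_le_compat_l; [apply Cmod_ge_0|]. nra. }
  set (z0 := ((3 / 4)%R * rho)%C).
  assert (R0 : rg z0).
  { unfold z0; split; [rewrite Cmod_mult, rho_mod, Cmod_R, Rabs_pos_eq; lra|].
    replace ((3 / 4)%R * rho - rho)%C with ((- / 4)%R * rho)%C.
    - rewrite Cmod_mult, rho_mod, Cmod_R, Rabs_left; lra.
    - replace (- / 4)%R with (3 / 4 - 1) by field. rewrite RtoC_minus; ring. }
  exists (Cmod (Li (wl (x :: U)) z0) + 4 * B).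
  assert (C0 := Cmod_ge_0 (Li (wl (x :: U)) z0)).
  repeat split; [lra| |].
  + intros z Hz. eapply Rle_trans; [apply (Cmod_triangle_inv _ (Li (wl (x :: U)) z0))|].
    apply Rplus_le_compat_l. eapply Rle_trans; [apply L; auto|].
    assert (Cmod (z - z0) <= 1); [|nra].
    replace (z - z0)%C with ((z - rho) + - (z0 - rho))%C by ring.
    eapply Rle_trans; [apply Cmod_triangle|]. rewrite Cmod_opp. destruct Hz, R0; lra.
  + intros z w Hz Hww. eapply Rle_trans; [apply L; auto|]. apply Rmult_le_compat_r; [apply Cmod_ge_0|lra].
Qed.

(** Majorant of all the [GG] factors in the telescoping sum: slow near t = 1 and, for nonempty [S0],
    equal to 0 at t = 0. *)
Fixpoint gs (S0 W : list bool) (t : R) : R :=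
  Cmod (GG S0 t) + match W with [] => 0 | x :: U => gs (x :: S0) U t end.

Lemma gs_nonneg S0 W t : 0 <= gs S0 W t.
Proof.
revert S0; induction W as [|x U IH]; intros S0; simpl; generalize (Cmod_ge_0 (GG S0 t)); [lra|].
specialize (IH (x :: S0)); lra.
Qed.

Definition FF (W : list bool) (t : R) : C := Li (wl W) (uu t).

Lemma Li_near0 w z : w <> [] -> Cmod z <= / 2 -> Cmod (Li w z) <= 4 * Cmod z.
Proof.
intros Hw Hz. unfold Li, cps.
rewrite (Series_incr_1_aux (fun n => cw w n * Re _)) by (rewrite cw_0; auto; ring).
rewrite (Series_incr_1_aux (fun n => cw w n * Im _)) by (rewrite cw_0; auto; ring).
assert (P := Cmod_ge_0 z). assert (G := ex_series_geom (Cmod z) ltac:(rewrite Rabs_pos_eq; lra)).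
eapply Rle_trans.
- apply (Cmod_Series_le (fun n => cw w (S n)) (fun n => (z ^ S n)%C) (fun n => Cmod z * Cmod z ^ n)).
  + intros n. rewrite Cmod_pow. assert (B := cw_bounds w (S n)). rewrite Rabs_pos_eq by lra.
    rewrite <- (Rmult_1_l (Cmod z * _)). apply Rmult_le_compat; try lra. apply pow_le; auto.
    simpl; lra.
  + apply (ex_series_scal_l (V := R_NormedModule)); auto.
- rewrite Series_scal_l, Series_geom by (rewrite Rabs_pos_eq; lra).
  assert (/ (1 - Cmod z) <= 2). { rewrite <- (Rinv_inv 2). apply Rinv_le_contravar; lra. }
  assert (0 < / (1 - Cmod z)) by (apply Rinv_0_lt_compat; lra). nra.
Qed.

Lemma uu_le t : 0 <= t < 1 -> Cmod (uu t) <= 1 - t.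
Proof.
intros Ht. assert (S3 := sqrt3_sqr). assert (H : 1 <= 1 + t + t ^ 2) by nra.
assert (E : Cmod (uu t) * Cmod (uu t) = (1 - t) ^ 2 / (1 + t + t ^ 2)).
{ rewrite Cmod_sqr. unfold uu, Re, Im; cbn [fst snd].
  transitivity (((1 - t) ^ 4 / 4 + (sqrt 3 * sqrt 3) / 4 * (1 - t ^ 2) ^ 2) / (1 + t + t ^ 2) ^ 2); [field; nra|].
  rewrite S3. field; nra. }
assert (Cmod (uu t) * Cmod (uu t) <= (1 - t) * (1 - t)).
{ rewrite E. apply (Rmult_le_reg_r (1 + t + t ^ 2)); [lra|]. unfold Rdiv; rewrite Rmult_assoc, Rinv_l by lra.
  assert (Q := Rle_0_sqr (1 - t)). unfold Rsqr in Q. nra. }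
generalize (Cmod_ge_0 (uu t)); nra.
Qed.

(** Near t = 1 the point [uu t] tends to 0, so every summand with a nonempty [Li] word is of order
    1-t times its other factor. Only the summand in which the whole word has moved to [GG]
    survives. *)
Lemma tele_near1 S0 W t : / 2 <= t < 1 ->
  Cmod (tele FF GG S0 W t - GG (rev W ++ S0) t) <= 4 * (1 - t) * gs S0 W t.
Proof.
intros Ht. revert S0; induction W as [|x U IH]; intros S0; simpl.
- unfold FF; simpl. rewrite Li_nil. replace (GG S0 t * 1 + 0 - GG S0 t)%C with (RtoC 0) by ring. rewrite Cmod_0.
  generalize (Cmod_ge_0 (GG S0 t)); nra.
- rewrite <- app_assoc; simpl.
  replace (GG S0 t * FF (x :: U) t + tele FF GG (x :: S0) U t - GG (rev U ++ x :: S0) t)%C with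
   (FF (x :: U) t * GG S0 t + (tele FF GG (x :: S0) U t - GG (rev U ++ x :: S0) t))%C by ring.
  eapply Rle_trans; [apply Cmod_triangle|]. rewrite Rmult_plus_distr_l. apply Rplus_le_compat; [|apply IH].
  rewrite Cmod_mult. apply Rmult_le_compat_r; [apply Cmod_ge_0|].
  assert (U1 := uu_le t ltac:(lra)). eapply Rle_trans; [apply Li_near0; [discriminate|lra]|]. lra.
Qed.

Lemma slow_Cmod (f : R -> C) : slow (fun t => Re (f t)) -> slow (fun t => Im (f t)) -> slow (fun t => Cmod (f t)).
Proof.
intros H1 H2. apply (slow_le _ (fun t => Rabs (Re (f t)) + Rabs (Im (f t)))).
- intros t _. assert (C := Cmod_le_Rabs (f t)). assert (C' := Cmod_ge_0 (f t)).
  assert (P1 := Rabs_pos (Re (f t))). assert (P2 := Rabs_pos (Im (f t))).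
  rewrite (Rabs_pos_eq (Cmod _)), (Rabs_pos_eq (_ + _)); lra.
- apply slow_plus; [apply (slow_le _ (fun t => Re (f t)))|apply (slow_le _ (fun t => Im (f t)))]; auto;
  intros t _; rewrite Rabs_Rabsolu; lra.
Qed.

Lemma slow_lsum {A} (F : A -> R -> R) l : (forall x, In x l -> slow (F x)) ->
  slow (fun t => lsum (fun x => F x t) l).
Proof.
induction l as [|x l IH]; simpl; intros H; [apply (slow_const 0)|].
apply (slow_plus (F x)); auto.
Qed.

Lemma GG_slow S0 : slow (fun t => Cmod (GG S0 t)).
Proof.
apply slow_Cmod; unfold GG, gsum, Re, Im; cbn [fst snd].
- apply (slow_lsum (fun p t => Q2R (fst (fst p)) * cab (snd p) t)); intros p _.
  apply (slow_mult (fun _ => Q2R (fst (fst p)))); auto using slow_const, cab_slow.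
- apply (slow_lsum (fun p t => Q2R (snd (fst p)) * cab (snd p) t)); intros p _.
  apply (slow_mult (fun _ => Q2R (snd (fst p)))); auto using slow_const, cab_slow.
Qed.

Lemma gs_slow S0 W : slow (gs S0 W).
Proof.
revert S0; induction W as [|x U IH]; intros S0; simpl.
- apply (slow_plus (fun t => Cmod (GG S0 t))); [apply GG_slow|apply slow_const].
- apply (slow_plus (fun t => Cmod (GG S0 t))); [apply GG_slow|apply IH].
Qed.

Lemma small_Cmod (f : R -> C) : small (fun t => Re (f t)) -> small (fun t => Im (f t)) -> small (fun t => Cmod (f t)).
Proof.
intros H1 H2. apply (small_le _ (fun t => Rabs (Re (f t)) + Rabs (Im (f t)))).
- intros t _. assert (C := Cmod_le_Rabs (f t)). assert (C' := Cmod_ge_0 (f t)).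
  assert (P1 := Rabs_pos (Re (f t))). assert (P2 := Rabs_pos (Im (f t))).
  rewrite (Rabs_pos_eq (Cmod _)), (Rabs_pos_eq (_ + _)); lra.
- apply small_plus; [apply (small_le _ (fun t => Re (f t)))|apply (small_le _ (fun t => Im (f t)))]; auto;
  intros t _; rewrite Rabs_Rabsolu; lra.
Qed.

Lemma gexp_ga S0 p : In p (gexp (true :: S0)) -> ga (snd p) = true.
Proof. simpl; intros H; apply in_map_iff in H; destruct H as (q & <- & _); reflexivity. Qed.

Lemma GG_small S0 : small (fun t => Cmod (GG (true :: S0) t - gsum (gexp (true :: S0)) V)).
Proof.
assert (E : forall t, (GG (true :: S0) t - gsum (gexp (true :: S0)) V)%C = gsum (gexp (true :: S0)) (fun w => cab w t - V w)).
{ intros t; unfold GG, gsum, Cminus, Cplus, Copp; cbn [fst snd]; f_equal;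
  rewrite (lsum_ext (fun p => _ * (cab _ t - V _)) (fun p => _ * cab (snd p) t - _ * V (snd p))) by (intros; rewrite Rmult_minus_distr_l; reflexivity);
  rewrite lsum_minus; reflexivity. }
apply small_Cmod.
- apply (small_ext _ (fun t => lsum (fun p => Q2R (fst (fst p)) * (cab (snd p) t - V (snd p))) (gexp (true :: S0)))).
  + intros t _; rewrite E; reflexivity.
  + apply (small_lsum (fun p t => Q2R (fst (fst p)) * (cab (snd p) t - V (snd p)))). intros p Hp.
    apply (small_scal _ (fun t => cab (snd p) t - V (snd p))), V_small, (gexp_ga S0); auto.
- apply (small_ext _ (fun t => lsum (fun p => Q2R (snd (fst p)) * (cab (snd p) t - V (snd p))) (gexp (true :: S0)))).
  + intros t _; rewrite E; reflexivity.
  + apply (small_lsum (fun p t => Q2R (snd (fst p)) * (cab (snd p) t - V (snd p)))). intros p Hp.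
    apply (small_scal _ (fun t => cab (snd p) t - V (snd p))), V_small, (gexp_ga S0); auto.
Qed.

(** The innermost letter of an admissible word is dz/(1-z). After the reversal it is outermost and
    pulls back to a multiple of a, so that [ell] involves only genuine limits among the V's. *)
Lemma wf_rev W : wf (wl W) = true -> W <> [] -> exists S0, rev W = true :: S0.
Proof.
intros H1 H2. induction W as [|x U IH]; [congruence|].
destruct U as [|y U].
- destruct x; [exists []; reflexivity|discriminate].
- destruct IH as (S0 & E); [simpl in H1; apply andb_prop in H1; apply H1|discriminate|].
  exists (S0 ++ [x]). change (rev (x :: y :: U)) with (rev (y :: U) ++ [x]). rewrite E; reflexivity.
Qed.

Lemma Rle_0_of_small a f : small f -> (forall t, / 2 < t < 1 -> a <= f t) -> a <= 0.
Proof.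
intros H1 H2. apply Rnot_lt_le; intros Ha. destruct (small_eventually _ H1 a Ha) as (t0 & H0 & H3).
assert (M1 := Rmax_l t0 (3 / 4)). assert (M2 := Rmax_r t0 (3 / 4)).
assert (M3 : Rmax t0 (3 / 4) < 1) by (apply Rmax_lub_lt; lra).
specialize (H3 (Rmax t0 (3 / 4)) (conj M1 M3)). specialize (H2 (Rmax t0 (3 / 4)) ltac:(lra)).
apply Rabs_def2 in H3; lra.
Qed.

(** The telescoping sum does not depend on t, and by [tele_near1] its limit at t = 1 is [ell W];
    slow factors are absorbed by 1-t. *)
Lemma tele_ell W t : wf (wl W) = true -> W <> [] -> 0 < t < 1 -> tele FF GG [] W t = ell W.
Proof.
intros Hw Hn Ht. destruct W as [|x U]; [congruence|]. set (W := x :: U) in *.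
assert (Const : forall s, 0 < s < 1 -> tele FF GG [] W s = tele FF GG [] W t).
{ assert (K : forall a b, 0 < a < b -> b < 1 -> tele FF GG [] W a = tele FF GG [] W b).
  { intros a b H1 H2. apply (cderiv_zero_const _ a b); [|lra]. intros s Hs. apply tele_uu; auto; lra. }
  intros s Hs. destruct (Rtotal_order s t) as [H|[->|H]]; auto; [apply K; lra|symmetry; apply K; lra]. }
apply Ceq_minus. apply Cmod_eq_0. apply Rle_antisym; [|apply Cmod_ge_0].
destruct (wf_rev W Hw Hn) as (S0 & ES).
apply (Rle_0_of_small _ (fun s => 4 * ((1 - s) * gs [] W s) + Cmod (GG (true :: S0) s - ell W))).
- apply small_plus.
  + apply (small_scal 4 (fun s => (1 - s) * gs [] W s)). apply small_slow_mult; [apply small_1mt|apply gs_slow].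
  + unfold ell; rewrite ES. apply GG_small.
- intros s Hs. rewrite <- (Const s) by lra.
  replace (tele FF GG [] W s - ell W)%C with ((tele FF GG [] W s - GG (rev W ++ []) s) + (GG (true :: S0) s - ell W))%C.
  + eapply Rle_trans; [apply Cmod_triangle|]. apply Rplus_le_compat_r. rewrite <- Rmult_assoc. apply tele_near1; lra.
  + rewrite app_nil_r, ES; ring.
Qed.

Lemma uu_0 : uu 0 = rho.
Proof. unfold uu, rho; f_equal; field. Qed.

Lemma Cmod_continuous (f : R -> C) t : continuous (fun s => Re (f s)) t -> continuous (fun s => Im (f s)) t ->
  continuous (fun s => Cmod (f s)) t.
Proof.
intros H1 H2. unfold Cmod. apply continuous_comp with (g := sqrt).
- apply (continuous_plus (fun s => Re (f s) ^ 2) (fun s => Im (f s) ^ 2)); simpl.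
  + apply (continuous_mult (fun s => Re (f s)) (fun s => Re (f s) * 1)); auto.
    apply (continuous_mult (fun s => Re (f s)) (fun _ => 1)); auto; apply continuous_const.
  + apply (continuous_mult (fun s => Im (f s)) (fun s => Im (f s) * 1)); auto.
    apply (continuous_mult (fun s => Im (f s)) (fun _ => 1)); auto; apply continuous_const.
- apply continuity_pt_filterlim. apply continuity_pt_sqrt.
  generalize (pow2_ge_0 (Re (f t))) (pow2_ge_0 (Im (f t))); unfold Re, Im; lra.
Qed.

Lemma cderiv_continuous f t d : cderiv f t d -> continuous (fun s => Cmod (f s)) t.
Proof. intros [H1 H2]; apply Cmod_continuous.
- apply (ex_derive_continuous (fun s => Re (f s))); eexists; eauto.
- apply (ex_derive_continuous (fun s => Im (f s))); eexists; eauto. Qed.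

Lemma gs_continuous S0 W : continuous (gs S0 W) 0.
Proof.
assert (G : forall S1, continuous (fun t => Cmod (GG S1 t)) 0).
{ intros [|b S1].
  - apply (continuous_ext (fun _ => Cmod 1)); [intros; rewrite GG_nil; auto|apply continuous_const].
  - eapply cderiv_continuous, GG_deriv. rewrite Rabs_R0; lra. }
revert S0; induction W as [|x U IH]; intros S0; simpl.
- apply (continuous_plus (fun t => Cmod (GG S0 t)) (fun _ => 0)); auto; apply continuous_const.
- apply (continuous_plus (fun t => Cmod (GG S0 t)) (gs (x :: S0) U)); auto.
Qed.

Lemma GG_0 b S0 : GG (b :: S0) 0 = 0.
Proof.
unfold GG, gsum, RtoC. assert (H : forall p, In p (gexp (b :: S0)) -> cab (snd p) 0 = 0).
{ intros p Hp. assert (N := gexp_nonnil _ _ Hp ltac:(discriminate)). destruct (snd p) as [|a w]; [congruence|apply cab_0]. }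
f_equal; rewrite (lsum_ext _ (fun _ => 0 * 0)) by (intros p Hp; rewrite (H p Hp); ring); rewrite lsum_scal; ring.
Qed.

Lemma gs_0 b S0 W : gs (b :: S0) W 0 = 0.
Proof.
revert b S0; induction W as [|x U IH]; intros b S0; simpl; rewrite GG_0, Cmod_0; [ring|].
rewrite IH; ring.
Qed.

Lemma tele_le B S0 W t : 0 <= B ->
  (forall U, wf (wl U) = true -> (length U <= length W)%nat -> In U (map (fun n => skipn n W) (seq 0 (S (length W)))) -> Cmod (FF U t) <= B) ->
  wf (wl W) = true -> Cmod (tele FF GG S0 W t) <= B * gs S0 W t.
Proof.
intros HB. revert S0; induction W as [|x U IH]; intros S0 H Hw; simpl.
- rewrite Cplus_0_r, Cmod_mult. assert (Cmod (FF [] t) <= B) by (apply H; simpl; auto).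
  generalize (Cmod_ge_0 (GG S0 t)); nra.
- eapply Rle_trans; [apply Cmod_triangle|]. rewrite Rmult_plus_distr_l. apply Rplus_le_compat.
  + rewrite Cmod_mult. assert (Cmod (FF (x :: U) t) <= B) by (apply H; simpl; auto).
    generalize (Cmod_ge_0 (GG S0 t)); nra.
  + apply IH; [|simpl in Hw; apply andb_prop in Hw; apply Hw].
    intros Y HY1 HY2 HY3. apply H; auto; [simpl; lia|].
    apply in_map_iff in HY3. destruct HY3 as (n & <- & Hn). apply in_map_iff. exists (S n); split; [reflexivity|].
    apply in_seq in Hn. apply in_seq. simpl length; lia.
Qed.

Lemma rg_bound_suffixes W : wf (wl W) = true -> exists B, 0 <= B /\
  forall n z, rg z -> Cmod (Li (wl (skipn n W)) z) <= B.
Proof.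
induction W as [|x U IH]; intros Hw.
- destruct (Li_rg [] eq_refl) as (B & HB & H & _). exists B; split; auto. intros n; rewrite skipn_nil; auto.
- destruct IH as (B & HB & H); [simpl in Hw; apply andb_prop in Hw; apply Hw|].
  destruct (Li_rg (x :: U) Hw) as (B' & HB' & H' & _). exists (B + B'); split; [lra|].
  intros [|n] z Hz; simpl skipn; [specialize (H' z Hz)|specialize (H n z Hz)]; lra.
Qed.

(** At t = 0 every [GG] with a nonempty word vanishes, so by [tele_ell] the function [Li] tends to
    [ell W] along the arc. The Lipschitz bound of [Li_rg] carries this limit from the arc to the
    whole region. *)
Lemma ell_lim W : wf (wl W) = true -> exists M, 0 <= M /\
  forall z, rg z -> Cmod (Li (wl W) z - ell W) <= M * Cmod (z - rho).
Proof.
intros Hw. destruct W as [|x U].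
{ exists 0; split; [lra|]. intros z _. simpl; rewrite Li_nil. unfold ell, gsum; simpl.
  replace (1 - _)%C with (RtoC 0).
  - rewrite Cmod_0; lra.
  - rewrite RMicromega.Q2R_1, RMicromega.Q2R_0. unfold Cminus, Cplus, Copp, RtoC; simpl; f_equal; ring. }
destruct (Li_rg (x :: U) Hw) as (M & HM & _ & HL). destruct (rg_bound_suffixes (x :: U) Hw) as (B & HB & HS).
exists M; split; auto. intros z Hz. apply Rnot_lt_le; intros C.
(* Half of the supposed excess. A point of the arc is chosen so close to e^(i pi/3) that its
   distance and the remaining telescoping summands each cost less than [e]. *)
set (e := (Cmod (Li (wl (x :: U)) z - ell (x :: U)) - M * Cmod (z - rho)) / 2).
assert (He : 0 < e) by (unfold e; lra).
assert (Cu : continuous (fun t => Cmod (uu t - rho)) 0).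
{ apply (cderiv_continuous _ 0 (du 0 + 0)%C). apply (cderiv_plus uu (fun _ => (- rho)%C)); [apply uu_deriv; lra|apply cderiv_const]. }
assert (Cg := gs_continuous [x] U).
assert (Hd1 : 0 < e / (M + 1)) by (apply Rdiv_lt_0_compat; lra).
assert (Hd2 : 0 < e / (B + 1)) by (apply Rdiv_lt_0_compat; lra).
assert (Hd3 : 0 < Rmin (e / (M + 1)) (/ 2)) by (apply Rmin_pos; lra).
assert (L1 := Cu _ (locally_ball _ (mkposreal _ Hd3))). assert (L2 := Cg _ (locally_ball _ (mkposreal _ Hd2))).
unfold filtermap in L1, L2. destruct (filter_and _ _ L1 L2) as (d & Hd).
set (t := Rmin d 1 / 2). assert (Hd0 := cond_pos d).
assert (Hm : 0 < Rmin d 1) by (apply Rmin_pos; lra). assert (Hm1 := Rmin_l d 1). assert (Hm2 := Rmin_r d 1).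
assert (Ht : 0 < t < 1) by (unfold t; lra).
destruct (Hd t) as [B1 B2].
{ change (Rabs (t - 0) < d). rewrite Rminus_0_r, Rabs_pos_eq by lra. unfold t; lra. }
change (Rabs (Cmod (uu t - rho) - Cmod (uu 0 - rho)) < Rmin (e / (M + 1)) (/ 2)) in B1.
change (Rabs (gs [x] U t - gs [x] U 0) < e / (B + 1)) in B2.
rewrite uu_0 in B1. replace (rho - rho)%C with (RtoC 0) in B1 by ring. rewrite Cmod_0, Rminus_0_r, Rabs_pos_eq in B1 by apply Cmod_ge_0.
rewrite gs_0, Rminus_0_r, Rabs_pos_eq in B2 by apply gs_nonneg.
assert (R : rg (uu t)).
{ split; [apply uu_mod; auto|]. eapply Rlt_le_trans; [exact B1|apply Rmin_r]. }
assert (B1' : Cmod (uu t - rho) < e / (M + 1)) by (eapply Rlt_le_trans; [exact B1|apply Rmin_l]).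
assert (T := tele_ell (x :: U) t Hw ltac:(discriminate) Ht). simpl in T. rewrite GG_nil in T.
assert (E : (FF (x :: U) t - ell (x :: U))%C = (- tele FF GG [x] U t)%C) by (rewrite <- T; ring).
assert (Q1 : Cmod (FF (x :: U) t - ell (x :: U)) <= B * gs [x] U t).
{ rewrite E, Cmod_opp. apply tele_le; auto; [|simpl in Hw; apply andb_prop in Hw; apply Hw].
  intros Y _ _ HY. apply in_map_iff in HY. destruct HY as (n & <- & _). apply (HS (S n)); auto. }
assert (Q2 := HL (uu t) z R Hz). fold (FF (x :: U) t) in Q2.
assert (Q3 : Cmod (Li (wl (x :: U)) z - ell (x :: U)) <= Cmod (Li (wl (x :: U)) z - FF (x :: U) t) + Cmod (FF (x :: U) t - ell (x :: U))).
{ replace (Li (wl (x :: U)) z - ell (x :: U))%C with ((Li (wl (x :: U)) z - FF (x :: U) t) + (FF (x :: U) t - ell (x :: U)))%C by ring.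
  apply Cmod_triangle. }
assert (Q4 : Cmod (z - uu t) <= Cmod (z - rho) + Cmod (uu t - rho)).
{ replace (z - uu t)%C with ((z - rho) + - (uu t - rho))%C by ring. eapply Rle_trans; [apply Cmod_triangle|]. rewrite Cmod_opp; lra. }
assert (B * gs [x] U t <= B * (e / (B + 1))) by (apply Rmult_le_compat_l; lra).
assert (M * Cmod (uu t - rho) <= M * (e / (M + 1))) by (apply Rmult_le_compat_l; lra).
assert (M * Cmod (z - uu t) <= M * (Cmod (z - rho) + Cmod (uu t - rho))) by (apply Rmult_le_compat_l; lra).
assert (X1 : B * (e / (B + 1)) < e).
{ replace (B * (e / (B + 1))) with (e - e / (B + 1)) by (field; lra). lra. }
assert (X2 : M * (e / (M + 1)) < e).
{ replace (M * (e / (M + 1))) with (e - e / (M + 1)) by (field; lra). lra. }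
unfold e in *; lra.
Qed.

(** * Boundary values of absolutely convergent series *)

(** Makes the sum of n^(-5/4) telescope, with (b-a)(a+b)(a^2+b^2) = b^4 - a^4 = 1 for consecutive
    values a <= b <= 2a. *)
Lemma q4_tele5 n : / (q4 n ^ 5) <= 30 * (/ q4 n - / q4 (S n)).
Proof.
assert (Pa := q4_pos n); assert (Pb := q4_pos (S n)).
assert (Ea := q4_pow4 n); assert (Eb := q4_pow4 (S n)); rewrite S_INR in Eb.
assert (L := q4_le n (S n) ltac:(lia)). assert (Ga := q4_ge1 n). set (a := q4 n) in *; set (b := q4 (S n)) in *.
assert (b <= 2 * a).
{ apply Rnot_lt_le; intros C. assert (2 * a * (2 * a) < b * b) by nra.
  assert ((2 * a * (2 * a)) * (2 * a * (2 * a)) < b * b * (b * b)) by nra.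
  replace (b * b * (b * b)) with (b ^ 4) in H0 by ring. replace ((2 * a * (2 * a)) * (2 * a * (2 * a))) with (16 * a ^ 4) in H0 by ring.
  assert (1 <= a ^ 4) by (apply pow_R1_Rle; auto). lra. }
assert (E : (b - a) * ((a + b) * (a ^ 2 + b ^ 2)) = 1) by (ring_simplify; lra).
replace (/ a - / b) with ((b - a) / (a * b)) by (field; lra).
apply (Rmult_le_reg_r (a ^ 5 * b)); [apply Rmult_lt_0_compat; [apply pow_lt|]; auto|].
replace (/ a ^ 5 * (a ^ 5 * b)) with b by (field; lra).
replace (30 * ((b - a) / (a * b)) * (a ^ 5 * b)) with (30 * (b - a) * a ^ 4) by (field; lra).
assert (S1 : (a + b) * (a ^ 2 + b ^ 2) <= 15 * a ^ 3).
{ assert (b ^ 2 <= 4 * a ^ 2) by nra. replace (15 * a ^ 3) with ((3 * a) * (5 * a ^ 2)) by ring.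
  apply Rmult_le_compat; nra. }
assert (S2 : 1 <= (b - a) * (15 * a ^ 3)) by (rewrite <- E; apply Rmult_le_compat_l; lra).
replace (30 * (b - a) * a ^ 4) with (2 * a * ((b - a) * (15 * a ^ 3))) by ring. nra.
Qed.

Lemma ex_series_bounded u M : (forall n, 0 <= u n) -> (forall n, psum u n <= M) -> ex_series u.
Proof.
intros H1 H2. assert (E : ex_finite_lim_seq (fun n => psum u (S n))).
{ apply (ex_finite_lim_seq_incr _ M); [|intros; apply H2]. intros n; cbn [psum]; specialize (H1 (S n)); lra. }
destruct E as (l & Hl). exists l. change (is_lim_seq (sum_n u) l).
apply (is_lim_seq_ext (fun n => psum u (S n))); [intros; apply psum_sum_n|auto].
Qed.

Lemma ex_series_q5 : ex_series (fun n => / q4 n ^ 5).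
Proof.
apply (ex_series_bounded _ 30).
- intros n; left; apply Rinv_0_lt_compat, pow_lt, q4_pos.
- assert (T : forall n, psum (fun n => / q4 n ^ 5) n <= 30 * (/ q4 0 - / q4 n)).
  { induction n as [|n IH]; cbn [psum]; [lra|]. generalize (q4_tele5 n); lra. }
  intros n; eapply Rle_trans; [apply T|]. assert (Hp := Rinv_0_lt_compat _ (q4_pos n)).
  assert (/ q4 0 <= 1) by (rewrite <- Rinv_1; apply Rinv_le_contravar; [lra|apply q4_ge1]). lra.
Qed.

Definition Lb (a : nat -> R) (z : C) : C := (Series (fun n => a n * Re (z ^ n)%C), Series (fun n => a n * Im (z ^ n)%C)).

Lemma one_minus_pow_le r n : 0 <= r <= 1 -> 1 - r ^ n <= INR n * (1 - r).
Proof.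
intros Hr; induction n as [|n IH]; [simpl; lra|]. rewrite S_INR; simpl pow.
assert (0 <= r ^ n <= 1) by (split; [apply pow_le; lra|rewrite <- (pow1 n); apply pow_incr; lra]). nra.
Qed.

(** As 1 - r^n is at most 1 and at most n(1-r), it is at most the square root of n(1-r). Against
    coefficients of order n^(-7/4) this leaves n^(-5/4), which is summable. *)
Lemma abel_rate a K z : 0 <= K -> (forall n, Rabs (a n) <= K * / q4 n ^ 7) -> Cmod z = 1 ->
  ex_series (fun n => Rabs (a n)) /\
  exists M, 0 <= M /\ forall r, 0 <= r < 1 -> Cmod (cps a (r * z)%C - Lb a z) <= M * sqrt (1 - r).
Proof.
intros HK Ha Hz.
assert (G5 := ex_series_q5).
assert (A5 : forall n, Rabs (a n) * (q4 n * q4 n) <= K * / q4 n ^ 5).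
{ intros n. assert (P := q4_pos n). replace (K * / q4 n ^ 5) with (K * / q4 n ^ 7 * (q4 n * q4 n)) by (field; lra).
  apply Rmult_le_compat_r; [nra|auto]. }
assert (Ea : ex_series (fun n => Rabs (a n))).
{ apply (ex_series_dom _ (fun n => K * / q4 n ^ 5)).
  - intros n; rewrite Rabs_Rabsolu. eapply Rle_trans; [|apply A5]. generalize (q4_ge1 n) (Rabs_pos (a n)); intros.
    assert (1 <= q4 n * q4 n) by nra. nra.
  - apply (ex_series_scal_l (V := R_NormedModule)); auto. }
split; auto.
set (M := 2 * Series (fun n => K * / q4 n ^ 5)).
exists M. split.
{ apply Rmult_le_pos; [lra|]. apply Series_nonneg; [|apply (ex_series_scal_l (V := R_NormedModule)); auto].
  intros n; apply Rmult_le_pos; auto; left; apply Rinv_0_lt_compat, pow_lt, q4_pos. }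
intros r Hr.
assert (Hrz : Cmod (r * z) < 1) by (rewrite Cmod_mult, Cmod_R, Hz, Rabs_pos_eq; lra).
assert (Ra : rad a).
{ apply (rad_bounded _ (Series (fun n => Rabs (a n)))). intros n.
  assert (P : forall k, 0 <= Rabs (a k)) by (intros; apply Rabs_pos).
  eapply Rle_trans; [|apply (is_lim_seq_incr_compare (sum_n (fun n => Rabs (a n)))) with (n := n)].
  - destruct n as [|n]; [rewrite sum_O; lra|]. rewrite sum_Sn. change plus with Rplus; simpl.
    assert (0 <= sum_n (fun n => Rabs (a n)) n); [|lra].
    rewrite <- psum_sum_n; apply psum_nonneg; auto.
  - apply (Series_correct _ Ea).
  - intros k; rewrite sum_Sn. change plus with Rplus; simpl. specialize (P (S k)); lra. }
assert (E1 := cps_re a _ Ra Hrz). assert (E2 := cps_im a _ Ra Hrz).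
assert (Bd : forall p : C -> R, (forall x, Rabs (p x) <= Cmod x) -> ex_series (fun n => a n * p (z ^ n)%C)).
{ intros p Hp. apply (ex_series_dom _ _ ltac:(intros n; rewrite Rabs_mult; apply Rmult_le_compat_l; [apply Rabs_pos|apply Hp])).
  apply (ex_series_ext (fun n => Rabs (a n))); auto. intros n; rewrite Cmod_pow, Hz, pow1. eqR; ring. }
assert (E3 := Bd Re re_le_Cmod). assert (E4 := Bd Im im_le_Cmod).
replace (cps a (r * z) - Lb a z)%C with
  (Series (fun n => a n * Re ((r * z) ^ n - z ^ n)%C), Series (fun n => a n * Im ((r * z) ^ n - z ^ n)%C)).
- replace (M * sqrt (1 - r)) with (2 * Series (fun n => K * / q4 n ^ 5 * sqrt (1 - r))) by (rewrite Series_scal_r; unfold M; ring).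
  apply Cmod_Series_le.
  + intros n. replace ((r * z) ^ n - z ^ n)%C with (- ((1 - r ^ n)%R * z ^ n))%C.
    * rewrite Cmod_opp, Cmod_mult, Cmod_R, Cmod_pow, Hz, pow1, Rmult_1_r.
      assert (Hrn : 0 <= r ^ n <= 1) by (split; [apply pow_le; lra|rewrite <- (pow1 n); apply pow_incr; lra]).
      rewrite (Rabs_pos_eq (1 - r ^ n)) by lra.
      assert (X : 1 - r ^ n <= q4 n * q4 n * sqrt (1 - r)).
      { rewrite q4_sqr, <- sqrt_mult_alt by (generalize (INR1_pos n); lra).
        assert (L1 := one_minus_pow_le r n ltac:(lra)).
        set (x := 1 - r ^ n) in *. assert (0 <= x <= 1) by (unfold x; lra).
        apply Rle_trans with (sqrt x).
        - rewrite <- (sqrt_square x) at 1 by lra. apply sqrt_le_1_alt. nra.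
        - apply sqrt_le_1_alt. nra. }
      eapply Rle_trans; [apply Rmult_le_compat_l; [apply Rabs_pos|exact X]|].
      rewrite <- Rmult_assoc. apply Rmult_le_compat_r; [apply sqrt_pos|apply A5].
    * rewrite Cpow_mult_l, RtoC_minus, RtoC_pow; ring.
  + apply ex_series_scal_r, (ex_series_scal_l (V := R_NormedModule)); auto.
- assert (Q : forall p : C -> R, (forall x y, p (x - y)%C = p x - p y) ->
    ex_series (fun n => a n * p ((r * z) ^ n)%C) -> ex_series (fun n => a n * p (z ^ n)%C) ->
    Series (fun n => a n * p ((r * z) ^ n - z ^ n)%C) =
    Series (fun n => a n * p ((r * z) ^ n)%C) - Series (fun n => a n * p (z ^ n)%C)).
  { intros p Hp H1 H2. rewrite <- (Series_minus _ _ H1 H2). apply Series_ext; intros n; rewrite Hp; ring. }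
  apply injective_projections; [exact (Q Re ltac:(reflexivity) E1 E3)|exact (Q Im ltac:(reflexivity) E2 E4)].
Qed.

Lemma cw_LT_growth w : exists K, 0 <= K /\ forall n, Rabs (cw (LT :: w) n) <= K * / q4 n ^ 7.
Proof.
destruct (cw_growth w) as (K & HK & H). exists (2 * K); split; [lra|]. intros n.
assert (P := q4_pos n). assert (P3 := Rinv_0_lt_compat _ (pow_lt _ 3 P)). assert (P4 := Rinv_0_lt_compat _ (pow_lt _ 4 P)).
rewrite Rabs_pos_eq by apply cw_bounds. cbn [cw]; unfold ext. destruct n as [|n].
- apply Rmult_le_pos; [lra|]. left; apply Rinv_0_lt_compat, pow_lt; auto.
- replace (2 * K * / q4 (S n) ^ 7) with (K * / q4 (S n) ^ 3 * (2 * / q4 (S n) ^ 4)) by (field; lra).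
  unfold Rdiv. apply Rmult_le_compat; [apply cw_bounds|left; apply Rinv_0_lt_compat, INR_S_pos|apply H|].
  rewrite q4_pow4. apply inv_INR_le; lia.
Qed.

(* The word of the nested sum with the given exponents. *)
Fixpoint Wof (a : list nat) : list bool :=
  match a with [] => [] | a1 :: a' => repeat false (a1 - 1) ++ true :: Wof a' end.

Lemma cw_repeat k w l : (1 <= l)%nat -> cw (wl (repeat false k ++ true :: w)) l = psum (cw (wl w)) l / INR l ^ S k.
Proof.
intros Hl; destruct l as [|l]; [lia|]. assert (H := INR_S_pos l). induction k as [|k IH].
- cbn [repeat app wl map cw]; unfold ext. rewrite pow_1; reflexivity.
- cbn [repeat app wl map cw]; unfold ext. fold (wl (repeat false k ++ true :: w)). rewrite IH; clear IH.
  generalize dependent (INR (S l)); intros x Hx. change (x ^ S (S k)) with (x * x ^ S k).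
  field. split; [apply pow_nonzero|]; lra.
Qed.

Lemma cw_Wof_0 a1 a : cw (wl (Wof (a1 :: a))) 0 = 0.
Proof. cbn [Wof]. destruct (a1 - 1)%nat; reflexivity. Qed.

Lemma mhs_S a1 a L : mhs (a1 :: a) (S L) = mhs (a1 :: a) L + / INR (S L) ^ a1 * mhs a L.
Proof.
cbn [mhs]. destruct L as [|L].
- rewrite sum_n_n, sum_n_m_zero by lia. change zero with 0. simpl Nat.sub. ring.
- rewrite sum_n_Sm by lia. change plus with Rplus. replace (S (S L) - 1)%nat with (S L) by lia. reflexivity.
Qed.

Lemma mhs_0 a1 a : mhs (a1 :: a) 0 = 0.
Proof. cbn [mhs]. rewrite sum_n_m_zero by lia; reflexivity. Qed.

Definition pos_index (a : list nat) := List.Forall (fun n => (1 <= n)%nat) a.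

Lemma mhs_psum a L : pos_index a -> mhs a L = psum (cw (wl (Wof a))) (S L).
Proof.
intros Ha; revert L; induction Ha as [|a1 a H1 Ha IH]; intros L.
- induction L as [|L IHL]; [simpl; ring|]. cbn [psum] in *. rewrite <- IHL. simpl; ring.
- induction L as [|L IHL].
  + rewrite mhs_0. cbn [psum]. rewrite cw_Wof_0; ring.
  + rewrite mhs_S, IHL. cbn [psum]. f_equal. cbn [Wof]. rewrite cw_repeat by lia. rewrite IH.
    replace (S (a1 - 1)) with a1 by lia. unfold Rdiv; ring.
Qed.

Lemma cw_Wof a1 a l : pos_index (a1 :: a) -> (1 <= l)%nat -> cw (wl (Wof (a1 :: a))) l = / INR l ^ a1 * mhs a (l - 1).
Proof.
intros H Hl; inversion H; subst. cbn [Wof]. rewrite cw_repeat by auto. rewrite mhs_psum by auto.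
replace (S (l - 1)) with l by lia. replace (S (a1 - 1)) with a1 by lia. unfold Rdiv; ring.
Qed.

Lemma rho_pow l : expi (INR l * PI / 3) = (rho ^ l)%C.
Proof.
induction l as [|l IH].
- simpl. unfold expi. replace (0 * PI / 3) with 0 by field. rewrite cos_0, sin_0; reflexivity.
- rewrite Cpow_S, <- IH, S_INR. unfold expi, rho, Cmult; cbn [fst snd].
  replace ((INR l + 1) * PI / 3) with (PI / 3 + INR l * PI / 3) by field.
  rewrite cos_plus, sin_plus, cos_PI3, sin_PI3. f_equal; field.
Qed.

(** [psum] starts at 0, where the coefficient vanishes, and excludes its upper index; hence
    [S L]. *)
Lemma mcv_psum a1 a L : pos_index (a1 :: a) ->
  mcv_partial (a1 :: a) L = (psum (fun n => cw (wl (Wof (a1 :: a))) n * Re (rho ^ n)%C) (S L),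
                             psum (fun n => cw (wl (Wof (a1 :: a))) n * Im (rho ^ n)%C) (S L)).
Proof.
intros H. unfold mcv_partial. induction L as [|L IH].
- rewrite sum_n_m_zero by lia. cbn [psum]. rewrite cw_Wof_0.
  change (@zero C_AbelianMonoid) with ((0, 0) : C). apply injective_projections; cbn [fst snd]; ring.
- assert (E : forall f : nat -> C, sum_n_m (G := C_AbelianMonoid) f 1 (S L) = Cplus (sum_n_m (G := C_AbelianMonoid) f 1 L) (f (S L))).
  { intros f; destruct L as [|L].
    - rewrite sum_n_n, sum_n_m_zero by lia. change (@zero C_AbelianMonoid) with (RtoC 0). rewrite Cplus_0_l; reflexivity.
    - apply (sum_n_Sm f 1 (S L)); lia. }
  etransitivity; [apply E|]. etransitivity; [apply (f_equal (fun z : C => Cplus z _)); exact IH|].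
  rewrite (rho_pow (S L)), <- cw_Wof by (auto; lia).
  set (c := cw (wl (Wof (a1 :: a)))). cbn [psum]. generalize (rho ^ S L)%C; intros z.
  unfold Cplus, Cmult, RtoC, Re, Im; cbn [fst snd]. f_equal; ring.
Qed.

Lemma Series_psum u : ex_series u -> is_lim_seq (fun n => psum u (S n)) (Series u).
Proof.
intros H. apply (is_lim_seq_ext (sum_n u)); [intros; symmetry; apply psum_sum_n|]. apply (Series_correct _ H).
Qed.

Lemma filterlim_C (f : nat -> C) (z : C) : is_lim_seq (fun n => Re (f n)) (Re z) -> is_lim_seq (fun n => Im (f n)) (Im z) ->
  filterlim f Hierarchy.eventually (locally (T := C_CompleteNormedModule) z).
Proof.
intros H1 H2. apply filterlim_locally. intros eps.
assert (L1 := H1 _ (locally_ball (Re z) eps)). assert (L2 := H2 _ (locally_ball (Im z) eps)).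
unfold filtermap in L1, L2. generalize (filter_and _ _ L1 L2). apply filter_imp. intros n [A B]; split; assumption.
Qed.

Section Boundary.
Variables (w : word) (K : R).
Hypothesis HK : 0 <= K.
Hypothesis Hc : forall n, Rabs (cw w n) <= K * / q4 n ^ 7.

Lemma Lb_terms (p : C -> R) z : (forall x, Rabs (p x) <= Cmod x) -> Cmod z = 1 -> ex_series (fun n => cw w n * p (z ^ n)%C).
Proof.
intros Hp Hz. destruct (abel_rate (cw w) K z HK Hc Hz) as [E _].
apply (ex_series_dom _ _ ltac:(intros n; rewrite Rabs_mult; apply Rmult_le_compat_l; [apply Rabs_pos|apply Hp])).
apply (ex_series_ext (fun n => Rabs (cw w n))); auto. intros n; rewrite Cmod_pow, Hz, pow1. eqR; ring.
Qed.
End Boundary.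

Lemma small_sqrt : small (fun t => sqrt (1 - t)).
Proof.
exists (/ 2), 1; repeat split; try lra. intros t Ht. rewrite Rabs_pos_eq by apply sqrt_pos.
rewrite Rpower_sqrt by lra. lra.
Qed.

Lemma wf_Wof a : wf (wl (Wof a)) = true.
Proof.
induction a as [|a1 a IH]; [reflexivity|]. cbn [Wof].
assert (H : forall k, wf (wl (repeat false k ++ true :: Wof a)) = true); [|apply H].
induction k as [|k IHk]; [exact IH|].
cbn [repeat app wl map wf]. fold (wl (repeat false k ++ true :: Wof a)). rewrite IHk.
destruct k; reflexivity.
Qed.

(** Both sides are limits of [Li] along the radius to e^(i pi/3): the left by Abel's theorem, where
    the outermost dz/z makes the coefficients summable, the right by [ell_lim]. *)
Lemma Lb_ell W : wf (wl (false :: W)) = true -> Lb (cw (wl (false :: W))) rho = ell (false :: W).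
Proof.
intros Hw. destruct (cw_LT_growth (wl W)) as (K & HK & Hc).
destruct (abel_rate (cw (wl (false :: W))) K rho HK Hc rho_mod) as (_ & M & HM & H1).
destruct (ell_lim (false :: W) Hw) as (M' & HM' & H2).
apply Ceq_minus. apply Cmod_eq_0. apply Rle_antisym; [|apply Cmod_ge_0].
apply (Rle_0_of_small _ (fun t => M * sqrt (1 - t) + M' * (1 - t))).
- apply small_plus; apply small_scal; [apply small_sqrt|apply small_1mt].
- intros t Ht.
  assert (E : (t * rho - rho)%C = (- ((1 - t)%R * rho))%C) by (rewrite RtoC_minus; ring).
  assert (E' : Cmod (t * rho - rho) = 1 - t) by (rewrite E, Cmod_opp, Cmod_mult, rho_mod, Cmod_R, Rabs_pos_eq; lra).
  assert (R : rg (t * rho)).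
  { split; [rewrite Cmod_mult, rho_mod, Cmod_R, Rabs_pos_eq; lra|lra]. }
  replace (Lb (cw (wl (false :: W))) rho - ell (false :: W))%C with
    (- (cps (cw (wl (false :: W))) (t * rho) - Lb (cw (wl (false :: W))) rho) + (Li (wl (false :: W)) (t * rho) - ell (false :: W)))%C by (unfold Li; ring).
  eapply Rle_trans; [apply Cmod_triangle|]. rewrite Cmod_opp. apply Rplus_le_compat; [apply H1; lra|].
  rewrite <- E'. apply H2; auto.
Qed.

Definition conv_index (a : list nat) := match a with [] => False | a1 :: _ => (2 <= a1)%nat end.

Lemma Wof_false a : conv_index a -> exists W, Wof a = false :: W.
Proof.
destruct a as [|a1 a]; simpl; [tauto|]. intros H. destruct (a1 - 1)%nat as [|k] eqn:E; [lia|].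
eexists; reflexivity.
Qed.

Lemma cw_Wof_growth a : conv_index a -> exists K, 0 <= K /\ forall n, Rabs (cw (wl (Wof a)) n) <= K * / q4 n ^ 7.
Proof. intros H; destruct (Wof_false a H) as (W & ->). apply (cw_LT_growth (wl W)). Qed.

Lemma ex_series_Wof a : conv_index a -> ex_series (cw (wl (Wof a))).
Proof.
intros H. destruct (cw_Wof_growth a H) as (K & HK & Hc).
destruct (abel_rate _ K 1 HK Hc Cmod_1) as [E _]. revert E; apply ex_series_ext.
intros n; apply Rabs_pos_eq, cw_bounds.
Qed.

Lemma mhs_lim a : pos_index a -> conv_index a -> is_lim_seq (mhs a) (Series (cw (wl (Wof a)))).
Proof.
intros H1 H2. apply (is_lim_seq_ext (fun n => psum (cw (wl (Wof a))) (S n))).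
- intros n; symmetry; apply mhs_psum; auto.
- apply Series_psum, ex_series_Wof; auto.
Qed.

Lemma mzv_series a : pos_index a -> conv_index a -> mzv a = Series (cw (wl (Wof a))).
Proof. intros H1 H2; unfold mzv. rewrite (is_lim_seq_unique _ _ (mhs_lim a H1 H2)); reflexivity. Qed.

Lemma mu_ell a : pos_index a -> conv_index a -> mu a = ell (Wof a).
Proof.
intros H1 H2. destruct (Wof_false a H2) as (W & EW). destruct (cw_Wof_growth a H2) as (K & HK & Hc).
transitivity (Lb (cw (wl (Wof a))) rho).
- unfold mu. apply (iota_filterlim_locally (V := C_CompleteNormedModule) (F := Hierarchy.eventually)).
  destruct a as [|a1 a]; [destruct H2|].
  apply filterlim_C.
  + apply (is_lim_seq_ext (fun n => psum (fun n => cw (wl (Wof (a1 :: a))) n * Re (rho ^ n)%C) (S n))).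
    * intros n; rewrite mcv_psum; auto.
    * apply (Series_psum (fun n => cw (wl (Wof (a1 :: a))) n * Re (rho ^ n)%C)).
      apply (Lb_terms _ K HK Hc Re); auto using re_le_Cmod, rho_mod.
  + apply (is_lim_seq_ext (fun n => psum (fun n => cw (wl (Wof (a1 :: a))) n * Im (rho ^ n)%C) (S n))).
    * intros n; rewrite mcv_psum; auto.
    * apply (Series_psum (fun n => cw (wl (Wof (a1 :: a))) n * Im (rho ^ n)%C)).
      apply (Lb_terms _ K HK Hc Im); auto using im_le_Cmod, rho_mod.
- rewrite EW. apply Lb_ell. rewrite <- EW; apply wf_Wof.
Qed.

Lemma mzv_stuffle a b : (2 <= a)%nat -> (2 <= b)%nat ->
  mzv [a] * mzv [b] = mzv [a; b] + mzv [b; a] + mzv [(a + b)%nat].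
Proof.
intros Ha Hb.
assert (L : forall c, (2 <= hd 0%nat c)%nat -> (forall x, In x c -> (1 <= x)%nat) -> is_lim_seq (mhs c) (mzv c)).
{ intros c H1 H2. assert (P : pos_index c) by (apply List.Forall_forall; auto).
  assert (C : conv_index c) by (destruct c; simpl in *; lia). rewrite mzv_series by auto. apply mhs_lim; auto. }
assert (E : forall n, mhs [a] n * mhs [b] n = mhs [a; b] n + mhs [b; a] n + mhs [(a + b)%nat] n).
{ induction n as [|n IH]; [rewrite !mhs_0; ring|]. rewrite !mhs_S. rewrite pow_add, Rinv_mult.
  change (mhs [] n) with 1. ring_simplify. ring_simplify in IH. lra. }
assert (L1 : is_lim_seq (fun n => mhs [a] n * mhs [b] n) (mzv [a] * mzv [b])).
{ apply is_lim_seq_mult'; apply L; simpl; intuition lia. }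
assert (L2 : is_lim_seq (fun n => mhs [a] n * mhs [b] n) (mzv [a; b] + mzv [b; a] + mzv [(a + b)%nat])).
{ apply (is_lim_seq_ext _ _ _ (fun n => eq_sym (E n))).
  apply is_lim_seq_plus'; [apply is_lim_seq_plus'|]; apply L; simpl; intuition lia. }
apply is_lim_seq_unique in L1. apply is_lim_seq_unique in L2. rewrite L1 in L2. injection L2; auto.
Qed.

(** * Distribution relation at the sixth root of unity *)

Definition divi (d n : nat) : R := if Nat.eqb (n mod d) 0 then 1 else 0.

Lemma rho_6 : (rho ^ 6)%C = 1.
Proof.
assert (S3 := sqrt3_sqr).
assert (E2 : (rho ^ 2)%C = ((- / 2, sqrt 3 / 2) : C)).
{ simpl Cpow. unfold rho, Cmult, RtoC; cbn [fst snd]. apply injective_projections; cbn [fst snd].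
  - transitivity (/ 4 - sqrt 3 * sqrt 3 / 4); [field|lra].
  - field. }
assert (E3 : (rho ^ 3)%C = RtoC (-1)).
{ rewrite (Cpow_S rho 2), E2. unfold rho, Cmult, RtoC; cbn [fst snd]. apply injective_projections; cbn [fst snd].
  - transitivity (- / 4 - sqrt 3 * sqrt 3 / 4); [field|lra].
  - field. }
change 6%nat with (3 + 3)%nat. rewrite Cpow_add_r, E3, <- RtoC_mult. f_equal; ring.
Qed.

(** cos(n pi/3) is even with period 6, so it depends only on gcd(n,6); the four coefficients solve
    the system for the gcds 1, 2, 3, 6. Summed against n^(-s), the indicator of multiples of d
    becomes d^(-s) zeta(s). *)
Lemma Re_rho_pow n : Re (rho ^ n)%C = / 2 - divi 2 n - 3 / 2 * divi 3 n + 3 * divi 6 n.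
Proof.
assert (P : forall m, Re (rho ^ (6 + m))%C = Re (rho ^ m)%C) by (intros m; rewrite Cpow_add_r, rho_6, Cmult_1_l; reflexivity).
assert (D : forall d m, (d = 2 \/ d = 3 \/ d = 6)%nat -> divi d (6 + m) = divi d m).
{ intros d m Hd; unfold divi. replace ((6 + m) mod d) with (m mod d); auto.
  destruct Hd as [->|[->| ->]].
  - replace (6 + m)%nat with (m + 3 * 2)%nat by lia. rewrite Nat.Div0.mod_add; auto.
  - replace (6 + m)%nat with (m + 2 * 3)%nat by lia. rewrite Nat.Div0.mod_add; auto.
  - replace (6 + m)%nat with (m + 1 * 6)%nat by lia. rewrite Nat.Div0.mod_add; auto. }
assert (S3 := sqrt3_sqr).
assert (B : forall m, (m < 6)%nat -> Re (rho ^ m)%C = / 2 - divi 2 m - 3 / 2 * divi 3 m + 3 * divi 6 m).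
{ assert (E2 : (rho ^ 2)%C = ((- / 2, sqrt 3 / 2) : C)).
  { simpl Cpow. unfold rho, Cmult, RtoC; cbn [fst snd]. apply injective_projections; cbn [fst snd].
    - transitivity (/ 4 - sqrt 3 * sqrt 3 / 4); [field|lra].
    - field. }
  assert (E3 : (rho ^ 3)%C = RtoC (-1)).
  { rewrite (Cpow_S rho 2), E2. unfold rho, Cmult, RtoC; cbn [fst snd]. apply injective_projections; cbn [fst snd].
    - transitivity (- / 4 - sqrt 3 * sqrt 3 / 4); [field|lra].
    - field. }
  intros m Hm. destruct m as [|[|[|[|[|[|m]]]]]]; try lia; unfold divi; cbn [Nat.modulo Nat.divmod Nat.eqb fst snd Nat.sub].
  - unfold Re; simpl; lra.
  - rewrite Cpow_1_r. unfold Re, rho; simpl; lra.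
  - rewrite E2. unfold Re; simpl; lra.
  - rewrite E3. unfold Re; simpl; lra.
  - rewrite (Cpow_S rho 3), E3. unfold Re, rho, Cmult, RtoC; simpl; lra.
  - change 5%nat with (2 + 3)%nat. rewrite Cpow_add_r, E2, E3. unfold Re, Cmult, RtoC; simpl; lra. }
assert (G : forall k n, (n < 6 * k)%nat -> Re (rho ^ n)%C = / 2 - divi 2 n - 3 / 2 * divi 3 n + 3 * divi 6 n).
{ induction k as [|k IH]; intros m Hm; [lia|]. destruct (le_lt_dec 6 m) as [H|H]; [|apply B; auto].
  replace m with (6 + (m - 6))%nat by lia. rewrite P, !D by auto. apply IH; lia. }
apply (G (S n)); lia.
Qed.

Lemma psum_multiples d (f : nat -> R) N : (1 <= d)%nat ->
  psum (fun n => divi d n * f n) (d * N) = psum (fun m => f (d * m)%nat) N.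
Proof.
intros Hd. induction N as [|N IH]; [rewrite Nat.mul_0_r; reflexivity|].
assert (G : forall j, (j < d)%nat -> psum (fun n => divi d n * f n) (d * N + S j) = psum (fun m => f (d * m)%nat) N + f (d * N)%nat).
{ induction j as [|j IHj]; intros Hj.
  - rewrite Nat.add_1_r; cbn [psum]. rewrite IH. unfold divi. rewrite Nat.mul_comm, Nat.Div0.mod_mul. simpl; ring.
  - rewrite Nat.add_succ_r; cbn [psum]. rewrite IHj by lia. unfold divi.
    replace (d * N + S j)%nat with (S j + N * d)%nat by lia. rewrite Nat.Div0.mod_add, Nat.mod_small by lia. simpl; ring. }
replace (d * S N)%nat with (d * N + S (d - 1))%nat by lia. rewrite G by lia. reflexivity.
Qed.

Lemma Series_multiples d s : (1 <= d)%nat -> (2 <= s)%nat ->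
  is_lim_seq (fun n => psum (fun n => divi d n * cw (wl (Wof [s])) n) (S n)) (/ INR d ^ s * zeta s).
Proof.
intros Hd Hs. set (c := cw (wl (Wof [s]))).
assert (Hp : pos_index [s]) by (constructor; [lia|constructor]).
assert (Hcv : conv_index [s]) by (simpl; lia).
assert (Ec := ex_series_Wof [s] Hcv). fold c in Ec.
assert (Cb : forall n, 0 <= c n) by (intros; apply cw_bounds).
assert (Ex : ex_series (fun n => divi d n * c n)).
{ apply (ex_series_dom _ c); auto. intros n; specialize (Cb n); unfold divi; destruct Nat.eqb; rewrite ?Rmult_0_l, ?Rmult_1_l, ?Rabs_R0, ?Rabs_pos_eq; lra. }
assert (L := Series_psum _ Ex).
replace (/ INR d ^ s * zeta s) with (Series (fun n => divi d n * c n)); auto.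
assert (L' : is_lim_seq (fun n => psum (fun n => divi d n * c n) n) (Series (fun n => divi d n * c n))).
{ apply is_lim_seq_incr_1; auto. }
assert (L1 : is_lim_seq (fun N => psum (fun n => divi d n * c n) (d * N)) (Series (fun n => divi d n * c n))).
{ apply (is_lim_seq_subseq _ _ (fun N => (d * N)%nat)) in L'; auto.
  apply eventually_subseq. intros n; lia. }
assert (Ed : forall m, c (d * m)%nat = / INR d ^ s * c m).
{ intros m. destruct m as [|m]; [rewrite Nat.mul_0_r; unfold c; rewrite cw_Wof_0; ring|].
  unfold c. rewrite !cw_Wof by (auto; lia). simpl mhs. rewrite mult_INR, Rpow_mult_distr, Rinv_mult. ring. }
assert (L2 : is_lim_seq (fun N => psum (fun n => divi d n * c n) (d * N)) (/ INR d ^ s * zeta s)).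
{ apply (is_lim_seq_ext (fun N => / INR d ^ s * psum c N)).
  - intros N. rewrite psum_multiples by auto. rewrite <- psum_scal. apply psum_ext; intros; rewrite Ed; auto.
  - apply (is_lim_seq_scal_l _ (/ INR d ^ s) (zeta s)). apply is_lim_seq_incr_1.
    unfold zeta; rewrite mzv_series by auto. apply Series_psum; auto. }
apply is_lim_seq_unique in L1. apply is_lim_seq_unique in L2. rewrite L1 in L2. injection L2; auto.
Qed.

Lemma Re_ell_distribution s : (2 <= s)%nat ->
  Re (ell (Wof [s])) = (/ 2 - / 2 ^ s - 3 / 2 * / 3 ^ s + 3 * / 6 ^ s) * zeta s.
Proof.
intros Hs. set (c := cw (wl (Wof [s]))).
assert (Hcv : conv_index [s]) by (simpl; lia). destruct (Wof_false [s] Hcv) as (W & EW).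
assert (EL : ell (Wof [s]) = Lb c rho).
{ unfold c. rewrite EW. symmetry; apply Lb_ell. rewrite <- EW; apply wf_Wof. }
rewrite EL. unfold Lb, Re at 1; cbn [fst].
destruct (cw_Wof_growth [s] Hcv) as (K & HK & Hc).
assert (Ex := Lb_terms _ K HK Hc Re rho re_le_Cmod rho_mod). fold c in Ex.
assert (L1 := Series_psum _ Ex). cbv beta in L1.
assert (L2 : is_lim_seq (fun n => psum (fun n => c n * Re (rho ^ n)%C) (S n))
  (/ 2 * zeta s + (-1) * (/ INR 2 ^ s * zeta s) + (- (3 / 2)) * (/ INR 3 ^ s * zeta s) + 3 * (/ INR 6 ^ s * zeta s))).
{ apply (is_lim_seq_ext (fun n => / 2 * psum c (S n) + (-1) * psum (fun n => divi 2 n * c n) (S n) +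
   (- (3 / 2)) * psum (fun n => divi 3 n * c n) (S n) + 3 * psum (fun n => divi 6 n * c n) (S n))).
  - intros n. rewrite <- !psum_scal, <- !psum_plus. apply psum_ext. intros m _. rewrite Re_rho_pow. ring.
  - assert (SM : forall k d, (1 <= d)%nat -> is_lim_seq (fun n => k * psum (fun n => divi d n * c n) (S n)) (k * (/ INR d ^ s * zeta s))).
    { intros k d Hd. apply (is_lim_seq_scal_l _ k (/ INR d ^ s * zeta s)). apply Series_multiples; auto. }
    repeat apply is_lim_seq_plus'; try (apply SM; lia).
    apply (is_lim_seq_scal_l _ (/ 2) (zeta s)). assert (Hp : pos_index [s]) by (constructor; [lia|constructor]).
    unfold zeta; rewrite (mzv_series [s] Hp Hcv).
    apply Series_psum, ex_series_Wof; auto. }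
apply is_lim_seq_unique in L1. apply is_lim_seq_unique in L2. rewrite L1 in L2.
injection L2; intros ->.
replace (1 + 1) with 2 by ring. replace (2 + 1) with 3 by ring. replace (3 + 1 + 1 + 1) with 6 by ring. ring.
Qed.

(** * Composition of paths from 0 to 1 *)

Definition LG (S0 : list bool) (z : C) : C := Li (wl (map negb S0)) (1 - z)%C.

(** The telescoping sum for the paths from 0 to z and from z to 1, as a function of the point z
    alone, so that it can be followed along different paths. *)
Fixpoint HH (S0 W : list bool) (z : C) : C :=
  (LG S0 z * Li (wl W) z + match W with [] => 0 | x :: U => HH (x :: S0) U z end)%C.

(* Path composition 0 -> e^(i pi/3) -> 1, the second half being the image of the conjugate of the first under
   z -> 1-z, which exchanges the two forms. *)
Fixpoint pell (S0 W : list bool) : C :=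
  (Cconj (ell (map negb S0)) * ell W + match W with [] => 0 | x :: U => pell (x :: S0) U end)%C.

Lemma tele_HH (z : R -> C) S0 W s :
  tele (fun W s => Li (wl W) (z s)) (fun S1 s => LG S1 (z s)) S0 W s = HH S0 W (z s).
Proof. revert S0; induction W as [|x U IH]; intros S0; simpl; [reflexivity|rewrite IH; reflexivity]. Qed.

(** The word must begin with dz/z: the first letter that passes to the second factor then becomes
    dz/(1-z) under z -> 1-z, and the integral converges. The two disc conditions keep z away from 0
    and 1. *)
Lemma HH_deriv (z : R -> C) dz s W : wf (wl (false :: W)) = true -> cderiv z s dz ->
  Cmod (z s) < 1 -> Cmod (1 - z s) < 1 -> cderiv (fun t => HH [] (false :: W) (z t)) s 0.
Proof.
intros Hw Hd H1 H2.
assert (N0 : z s <> 0).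
{ intros E. rewrite E in H2. replace (1 - 0)%C with (RtoC 1) in H2 by ring. rewrite Cmod_1 in H2; lra. }
assert (N1 : (1 - z s)%C <> 0).
{ intros E. replace (z s) with (1 - (1 - z s))%C in H1 by ring. rewrite E in H1.
  replace (1 - 0)%C with (RtoC 1) in H1 by ring. rewrite Cmod_1 in H1; lra. }
assert (Dz : cderiv (fun t => (1 - z t)%C) s (- dz)%C).
{ apply (cderiv_ext (fun t => 1 + (RtoC (-1)) * z t)%C); [intros; ring|].
  apply (cderiv_eq _ _ (0 + RtoC (-1) * dz)%C); [ring|]. apply cderiv_plus; [apply cderiv_const|apply cderiv_scal; auto]. }
apply (cderiv_ext (tele (fun W s => Li (wl W) (z s)) (fun S1 s => LG S1 (z s)) [] (false :: W))).
{ intros t; apply tele_HH. }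
apply (tele_deriv_0 _ _ (fun b => dz * phi (if b then L1 else LT) (z s))%C s (fun W => wf (wl W) = true)
  (fun S1 => S1 <> [] /\ wf (wl (map negb S1)) = true)); auto.
- intros y Y; simpl; intros H; apply andb_prop in H; tauto.
- intros x S1 [A B]. split; [discriminate|]. cbn [map wl wf]. fold (wl (map negb S1)). rewrite B.
  destruct x; simpl; auto. destruct S1; [congruence|reflexivity].
- apply (cderiv_ext (fun _ => RtoC 1)); [intros; simpl; rewrite Li_nil; auto|apply cderiv_const].
- intros y Y HY. apply (cderiv_eq _ _ (dz * (phi (if y then L1 else LT) (z s) * Li (wl Y) (z s)))%C); [ring|].
  apply (Li_deriv (if y then L1 else LT) (wl Y) z); auto.
- intros y S1 [_ B].
  apply (cderiv_eq _ _ (- dz * (phi (if negb y then L1 else LT) (1 - z s) * LG S1 (z s)))%C).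
  + replace (phi (if negb y then L1 else LT) (1 - z s)%C) with (phi (if y then L1 else LT) (z s)); [ring|].
    destruct y; cbn [phi negb]; [reflexivity|]. f_equal; ring.
  + apply (Li_deriv (if negb y then L1 else LT) (wl (map negb S1)) (fun t => (1 - z t)%C)); auto.
- split; [discriminate|reflexivity].
- apply (cderiv_ext (fun _ => RtoC 1)); [intros; unfold LG; simpl; rewrite Li_nil; auto|apply cderiv_const].
Qed.

Lemma HH_const (z : R -> C) dz W a b : wf (wl (false :: W)) = true -> a < b ->
  (forall s, a <= s <= b -> cderiv z s (dz s) /\ Cmod (z s) < 1 /\ Cmod (1 - z s) < 1) ->
  HH [] (false :: W) (z a) = HH [] (false :: W) (z b).
Proof.
intros Hw Hab H. apply (cderiv_zero_const (fun t => HH [] (false :: W) (z t)) a b); auto.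
intros s Hs; destruct (H s Hs) as (A & B & C). apply (HH_deriv z (dz s)); auto.
Qed.

Definition halfC : C := RtoC (/ 2).

Lemma HH_real W t : wf (wl (false :: W)) = true -> / 2 < t < 1 ->
  HH [] (false :: W) (RtoC t) = HH [] (false :: W) halfC.
Proof.
intros Hw Ht. symmetry. apply (HH_const (fun s => RtoC s) (fun _ => RtoC 1) W (/ 2) t); auto; [lra|].
intros s Hs. split; [exact (cderiv_RtoC (fun s => s) s 1 (is_derive_id s))|split].
- rewrite Cmod_R, Rabs_pos_eq; lra.
- rewrite <- RtoC_minus, Cmod_R, Rabs_pos_eq; lra.
Qed.

Definition vert (t : R) : C := (/ 2, sqrt 3 / 2 * t).

Lemma vert_mod t : 0 <= t < 1 -> Cmod (vert t) < 1 /\ Cmod (1 - vert t) < 1.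
Proof.
intros Ht. assert (S3 := sqrt3_sqr).
assert (K : forall z, Re z * Re z + Im z * Im z < 1 -> Cmod z < 1).
{ intros z H; rewrite <- Cmod_sqr in H. generalize (Cmod_ge_0 z); nra. }
split; apply K; unfold vert, Re, Im, Cminus, Cplus, Copp, RtoC; cbn [fst snd].
- replace (sqrt 3 / 2 * t * (sqrt 3 / 2 * t)) with (sqrt 3 * sqrt 3 / 4 * (t * t)) by field. rewrite S3. nra.
- replace ((0 + - (sqrt 3 / 2 * t)) * (0 + - (sqrt 3 / 2 * t))) with (sqrt 3 * sqrt 3 / 4 * (t * t)) by field. rewrite S3. nra.
Qed.

Lemma HH_vert W t : wf (wl (false :: W)) = true -> 0 < t < 1 ->
  HH [] (false :: W) (vert t) = HH [] (false :: W) halfC.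
Proof.
intros Hw Ht. replace halfC with (vert 0) by (unfold vert, halfC, RtoC; f_equal; ring).
symmetry. apply (HH_const vert (fun _ => (0, sqrt 3 / 2)) W 0 t); auto; [lra|].
intros s Hs. split; [|apply vert_mod; lra]. split; unfold vert, Re, Im; cbn [fst snd].
- exact (is_derive_const (V := R_NormedModule) (/ 2) s).
- auto_derive; auto; ring.
Qed.

Lemma Li_conj w z : Li w (Cconj z) = Cconj (Li w z).
Proof.
unfold Li, cps, Cconj; cbn [fst snd]. f_equal.
- apply Series_ext; intros n. change (fst z, - snd z) with (Cconj z). rewrite <- Cpow_conj. reflexivity.
- rewrite <- Series_opp. apply Series_ext; intros n. change (fst z, - snd z) with (Cconj z). rewrite <- Cpow_conj.
  unfold Cconj, Im; cbn [snd]; ring.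
Qed.

Lemma Cmod_mult_diff a b a' b' : Cmod (a * b - a' * b') <= Cmod (a - a') * Cmod b + Cmod a' * Cmod (b - b').
Proof.
replace (a * b - a' * b')%C with ((a - a') * b + a' * (b - b'))%C by ring.
eapply Rle_trans; [apply Cmod_triangle|]. rewrite !Cmod_mult; lra.
Qed.

(** On Re z = 1/2 one has 1-z = conj z, and [Li] has real coefficients, so the factor at 1-z is the
    conjugate of a value at z; [ell_lim] then applies to both factors. The third hypothesis ensures
    that the words formed in [S0] stay admissible. *)
Lemma HH_pell S0 W : wf (wl (map negb S0)) = true -> wf (wl W) = true -> (W = [] \/ S0 <> [] \/ exists U, W = false :: U) ->
  exists K, 0 <= K /\ forall z, rg z -> (1 - z)%C = Cconj z -> Cmod (HH S0 W z - pell S0 W) <= K * Cmod (z - rho).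
Proof.
revert S0; induction W as [|x U IH]; intros S0 HS HW Hst.
- destruct (ell_lim _ HS) as (M & HM & H). exists M; split; auto. intros z Hz Hc. simpl.
  rewrite Li_nil. unfold LG; rewrite Hc, Li_conj.
  replace (ell []) with (RtoC 1).
  2:{ unfold ell, gsum; simpl. rewrite RMicromega.Q2R_1, RMicromega.Q2R_0. unfold RtoC; f_equal; ring. }
  replace (_ - _)%C with (Cconj (Li (wl (map negb S0)) z - ell (map negb S0))) by
    (unfold Cconj, Cminus, Cplus, Copp, Cmult, RtoC; simpl; f_equal; ring).
  rewrite Cmod_conj; auto.
- destruct (ell_lim _ HS) as (M & HM & H). destruct (ell_lim _ HW) as (M' & HM' & H').
  destruct (Li_rg _ HW) as (B & HB & Hb & _).
  assert (HU : wf (wl U) = true) by (simpl in HW; apply andb_prop in HW; apply HW).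
  destruct (IH (x :: S0)) as (K & HK & HI); auto.
  + cbn [map wl wf]. fold (wl (map negb S0)). rewrite HS. destruct x; simpl; auto.
    destruct S0; [|reflexivity]. destruct Hst as [?|[?|[Y E]]]; congruence.
  + right; left; discriminate.
  + exists (M * B + Cmod (ell (map negb S0)) * M' + K).
    assert (P := Cmod_ge_0 (ell (map negb S0))). split.
    { assert (0 <= M * B) by (apply Rmult_le_pos; auto). assert (0 <= Cmod (ell (map negb S0)) * M') by (apply Rmult_le_pos; auto). lra. }
    intros z Hz Hc.
    change (HH S0 (x :: U) z) with (LG S0 z * Li (wl (x :: U)) z + HH (x :: S0) U z)%C.
    change (pell S0 (x :: U)) with (Cconj (ell (map negb S0)) * ell (x :: U) + pell (x :: S0) U)%C.
    replace (LG S0 z * Li (wl (x :: U)) z + HH (x :: S0) U z - (Cconj (ell (map negb S0)) * ell (x :: U) + pell (x :: S0) U))%C with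
      ((LG S0 z * Li (wl (x :: U)) z - Cconj (ell (map negb S0)) * ell (x :: U)) + (HH (x :: S0) U z - pell (x :: S0) U))%C by ring.
    eapply Rle_trans; [apply Cmod_triangle|]. rewrite Rmult_plus_distr_r. apply Rplus_le_compat; [|auto].
    eapply Rle_trans; [apply Cmod_mult_diff|]. unfold LG; rewrite Hc, Li_conj.
    replace (Cconj (Li (wl (map negb S0)) z) - Cconj (ell (map negb S0)))%C with (Cconj (Li (wl (map negb S0)) z - ell (map negb S0))) by
      (unfold Cconj, Cminus, Cplus, Copp; simpl; f_equal; ring).
    rewrite !Cmod_conj. specialize (H z Hz). specialize (H' z Hz). specialize (Hb z Hz).
    assert (Q1 := Cmod_ge_0 (Li (wl (map negb S0)) z - ell (map negb S0))).
    assert (Q2 := Cmod_ge_0 (Li (wl (x :: U)) z)). assert (Q3 := Cmod_ge_0 (z - rho)).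
    rewrite Rmult_plus_distr_r. apply Rplus_le_compat.
    * replace (M * B * Cmod (z - rho)) with ((M * Cmod (z - rho)) * B) by ring. apply Rmult_le_compat; auto.
    * rewrite Rmult_assoc. apply Rmult_le_compat_l; auto.
Qed.

Fixpoint zsum (W : list bool) (t : R) : R :=
  zr (wl W) t + match W with [] => 0 | x :: U => zsum U t end.

Lemma zsum_slow W : wf (wl W) = true -> slow (zsum W).
Proof.
induction W as [|x U IH]; intros Hw; simpl.
- apply (slow_plus (zr [])); [apply zr_slow; auto|apply slow_const].
- apply (slow_plus (zr (wl (x :: U)))); [apply zr_slow; auto|].
  apply IH. simpl in Hw; apply andb_prop in Hw; apply Hw.
Qed.

Lemma HH_near1 S0 W t : S0 <> [] -> / 2 <= t < 1 -> Cmod (HH S0 W (RtoC t)) <= 4 * (1 - t) * zsum W t.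
Proof.
intros HS Ht.
assert (G : forall S1, S1 <> [] -> Cmod (LG S1 (RtoC t)) <= 4 * (1 - t)).
{ intros S1 H1. unfold LG. rewrite <- RtoC_minus. assert (E : Cmod (RtoC (1 - t)) = 1 - t) by (rewrite Cmod_R, Rabs_pos_eq; lra).
  eapply Rle_trans; [apply Li_near0|]; rewrite ?E; try lra. destruct S1; [congruence|discriminate]. }
assert (Z : forall U, Cmod (Li (wl U) (RtoC t)) = zr (wl U) t).
{ intros U. rewrite Li_RtoC, Cmod_R, Rabs_pos_eq; auto. apply zr_nonneg; lra. }
revert S0 HS; induction W as [|x U IH]; intros S0 HS.
- change (HH S0 [] (RtoC t)) with (LG S0 (RtoC t) * Li (wl []) (RtoC t) + 0)%C.
  change (zsum [] t) with (zr (wl []) t + 0).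
  rewrite Cplus_0_r, Rplus_0_r, Cmod_mult, (Z []). apply Rmult_le_compat_r; auto. apply zr_nonneg; lra.
- change (HH S0 (x :: U) (RtoC t)) with (LG S0 (RtoC t) * Li (wl (x :: U)) (RtoC t) + HH (x :: S0) U (RtoC t))%C.
  change (zsum (x :: U) t) with (zr (wl (x :: U)) t + zsum U t).
  eapply Rle_trans; [apply Cmod_triangle|]. rewrite Rmult_plus_distr_l. apply Rplus_le_compat; [|apply IH; discriminate].
  rewrite Cmod_mult, (Z (x :: U)). apply Rmult_le_compat_r; auto. apply zr_nonneg; lra.
Qed.

(** [HH] is constant from 1/2 towards 1 on the real axis and from 1/2 towards e^(i pi/3) on Re z =
    1/2. At the first end only the undivided word survives and gives the series at 1; at the other
    the limit is [pell]. *)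
Theorem zeta_pell W : wf (wl (false :: W)) = true ->
  RtoC (Series (cw (wl (false :: W)))) = pell [] (false :: W).
Proof.
intros Hw. set (c := cw (wl (false :: W))).
destruct (cw_LT_growth (wl W)) as (K & HK & Hc).
destruct (abel_rate c K 1 HK Hc Cmod_1) as (_ & M & HM & H1).
destruct (HH_pell [] (false :: W) eq_refl Hw ltac:(right; right; eauto)) as (K' & HK' & H2).
assert (E1 : Lb c 1 = RtoC (Series c)).
{ unfold Lb, RtoC. f_equal.
  - apply Series_ext; intros n. change (1, 0) with (RtoC 1). rewrite Cpow_1_l. unfold Re; simpl; ring.
  - rewrite (Series_ext _ (fun n => 0 * c n)); [rewrite Series_scal_l; ring|].
    intros n. change (1, 0) with (RtoC 1). rewrite Cpow_1_l. unfold Im; simpl; ring. }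
assert (HU : wf (wl W) = true) by (simpl in Hw; apply andb_prop in Hw; apply Hw).
apply Ceq_minus. apply Cmod_eq_0. apply Rle_antisym; [|apply Cmod_ge_0].
apply (Rle_0_of_small _ (fun t => (M * sqrt (1 - t) + 4 * ((1 - t) * zsum W t)) + K' * (1 - t))).
- apply small_plus; [apply small_plus|]; [apply small_scal, small_sqrt| |apply small_scal, small_1mt].
  apply (small_scal 4 (fun t => (1 - t) * zsum W t)). apply small_slow_mult; [apply small_1mt|apply zsum_slow; auto].
- intros t Ht.
  assert (S3 := sqrt3_sqr). assert (P3 := sqrt3_pos).
  assert (Ev : (vert t - rho)%C = (0, - (sqrt 3 / 2 * (1 - t)))).
  { unfold vert, rho, Cminus, Cplus, Copp; cbn [fst snd]; f_equal; ring. }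
  assert (Hs2 : sqrt 3 < 2) by nra.
  assert (Ev' : Cmod (vert t - rho) <= 1 - t).
  { rewrite Ev. eapply Rle_trans; [apply Cmod_le_Rabs|]. unfold Re, Im; cbn [fst snd]. rewrite Rabs_R0, Rabs_Ropp, Rabs_pos_eq by nra. nra. }
  assert (R : rg (vert t)) by (split; [apply vert_mod; lra|lra]).
  assert (Hv := H2 (vert t) R ltac:(unfold vert, Cconj, Cminus, Cplus, Copp, RtoC; cbn [fst snd]; f_equal; field)).
  assert (HC : HH [] (false :: W) (RtoC t) = HH [] (false :: W) (vert t)).
  { rewrite HH_real, HH_vert; auto; lra. }
  rewrite <- HC in Hv.
  assert (Hr : Cmod (HH [] (false :: W) (RtoC t) - RtoC (Series c)) <= M * sqrt (1 - t) + 4 * ((1 - t) * zsum W t)).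
  { change (HH [] (false :: W) (RtoC t)) with (LG [] (RtoC t) * Li (wl (false :: W)) (RtoC t) + HH [false] W (RtoC t))%C.
    replace (LG [] (RtoC t)) with (RtoC 1) by (unfold LG; simpl; rewrite Li_nil; auto).
    replace (1 * Li (wl (false :: W)) t + HH [false] W t - RtoC (Series c))%C with
      ((cps c (t * 1) - Lb c 1) + HH [false] W t)%C by (rewrite E1, Cmult_1_r; unfold Li, c; ring).
    eapply Rle_trans; [apply Cmod_triangle|]. apply Rplus_le_compat; [apply H1; lra|].
    rewrite <- Rmult_assoc. apply HH_near1; [discriminate|lra]. }
  replace (RtoC (Series c) - pell [] (false :: W))%C with
    (- (HH [] (false :: W) (RtoC t) - RtoC (Series c)) + (HH [] (false :: W) (RtoC t) - pell [] (false :: W)))%C by ring.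
  eapply Rle_trans; [apply Cmod_triangle|]. rewrite Cmod_opp.
  assert (K' * Cmod (vert t - rho) <= K' * (1 - t)) by (apply Rmult_le_compat_l; auto). lra.
Qed.

(** * Stuffle with a harmonic sum in a fixed residue class *)

Definition lt_of (k : nat) : letter := match k mod 3 with 1 => LX | 2 => LY | _ => LS end.

(* The letter that raises a word of class [b] to class [a]. *)
Definition ltd (a b : nat) : letter := lt_of (a + 3 - b).

(* The terms of the product of a nested sum with [Hs r]: the new index falls above, on, or below each index of
   [w]. *)
Fixpoint ins (r : nat) (w : word) : list word :=
  match w with
  | [] => [[ltd r 0]]
  | l :: w' =>
      (ltd r (cls w) :: w) ::
      (if Nat.eqb r (cls w) then [LT :: w] else []) ++
      map (fun v => ltd (cls w) (cls v) :: v) (ins r w')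
  end.

Definition xyw (w : word) := forallb (fun l => match l with LX | LY => true | _ => false end) w.

Definition eta (r n : nat) : R := match n with O => 0 | S _ => if Nat.eqb (n mod 3) r then / INR n else 0 end.
Definition Hs (r n : nat) : R := psum (eta r) (S n).

Lemma cls_ltd a w : (a < 3)%nat -> cls (ltd a (cls w) :: w) = a.
Proof.
intros Ha. assert (Hc := cls_lt w). cbn [cls]. unfold ltd, lt_of.
destruct ((a + 3 - cls w) mod 3) as [|[|[|k]]] eqn:E; cbn [lval]; try lia.
Qed.

Lemma cw_ltd a w n : (a < 3)%nat -> cw (ltd a (cls w) :: w) n =
  match n with O => 0 | S _ => if Nat.eqb (n mod 3) a then psum (cw w) n / INR n else 0 end.
Proof.
intros Ha. assert (E := cls_ltd a w Ha). cbn [cw]. rewrite E. unfold ext, ltd, lt_of.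
destruct n; auto. destruct ((a + 3 - cls w) mod 3) as [|[|[|k]]]; auto.
Qed.

Lemma lsum_cons {A} (f : A -> R) x l : lsum f (x :: l) = f x + lsum f l.
Proof. reflexivity. Qed.

Lemma lsum_0 {A} (l : list A) : lsum (fun _ => 0) l = 0.
Proof. induction l as [|x l IH]; simpl; [auto|rewrite IH; ring]. Qed.

Lemma psum_lsum {A} (f : A -> nat -> R) L n : psum (fun m => lsum (fun v => f v m) L) n = lsum (fun v => psum (f v) n) L.
Proof. induction n as [|n IH]; simpl; [induction L; simpl; lra|]. rewrite IH, <- lsum_plus; auto. Qed.

Lemma cw_xy l w n : xyw (l :: w) = true -> cw (l :: w) n =
  match n with O => 0 | S _ => if Nat.eqb (n mod 3) (cls (l :: w)) then psum (cw w) n / INR n else 0 end.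
Proof. simpl; destruct l; try discriminate; intros _; reflexivity. Qed.

(** Splits the pairs of indices below n, one from [eta r] and one from [c], by whether the first is
    at most the second or exceeds it. *)
Lemma abel_sum_coef (c : nat -> R) r n :
  psum (fun m => c m * Hs r m + eta r m * psum c m) n = psum c n * psum (eta r) n.
Proof. induction n as [|n IH]; [simpl; ring|]. unfold Hs in *; cbn [psum] in *; rewrite IH. ring. Qed.

(** With n the top index of the result, either n belongs to [w] and the new index is at most n, or
    the new index is n and lies above all of [w]. In the induction, [abel_sum_coef] handles the new
    index below the outermost one. *)
Lemma ins_coef r w n : (r < 3)%nat -> xyw w = true ->
  lsum (fun v => cw v n) (ins r w) = cw w n * Hs r n + eta r n * psum (cw w) n.
Proof.
intros Hr; revert n; induction w as [|l w IH]; intros n Hw.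
- cbn [ins lsum fold_right]. assert (E0 := cw_ltd r [] n Hr). cbn [cls] in E0. rewrite E0; clear E0. unfold Hs, eta. destruct n as [|n].
  + simpl; ring.
  + change (cw [] (S n)) with 0. destruct Nat.eqb; unfold Rdiv; ring.
- assert (Hw' : xyw w = true) by (simpl in Hw; destruct l; try discriminate; auto).
  specialize (fun m => IH m Hw').
  assert (Hc := cls_lt (l :: w)).
  cbn [ins]. rewrite lsum_cons, lsum_app, lsum_map, (cw_ltd r (l :: w) n Hr).
  rewrite (lsum_ext (fun x => cw (ltd (cls (l :: w)) (cls x) :: x) n)
    (fun x => match n with O => 0 | S _ => if Nat.eqb (n mod 3) (cls (l :: w)) then / INR n * psum (cw x) n else 0 end)).
  2:{ intros x _. rewrite cw_ltd by auto. destruct n; auto. destruct Nat.eqb; auto. unfold Rdiv; ring. }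
  destruct n as [|n].
  { rewrite (lsum_0 (ins r w)), (cw_xy l w 0 Hw).
    destruct (Nat.eqb r (cls (l :: w))); unfold lsum; cbn [fold_right cw ext eta psum]; ring. }
  assert (Hn := INR_S_pos n).
  assert (HS : Hs r (S n) = psum (eta r) (S n) + eta r (S n)) by reflexivity.
  rewrite HS. rewrite (cw_xy l w (S n) Hw).
  match goal with |- _ + (?X + _) = _ =>
    assert (ET : X = if Nat.eqb r (cls (l :: w)) then cw (l :: w) (S n) / INR (S n) else 0);
    [destruct Nat.eqb; unfold lsum; cbn [fold_right]; [|ring]; cbn [cw]; unfold ext at 1; ring|rewrite ET; clear ET] end.
  rewrite (cw_xy l w (S n) Hw).
  destruct (Nat.eqb_spec (S n mod 3) (cls (l :: w))) as [E|E].
  + assert (EP : lsum (fun v => psum (cw v) (S n)) (ins r w) = psum (cw w) (S n) * psum (eta r) (S n)).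
    { rewrite <- abel_sum_coef. rewrite <- (psum_lsum cw). apply psum_ext; intros; apply IH. }
    rewrite lsum_scal, EP. change (eta r (S n)) with (if Nat.eqb (S n mod 3) r then / INR (S n) else 0). rewrite E.
    rewrite (Nat.eqb_sym r (cls (l :: w))). destruct (Nat.eqb_spec (cls (l :: w)) r) as [E'|E']; unfold Rdiv; field; lra.
  + rewrite (lsum_0 (ins r w)). change (eta r (S n)) with (if Nat.eqb (S n mod 3) r then / INR (S n) else 0).
    destruct (Nat.eqb_spec (S n mod 3) r) as [E'|E']; destruct (Nat.eqb r (cls (l :: w))); unfold Rdiv; try (field; lra).
Qed.

Lemma cw_lt_of r n : (r < 3)%nat -> cw [ltd r 0] n = eta r n.
Proof.
intros Hr. assert (E0 := cw_ltd r [] n Hr). cbn [cls] in E0. rewrite E0; clear E0. unfold eta. destruct n as [|n]; auto.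
destruct Nat.eqb; auto. replace (psum (cw []) (S n)) with 1; [unfold Rdiv; ring|].
induction n as [|n IH]; [simpl; ring|]. cbn [psum] in *. rewrite <- IH. simpl; ring.
Qed.

Lemma zr_lsum L t : Rabs t < 1 -> lsum (fun v => zr v t) L = Series (fun n => lsum (fun v => cw v n) L * t ^ n) /\
  ex_series (fun n => lsum (fun v => cw v n) L * t ^ n).
Proof.
intros Ht. induction L as [|v L [IH1 IH2]]; simpl.
- split.
  + rewrite (Series_ext _ (fun n => 0 * 0)) by (intros; ring). rewrite Series_scal_l; ring.
  + apply (ex_series_ext (fun n => 0 * t ^ n)); [intros; eqR; ring|].
    apply (ex_series_scal_l (V := R_NormedModule)), ex_series_geom; auto.
- assert (E := rad_ex (cw v) t (cw_rad v) Ht).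
  split.
  + rewrite IH1. unfold zr, PSeries. rewrite <- Series_plus; auto. apply Series_ext; intros; ring.
  + apply (ex_series_ext (fun n => cw v n * t ^ n + lsum (fun v => cw v n) L * t ^ n)); [intros; eqR; ring|].
    apply (ex_series_plus (V := R_NormedModule)); auto.
Qed.

(** By summation by parts the quasi-shuffle side is 1-t times the series of (partial sum of [cf h])
    times [Hs r]. Replacing the partial sums by their limit [F] gives [F] times the harmonic
    function. The error coefficients are O(n^(-1/2)) times O(n^(1/4)), so [small_abel] applies; on
    the shuffle side a small factor meets a slow one. *)
Theorem residue_stuffle_small r h : (r < 3)%nat -> xyw h = true ->
  small (fun t => lsum (fun v => zr v t) (ins r (LX :: h)) - lsum (fun v => zr v t) (ins r (LY :: h))
     - zr [ltd r 0] t * (zr (LX :: h) t - zr (LY :: h) t)).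
Proof.
intros Hr Hh. destruct (cf_limit h) as (K & HK & HF). destruct (psum_cw_growth [ltd r 0]) as (K' & HK' & HG).
set (F := Flim h) in *. set (e := fun n => psum (cf h) (S n) - F).
assert (HsG : forall n, 0 <= Hs r n <= 2 * K' * q4 n).
{ intros n. unfold Hs. rewrite (psum_ext _ (cw [ltd r 0])) by (intros; rewrite cw_lt_of; auto).
  split; [apply psum_nonneg; intros; apply cw_bounds|]. eapply Rle_trans; [apply HG|].
  assert (q4 (S n) <= 2 * q4 n); [|nra].
  apply Rnot_lt_le; intros C. assert (P := q4_pos n). assert (E1 := q4_pow4 n). assert (E2 := q4_pow4 (S n)). rewrite S_INR in E2.
  assert (2 * q4 n * (2 * q4 n) < q4 (S n) * q4 (S n)) by nra.
  assert ((2 * q4 n * (2 * q4 n)) * (2 * q4 n * (2 * q4 n)) < q4 (S n) * q4 (S n) * (q4 (S n) * q4 (S n))) by nra.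
  replace (q4 (S n) * q4 (S n) * (q4 (S n) * q4 (S n))) with (q4 (S n) ^ 4) in H0 by ring.
  replace ((2 * q4 n * (2 * q4 n)) * (2 * q4 n * (2 * q4 n))) with (16 * q4 n ^ 4) in H0 by ring.
  generalize (pos_INR n); lra. }
assert (Hes : forall n, Rabs (e n) <= K * / s2 n).
{ intros n; unfold e. eapply Rle_trans; [apply HF|]. apply Rmult_le_compat_l; auto.
  apply Rinv_le_contravar; [apply s2_pos|]. unfold s2. generalize (q4_le n (S n) ltac:(lia)) (q4_pos n); intros; nra. }
apply (small_ext _ (fun t => 1 * ((1 - t) * Series (fun n => (e n * Hs r n) * t ^ n))
   + (-1) * ((zr (LX :: h) t - zr (LY :: h) t - F) * zr [ltd r 0] t))).
- intros t Ht. assert (Rt : Rabs t < 1) by (rewrite Rabs_pos_eq; lra).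
  destruct (zr_lsum (ins r (LX :: h)) t Rt) as [Z1 Y1]. destruct (zr_lsum (ins r (LY :: h)) t Rt) as [Z2 Y2].
  rewrite Z1, Z2, <- Series_minus by auto.
  set (b := fun n => psum (cf h) (S n) * Hs r n).
  assert (Rb : rad b).
  { apply (rad_growth _ ((K + Rabs F) * (2 * K'))). intros n; unfold b. rewrite Rabs_mult.
    destruct (HsG n) as [G1 G2]. rewrite (Rabs_pos_eq _ G1).
    assert (Rabs (psum (cf h) (S n)) <= K + Rabs F).
    { replace (psum (cf h) (S n)) with (e n + F) by (unfold e; ring). eapply Rle_trans; [apply Rabs_triang|].
      apply Rplus_le_compat_r. eapply Rle_trans; [apply Hes|].
      assert (/ s2 n <= 1). { rewrite <- Rinv_1. apply Rinv_le_contravar; [lra|]. unfold s2; generalize (q4_ge1 n); nra. }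
      assert (0 < / s2 n) by (apply Rinv_0_lt_compat, s2_pos). nra. }
    rewrite (Rmult_assoc (K + Rabs F)). apply Rmult_le_compat; auto using Rabs_pos. }
  assert (RH : rad (Hs r)).
  { apply (rad_growth _ (2 * K')). intros n; destruct (HsG n) as [G1 G2]. rewrite Rabs_pos_eq; auto. }
  rewrite (Series_ext _ (fun n => (cf h n * Hs r n + eta r n * psum (cf h) n) * t ^ n)).
  2:{ intros n. rewrite !ins_coef by auto. unfold cf at 1.
      assert (EP : forall m, psum (cf h) m = psum (cw (LX :: h)) m - psum (cw (LY :: h)) m).
      { induction m as [|m IHm]; [simpl; ring|]. cbn [psum]; rewrite IHm; unfold cf; ring. }
      rewrite EP; ring. }
  rewrite (telescoped_series _ b t Rb); auto.
  2:{ unfold b, Hs; cbn [psum]. simpl eta. ring. }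
  2:{ intros n; unfold b, Hs; cbn [psum]. ring. }
  assert (Es : zr [ltd r 0] t = (1 - t) * Series (fun n => Hs r n * t ^ n)).
  { unfold zr, PSeries. rewrite (Series_ext _ (fun n => eta r n * t ^ n)) by (intros; rewrite cw_lt_of; auto).
    apply telescoped_series; auto; unfold Hs; cbn [psum]; [simpl; ring|intros; ring]. }
  rewrite (Series_ext (fun n => b n * t ^ n) (fun n => F * (Hs r n * t ^ n) + e n * Hs r n * t ^ n)) by (intros n; unfold b, e; ring).
  assert (Re : rad (fun n => e n * Hs r n)).
  { apply (rad_growth _ (K * (2 * K'))). intros n. rewrite Rabs_mult. destruct (HsG n) as [G1 G2]. rewrite (Rabs_pos_eq _ G1), Rmult_assoc.
    apply Rmult_le_compat; auto using Rabs_pos. eapply Rle_trans; [apply Hes|].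
      assert (/ s2 n <= 1). { rewrite <- Rinv_1. apply Rinv_le_contravar; [lra|]. unfold s2; generalize (q4_ge1 n); nra. }
      assert (0 < / s2 n) by (apply Rinv_0_lt_compat, s2_pos). nra. }
  rewrite Series_plus, Series_scal_l.
  + rewrite Es; ring.
  + apply (ex_series_scal_l (V := R_NormedModule)), rad_ex; auto.
  + apply rad_ex; auto.
- apply small_plus; apply small_scal.
  + apply (small_abel (fun n => e n * Hs r n) (K * (2 * K'))). intros n. rewrite Rabs_mult. destruct (HsG n) as [G1 G2]. rewrite (Rabs_pos_eq _ G1).
    assert (P := q4_pos n). apply Rle_trans with (K * / s2 n * (2 * K' * q4 n)); [apply Rmult_le_compat; auto using Rabs_pos|].
    apply Req_le; unfold s2; field; lra.
  + apply small_slow_mult; [apply Flim_small|]. apply zr_slow. unfold ltd, lt_of. destruct ((r + 3 - 0) mod 3) as [|[|[|k]]]; reflexivity.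
Qed.

(* LX h - LY h converges at 1, so its quasi-shuffle product with [Hs r] and its shuffle product with the
   corresponding form differ by a function that vanishes there. *)
Definition rowE (r : nat) (h : word) : list (Z * word) :=
  map (pair 1%Z) (ins r (LX :: h)) ++ map (pair (-1)%Z) (ins r (LY :: h)) ++
  map (pair (-1)%Z) (shuf [ltd r 0] (LX :: h)) ++ map (pair 1%Z) (shuf [ltd r 0] (LY :: h)).

(* Linear combinations of words with integer coefficients, branching on the letters LX, LY, LS, LT. *)
Inductive trie := TL | TN (c : Z) (x y s t : trie).

(* Both are the identity; they keep call-by-need evaluation from piling up suspended additions. *)
Definition forceZ {A} (z : Z) (k : Z -> A) : A := if Z.eqb z z then k z else k 0%Z.
Definition force {A} (T : trie) (k : trie -> A) : A := match T with TL => k TL | TN c x y s t => k (TN c x y s t) end.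

Lemma forceZ_eq {A} z (k : Z -> A) : forceZ z k = k z.
Proof. unfold forceZ; rewrite Z.eqb_refl; reflexivity. Qed.

Lemma force_eq {A} T (k : trie -> A) : force T k = k T.
Proof. destruct T; reflexivity. Qed.

Fixpoint tadd (c : Z) (w : word) (T : trie) : trie :=
  match w with
  | [] => match T with TL => TN c TL TL TL TL | TN d x y s t => forceZ (c + d) (fun e => TN e x y s t) end
  | l :: w' =>
    let '(d, x, y, s, t) := match T with TL => (0%Z, TL, TL, TL, TL) | TN d x y s t => (d, x, y, s, t) end in
    match l with
    | LX => force (tadd c w' x) (fun x => TN d x y s t)
    | LY => force (tadd c w' y) (fun y => TN d x y s t)
    | LS => force (tadd c w' s) (fun s => TN d x y s t)
    | _ => force (tadd c w' t) (fun t => TN d x y s t)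
    end
  end.

Fixpoint teval (T : trie) (F : word -> R) : R :=
  match T with
  | TL => 0
  | TN c x y s t => IZR c * F [] + teval x (fun w => F (LX :: w)) + teval y (fun w => F (LY :: w))
      + teval s (fun w => F (LS :: w)) + teval t (fun w => F (LT :: w))
  end.

Lemma teval_tadd c w T F : pure w = true -> teval (tadd c w T) F = IZR c * F w + teval T F.
Proof.
revert T F; induction w as [|l w IH]; intros T F Hp.
- destruct T; cbn [tadd]; rewrite ?forceZ_eq; simpl; [ring|rewrite plus_IZR; ring].
- simpl in Hp; apply andb_prop in Hp; destruct Hp as [Hl Hp].
  destruct l; try discriminate; destruct T; cbn [tadd]; rewrite force_eq; simpl; rewrite IH by auto; simpl; ring.
Qed.

Definition tchild (l : letter) (f : trie -> trie) (T : trie) : trie :=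
  let '(d, x, y, s, t) := match T with TL => (0%Z, TL, TL, TL, TL) | TN d x y s t => (d, x, y, s, t) end in
  match l with
  | LX => force (f x) (fun x => TN d x y s t) | LY => force (f y) (fun y => TN d x y s t)
  | LS => force (f s) (fun s => TN d x y s t) | _ => force (f t) (fun t => TN d x y s t)
  end.

(** Adds the shuffle into the trie branch by branch; the list of shuffled words, which grows like a
    binomial coefficient, is never built. *)
Fixpoint tshuf (c : Z) (u v : word) (T : trie) : trie :=
  match u with
  | [] => tadd c v T
  | l :: u' =>
    (fix aux (v : word) (T : trie) := match v with
     | [] => tadd c u T
     | m :: v' => tchild m (aux v') (tchild l (tshuf c u' v) T)
     end) v T
  end.

Definition purel (l : letter) : bool := match l with LX | LY | LS | LT => true | L1 => false end.

Lemma teval_tchild l f T F k : purel l = true -> (forall T G, teval (f T) G = k G + teval T G) ->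
  teval (tchild l f T) F = k (fun w => F (l :: w)) + teval T F.
Proof. intros Hl H; destruct l; try discriminate; destruct T; unfold tchild; rewrite force_eq; simpl; rewrite H; simpl; ring. Qed.

Lemma pure_cons l w : pure (l :: w) = true -> purel l = true /\ pure w = true.
Proof. intros H; simpl in H; apply andb_prop in H; destruct H as [H1 H2]. split; auto. Qed.

Lemma teval_tshuf c u v T F : pure u = true -> pure v = true ->
  teval (tshuf c u v T) F = IZR c * lsum F (shuf u v) + teval T F.
Proof.
revert v T F; induction u as [|l u IHu]; intros v T F Hu Hv.
- cbn [tshuf shuf]. rewrite teval_tadd by auto. simpl; ring.
- destruct (pure_cons l u Hu) as [Hl Hu']. revert T F; induction v as [|m v IHv]; intros T F.
  + cbn [tshuf]. rewrite teval_tadd, shuf_nil_r by auto. simpl; ring.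
  + destruct (pure_cons m v Hv) as [Hm Hv']. rewrite shuf_cons, lsum_app, !lsum_map.
    cbn [tshuf] in *.
    rewrite (teval_tchild m _ _ F (fun G => IZR c * lsum G (shuf (l :: u) v))) by (auto; intros; apply IHv; auto).
    rewrite (teval_tchild l _ _ F (fun G => IZR c * lsum G (shuf u (m :: v)))) by (auto; intros; apply IHu; auto).
    match goal with |- IZR c * ?a + (IZR c * ?b + ?r) = _ => change (IZR c * a + (IZR c * b + r) = IZR c * (b + a) + r) end. ring.
Qed.

(** * Combinations of the stuffle relations *)

Record row := Row { rc : Z; rr : nat; rh : word; ru : word }.

(** A row is an integer times a relation [rowE], multiplied by the function of a further word [ru].
    That function is slow, so the product still tends to 0 and counts as a relation. *)
Definition addrow (p : row) (T : trie) : trie :=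
  fold_right (fun e T => tshuf (rc p * fst e) (ru p) (snd e) T) T (rowE (rr p) (rh p)).

Definition okrow (p : row) := andb (Nat.ltb (rr p) 3) (andb (xyw (rh p)) (xyw (ru p))).

Lemma xyw_good w : xyw w = true -> goodw w.
Proof.
induction w as [|l w IH]; intros H; [split; reflexivity|].
assert (H' : xyw w = true) by (simpl in H; destruct l; try discriminate; auto).
destruct (IH H') as [A B]. split; simpl in *; rewrite ?A, ?B; destruct l; try discriminate; auto.
Qed.

Lemma ltd_good a b w : goodw w -> goodw (ltd a b :: w).
Proof.
intros [A B]. unfold ltd, lt_of, goodw.
destruct (Nat.modulo (a + 3 - b) 3) as [|[|[|k]]]; simpl; rewrite A, B; auto.
Qed.

Lemma ins_good r w v : xyw w = true -> In v (ins r w) -> goodw v.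
Proof.
revert v; induction w as [|l w IH]; intros v Hw Hv.
- destruct Hv as [<-|[]]. apply ltd_good; split; reflexivity.
- assert (H' : xyw w = true) by (simpl in Hw; destruct l; try discriminate; auto).
  assert (G := xyw_good _ Hw). cbn [ins] in Hv. destruct Hv as [<-|Hv]; [apply ltd_good; auto|].
  apply in_app_or in Hv; destruct Hv as [Hv|Hv].
  + destruct Nat.eqb; [|destruct Hv]. destruct Hv as [<-|[]]. destruct G as [A B]. split; simpl in *; rewrite ?A, ?B; auto.
  + apply in_map_iff in Hv. destruct Hv as (v' & <- & Hv). apply ltd_good; auto.
Qed.

Lemma rowE_good r h e : xyw h = true -> In e (rowE r h) -> goodw (snd e).
Proof.
intros Hh H. unfold rowE in H.
assert (HX : xyw (LX :: h) = true) by (simpl; auto). assert (HY : xyw (LY :: h) = true) by (simpl; auto).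
assert (GL : goodw [ltd r 0]) by (apply ltd_good; split; reflexivity).
repeat (apply in_app_or in H; destruct H as [H|H]); apply in_map_iff in H; destruct H as (v & <- & Hv); simpl.
- apply (ins_good r (LX :: h)); auto.
- apply (ins_good r (LY :: h)); auto.
- apply (goodw_shuf [ltd r 0] (LX :: h)); auto using xyw_good.
- apply (goodw_shuf [ltd r 0] (LY :: h)); auto using xyw_good.
Qed.

Lemma rowE_small r h : (r < 3)%nat -> xyw h = true ->
  small (fun t => lsum (fun e => IZR (fst e) * zr (snd e) t) (rowE r h)).
Proof.
intros Hr Hh.
assert (HX : xyw (LX :: h) = true) by (simpl; auto). assert (HY : xyw (LY :: h) = true) by (simpl; auto).
assert (GL : goodw [ltd r 0]) by (apply ltd_good; split; reflexivity).
eapply small_ext; [|apply (residue_stuffle_small r h Hr Hh)]. intros t Ht; cbv beta.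
unfold rowE. rewrite !lsum_app, !lsum_map. cbn [fst snd].
rewrite !lsum_scal. rewrite Rmult_minus_distr_l, !zr_shuffle by (auto using xyw_good). unfold word; ring.
Qed.

Lemma teval_addrow p T t : okrow p = true -> 0 <= t < 1 ->
  teval (addrow p T) (fun w => zr w t) =
  IZR (rc p) * (zr (ru p) t * lsum (fun e => IZR (fst e) * zr (snd e) t) (rowE (rr p) (rh p))) + teval T (fun w => zr w t).
Proof.
intros Hp Ht. unfold okrow in Hp. apply andb_prop in Hp; destruct Hp as [_ Hp]. apply andb_prop in Hp; destruct Hp as [Hh Hu].
unfold addrow.
assert (G : forall e, In e (rowE (rr p) (rh p)) -> goodw (snd e)) by (intros e; apply rowE_good; auto).
induction (rowE (rr p) (rh p)) as [|e L IH]; simpl; [ring|].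
assert (Ge : goodw (snd e)) by (apply G; left; auto).
assert (E : forall T, teval (tshuf (rc p * fst e) (ru p) (snd e) T) (fun w => zr w t) =
   IZR (rc p * fst e) * (zr (ru p) t * zr (snd e) t) + teval T (fun w => zr w t)).
{ intros T'. rewrite zr_shuffle by (auto using xyw_good). apply teval_tshuf; [apply xyw_good; auto|apply Ge]. }
rewrite E, IH by (intros; apply G; right; auto). rewrite mult_IZR. ring.
Qed.

Definition total (L : list row) : trie := fold_right addrow TL L.

Lemma total_small L : forallb okrow L = true -> small (fun t => teval (total L) (fun w => zr w t)).
Proof.
induction L as [|p L IH]; intros H; [apply small_0|]. simpl in H; apply andb_prop in H; destruct H as [Hp H].
apply (small_ext _ _ (fun t Ht => teval_addrow p (total L) t Hp Ht)).
apply small_plus; auto. apply (small_scal (IZR (rc p)) (fun t => zr (ru p) t * _)).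
unfold okrow in Hp. apply andb_prop in Hp; destruct Hp as [Hr Hp]. apply andb_prop in Hp; destruct Hp as [Hh Hu].
apply (small_ext _ (fun t => lsum (fun e => IZR (fst e) * zr (snd e) t) (rowE (rr p) (rh p)) * zr (ru p) t)); [intros; ring|].
apply small_slow_mult; [apply rowE_small; auto; apply Nat.ltb_lt; auto|]. apply zr_slow, xyw_good; auto.
Qed.

Fixpoint tcomb (k : Z) (A B : trie) : trie :=
  match A, B with
  | TL, TL => TL
  | TN c x y s t, TL => A
  | TL, TN c x y s t => TN (k * c) (tcomb k TL x) (tcomb k TL y) (tcomb k TL s) (tcomb k TL t)
  | TN c x y s t, TN c' x' y' s' t' => TN (c + k * c') (tcomb k x x') (tcomb k y y') (tcomb k s s') (tcomb k t t')
  end.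

Lemma teval_tcomb_TL k B F : teval (tcomb k TL B) F = IZR k * teval B F.
Proof.
revert F; induction B as [|c x IHx y IHy s IHs t IHt]; intros F; simpl; [ring|].
rewrite IHx, IHy, IHs, IHt, mult_IZR; ring.
Qed.

Lemma teval_tcomb k A B F : teval (tcomb k A B) F = teval A F + IZR k * teval B F.
Proof.
revert B F; induction A as [|c x IHx y IHy s IHs t IHt]; intros B F; [rewrite teval_tcomb_TL; simpl; ring|].
destruct B; simpl; [ring|]. rewrite IHx, IHy, IHs, IHt, plus_IZR, mult_IZR; ring.
Qed.

Fixpoint tzero (T : trie) : bool :=
  match T with TL => true | TN c x y s t => andb (Z.eqb c 0) (andb (tzero x) (andb (tzero y) (andb (tzero s) (tzero t)))) end.

Lemma tzero_eval T F : tzero T = true -> teval T F = 0.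
Proof.
revert F; induction T as [|c x IHx y IHy s IHs t IHt]; intros F H; simpl in *; [auto|].
apply andb_prop in H; destruct H as [H1 H]. apply andb_prop in H; destruct H as [H2 H].
apply andb_prop in H; destruct H as [H3 H]. apply andb_prop in H; destruct H as [H4 H5].
apply Z.eqb_eq in H1. rewrite IHx, IHy, IHs, IHt, H1 by auto; ring.
Qed.

(* Rewrites a combination of words in LX, LY in terms of a and b; [None] if LS or LT occurs. The powers of
   [sqrt 3] are left out. *)
Fixpoint conv (n : nat) (T : trie) : option (list (Q * list bool)) :=
  match T with
  | TL => Some []
  | TN c x y s t => match n with
    | O => if andb (tzero x) (andb (tzero y) (andb (tzero s) (tzero t))) then Some [(inject_Z c, [])] else None
    | S n' =>
      if andb (Z.eqb c 0) (andb (tzero s) (tzero t)) then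
        match conv n' (tcomb (-1) x y), conv n' (tcomb 1 x y) with
        | Some A, Some B => Some (map (fun p => ((fst p * (1 # 2))%Q, true :: snd p)) A ++
                                  map (fun p => ((fst p * (1 # 3))%Q, false :: snd p)) B)
        | _, _ => None
        end
      else None
    end
  end.

Definition na (w : list bool) : nat := length (filter (fun b => b) w).

Lemma teval_lin T a F b G : teval T (fun w => a * F w + b * G w) = a * teval T F + b * teval T G.
Proof.
revert F G; induction T as [|c x IHx y IHy s IHs t IHt]; intros F G; simpl; [ring|].
rewrite IHx, IHy, IHs, IHt; ring.
Qed.

Lemma lc_lin L a F b G : lc L (fun w => a * F w + b * G w) = a * lc L F + b * lc L G.
Proof. unfold lc. rewrite <- !lsum_scal, <- lsum_plus. apply lsum_ext; intros; ring. Qed.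

Lemma Q2R_third : Q2R (1 # 3) = / 3.
Proof. unfold Q2R; simpl; lra. Qed.

Lemma Q2R_inject c : Q2R (inject_Z c) = IZR c.
Proof. unfold Q2R; simpl. lra. Qed.

Lemma conv_sound n T L F : conv n T = Some L ->
  teval T F = lsum (fun p => Q2R (fst p) * (/ sqrt 3) ^ na (snd p) * lc (abexp (snd p)) F) L.
Proof.
assert (P3 := sqrt3_pos).
revert T L F; induction n as [|n IH]; intros [|c x y s t] L F H; simpl in H; try (injection H as <-; reflexivity).
- destruct (tzero x) eqn:H1, (tzero y) eqn:H2, (tzero s) eqn:H3, (tzero t) eqn:H4; try discriminate. injection H as <-.
  simpl. rewrite !tzero_eval by auto. rewrite Q2R_inject. unfold lc; simpl. ring.
- destruct (Z.eqb_spec c 0) as [->|]; [|discriminate].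
  destruct (tzero s) eqn:H3, (tzero t) eqn:H4; try discriminate. cbn [andb] in H.
  destruct (conv n (tcomb (-1) x y)) as [A|] eqn:EA; [|discriminate].
  destruct (conv n (tcomb 1 x y)) as [B|] eqn:EB; [|discriminate]. injection H as <-.
  cbn [teval]. rewrite (tzero_eval s), (tzero_eval t) by auto. rewrite lsum_app, !lsum_map. cbn [fst snd].
  set (FX := fun w => F (LX :: w)). set (FY := fun w => F (LY :: w)).
  transitivity (teval (tcomb (-1) x y) (fun w => / 2 * FX w + (- / 2) * FY w) + teval (tcomb 1 x y) (fun w => / 2 * FX w + / 2 * FY w)).
  { rewrite !teval_tcomb, !teval_lin.
    change (teval x (fun w => F (LX :: w))) with (teval x FX). change (teval y (fun w => F (LY :: w))) with (teval y FY). field. }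
  rewrite (IH _ A), (IH _ B) by auto. f_equal; apply lsum_ext; intros [q w] _; cbn [fst snd].
  + cbn [abexp na filter length]. rewrite lc_app, !lc_cons, lc_lin. fold (na w).
    change (lc (abexp w) (fun v => F (LX :: v))) with (lc (abexp w) FX). change (lc (abexp w) (fun v => F (LY :: v))) with (lc (abexp w) FY).
    rewrite Q2R_mult, Q2R_half. change ((/ sqrt 3) ^ S (na w)) with (/ sqrt 3 * (/ sqrt 3) ^ na w).
    generalize ((/ sqrt 3) ^ na w); intros k. field; lra.
  + cbn [abexp]. change (na (false :: w)) with (na w). rewrite lc_app, !lc_cons, lc_lin.
    change (lc (abexp w) (fun v => F (LX :: v))) with (lc (abexp w) FX). change (lc (abexp w) (fun v => F (LY :: v))) with (lc (abexp w) FY).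
    rewrite Q2R_mult, Q2R_third. generalize ((/ sqrt 3) ^ na w); intros k. field.
Qed.

Definition nzq (p : Q * list bool) : bool := negb (Qeq_bool (fst p) 0).
(** The word must have a value at 1, and an even number of a's makes the omitted power of sqrt 3
    rational. *)
Definition okp (p : Q * list bool) : bool := andb (ga (snd p)) (Nat.even (na (snd p))).

(** Every failed check gives the empty list, so that [exotic_relation] holds unconditionally. The
    division by a power of 3 restores the factors of sqrt 3 that [conv] leaves out. *)
Definition exotic (n : nat) (L : list row) : list (Q * list bool) :=
  match conv n (total L) with
  | Some C =>
    let M := filter nzq C in
    if andb (forallb okrow L) (forallb okp M)
    then map (fun p => (Qred (fst p * (1 # Pos.of_nat (3 ^ Nat.div2 (na (snd p))))), snd p)) M else []
  | None => []
  end.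

Lemma inv_sqrt3_pow k : (/ sqrt 3) ^ (2 * k) = / IZR (Z.of_nat (3 ^ k)).
Proof.
rewrite pow_mult. replace ((/ sqrt 3) ^ 2) with (/ 3).
- rewrite <- INR_IZR_INZ, pow_INR, pow_inv. simpl INR. replace (1 + 1 + 1) with 3 by ring. reflexivity.
- simpl. rewrite Rmult_1_r, <- Rinv_mult, sqrt3_sqr; auto.
Qed.

(** The total of the rows tends to 0 as t tends to 1. It is also a combination of functions [cab] of
    words that do not begin with b, so it tends to the same combination of V's. *)
Theorem exotic_relation n L : lsum (fun p => Q2R (fst p) * V (snd p)) (exotic n L) = 0.
Proof.
unfold exotic. destruct (conv n (total L)) as [C|] eqn:EC; [|reflexivity]. set (M := filter nzq C).
destruct (forallb okrow L) eqn:H1; [|reflexivity]. destruct (forallb okp M) eqn:H3; [|reflexivity]. cbn [andb].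
assert (S := total_small L H1). rewrite lsum_map. cbn [fst snd].
assert (HM : forall p, In p M -> okp p = true) by (apply forallb_forall; auto).
transitivity (lsum (fun p => Q2R (fst p) * (/ sqrt 3) ^ na (snd p) * V (snd p)) M).
{ apply lsum_ext; intros p Hp. f_equal. rewrite (Qeq_eqR _ _ (Qred_correct _)), Q2R_mult. f_equal.
  specialize (HM p Hp). apply andb_prop in HM; destruct HM as [_ HE].
  assert (E : na (snd p) = (2 * Nat.div2 (na (snd p)))%nat).
  { apply Nat.even_spec, Nat.Even_double in HE. unfold Nat.double in HE. lia. }
  rewrite E at 2. rewrite inv_sqrt3_pow. unfold Q2R; cbn [Qnum Qden].
  rewrite Rmult_1_l. f_equal. f_equal.
  assert (3 ^ Nat.div2 (na (snd p)) <> 0)%nat by (apply Nat.pow_nonzero; lia).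
  rewrite <- positive_nat_Z, Nat2Pos.id; auto. }
apply small_const_0.
apply (small_ext _ (fun t => teval (total L) (fun w => zr w t) + (-1) * lsum (fun p => Q2R (fst p) * (/ sqrt 3) ^ na (snd p) * (cab (snd p) t - V (snd p))) M)).
- intros t Ht. rewrite (conv_sound n _ _ _ EC).
  assert (E : lsum (fun p => Q2R (fst p) * (/ sqrt 3) ^ na (snd p) * lc (abexp (snd p)) (fun w => zr w t)) C =
              lsum (fun p => Q2R (fst p) * (/ sqrt 3) ^ na (snd p) * cab (snd p) t) M).
  { unfold M. clear. induction C as [|p X IH]; [reflexivity|].
    cbn [filter]. rewrite lsum_cons, IH. unfold nzq at 2. destruct (Qeq_bool (fst p) 0) eqn:E; cbn [negb].
    - apply Qeq_bool_eq in E. rewrite (Qeq_eqR _ _ E), RMicromega.Q2R_0. ring.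
    - reflexivity. }
  rewrite E, <- lsum_scal, <- lsum_plus. apply lsum_ext; intros; ring.
- apply small_plus; auto. apply (small_scal (-1) (fun t => lsum _ M)).
  apply (small_lsum (fun p t => Q2R (fst p) * (/ sqrt 3) ^ na (snd p) * (cab (snd p) t - V (snd p)))).
  intros p Hp. apply (small_scal _ (fun t => cab (snd p) t - V (snd p))), V_small.
  specialize (HM p Hp). apply andb_prop in HM; tauto.
Qed.

(* All the rows of weight [n], in the order in which a certificate lists its coefficients. *)
Fixpoint xywords (n : nat) : list word :=
  match n with O => [[]] | S n' => flat_map (fun l => map (cons l) (xywords n')) [LX; LY] end.

Definition row_keys (n : nat) : list (nat * word * word) :=
  flat_map (fun m => flat_map (fun h => flat_map (fun r => map (fun u => (r, h, u)) (xywords (n - m))) (seq 0 3))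
    (xywords (m - 2))) (rev (seq 3 (n - 2))).

Definition swapw (w : word) : word := map (fun l => match l with LX => LY | LY => LX | _ => l end) w.

(** Each row comes with its mirror image under exchange of [LX] and [LY]. The exchange negates
    residues mod 3 and reverses the sign of LX h - LY h, whence the coefficient -c. It also reverses
    the sign of a and fixes b, so the sum retains only words with an even number of a's. *)
Definition cert_rows (n : nat) (cs : list Z) : list row :=
  flat_map (fun p => let '(c, (r, h, u)) := p in
     if Z.eqb c 0 then [] else [Row c r h u; Row (- c) (Nat.modulo (3 - r) 3) (swapw h) (swapw u)])
   (combine cs (row_keys n)).

(** * Formal expansion of the summand *)

(** Multiplication of a power series in y by c + d y; [ldiv] is the division by it. *)
Definition lmul (c d : R) (f : nat -> R) (j : nat) : R := c * f j + d * match j with O => 0 | S i => f i end.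

Fixpoint ldiv (c d : R) (f : nat -> R) (j : nat) : R :=
  match j with O => f O / c | S i => (f (S i) - d * ldiv c d f i) / c end.

Lemma lmul_ldiv c d f j : c <> 0 -> lmul c d (ldiv c d f) j = f j.
Proof. intros Hc; unfold lmul; destruct j; simpl; field; auto. Qed.

Lemma lmul_inj c d f g : c <> 0 -> (forall j, lmul c d f j = lmul c d g j) -> forall j, f j = g j.
Proof.
intros Hc H j; induction j as [|j IH]; specialize (H 0%nat) as H0.
- unfold lmul in H0. apply (Rmult_eq_reg_l c); auto. lra.
- specialize (H (S j)). unfold lmul in H. rewrite IH in H. apply (Rmult_eq_reg_l c); auto. lra.
Qed.

(** Truncations of the norm that bounds a power series on |y| <= 1/4. The radius stays below 1/2,
    where the first denominator 1+2y of the product in [bq] vanishes. *)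
Definition nrm (f : nat -> R) (n : nat) := psum (fun i => Rabs (f i) * (/ 4) ^ i) n.

Lemma nrm_nonneg f n : 0 <= nrm f n.
Proof. apply psum_nonneg; intros; apply Rmult_le_pos; [apply Rabs_pos|apply pow_le; lra]. Qed.

Lemma nrm_S f n : nrm f (S n) = Rabs (f O) + / 4 * nrm (fun i => f (S i)) n.
Proof.
unfold nrm; induction n as [|n IH]; [cbn [psum]; simpl pow; ring|].
cbn [psum] in *. rewrite IH. simpl pow. ring.
Qed.

Lemma nrm_mono f n : nrm f n <= nrm f (S n).
Proof. unfold nrm; cbn [psum]. assert (0 <= Rabs (f n) * (/ 4) ^ n) by (apply Rmult_le_pos; [apply Rabs_pos|apply pow_le; lra]). lra. Qed.

Lemma nrm_le_lin f g h a b n : 0 <= a -> 0 <= b -> (forall i, Rabs (f i) <= a * Rabs (g i) + b * Rabs (h i)) ->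
  nrm f n <= a * nrm g n + b * nrm h n.
Proof.
intros Ha Hb H; unfold nrm. rewrite <- !psum_scal, <- psum_plus. apply psum_le; intros i _.
replace (a * (Rabs (g i) * (/ 4) ^ i) + b * (Rabs (h i) * (/ 4) ^ i)) with ((a * Rabs (g i) + b * Rabs (h i)) * (/ 4) ^ i) by ring.
apply Rmult_le_compat_r; auto; apply pow_le; lra.
Qed.

Definition shift1 (f : nat -> R) (j : nat) : R := match j with O => 0 | S i => f i end.

Lemma nrm_shift1 f n : nrm (shift1 f) n <= / 4 * nrm f n.
Proof.
destruct n as [|n]; [unfold nrm; simpl; lra|]. rewrite nrm_S. simpl shift1 at 1. rewrite Rabs_R0, Rplus_0_l.
apply Rmult_le_compat_l; [lra|]. apply (nrm_mono f n).
Qed.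

Lemma nrm_lmul c d f n : 0 <= c -> 0 <= d -> nrm (lmul c d f) n <= (c + d / 4) * nrm f n.
Proof.
intros Hc Hd. eapply Rle_trans; [apply (nrm_le_lin _ f (shift1 f) c d); auto|].
- intros i; unfold lmul. fold (shift1 f i). eapply Rle_trans; [apply Rabs_triang|]. rewrite !Rabs_mult, (Rabs_pos_eq c), (Rabs_pos_eq d); auto; lra.
- generalize (nrm_shift1 f n); nra.
Qed.

(** For the quotient g one has c g = f - d y g, and multiplication by y costs a factor 1/4 in this
    norm. *)
Lemma nrm_ldiv c d f n : 0 <= d -> d / 4 < c -> nrm (ldiv c d f) n <= / (c - d / 4) * nrm f n.
Proof.
intros Hd Hc. set (g := ldiv c d f).
assert (H : nrm (fun i => c * g i) n <= 1 * nrm f n + d * nrm (shift1 g) n).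
{ apply nrm_le_lin; try lra. intros i. replace (c * g i) with (f i + - (d * shift1 g i)).
  - eapply Rle_trans; [apply Rabs_triang|]. rewrite Rabs_Ropp, Rabs_mult, (Rabs_pos_eq d); auto; lra.
  - unfold g. destruct i; simpl; field; lra. }
assert (E : nrm (fun i => c * g i) n = c * nrm g n).
{ unfold nrm. rewrite <- psum_scal. apply psum_ext; intros i _. rewrite Rabs_mult, (Rabs_pos_eq c) by lra. ring. }
assert (S1 := nrm_shift1 g n). assert (G := nrm_nonneg g n).
apply (Rmult_le_reg_l (c - d / 4)); [lra|]. rewrite <- Rmult_assoc, Rinv_r, Rmult_1_l by lra. nra.
Qed.

Lemma nrm_bound f j : Rabs (f j) <= 4 ^ j * nrm f (S j).
Proof.
assert (0 <= nrm f j) by apply nrm_nonneg. unfold nrm in *; cbn [psum].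
assert (P : 0 < 4 ^ j) by (apply pow_lt; lra).
rewrite Rmult_plus_distr_l. replace (4 ^ j * (Rabs (f j) * (/ 4) ^ j)) with (Rabs (f j)).
- nra.
- rewrite pow_inv. field. lra.
Qed.

Definition ps_one (j : nat) : R := match j with O => 1 | _ => 0 end.

(* Power series in y of prod_(m <= k) (m+y) / (2 (2m-1+2y)); dividing by (k+y)^s gives [rs s k]. *)
Fixpoint bq (k : nat) : nat -> R :=
  match k with O => ps_one | S k' => ldiv (2 * (2 * INR k' + 1)) 4 (lmul (INR k' + 1) 1 (bq k')) end.

Fixpoint rs (s k : nat) : nat -> R :=
  match s with O => bq k | S s' => ldiv (INR k) 1 (rs s' k) end.

(** The term k = 0 is set to 0 since the sums start at k = 1; the power series in e^theta formed
    from the family then have no constant term. *)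
Definition fam (s k : nat) : nat -> R := match k with O => fun _ => 0 | S _ => rs s k end.

Lemma nrm_one n : nrm ps_one n <= 1.
Proof.
destruct n as [|n]; [unfold nrm; simpl; lra|]. rewrite nrm_S. simpl ps_one at 1. rewrite Rabs_R1.
assert (nrm (fun i => ps_one (S i)) n = 0); [|lra].
unfold nrm. rewrite (psum_ext _ (fun _ => 0)) by (intros; simpl; rewrite Rabs_R0; ring). rewrite psum_const; ring.
Qed.

(** The step from k to k+1 costs at most (k + 5/4)/(4k + 1). This is 5/4 at k = 0, which the
    constant 5/2 allows for, and at most 1/2 afterwards. The true decay is like 4^(-k); ratio 1/2 is
    enough to have e^theta = 1 inside the disc of convergence. *)
Lemma nrm_bq k n : nrm (bq k) n <= 5 / 2 * (/ 2) ^ k.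
Proof.
induction k as [|k IH]; [simpl; generalize (nrm_one n); lra|].
assert (Hk := pos_INR k). cbn [bq].
eapply Rle_trans; [apply nrm_ldiv; lra|].
assert (N := nrm_lmul (INR k + 1) 1 (bq k) n ltac:(lra) ltac:(lra)).
destruct k as [|k].
- assert (N1 := nrm_one n). simpl in *.
  replace (/ (2 * (2 * 0 + 1) - 4 / 4)) with 1 by field. lra.
- assert (Hk1 : 1 <= INR (S k)) by (rewrite S_INR; generalize (pos_INR k); lra).
  set (x := INR (S k)) in *. change ((/ 2) ^ S (S k)) with (/ 2 * (/ 2) ^ S k).
  apply (Rmult_le_reg_l (2 * (2 * x + 1) - 4 / 4)); [lra|]. rewrite <- Rmult_assoc, Rinv_r, Rmult_1_l by lra.
  assert (G := nrm_nonneg (bq (S k)) n). nra.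
Qed.

Lemma nrm_rs s k n : (1 <= k)%nat -> nrm (rs s k) n <= (4 / 3) ^ s * (5 / 2 * (/ 2) ^ k).
Proof.
intros Hk. apply le_INR in Hk; simpl in Hk. induction s as [|s IH]; [simpl; generalize (nrm_bq k n); lra|].
cbn [rs]. eapply Rle_trans; [apply nrm_ldiv; lra|]. simpl pow.
assert (/ (INR k - 1 / 4) <= 4 / 3).
{ apply (Rmult_le_reg_r (INR k - 1 / 4)); [lra|]. rewrite Rinv_l by lra. lra. }
assert (0 < / (INR k - 1 / 4)) by (apply Rinv_0_lt_compat; lra). rewrite Rmult_assoc.
assert (G := nrm_nonneg (rs s k) n). apply Rmult_le_compat; lra.
Qed.

Lemma fam_bound s j : exists K, 0 <= K /\ forall k, Rabs (fam s k j) <= K * (/ 2) ^ k.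
Proof.
exists (4 ^ j * ((4 / 3) ^ s * (5 / 2))).
assert (P : 0 <= 4 ^ j * ((4 / 3) ^ s * (5 / 2))).
{ apply Rmult_le_pos; [apply pow_le; lra|]. apply Rmult_le_pos; [apply pow_le; lra|lra]. }
split; auto. intros [|k]; cbn [fam]; [rewrite Rabs_R0; simpl; lra|].
eapply Rle_trans; [apply nrm_bound|]. rewrite Rmult_assoc. apply Rmult_le_compat_l; [apply pow_le; lra|].
eapply Rle_trans; [apply nrm_rs; lia|]. lra.
Qed.

Lemma fam_step s k j : lmul (INR k) 1 (fam (S s) k) j = fam s k j.
Proof.
destruct k as [|k]; cbn [fam]; [unfold lmul; destruct j; ring|].
cbn [rs]. apply lmul_ldiv. generalize (INR_S_pos k); lra.
Qed.

Lemma lmul_ext c d f g j : (forall i, f i = g i) -> lmul c d f j = lmul c d g j.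
Proof. intros H; unfold lmul; destruct j; rewrite ?H; reflexivity. Qed.

(** The recursion 2 (2k-1+2y) b_k = (k+y) b_(k-1) of the product, written as 4 (k+y) b_k - 2 b_k =
    (k+y) b_(k-1) and divided by k+y. *)
Lemma fam_recurrence k j : 4 * fam 0 k j - 2 * fam 1 k j - match k with O => 0 | S k' => fam 0 k' j end =
  match k with 1%nat => ps_one j | _ => 0 end.
Proof.
destruct k as [|k]; [cbn [fam]; ring|].
assert (E : forall j, 4 * bq (S k) j - 2 * rs 1 (S k) j = bq k j).
{ assert (Hk := pos_INR k).
  apply (lmul_inj (INR (S k)) 1); [generalize (INR_S_pos k); lra|].
  apply (lmul_inj (2 * (2 * INR k + 1)) 4); [lra|]. intros i.
  assert (L1 : forall i, lmul (INR (S k)) 1 (fun j => 4 * bq (S k) j - 2 * rs 1 (S k) j) i = lmul (2 * (2 * INR k + 1)) 4 (bq (S k)) i).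
  { intros m. transitivity (4 * lmul (INR (S k)) 1 (bq (S k)) m - 2 * lmul (INR (S k)) 1 (rs 1 (S k)) m); [unfold lmul; destruct m; ring|].
    cbn [rs]. rewrite lmul_ldiv by (generalize (INR_S_pos k); lra). rewrite S_INR. unfold lmul; destruct m; ring. }
  rewrite (lmul_ext _ _ _ _ i L1).
  rewrite (lmul_ext _ _ _ (lmul (INR k + 1) 1 (bq k))).
  - rewrite S_INR; reflexivity.
  - intros m. cbn [bq]. apply lmul_ldiv. lra. }
cbn [fam]. change (rs 0 (S k) j) with (bq (S k) j). rewrite E.
destruct k as [|k]; cbn [fam]; [cbn [bq]; ring|]. change (rs 0 (S k) j) with (bq (S k) j). ring.
Qed.

(** * The generating series along the arc *)

Definition ser (b : nat -> R) (th : R) : R := PSeries b (exp th).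

Definition expo (i : nat) (th : R) : R := th ^ i / INR (fact i).

(** The coefficient of y^j in the sum over k of a_k(y) e^((k+y) theta), with e^(y theta) expanded
    into the factors [expo i]. *)
Definition XX (a : nat -> nat -> R) (j : nat) (th : R) : R :=
  psum (fun i => expo i th * ser (fun k => a k (j - i)%nat) th) (S j).

(** The series then converges for e^theta < 2, in particular at theta = 0, where the sums over k are
    read off. *)
Definition geo (b : nat -> R) := exists K, 0 <= K /\ forall k, Rabs (b k) <= K * (/ 2) ^ k.

Lemma geo_CV b : geo b -> Rbar_le 2 (CV_radius b).
Proof.
intros (K & HK & H). destruct (CV_radius_bounded b) as [H1 _]. apply H1. exists K; intros n.
rewrite Rabs_mult, (Rabs_pos_eq (2 ^ n)) by (apply pow_le; lra).
assert (P : 0 < 2 ^ n) by (apply pow_lt; lra).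
specialize (H n). rewrite pow_inv in H. apply (Rmult_le_compat_r (2 ^ n)) in H; [|lra].
rewrite Rmult_assoc, Rinv_l, Rmult_1_r in H; lra.
Qed.

Lemma expo_deriv i th : is_derive (expo i) th (match i with O => 0 | S i' => expo i' th end).
Proof.
unfold expo. destruct i as [|i].
- apply (is_derive_ext (fun _ => 1)); [intros; simpl; field|]. exact (is_derive_const (V := R_NormedModule) 1 th).
- assert (H : INR (fact i) <> 0) by apply INR_fact_neq_0. assert (H0 := INR_S_pos i).
  auto_derive; [auto|]. change (match i with O => 1 | S _ => INR i + 1 end) with (INR (S i)).
  replace (fact i + i * fact i)%nat with (S i * fact i)%nat by (simpl; lia). rewrite mult_INR. field; lra.
Qed.

Lemma ser_deriv b th : geo b -> exp th < 2 -> is_derive (ser b) th (ser (fun k => INR k * b k) th).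
Proof.
intros Hb Hth. assert (CV := geo_CV b Hb).
assert (R : Rbar_lt (Rabs (exp th)) (CV_radius b)).
{ eapply Rbar_lt_le_trans; [|exact CV]. simpl. rewrite Rabs_pos_eq; auto. left; apply exp_pos. }
assert (D := is_derive_PSeries b (exp th) R). assert (E := is_derive_exp th).
assert (C := is_derive_comp (PSeries b) exp th _ _ D E).
unfold ser. replace (PSeries (fun k => INR k * b k) (exp th)) with (scal (exp th) (PSeries (PS_derive b) (exp th))); auto.
change scal with Rmult; simpl. rewrite <- PSeries_incr_1. apply PSeries_ext. intros [|n]; unfold PS_incr_1, PS_derive.
- change (0 = INR 0 * b 0%nat). simpl; ring.
- reflexivity.
Qed.

Lemma psum_S_l f n : psum f (S n) = f O + psum (fun i => f (S i)) n.
Proof. induction n as [|n IH]; [simpl; ring|]. cbn [psum] in *. rewrite IH; ring. Qed.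

Lemma psum_derive (f : nat -> R -> R) (d : nat -> R) n t :
  (forall i, (i < n)%nat -> is_derive (f i) t (d i)) -> is_derive (fun s => psum (fun i => f i s) n) t (psum d n).
Proof.
induction n as [|n IH]; intros H; cbn [psum].
- exact (is_derive_const (V := R_NormedModule) 0 t).
- apply (is_derive_plus (fun s => psum (fun i => f i s) n) (f n)); auto.
Qed.

Lemma geo_lin b c x y : geo b -> geo c -> geo (fun k => x * b k + y * c k).
Proof.
intros (K & HK & H) (L & HL & H'). exists (Rabs x * K + Rabs y * L).
assert (P1 := Rabs_pos x). assert (P2 := Rabs_pos y). split; [nra|]. intros k.
eapply Rle_trans; [apply Rabs_triang|]. rewrite !Rabs_mult. specialize (H k); specialize (H' k). nra.
Qed.

Lemma geo_ex b th : geo b -> exp th < 2 -> ex_series (fun k => b k * exp th ^ k).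
Proof.
intros Hb Hth. assert (E : ex_pseries b (exp th)).
{ apply CV_disk_correct, CV_disk_inside. eapply Rbar_lt_le_trans; [|apply geo_CV; auto]. simpl.
  rewrite Rabs_pos_eq; auto. left; apply exp_pos. }
revert E; apply ex_series_ext; intros k. rewrite pow_n_pow. change scal with Rmult; simpl. eqR; ring.
Qed.

Lemma ser_lin b c x y th : geo b -> geo c -> exp th < 2 ->
  ser (fun k => x * b k + y * c k) th = x * ser b th + y * ser c th.
Proof.
intros Hb Hc Hth. unfold ser, PSeries. rewrite <- !Series_scal_l, <- Series_plus.
- apply Series_ext; intros; ring.
- apply (ex_series_scal_l (V := R_NormedModule)), geo_ex; auto.
- apply (ex_series_scal_l (V := R_NormedModule)), geo_ex; auto.
Qed.

Lemma ser_ext b c th : (forall k, b k = c k) -> ser b th = ser c th.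
Proof. intros H; apply PSeries_ext; auto. Qed.

(* [k + y] acts on the family as [d/dtheta] acts on the series. *)
Lemma XX_deriv (a b : nat -> nat -> R) j th : (forall i, geo (fun k => a k i)) ->
  (forall i, geo (fun k => b k i)) -> (forall k i, lmul (INR k) 1 (a k) i = b k i) -> exp th < 2 ->
  is_derive (XX a j) th (XX b j th).
Proof.
intros Ha Hb E Hth. unfold XX.
set (p := fun l => ser (fun k => a k l) th). set (p' := fun l => ser (fun k => INR k * a k l) th).
set (D := fun i => match i with O => 0 | S i' => expo i' th end).
assert (X : psum (fun i => expo i th * ser (fun k => b k (j - i)%nat) th) (S j) =
  psum (fun i => D i * p (j - i)%nat + expo i th * p' (j - i)%nat) (S j)).
{ transitivity (psum (fun i => expo i th * p' (j - i)%nat + expo i th * match (j - i)%nat with O => 0 | S l => p l end) (S j)).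
  - apply psum_ext; intros i Hi. rewrite <- Rmult_plus_distr_l. f_equal. unfold p, p'.
    destruct (j - i)%nat as [|l].
    + rewrite Rplus_0_r. apply ser_ext; intros k; rewrite <- E; unfold lmul; ring.
    + transitivity (ser (fun k => 1 * (b k (S l) - a k l) + 1 * a k l) th).
      * apply ser_ext; intros; ring.
      * rewrite ser_lin; auto.
        -- rewrite !Rmult_1_l. f_equal. apply ser_ext; intros k; rewrite <- E; unfold lmul; ring.
        -- destruct (geo_lin _ _ 1 (-1) (Hb (S l)) (Ha l)) as (K & HK & H). exists K; split; auto. intros k.
           replace (b k (S l) - a k l) with (1 * b k (S l) + -1 * a k l) by ring. apply H.
  - rewrite !psum_plus, Rplus_comm. f_equal.
    rewrite (psum_S_l (fun i => D i * p (j - i)%nat)). cbn [psum]. rewrite Nat.sub_diag. unfold D at 1.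
    rewrite Rmult_0_l, Rmult_0_r, Rplus_0_l, Rplus_0_r. apply psum_ext; intros i Hi. cbn [D].
    replace (j - i)%nat with (S (j - S i)) by lia. reflexivity. }
rewrite X. apply psum_derive. intros i Hi.
apply (is_derive_mulR (expo i) (ser (fun k => a k (j - i)%nat))); [apply expo_deriv|apply ser_deriv; auto].
Qed.

Lemma geo_fam s j : geo (fun k => fam s k j).
Proof. apply fam_bound. Qed.

Lemma geo_shift b : geo b -> geo (fun k => match k with O => 0 | S k' => b k' end).
Proof.
intros (K & HK & H). exists (2 * K); split; [lra|]. intros [|k]; [rewrite Rabs_R0; simpl; lra|].
specialize (H k). simpl pow. lra.
Qed.

Lemma ser_shift b th : ser (fun k => match k with O => 0 | S k' => b k' end) th = exp th * ser b th.
Proof. unfold ser. rewrite <- PSeries_incr_1. apply PSeries_ext. intros [|k]; reflexivity. Qed.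

Lemma XX_lin a b x y j th : (forall i, geo (fun k => a k i)) -> (forall i, geo (fun k => b k i)) -> exp th < 2 ->
  XX (fun k i => x * a k i + y * b k i) j th = x * XX a j th + y * XX b j th.
Proof.
intros Ha Hb Hth. unfold XX. rewrite <- !psum_scal, <- psum_plus. apply psum_ext; intros i _.
rewrite (ser_lin (fun k => a k (j - i)%nat) (fun k => b k (j - i)%nat)) by auto. ring.
Qed.

(** [fam_recurrence] multiplied by e^((k+y) theta) and summed over k: the shift in k produces a
    factor e^theta, and the exceptional term k = 1 gives the right-hand side. As X_0 is the
    derivative of X_1, this is a linear differential equation for X_1. *)
Lemma XX_identity j th : exp th < 2 ->
  (4 - exp th) * XX (fam 0) j th - 2 * XX (fam 1) j th = exp th * expo j th.
Proof.
intros Hth.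
set (sh := fun k i => match k with O => 0 | S k' => fam 0 k' i end).
assert (Gs : forall i, geo (fun k => sh k i)).
{ intros i. destruct (geo_shift _ (geo_fam 0 i)) as (K & HK & H). exists K; split; [exact HK|exact H]. }
assert (Es : XX sh j th = exp th * XX (fam 0) j th).
{ unfold XX. rewrite <- psum_scal. apply psum_ext; intros i _. unfold sh. rewrite (ser_shift (fun k => fam 0 k (j - i)%nat)). ring. }
set (d := fun k (i : nat) => match k with 1%nat => ps_one i | _ => 0 end).
assert (Ed : XX d j th = exp th * expo j th).
{ unfold XX. cbn [psum]. rewrite Nat.sub_diag.
  assert (S1 : forall c, ser (fun k => match k with 1%nat => c | _ => 0 end) th = exp th * c).
  { intros c. unfold ser. transitivity (PSeries (PS_incr_1 (fun k => match k with O => c | _ => 0 end)) (exp th)).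
    - apply PSeries_ext; intros [|[|k]]; reflexivity.
    - rewrite PSeries_incr_1. f_equal. unfold PSeries. rewrite Series_incr_1.
      + rewrite (Series_ext _ (fun _ => 0 * 0)) by (intros; ring). rewrite Series_scal_l; simpl; ring.
      + apply ex_series_incr_1. apply (ex_series_ext (fun n => 0 * 0 ^ n)); [intros; eqR; simpl; ring|].
        apply (ex_series_scal_l (V := R_NormedModule)), ex_series_geom. rewrite Rabs_R0; lra. }
  unfold d. rewrite (S1 (ps_one 0)).
  rewrite (psum_ext _ (fun _ => 0)); [rewrite psum_const; simpl; ring|].
  intros i Hi. rewrite (S1 (ps_one (j - i))). replace (j - i)%nat with (S (j - i - 1)) by lia. simpl; ring. }
assert (G2 : forall i, geo (fun k => 4 * fam 0 k i + (-2) * fam 1 k i)) by (intros i; apply (geo_lin _ _ 4 (-2)); apply geo_fam).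
rewrite <- Ed. transitivity (XX (fun k i => 1 * (4 * fam 0 k i + (-2) * fam 1 k i) + (-1) * sh k i) j th).
- rewrite (XX_lin (fun k i => 4 * fam 0 k i + (-2) * fam 1 k i) sh) by auto. rewrite (XX_lin (fam 0) (fam 1)) by auto using geo_fam.
  rewrite Es; ring.
- unfold XX; apply psum_ext; intros i _. f_equal. apply ser_ext; intros k. unfold d, sh. rewrite <- fam_recurrence. ring.
Qed.

Definition thf (t : R) : R := 2 * ln (1 - t) - ln (1 + t + t ^ 2).

Lemma quad_pos t : 0 <= t -> 0 < 1 + t + t ^ 2.
Proof. intros; nra. Qed.

Lemma thf_deriv t : 0 <= t < 1 -> is_derive thf t (- 2 * beta t).
Proof.
intros Ht. assert (H := quad_pos t ltac:(lra)). unfold thf, beta.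
replace (1 - t ^ 3) with ((1 - t) * (1 + t + t ^ 2)) by ring.
auto_derive; [split; [lra|split; auto]; nra|]. field. nra.
Qed.

Lemma exp_thf t : 0 <= t < 1 -> exp (thf t) = (1 - t) ^ 2 / (1 + t + t ^ 2).
Proof.
intros Ht. assert (H := quad_pos t ltac:(lra)). unfold thf, Rminus at 1. rewrite exp_plus, exp_Ropp.
replace (2 * ln (1 - t)) with (ln (1 - t) + ln (1 - t)) by ring. rewrite exp_plus, !exp_ln by lra.
unfold Rdiv; ring.
Qed.

Lemma exp_thf_le t : 0 <= t < 1 -> 0 < exp (thf t) <= (1 - t) ^ 2.
Proof.
intros Ht. split; [apply exp_pos|]. rewrite exp_thf by auto. assert (H := quad_pos t ltac:(lra)).
apply (Rmult_le_reg_r (1 + t + t ^ 2)); auto. unfold Rdiv; rewrite Rmult_assoc, Rinv_l by lra.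
assert (0 <= (1 - t) ^ 2) by (apply pow2_ge_0). nra.
Qed.

Lemma exp_thf_lt2 t : 0 <= t < 1 -> exp (thf t) < 2.
Proof. intros Ht. destruct (exp_thf_le t Ht). nra. Qed.

Lemma thf_0 : thf 0 = 0.
Proof. unfold thf. replace (1 - 0) with 1 by ring. replace (1 + 0 + 0 ^ 2) with 1 by ring. rewrite ln_1; ring. Qed.

Lemma cab_repeat_b j t : 0 <= t < 1 -> expo j (thf t) = (-2) ^ j * cab (repeat false j) t.
Proof.
intros Ht. revert t Ht; induction j as [|j IH]; intros t Ht.
- unfold expo; simpl. rewrite cab_nil; field.
- assert (D1 : forall s, 0 <= s < 1 -> is_derive (fun t => expo (S j) (thf t)) s (expo j (thf s) * (- 2 * beta s))).
  { intros s Hs. assert (D := is_derive_comp (expo (S j)) thf s _ _ (expo_deriv (S j) (thf s)) (thf_deriv s Hs)).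
    replace (expo j (thf s) * (- 2 * beta s)) with (scal (- 2 * beta s) (expo j (thf s))); auto.
    change scal with Rmult; simpl; ring. }
  assert (D2 : forall s, 0 <= s < 1 -> is_derive (fun t => (-2) ^ S j * cab (repeat false (S j)) t) s (expo j (thf s) * (- 2 * beta s))).
  { intros s Hs. rewrite IH by auto. replace ((-2) ^ j * cab (repeat false j) s * (-2 * beta s)) with ((-2) ^ S j * (beta s * cab (repeat false j) s)) by (simpl; ring).
    apply (is_derive_scal (cab (repeat false (S j)))). apply (cab_deriv false). rewrite Rabs_pos_eq; lra. }
  apply (derive_eq_open (fun t => expo (S j) (thf t)) (fun t => (-2) ^ S j * cab (repeat false (S j)) t) (fun s => expo j (thf s) * (- 2 * beta s)) 0 t); try lra.
  + intros s Hs; apply D1; lra.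
  + intros s Hs; apply D2; lra.
  + intros s Hs. apply (ex_derive_continuous (fun t => expo (S j) (thf t))); eexists; apply D1; lra.
  + intros s Hs. apply (ex_derive_continuous (fun t => (-2) ^ S j * cab (repeat false (S j)) t)); eexists; apply D2; lra.
  + rewrite thf_0. cbn [repeat]. rewrite cab_0. unfold expo. simpl pow. unfold Rdiv; ring.
Qed.

Definition Xf (s j : nat) (t : R) : R := XX (fam s) j (thf t).

Lemma Xf_deriv s j t : 0 <= t < 1 -> is_derive (Xf (S s) j) t (- 2 * beta t * Xf s j t).
Proof.
intros Ht. assert (D := XX_deriv (fam (S s)) (fam s) j (thf t) (geo_fam (S s)) (geo_fam s) (fam_step s) (exp_thf_lt2 t Ht)).
exact (is_derive_comp (XX (fam (S s)) j) thf t _ _ D (thf_deriv t Ht)).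
Qed.

(** An integrating factor of the equation in [XX_identity]: it turns X_1 into [Qf], whose derivative
    no longer contains X_0 or X_1. Moreover beta = alpha kap, which makes the cancellation in [Xf_V]
    possible. *)
Definition kap (t : R) : R := sqrt 3 / 2 * (1 + t) / (1 - t).
Definition Qf (j : nat) (t : R) : R := 2 * kap t * Xf 1 j t.

Lemma Qf_deriv j t : 0 <= t < 1 -> is_derive (Qf j) t (- alpha t * expo j (thf t)).
Proof.
intros Ht. assert (H := quad_pos t ltac:(lra)). assert (I := XX_identity j (thf t) (exp_thf_lt2 t Ht)).
fold (Xf 0 j t) (Xf 1 j t) in I. rewrite exp_thf in I by auto.
assert (Dk : is_derive (fun t => 2 * kap t) t (2 * sqrt 3 / (1 - t) ^ 2)).
{ unfold kap. auto_derive; [lra|]. field; lra. }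
assert (D := is_derive_mulR _ _ _ _ _ Dk (Xf_deriv 0 j t Ht)).
replace (- alpha t * expo j (thf t)) with (2 * sqrt 3 / (1 - t) ^ 2 * Xf 1 j t + 2 * kap t * (- 2 * beta t * Xf 0 j t)); auto.
unfold alpha, beta, kap. replace (1 - t ^ 3) with ((1 - t) * (1 + t + t ^ 2)) by ring.
set (X0 := Xf 0 j t) in *. set (X1 := Xf 1 j t) in *. set (e := expo j (thf t)) in *.
assert (I2 : e = (1 + t + t ^ 2) / (1 - t) ^ 2 * ((4 - (1 - t) ^ 2 / (1 + t + t ^ 2)) * X0 - 2 * X1)).
{ rewrite I. field. lra. }
rewrite I2. field. lra.
Qed.

Lemma ser_bound b K th : 0 <= K -> (forall k, Rabs (b k) <= K * (/ 2) ^ k) -> b O = 0 -> exp th <= 1 ->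
  Rabs (ser b th) <= K * exp th.
Proof.
intros HK H H0 Hth. assert (P := exp_pos th). unfold ser, PSeries. rewrite Series_incr_1_aux by (rewrite H0; ring).
assert (G : ex_series (fun k => (/ 2) ^ k)) by (apply ex_series_geom; rewrite Rabs_pos_eq; lra).
eapply Rle_trans; [apply (Rabs_Series_le _ (fun k => (K * exp th / 2) * (/ 2) ^ k))|].
- intros k. rewrite Rabs_mult. specialize (H (S k)).
  assert (Q : Rabs (exp th ^ S k) <= exp th).
  { rewrite Rabs_pos_eq by (apply pow_le; lra). simpl. assert (exp th ^ k <= 1) by (rewrite <- (pow1 k); apply pow_incr; lra).
    assert (0 <= exp th ^ k) by (apply pow_le; lra). nra. }
  replace (K * exp th / 2 * (/ 2) ^ k) with (K * (/ 2) ^ S k * exp th) by (simpl; field).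
  apply Rmult_le_compat; auto using Rabs_pos.
- apply (ex_series_scal_l (V := R_NormedModule)); auto.
- rewrite Series_scal_l, Series_geom by (rewrite Rabs_pos_eq; lra). lra.
Qed.

Lemma thf_slow i : slow (fun t => expo i (thf t)).
Proof.
apply (slow_le _ (fun t => (-2) ^ i * cab (repeat false i) t)).
- intros t Ht. rewrite cab_repeat_b by auto; lra.
- apply (slow_mult (fun _ => (-2) ^ i)); [apply slow_const|apply cab_slow].
Qed.

(** e^theta is at most (1-t)^2 and the series has no constant term, so even after division by 1-t it
    is O(1-t). This absorbs the pole of [kap]. *)
Lemma ser_small s j : small (fun t => / (1 - t) * ser (fun k => fam s k j) (thf t)).
Proof.
destruct (geo_fam s j) as (K & HK & H).
exists 1, K; repeat split; try lra. intros t Ht. rewrite Rpower_1 by lra.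
destruct (exp_thf_le t Ht) as [E1 E2].
assert (B := ser_bound _ K (thf t) HK H eq_refl ltac:(nra)).
assert (Ip : 0 < / (1 - t)) by (apply Rinv_0_lt_compat; lra).
rewrite Rabs_mult, (Rabs_pos_eq (/ (1 - t))) by lra.
apply Rle_trans with (/ (1 - t) * (K * (1 - t) ^ 2)).
- apply Rmult_le_compat_l; [lra|]. eapply Rle_trans; [exact B|]. apply Rmult_le_compat_l; auto.
- apply Req_le. field. lra.
Qed.

Lemma small_psum (f : nat -> R -> R) n : (forall i, small (f i)) -> small (fun t => psum (fun i => f i t) n).
Proof. intros H; induction n as [|n IH]; cbn [psum]; [apply small_0|]. apply (small_plus _ (f n)); auto. Qed.

Lemma Xf_small s j : small (fun t => / (1 - t) * Xf s j t).
Proof.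
apply (small_ext _ (fun t => psum (fun i => / (1 - t) * ser (fun k => fam s k (j - i)%nat) (thf t) * expo i (thf t)) (S j))).
- intros t Ht. unfold Xf, XX. rewrite <- psum_scal. apply psum_ext; intros; ring.
- apply (small_psum (fun i t => / (1 - t) * ser (fun k => fam s k (j - i)%nat) (thf t) * expo i (thf t))). intros i.
  apply (small_slow_mult (fun t => / (1 - t) * ser (fun k => fam s k (j - i)%nat) (thf t))); [apply ser_small|apply thf_slow].
Qed.

Lemma slow_id_like f M : (forall t, 0 <= t < 1 -> Rabs (f t) <= M) -> slow f.
Proof.
intros H. apply (slow_le _ (fun _ => M)); [|apply slow_const]. intros t Ht. eapply Rle_trans; [apply H; auto|apply Rle_abs].
Qed.

Lemma Xf_small' s j : small (Xf s j).
Proof.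
apply (small_ext _ (fun t => / (1 - t) * Xf s j t * (1 - t))); [intros; field; lra|].
apply small_slow_mult; [apply Xf_small|]. apply (slow_id_like _ 1). intros t Ht; rewrite Rabs_pos_eq; lra.
Qed.

Lemma Qf_small j : small (Qf j).
Proof.
apply (small_ext _ (fun t => / (1 - t) * Xf 1 j t * (sqrt 3 * (1 + t)))); [intros; unfold Qf, kap; field; lra|].
apply small_slow_mult; [apply Xf_small|]. apply (slow_id_like _ (sqrt 3 * 2)). intros t Ht.
assert (P := sqrt3_pos). rewrite Rabs_pos_eq; nra.
Qed.

(** Repeated integration by parts: the summands are weighted so that the derivative telescopes and
    only a term with X_1 remains, which [Qf] can take over. *)
Definition Tf (m j : nat) (t : R) : R := psum (fun i => 2 ^ i * cab (repeat false i) t * Xf (m + 2 - i) j t) (S m).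

Lemma psum_tele (g : nat -> R) n : psum (fun i => g i - g (S i)) n = g O - g n.
Proof. induction n as [|n IH]; cbn [psum]; [ring|rewrite IH; ring]. Qed.

Lemma Tf_deriv m j t : 0 <= t < 1 -> is_derive (Tf m j) t (- (2 ^ S m * beta t * cab (repeat false m) t * Xf 1 j t)).
Proof.
intros Ht. set (g := fun i => match i with O => 0 | S i' => 2 ^ i * beta t * cab (repeat false i') t * Xf (m + 1 - i') j t end).
replace (- (2 ^ S m * beta t * cab (repeat false m) t * Xf 1 j t)) with (psum (fun i => g i - g (S i)) (S m)).
2:{ rewrite psum_tele. unfold g. replace (m + 1 - m)%nat with 1%nat by lia. ring. }
apply psum_derive. intros i Hi. replace (m + 2 - i)%nat with (S (m + 1 - i)) by lia.
assert (Dc : is_derive (fun s => 2 ^ i * cab (repeat false i) s) t (match i with O => 0 | S i' => 2 ^ i * (beta t * cab (repeat false i') t) end)).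
{ destruct i as [|i].
  - apply (is_derive_ext (fun _ => 1)); [intros; simpl; rewrite cab_nil; ring|]. exact (is_derive_const (V := R_NormedModule) 1 t).
  - apply (is_derive_scal (cab (repeat false (S i)))). apply (cab_deriv false). rewrite Rabs_pos_eq; lra. }
assert (D := is_derive_mulR _ _ _ _ _ Dc (Xf_deriv (m + 1 - i) j t Ht)).
match type of D with is_derive _ _ ?x => replace (g i - g (S i)) with x; auto end.
unfold g. destruct i as [|i].
- simpl pow. ring.
- replace (S (m + 1 - S i)) with (m + 1 - i)%nat by lia. simpl pow. ring.
Qed.

Definition Vwords (m j : nat) : list (list bool) := map (cons true) (shuf (repeat false j) (true :: repeat false m)).

(** The function [M] is constant. The derivative of [Tf] cancels against that of the word a b^m in
    the second term, because beta = alpha kap. The derivative of [Qf] cancels against the shuffle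
    sum, because theta^j/j! is (-2)^j times the integral of b^j. At t = 0 only X_(m+2) is left; as t
    tends to 1, only the V's. *)
Theorem Xf_V m j : Xf (m + 2) j 0 = (-1) ^ j * 2 ^ (m + j) * lsum V (Vwords m j).
Proof.
set (c := (-1) ^ j * 2 ^ (m + j)).
set (M := fun t => Tf m j t + 2 ^ m * (cab (true :: repeat false m) t * Qf j t) + c * lsum (fun w => cab w t) (Vwords m j)).
assert (Ec : c = 2 ^ m * (-2) ^ j).
{ unfold c. replace (-2) with (-1 * 2) by ring. rewrite Rpow_mult_distr, pow_add. ring. }
assert (D : forall t, 0 <= t < 1 -> is_derive M t 0).
{ intros t Ht. assert (D1 := Tf_deriv m j t Ht).
  assert (D2 := is_derive_mulR _ _ _ _ _ (cab_deriv true (repeat false m) t ltac:(rewrite Rabs_pos_eq; lra)) (Qf_deriv j t Ht)).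
  assert (D3 : is_derive (fun t => lsum (fun w => cab w t) (Vwords m j)) t (alpha t * (cab (repeat false j) t * cab (true :: repeat false m) t))).
  { rewrite cab_shuffle by auto. rewrite <- lsum_scal. unfold Vwords.
    apply (is_derive_ext (fun t => lsum (fun w => cab (true :: w) t) (shuf (repeat false j) (true :: repeat false m)))); [intros; rewrite lsum_map; auto|].
    apply (lsum_derive (fun w => cab (true :: w))). intros w _. apply (cab_deriv true). rewrite Rabs_pos_eq; lra. }
  assert (D4 := is_derive_plus _ _ _ _ _ (is_derive_plus _ _ _ _ _ D1 (is_derive_scal _ _ (2 ^ m) _ D2)) (is_derive_scal _ _ c _ D3)).
  revert D4. match goal with |- is_derive _ _ ?x -> _ => replace x with 0; auto end.
  change plus with Rplus. cbn beta. simpl abform.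
  rewrite cab_repeat_b by auto. rewrite Ec.
  assert (Hab : beta t = alpha t * kap t).
  { assert (H := quad_pos t ltac:(lra)). unfold alpha, beta, kap. replace (1 - t ^ 3) with ((1 - t) * (1 + t + t ^ 2)) by ring.
    transitivity ((sqrt 3 * sqrt 3) / 2 * (1 + t) / ((1 - t) * (1 + t + t ^ 2))); [rewrite sqrt3_sqr|]; field; lra. }
  rewrite Hab. unfold Qf. cbn. ring. }
assert (Cst : forall t, 0 <= t < 1 -> M t = M 0).
{ intros t Ht. destruct (Req_dec t 0) as [->|Hn]; auto. symmetry. apply (eq_is_derive M 0 t); [|lra]. intros s Hs; apply D; lra. }
assert (M0 : M 0 = Xf (m + 2) j 0).
{ unfold M. rewrite cab_0. unfold Tf. rewrite psum_S_l. rewrite (psum_ext _ (fun _ => 0)).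
  - rewrite psum_const. cbn [repeat]. rewrite cab_nil. rewrite Nat.sub_0_r.
    unfold Vwords. rewrite lsum_map. rewrite (lsum_ext _ (fun _ => 0 * 0)) by (intros; rewrite cab_0; ring). rewrite lsum_scal. simpl; ring.
  - intros i _. cbn [repeat]. rewrite cab_0; ring. }
rewrite <- M0. apply Rminus_diag_uniq. apply small_const_0.
apply (small_ext _ (fun t => (Tf m j t + 2 ^ m * (Qf j t * cab (true :: repeat false m) t)) + c * lsum (fun w => cab w t - V w) (Vwords m j))).
- intros t Ht. rewrite <- (Cst t Ht). rewrite lsum_minus. unfold M. ring.
- apply small_plus; [apply small_plus|].
  + apply (small_psum (fun i t => 2 ^ i * cab (repeat false i) t * Xf (m + 2 - i) j t)). intros i.
    apply (small_ext _ (fun t => Xf (m + 2 - i) j t * (2 ^ i * cab (repeat false i) t))); [intros; ring|].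
    apply small_slow_mult; [apply Xf_small'|]. apply (slow_mult (fun _ => 2 ^ i)); [apply slow_const|apply cab_slow].
  + apply (small_scal _ (fun t => Qf j t * _)). apply small_slow_mult; [apply Qf_small|apply cab_slow].
  + apply (small_scal c (fun t => lsum _ (Vwords m j))). apply (small_lsum (fun w t => cab w t - V w)).
    intros w Hw. apply V_small. unfold Vwords in Hw. apply in_map_iff in Hw. destruct Hw as (w' & <- & _). reflexivity.
Qed.

Lemma Xf_0 s j : Xf s j 0 = Series (fun k => fam s k j).
Proof.
unfold Xf. rewrite thf_0. unfold XX. rewrite psum_S_l. rewrite (psum_ext _ (fun _ => 0)).
- rewrite psum_const, Nat.sub_0_r. unfold expo, ser, PSeries. rewrite exp_0.
  rewrite (Series_ext _ (fun k => fam s k j)) by (intros; rewrite pow1; ring). simpl; field.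
- intros i _. unfold expo. simpl pow. unfold Rdiv; ring.
Qed.

Theorem fam_series m j : is_series (fun k => fam (m + 2) k j) ((-1) ^ j * 2 ^ (m + j) * lsum V (Vwords m j)).
Proof.
rewrite <- Xf_V, Xf_0. apply Series_correct.
assert (E := geo_ex _ 0 (geo_fam (m + 2) j) ltac:(rewrite exp_0; lra)). revert E; apply ex_series_ext; intros k.
rewrite exp_0, pow1; eqR; ring.
Qed.

(** * Euler's integral *)

Definition gint (x t : R) : R := Rpower t (x - 1) * exp (- t).

Lemma gint_pos x t : 0 < gint x t.
Proof. unfold gint. apply Rmult_lt_0_compat; apply exp_pos. Qed.

Lemma gint_continuous x t : 0 < t -> continuous (gint x) t.
Proof.
intros Ht. apply (ex_derive_continuous (gint x)). unfold gint, Rpower. auto_derive; auto.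
Qed.

Lemma gint_ex_RInt x a b : 0 < a <= b -> ex_RInt (gint x) a b.
Proof.
intros H. apply (ex_RInt_continuous (V := R_CompleteNormedModule)). rewrite Rmin_left, Rmax_right by lra.
intros z Hz; apply gint_continuous; lra.
Qed.

(** With u = t/(2p) the inequality ln u <= u gives t^p <= (2p)^p e^(t/2). *)
Lemma pow_exp_bound p t : 0 < p -> 0 < t -> Rpower t p * exp (- t) <= Rpower (2 * p) p * exp (- t / 2).
Proof.
intros Hp Ht. unfold Rpower. rewrite <- !exp_plus.
assert (L : p * ln t + - t <= p * ln (2 * p) + - t / 2).
{ assert (E : ln t = ln (2 * p) + ln (t / (2 * p))).
  { rewrite <- ln_mult; [f_equal; field; lra|lra|apply Rdiv_lt_0_compat; lra]. }
  assert (Hu : 0 < t / (2 * p)) by (apply Rdiv_lt_0_compat; lra).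
  assert (L0 := exp_ineq1_le (ln (t / (2 * p)))). rewrite exp_ln in L0 by auto.
  assert (ln (t / (2 * p)) <= t / (2 * p)) by lra.
  assert (p * ln (t / (2 * p)) <= p * (t / (2 * p))) by (apply Rmult_le_compat_l; lra).
  replace (p * (t / (2 * p))) with (t / 2) in H0 by (field; lra). rewrite E. lra. }
destruct L as [L|L]; [left; apply exp_increasing; auto|rewrite L; lra].
Qed.

Lemma gint_bound x a b : 1 < x -> 0 < a <= b ->
  RInt (gint x) a b <= 2 * Rpower (2 * (x - 1)) (x - 1).
Proof.
intros Hx H. set (p := x - 1). assert (Hp : 0 < p) by (unfold p; lra). set (C := Rpower (2 * p) p).
assert (HC : 0 < C) by apply exp_pos.
assert (D : forall t, is_derive (fun t => - 2 * C * exp (- t / 2)) t (C * exp (- t / 2))).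
{ intros t. auto_derive; auto. change (exp (- t * / 2)) with (exp (- t / 2)). lra. }
assert (I : is_RInt (fun t => C * exp (- t / 2)) a b (- 2 * C * exp (- b / 2) - - 2 * C * exp (- a / 2))).
{ apply (is_RInt_derive (fun t => - 2 * C * exp (- t / 2)) (fun t => C * exp (- t / 2))).
  - intros t _; apply D.
  - intros t _. apply (ex_derive_continuous (fun t => C * exp (- t / 2))). auto_derive; auto. }
apply Rle_trans with (- 2 * C * exp (- b / 2) - - 2 * C * exp (- a / 2)).
- rewrite <- (is_RInt_unique _ _ _ _ I). apply RInt_le; try lra.
  + apply gint_ex_RInt; auto.
  + eexists; exact I.
  + intros t Ht. apply pow_exp_bound; lra.
- assert (exp (- a / 2) <= 1).
  { rewrite <- exp_0. destruct (Req_dec a 0); [lra|]. left; apply exp_increasing; lra. }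
  assert (0 < exp (- b / 2)) by apply exp_pos. nra.
Qed.

Notation GF := (filter_prod (at_right 0) (Rbar_locally p_infty)).

Lemma GF_eventually P a0 b0 : 0 < a0 -> (forall a b, 0 < a <= a0 -> b0 <= b -> P (a, b)) -> GF P.
Proof.
intros Ha H. apply (Filter_prod _ _ _ (fun a => 0 < a <= a0) (fun b => b0 <= b)).
- exists (mkposreal _ Ha). intros y By Hy. change (Rabs (y - 0) < a0) in By. rewrite Rminus_0_r in By.
  apply Rabs_def2 in By; lra.
- exists b0; intros; lra.
- intros a b H1 H2; apply H; auto.
Qed.

Lemma RInt_gint_mono x a b a' b' : 0 < a' <= a -> a <= b <= b' -> RInt (gint x) a b <= RInt (gint x) a' b'.
Proof.
intros H1 H2.
assert (C1 := RInt_Chasles (V := R_CompleteNormedModule) (gint x) a' a b' (gint_ex_RInt x a' a ltac:(lra)) (gint_ex_RInt x a b' ltac:(lra))).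
assert (C2 := RInt_Chasles (V := R_CompleteNormedModule) (gint x) a b b' (gint_ex_RInt x a b ltac:(lra)) (gint_ex_RInt x b b' ltac:(lra))).
change plus with Rplus in C1, C2.
assert (P1 : 0 <= RInt (gint x) a' a) by (apply RInt_ge_0; [lra|apply gint_ex_RInt; lra|intros; left; apply gint_pos]).
assert (P2 : 0 <= RInt (gint x) b b') by (apply RInt_ge_0; [lra|apply gint_ex_RInt; lra|intros; left; apply gint_pos]).
lra.
Qed.

(** The integrand is positive, so the improper integral is the supremum of the integrals over
    compact intervals. The last two clauses express this and reduce later estimates to compact
    intervals. *)
Lemma Gamma_correct x : 1 < x -> is_RInt_gen (gint x) (at_right 0) (Rbar_locally p_infty) (Gamma x) /\
  (forall a b, 0 < a <= b -> RInt (gint x) a b <= Gamma x) /\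
  (forall B, (forall a b, 0 < a <= b -> RInt (gint x) a b <= B) -> Gamma x <= B).
Proof.
intros Hx.
set (E := fun y => exists a b, 0 < a <= b /\ y = RInt (gint x) a b).
destruct (completeness E) as (S & HS1 & HS2).
- exists (2 * Rpower (2 * (x - 1)) (x - 1)). intros y (a & b & H & ->). apply gint_bound; auto.
- exists (RInt (gint x) 1 1), 1, 1; split; [lra|auto].
- assert (I : is_RInt_gen (gint x) (at_right 0) (Rbar_locally p_infty) S).
  { intros P (eps & HP).
    assert (Hn : exists a b, 0 < a <= b /\ S - eps < RInt (gint x) a b).
    { apply Classical_Prop.NNPP; intros C. assert (S <= S - eps); [|generalize (cond_pos eps); lra].
      apply HS2. intros y (a & b & H & ->). apply Rnot_lt_le; intros C'. apply C; exists a, b; auto. }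
    destruct Hn as (a0 & b0 & H0 & H1).
    apply (GF_eventually _ a0 b0); [lra|]. intros a b Ha Hb. exists (RInt (gint x) a b). split.
    - apply (RInt_correct (V := R_CompleteNormedModule)). apply gint_ex_RInt; lra.
    - apply HP. change (Rabs (RInt (gint x) a b - S) < eps).
      assert (RInt (gint x) a0 b0 <= RInt (gint x) a b) by (apply RInt_gint_mono; lra).
      assert (RInt (gint x) a b <= S) by (apply HS1; exists a, b; split; [lra|auto]).
      apply Rabs_def1; generalize (cond_pos eps); lra. }
  assert (EG : Gamma x = S) by exact (is_RInt_gen_unique (V := R_CompleteNormedModule) (gint x) S I).
  rewrite EG. split; [exact I|split].
  + intros a b H; apply HS1; exists a, b; auto.
  + intros B HB. apply HS2. intros y (a & b & H & ->). auto.
Qed.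

Lemma Gamma_pos x : 1 < x -> 0 < Gamma x.
Proof.
intros Hx. destruct (Gamma_correct x Hx) as (_ & H & _). eapply Rlt_le_trans; [|apply (H 1 2); lra].
apply RInt_gt_0; [lra| |].
- intros; apply gint_pos.
- intros t Ht; apply gint_continuous; lra.
Qed.

Lemma Gamma_rec x : 1 < x -> Gamma (x + 1) = x * Gamma x.
Proof.
intros Hx. destruct (Gamma_correct x Hx) as (I1 & _). destruct (Gamma_correct (x + 1) ltac:(lra)) as (I2 & _).
set (h := fun t => Rpower t x * exp (- t)).
assert (D : forall t, 0 < t -> is_derive h t (x * gint x t - gint (x + 1) t)).
{ intros t Ht. unfold h, gint. replace (x + 1 - 1) with x by ring.
  replace (Rpower t (x - 1)) with (Rpower t x / t).
  - unfold Rpower. auto_derive; auto. field; lra.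
  - unfold Rminus. rewrite Rpower_plus, Rpower_Ropp, Rpower_1; auto. }
assert (I3 : is_RInt_gen (fun t => plus (scal x (gint x t)) (opp (gint (x + 1) t))) (at_right 0) (Rbar_locally p_infty) (plus (scal x (Gamma x)) (opp (Gamma (x + 1))))).
{ apply (is_RInt_gen_plus (V := R_NormedModule)); [apply (is_RInt_gen_scal (V := R_NormedModule))|apply (is_RInt_gen_opp (V := R_NormedModule))]; auto. }
assert (I4 : is_RInt_gen (fun t => plus (scal x (gint x t)) (opp (gint (x + 1) t))) (at_right 0) (Rbar_locally p_infty) 0).
{ intros P (eps & HP).
  set (C := Rpower (2 * x) x). assert (HC : 0 < C) by apply exp_pos.
  assert (He := cond_pos eps).
  set (a0 := Rmin 1 (Rpower (eps / 3) (/ x))).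
  assert (Ha0 : 0 < a0) by (apply Rmin_pos; [lra|apply exp_pos]).
  set (b0 := Rmax 1 (2 * ln (3 * C / eps))).
  apply (GF_eventually _ a0 b0); auto. intros a b Ha Hb.
  assert (M1 := Rmin_l 1 (Rpower (eps / 3) (/ x))). assert (M2 := Rmin_r 1 (Rpower (eps / 3) (/ x))).
  assert (M3 := Rmax_l 1 (2 * ln (3 * C / eps))). assert (M4 := Rmax_r 1 (2 * ln (3 * C / eps))). fold a0 in M1, M2. fold b0 in M3, M4.
  exists (minus (h b) (h a)). split.
  - apply (is_RInt_derive h).
    + rewrite Rmin_left, Rmax_right by lra. intros t Ht. apply D; lra.
    + rewrite Rmin_left, Rmax_right by lra. intros t Ht.
      apply (continuous_plus (fun t => scal x (gint x t)) (fun t => opp (gint (x + 1) t))).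
      * apply (continuous_scal_r x (gint x)). apply gint_continuous; lra.
      * apply (continuous_opp (gint (x + 1))). apply gint_continuous; lra.
  - apply HP. change (Rabs (h b - h a - 0) < eps). rewrite Rminus_0_r.
    assert (Ba : 0 < h a <= eps / 3).
    { unfold h. split; [apply Rmult_lt_0_compat; apply exp_pos|].
      assert (Rpower a x <= eps / 3).
      { replace (eps / 3) with (Rpower (Rpower (eps / 3) (/ x)) x).
        - apply Rle_Rpower_l; lra.
        - rewrite Rpower_mult, Rinv_l by lra. apply Rpower_1; lra. }
      assert (exp (- a) <= 1). { rewrite <- exp_0. left; apply exp_increasing; lra. }
      assert (0 < exp (- a)) by apply exp_pos. assert (0 < Rpower a x) by apply exp_pos. nra. }
    assert (Bb : 0 < h b <= eps / 3).
    { unfold h. split; [apply Rmult_lt_0_compat; apply exp_pos|].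
      eapply Rle_trans; [apply pow_exp_bound; lra|]. fold C.
      assert (exp (- b / 2) <= eps / (3 * C)).
      { replace (eps / (3 * C)) with (exp (- ln (3 * C / eps))).
        - destruct (Rle_lt_or_eq_dec (- b / 2) (- ln (3 * C / eps)) ltac:(lra)) as [L|L]; [left; apply exp_increasing; auto|rewrite L; lra].
        - rewrite exp_Ropp, exp_ln by (apply Rdiv_lt_0_compat; lra). field; lra. }
      apply Rle_trans with (C * (eps / (3 * C))); [apply Rmult_le_compat_l; lra|]. apply Req_le; field; lra. }
    apply Rabs_def1; lra. }
assert (U1 := is_RInt_gen_unique (V := R_CompleteNormedModule) _ _ I3). assert (U2 := is_RInt_gen_unique (V := R_CompleteNormedModule) _ _ I4).
rewrite U1 in U2. change (x * Gamma x + - Gamma (x + 1) = 0) in U2. lra.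
Qed.

Lemma exp_convex x l : 0 <= x <= 1 -> exp (x * l) <= 1 - x + x * exp l.
Proof.
intros Hx. assert (H1 := exp_ineq1_le (- (x * l))). assert (H2 := exp_ineq1_le ((1 - x) * l)).
assert (P := exp_pos (x * l)).
assert (E1 : 1 = exp (x * l) * exp (- (x * l))) by (rewrite <- exp_plus, Rplus_opp_r, exp_0; auto).
assert (E2 : exp l = exp (x * l) * exp ((1 - x) * l)) by (rewrite <- exp_plus; f_equal; ring).
rewrite E2.
assert (A1 : exp (x * l) * (1 + - (x * l)) <= 1) by (rewrite E1 at 2; apply Rmult_le_compat_l; lra).
assert (A2 : exp (x * l) * (1 + (1 - x) * l) <= exp (x * l) * exp ((1 - x) * l)) by (apply Rmult_le_compat_l; lra).
nra.
Qed.

(** By convexity (t/N)^x <= 1 - x + x t/N. Integrated against the integrand of Gamma(N), with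
    Gamma(N+1) = N Gamma(N), the right-hand side becomes Gamma(N). *)
Lemma Gamma_upper N x : 1 < N -> 0 <= x <= 1 -> Gamma (N + x) <= Rpower N x * Gamma N.
Proof.
intros HN Hx. destruct (Gamma_correct (N + x) ltac:(lra)) as (_ & _ & H). apply H. intros a b Hab.
destruct (Gamma_correct N HN) as (_ & G1 & _). destruct (Gamma_correct (N + 1) ltac:(lra)) as (_ & G2 & _).
assert (P := Gamma_pos N HN). assert (Q : 0 < Rpower N x) by apply exp_pos.
apply Rle_trans with (RInt (fun t => plus (scal (Rpower N x * (1 - x)) (gint N t)) (scal (Rpower N x * (x / N)) (gint (N + 1) t))) a b).
- apply RInt_le; [lra|apply gint_ex_RInt; lra| |].
  + apply (ex_RInt_plus (V := R_NormedModule)); apply (ex_RInt_scal (V := R_NormedModule)); apply gint_ex_RInt; auto.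
  + intros t Ht. change (gint (N + x) t <= Rpower N x * (1 - x) * gint N t + Rpower N x * (x / N) * gint (N + 1) t).
    unfold gint. assert (Et : Rpower t (N + 1 - 1) = Rpower t (N - 1) * t).
    { replace (N + 1 - 1) with ((N - 1) + 1) by ring. rewrite Rpower_plus, Rpower_1; auto; lra. }
    assert (Ex : Rpower t (N + x - 1) = Rpower t (N - 1) * Rpower t x) by (rewrite <- Rpower_plus; f_equal; ring).
    rewrite Et, Ex.
    assert (Hu : Rpower t x <= Rpower N x * (1 - x + x * (t / N))).
    { assert (E := exp_convex x (ln (t / N)) Hx). rewrite exp_ln in E by (apply Rdiv_lt_0_compat; lra).
      replace (Rpower t x) with (Rpower N x * exp (x * ln (t / N))).
      - apply Rmult_le_compat_l; lra.
      - unfold Rpower. rewrite <- exp_plus. f_equal. unfold Rdiv. rewrite ln_mult, ln_Rinv by (try apply Rinv_0_lt_compat; lra). ring. }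
    assert (0 < Rpower t (N - 1) * exp (- t)) by (apply Rmult_lt_0_compat; apply exp_pos).
    replace (Rpower t (N - 1) * Rpower t x * exp (- t)) with (Rpower t (N - 1) * exp (- t) * Rpower t x) by ring.
    replace (Rpower N x * (1 - x) * (Rpower t (N - 1) * exp (- t)) + Rpower N x * (x / N) * (Rpower t (N - 1) * t * exp (- t))) with
      (Rpower t (N - 1) * exp (- t) * (Rpower N x * (1 - x + x * (t / N)))) by (field; lra).
    apply Rmult_le_compat_l; lra.
- rewrite (RInt_plus (V := R_CompleteNormedModule)) by (apply (ex_RInt_scal (V := R_NormedModule)); apply gint_ex_RInt; auto).
  rewrite !(RInt_scal (V := R_CompleteNormedModule)) by (apply gint_ex_RInt; auto).
  change (Rpower N x * (1 - x) * RInt (gint N) a b + Rpower N x * (x / N) * RInt (gint (N + 1)) a b <= Rpower N x * Gamma N).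
  specialize (G1 a b Hab). specialize (G2 a b Hab). rewrite Gamma_rec in G2 by lra.
  assert (0 <= Rpower N x * (1 - x)) by (apply Rmult_le_pos; lra).
  assert (0 <= Rpower N x * (x / N)) by (apply Rmult_le_pos; [lra|apply Rdiv_le_0_compat; lra]).
  apply Rle_trans with (Rpower N x * (1 - x) * Gamma N + Rpower N x * (x / N) * (N * Gamma N)).
  + apply Rplus_le_compat; apply Rmult_le_compat_l; lra.
  + apply Req_le; field; lra.
Qed.

(** [Gamma_upper] at N+x with exponent 1-x bounds Gamma(N+1) = N Gamma(N) by a multiple of
    Gamma(N+x). *)
Lemma Gamma_lower N x : 1 < N -> 0 <= x <= 1 -> Rpower (N / (N + x)) (1 - x) * (Rpower N x * Gamma N) <= Gamma (N + x).
Proof.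
intros HN Hx. assert (H := Gamma_upper (N + x) (1 - x) ltac:(lra) ltac:(lra)).
replace (N + x + (1 - x)) with (N + 1) in H by ring. rewrite Gamma_rec in H by lra.
unfold Rdiv. rewrite <- Rpower_mult_distr by (try apply Rinv_0_lt_compat; lra).
assert (E : Rpower (/ (N + x)) (1 - x) = / Rpower (N + x) (1 - x)).
{ unfold Rpower. rewrite ln_Rinv by lra. rewrite <- exp_Ropp. f_equal; ring. }
rewrite E. assert (P : 0 < Rpower (N + x) (1 - x)) by apply exp_pos.
assert (E2 : Rpower N (1 - x) * Rpower N x = N).
{ rewrite <- Rpower_plus. replace (1 - x + x) with 1 by ring. apply Rpower_1; lra. }
apply (Rmult_le_reg_l (Rpower (N + x) (1 - x))); auto.
replace (Rpower (N + x) (1 - x) * (Rpower N (1 - x) * / Rpower (N + x) (1 - x) * (Rpower N x * Gamma N))) with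
  ((Rpower N (1 - x) * Rpower N x) * Gamma N) by (field; lra).
rewrite E2; auto.
Qed.

Lemma Gamma_2 : Gamma 2 = 1.
Proof.
destruct (Gamma_correct 2 ltac:(lra)) as (_ & H1 & H2).
assert (I : forall a b, 0 < a <= b -> RInt (gint 2) a b = (a + 1) * exp (- a) - (b + 1) * exp (- b)).
{ intros a b Hab. apply is_RInt_unique.
  replace ((a + 1) * exp (- a) - (b + 1) * exp (- b)) with (minus (- (b + 1) * exp (- b)) (- (a + 1) * exp (- a)))
    by (unfold minus, plus, opp; simpl; ring).
  apply (is_RInt_derive (fun t => - (t + 1) * exp (- t)) (gint 2)).
  - rewrite Rmin_left, Rmax_right by lra. intros t Ht. unfold gint. replace (2 - 1) with 1 by ring. rewrite Rpower_1 by lra.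
    auto_derive; auto; ring.
  - rewrite Rmin_left, Rmax_right by lra. intros t Ht. apply gint_continuous; lra. }
assert (E : forall t, 0 < t -> (t + 1) * exp (- t) <= 1).
{ intros t Ht. assert (E := exp_ineq1_le t). assert (P := exp_pos (- t)).
  assert (Q : exp t * exp (- t) = 1) by (rewrite <- exp_plus, Rplus_opp_r, exp_0; auto). nra. }
apply Rle_antisym.
- apply H2. intros a b Hab. rewrite I by auto. assert (P := exp_pos (- b)). specialize (E a ltac:(lra)). nra.
- apply le_epsilon. intros eps He.
  set (a := Rmin (/ 2) (eps / 4)). set (b := Rmax 1 (8 / eps)).
  assert (Ha : 0 < a) by (apply Rmin_pos; lra).
  assert (A1 := Rmin_l (/ 2) (eps / 4)). assert (A2 := Rmin_r (/ 2) (eps / 4)).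
  assert (B1 := Rmax_l 1 (8 / eps)). assert (B2 := Rmax_r 1 (8 / eps)). fold a in A1, A2. fold b in B1, B2.
  specialize (H1 a b ltac:(lra)). rewrite I in H1 by lra.
  assert (L1 : 1 - a * a <= (a + 1) * exp (- a)).
  { assert (X := exp_ineq1_le (- a)). nra. }
  assert (L2 : (b + 1) * exp (- b) <= eps / 2).
  { assert (X := exp_ineq1_le (b / 2)).
    assert (Q : exp (b / 2) * exp (b / 2) * exp (- b) = 1).
    { rewrite <- !exp_plus. replace (b / 2 + b / 2 + - b) with 0 by field. apply exp_0. }
    assert (P := exp_pos (- b)).
    assert (Z : (b + 1) * (b + 1) / 4 * exp (- b) <= 1) by nra.
    assert (W : 8 <= eps * b). { apply (Rmult_le_compat_l eps) in B2; [|lra]. replace (eps * (8 / eps)) with 8 in B2 by (field; lra). lra. }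
    apply (Rmult_le_reg_l ((b + 1) / 4)); [lra|].
    apply Rle_trans with 1; [lra|]. nra. }
  nra.
Qed.

(** * The product formula for the central binomial coefficient *)

Fixpoint pr (n : nat) (z : R) : R := match n with O => 1 | S n' => pr n' z * (INR n' + 1 + z) end.

Lemma pr_pos n z : -1 < z -> 0 < pr n z.
Proof. intros Hz; induction n as [|n IH]; simpl; [lra|]. apply Rmult_lt_0_compat; auto. generalize (pos_INR n); lra. Qed.

(** Gamma(1+z) for z > -1, expressed through an argument above 1, the range in which [Gamma_rec] is
    available. *)
Definition Gam1 (z : R) : R := Gamma (2 + z) / (1 + z).

Lemma Gamma_pr n z : -1 < z -> Gamma (INR n + 2 + z) = pr (S n) z * Gam1 z.
Proof.
intros Hz. induction n as [|n IH].
- simpl. unfold Gam1. replace (0 + 2 + z) with (2 + z) by ring. field; lra.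
- assert (Hn := pos_INR n). rewrite S_INR. replace (INR n + 1 + 2 + z) with ((INR n + 2 + z) + 1) by ring.
  rewrite Gamma_rec by lra. rewrite IH. cbn [pr]. rewrite S_INR. ring.
Qed.

Lemma Gam1_pos z : -1 < z -> 0 < Gam1 z.
Proof. intros Hz. apply Rdiv_lt_0_compat; [apply Gamma_pos|]; lra. Qed.

Lemma Gam1_0 : Gam1 0 = 1.
Proof. unfold Gam1. rewrite Rplus_0_r, Gamma_2. field. Qed.

Definition Gq (y : R) : R := Gam1 y ^ 2 / Gam1 (2 * y).

Lemma summand_pr s k y : (1 <= k)%nat -> - / 4 < y < / 4 ->
  summand s (INR k + y) = / (INR k + y) ^ s * (Gq y * (pr k y ^ 2 / pr (2 * k) (2 * y))).
Proof.
intros Hk Hy. assert (Hk' := le_INR _ _ Hk). simpl in Hk'.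
unfold summand, central_binom.
destruct k as [|k]; [lia|].
replace (INR (S k) + y + 1) with (INR k + 2 + y) by (rewrite S_INR; ring).
replace (2 * (INR (S k) + y) + 1) with (INR (2 * k + 1) + 2 + 2 * y) by (rewrite plus_INR, mult_INR, !S_INR; simpl INR; ring).
rewrite !Gamma_pr by lra. replace (S (2 * k + 1)) with (2 * S k)%nat by lia.
unfold Gq. assert (P1 := Gam1_pos y ltac:(lra)). assert (P2 := Gam1_pos (2 * y) ltac:(lra)).
assert (P3 := pr_pos (S k) y ltac:(lra)). assert (P4 := pr_pos (2 * S k) (2 * y) ltac:(lra)).
field. repeat split; try lra. apply pow_nonzero; lra.
Qed.

Lemma ratio_lim z : 0 <= z -> is_lim_seq (fun n => (INR n + 2) / (INR n + 2 + z)) 1.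
Proof.
intros Hz. apply (is_lim_seq_ext (fun n => 1 - z * / (INR n + (2 + z)))).
- intros n. generalize (pos_INR n); intros. field; lra.
- replace (Finite 1) with (Finite (1 - z * 0)) by (f_equal; ring).
  apply is_lim_seq_minus'; [apply is_lim_seq_const|]. apply (is_lim_seq_scal_l _ z 0).
  apply (is_lim_seq_inv _ p_infty); [|discriminate].
  apply (is_lim_seq_plus _ _ p_infty (2 + z)); [apply is_lim_seq_INR|apply is_lim_seq_const|reflexivity].
Qed.

Lemma Gamma_ratio z : 0 <= z <= 1 ->
  is_lim_seq (fun n => Gamma (INR n + 2 + z) / (Rpower (INR n + 2) z * Gamma (INR n + 2))) 1.
Proof.
intros Hz. apply (is_lim_seq_le_le (fun n => (INR n + 2) / (INR n + 2 + z)) _ (fun _ => 1)).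
- intros n. assert (Hn := pos_INR n). set (N := INR n + 2). assert (HN : 2 <= N) by (unfold N; lra).
  assert (U := Gamma_upper N z ltac:(lra) Hz). assert (L := Gamma_lower N z ltac:(lra) Hz).
  assert (P : 0 < Rpower N z * Gamma N) by (apply Rmult_lt_0_compat; [apply exp_pos|apply Gamma_pos; lra]).
  split.
  + apply (Rmult_le_reg_r (Rpower N z * Gamma N)); auto.
    replace (Gamma (N + z) / (Rpower N z * Gamma N) * (Rpower N z * Gamma N)) with (Gamma (N + z)).
    * eapply Rle_trans; [|apply L]. apply Rmult_le_compat_r; [lra|].
      assert (Hu : 0 < N / (N + z) <= 1).
      { split; [apply Rdiv_lt_0_compat; lra|]. apply (Rmult_le_reg_r (N + z)); [lra|]. unfold Rdiv. rewrite Rmult_assoc, Rinv_l by lra. lra. }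
      rewrite <- (Rpower_1 (N / (N + z))) at 1 by lra. unfold Rpower.
      assert (Hl : ln (N / (N + z)) <= 0) by (rewrite <- ln_1; apply ln_le; lra).
      destruct (Rle_lt_or_eq_dec (1 * ln (N / (N + z))) ((1 - z) * ln (N / (N + z))) ltac:(nra)) as [Q|Q];
        [left; apply exp_increasing; auto|rewrite Q; lra].
    * field. split; [apply Rgt_not_eq, Gamma_pos; lra|apply Rgt_not_eq, exp_pos].
  + apply (Rmult_le_reg_r (Rpower N z * Gamma N)); auto. rewrite Rmult_1_l.
    replace (Gamma (N + z) / (Rpower N z * Gamma N) * (Rpower N z * Gamma N)) with (Gamma (N + z)); auto.
    field. split; [apply Rgt_not_eq, Gamma_pos; lra|apply Rgt_not_eq, exp_pos].
- apply ratio_lim; lra.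
- apply is_lim_seq_const.
Qed.

Lemma Gq_lim y : - / 4 < y < / 4 ->
  is_lim_seq (fun n => pr (S n) y ^ 2 / (pr (S n) (2 * y) * pr (S n) 0)) (/ Gq y).
Proof.
intros Hy.
assert (F : is_lim_seq (fun n => Gamma (INR n + 2 + y) ^ 2 / (Gamma (INR n + 2 + 2 * y) * Gamma (INR n + 2 + 0))) 1).
(* [Gamma_ratio] covers shifts in [0,1]. For negative y all arguments are moved up by 1; the powers
   of N cancel in the quotient in either case. *)
{ destruct (Rle_dec 0 y) as [H|H].
  - assert (L := is_lim_seq_div' _ _ _ _ (is_lim_seq_mult' _ _ _ _ (Gamma_ratio y ltac:(lra)) (Gamma_ratio y ltac:(lra))) (Gamma_ratio (2 * y) ltac:(lra)) ltac:(lra)).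
    replace (1 * 1 / 1) with 1 in L by field. revert L; apply is_lim_seq_ext; intros n.
    assert (Hn := pos_INR n). rewrite Rplus_0_r. set (N := INR n + 2). assert (HN : 2 <= N) by (unfold N; lra).
    replace (Rpower N (2 * y)) with (Rpower N y * Rpower N y) by (rewrite <- Rpower_plus; f_equal; ring).
    field. repeat split; apply Rgt_not_eq; try apply exp_pos; apply Gamma_pos; lra.
  - assert (L := is_lim_seq_div' _ _ _ _ (is_lim_seq_mult' _ _ _ _ (Gamma_ratio (1 + y) ltac:(lra)) (Gamma_ratio (1 + y) ltac:(lra))) (Gamma_ratio (1 + 2 * y) ltac:(lra)) ltac:(lra)).
    replace (1 * 1 / 1) with 1 in L by field. apply is_lim_seq_incr_1. revert L; apply is_lim_seq_ext; intros n.
    assert (Hn := pos_INR n). rewrite S_INR.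
    replace (INR n + 1 + 2 + y) with (INR n + 2 + (1 + y)) by ring.
    replace (INR n + 1 + 2 + 2 * y) with (INR n + 2 + (1 + 2 * y)) by ring.
    replace (INR n + 1 + 2 + 0) with ((INR n + 2) + 1) by ring.
    set (N := INR n + 2). assert (HN : 2 <= N) by (unfold N; lra). rewrite (Gamma_rec N) by lra.
    replace (Rpower N (1 + y)) with (N * Rpower N y) by (rewrite Rpower_plus, Rpower_1 by lra; ring).
    replace (Rpower N (1 + 2 * y)) with (N * (Rpower N y * Rpower N y)).
    2:{ rewrite <- Rpower_plus, (Rpower_plus 1), Rpower_1 by lra. f_equal. f_equal. ring. }
    field. repeat split; try lra; apply Rgt_not_eq; try apply exp_pos; apply Gamma_pos; lra. }
assert (P1 := Gam1_pos y ltac:(lra)). assert (P2 := Gam1_pos (2 * y) ltac:(lra)).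
apply (is_lim_seq_scal_l _ (/ Gq y)) in F. replace (Rbar_mult (/ Gq y) 1) with (Finite (/ Gq y)) in F by (simpl; f_equal; ring).
revert F; apply is_lim_seq_ext; intros n. rewrite !Gamma_pr, Gam1_0 by lra. unfold Gq.
assert (P3 := pr_pos (S n) y ltac:(lra)). assert (P4 := pr_pos (S n) (2 * y) ltac:(lra)). assert (P5 := pr_pos (S n) 0 ltac:(lra)).
field. repeat split; lra.
Qed.

(* Coefficients of ln (1+2x) - 2 ln (1+x). *)
Definition e0 (k : nat) : R := match k with O => 0 | S k' => (-1) ^ k' * (2 ^ k - 2) / INR k end.

(** The Taylor coefficients of ln Gq. Those of index 0 and 1 vanish because [e0] does, so the
    divergent harmonic series does not enter. *)
Definition ee (k : nat) : R := e0 k * zeta k.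

Lemma CV_pow_bound f K q : 0 < q -> (forall k, Rabs (f k) <= K * q ^ k) -> Rbar_le (/ q) (CV_radius f).
Proof.
intros Hq H. destruct (CV_radius_bounded f) as [H1 _]. apply H1. exists K; intros n.
rewrite Rabs_mult, (Rabs_pos_eq ((/ q) ^ n)) by (apply pow_le; left; apply Rinv_0_lt_compat; lra).
apply Rle_trans with (K * q ^ n * (/ q) ^ n).
- apply Rmult_le_compat_r; auto. apply pow_le; left; apply Rinv_0_lt_compat; lra.
- rewrite Rmult_assoc, <- Rpow_mult_distr, Rinv_r, pow1 by lra. lra.
Qed.

Lemma e0_bound k : Rabs (e0 k) <= 2 * 2 ^ k.
Proof.
destruct k as [|k]; unfold e0; [rewrite Rabs_R0; simpl; lra|].
assert (Hk := pos_INR k). assert (P : 1 <= 2 ^ k) by (apply pow_R1_Rle; lra).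
unfold Rdiv. rewrite !Rabs_mult, <- RPow_abs. replace (Rabs (-1)) with 1 by (rewrite Rabs_left; lra). rewrite pow1. rewrite (Rabs_pos_eq (2 ^ S k - 2)) by (simpl; lra).
rewrite Rabs_pos_eq by (left; apply Rinv_0_lt_compat; rewrite S_INR; lra).
assert (/ INR (S k) <= 1). { rewrite <- Rinv_1. apply Rinv_le_contravar; rewrite ?S_INR; lra. }
assert (0 < / INR (S k)) by (apply Rinv_0_lt_compat; rewrite S_INR; lra).
simpl pow. nra.
Qed.

Lemma zeta_lim k : (2 <= k)%nat -> is_lim_seq (mhs [k]) (zeta k).
Proof.
intros Hk. assert (Hp : pos_index [k]) by (constructor; [lia|constructor]). assert (Hc : conv_index [k]) by exact Hk.
unfold zeta. rewrite mzv_series by auto. apply mhs_lim; auto.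
Qed.

Lemma mhs_incr k n m : (2 <= k)%nat -> 0 <= mhs [k] (n + m) - mhs [k] n <= mhs [2%nat] (n + m) - mhs [2%nat] n.
Proof.
intros Hk. induction m as [|m IH]; [rewrite Nat.add_0_r; lra|]. rewrite Nat.add_succ_r, !mhs_S. cbn [mhs]. rewrite !Rmult_1_r.
assert (Hn := pos_INR (n + m)). rewrite <- Nat.add_succ_r in *.
assert (H1 : 1 <= INR (n + S m)) by (rewrite Nat.add_succ_r, S_INR; lra).
assert (P : 0 < / INR (n + S m) ^ k <= / INR (n + S m) ^ 2).
{ split; [apply Rinv_0_lt_compat, pow_lt; lra|]. apply Rinv_le_contravar; [apply pow_lt; lra|]. apply Rle_pow; auto. }
cbn [mhs] in IH. lra.
Qed.

(** Comparison with the tail of zeta(2) makes the convergence in [Hn_lim] uniform in the index k. *)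
Lemma zeta_tail k n : (2 <= k)%nat -> 0 <= zeta k - mhs [k] n <= zeta 2 - mhs [2%nat] n.
Proof.
intros Hk.
assert (L : forall j, (2 <= j)%nat -> is_lim_seq (fun m => mhs [j] (n + m) - mhs [j] n) (zeta j - mhs [j] n)).
{ intros j Hj. apply is_lim_seq_minus'; [|apply is_lim_seq_const].
  apply (is_lim_seq_ext (fun m => mhs [j] (m + n))); [intros; f_equal; lia|]. apply is_lim_seq_incr_n. apply zeta_lim; auto. }
split.
- apply (is_lim_seq_le (fun _ => 0) (fun m => mhs [k] (n + m) - mhs [k] n) 0 (zeta k - mhs [k] n)).
  + intros m; apply mhs_incr; auto. + apply is_lim_seq_const. + apply L; auto.
- apply (is_lim_seq_le (fun m => mhs [k] (n + m) - mhs [k] n) (fun m => mhs [2%nat] (n + m) - mhs [2%nat] n) (zeta k - mhs [k] n) (zeta 2 - mhs [2%nat] n)).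
  + intros m; apply mhs_incr; auto. + apply L; auto. + apply L; auto.
Qed.

Lemma ee_bound k : Rabs (ee k) <= (2 * zeta 2) * 2 ^ k.
Proof.
unfold ee. rewrite Rabs_mult. assert (B := e0_bound k).
destruct (Nat.le_gt_cases 2 k) as [Hk|Hk].
- destruct (zeta_tail k 0 Hk) as [A1 A2]. rewrite (mhs_0 k), Rminus_0_r in A1, A2. rewrite (mhs_0 2), Rminus_0_r in A2. rewrite (Rabs_pos_eq (zeta k)) by lra.
  assert (P := Rabs_pos (e0 k)). replace (2 * zeta 2 * 2 ^ k) with (2 * 2 ^ k * zeta 2) by ring. apply Rmult_le_compat; lra.
- assert (E : e0 k = 0). { destruct k as [|[|k]]; [reflexivity|unfold e0; simpl; field|exfalso; lia]. }
  rewrite E, Rabs_R0, Rmult_0_l. destruct (zeta_tail 2 0 ltac:(lia)) as [A1 A2]. rewrite !mhs_0, !Rminus_0_r in A1.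
  assert (0 < 2 ^ k) by (apply pow_lt; lra). nra.
Qed.

Lemma CV_ee : Rbar_le (/ 2) (CV_radius ee).
Proof. apply (CV_pow_bound _ (2 * zeta 2)); [lra|apply ee_bound]. Qed.

Lemma CV_e0 : Rbar_le (/ 2) (CV_radius e0).
Proof. apply (CV_pow_bound _ 2); [lra|apply e0_bound]. Qed.

Lemma scal_pow (x : R) k a : scal (V := R_NormedModule) (pow_n x k) a = a * x ^ k.
Proof. unfold scal; simpl. rewrite (pow_n_pow x k). unfold mult; simpl. eqR; ring. Qed.

Lemma geom_PSeries q x : Rabs (q * x) < 1 -> PSeries (fun k => q ^ k) x = / (1 - q * x).
Proof.
intros H. unfold PSeries. rewrite <- (Series_geom (q * x)) by auto. apply Series_ext; intros k. rewrite Rpow_mult_distr; reflexivity.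
Qed.

Lemma geom_ex q x : Rabs (q * x) < 1 -> ex_series (fun k => q ^ k * x ^ k).
Proof. intros H. apply (ex_series_ext (fun k => (q * x) ^ k)); [intros; apply Rpow_mult_distr|apply ex_series_geom; auto]. Qed.

Lemma log_deriv x : Rabs x < / 2 -> PSeries (PS_derive e0) x = 2 / (1 + 2 * x) - 2 / (1 + x).
Proof.
intros H. apply Rabs_def2 in H.
assert (H2 : Rabs (-2 * x) < 1) by (apply Rabs_def1; lra). assert (H1 : Rabs (-1 * x) < 1) by (apply Rabs_def1; lra).
transitivity (2 * PSeries (fun k => (-2) ^ k) x - 2 * PSeries (fun k => (-1) ^ k) x).
- unfold PSeries. rewrite <- !Series_scal_l, <- Series_minus.
  + apply Series_ext; intros k. unfold PS_derive, e0.
    replace ((-2) ^ k) with ((-1) ^ k * 2 ^ k) by (rewrite <- Rpow_mult_distr; f_equal; lra).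
    simpl (2 ^ S k). field. rewrite S_INR; generalize (pos_INR k); lra.
  + apply (ex_series_scal_l (V := R_NormedModule) 2 (fun k => (-2) ^ k * x ^ k)). apply geom_ex; auto.
  + apply (ex_series_scal_l (V := R_NormedModule) 2 (fun k => (-1) ^ k * x ^ k)). apply geom_ex; auto.
- rewrite !geom_PSeries by auto. field; lra.
Qed.

Lemma log_series x : Rabs x < / 2 -> ln (1 + 2 * x) - 2 * ln (1 + x) = PSeries e0 x.
Proof.
intros H.
set (f := fun t => ln (1 + 2 * (x * t)) - 2 * ln (1 + x * t)). set (g := fun t => PSeries e0 (x * t)).
set (d := fun t => x * (2 / (1 + 2 * (x * t)) - 2 / (1 + x * t))).
assert (Hb : forall t, 0 <= t <= 1 -> Rabs (x * t) < / 2).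
{ intros t Ht. rewrite Rabs_mult, (Rabs_pos_eq t) by lra. assert (P := Rabs_pos x). nra. }
assert (Df : forall t, 0 <= t <= 1 -> is_derive f t (d t)).
{ intros t Ht. specialize (Hb t Ht). apply Rabs_def2 in Hb. unfold f, d. auto_derive; [repeat split; lra|]. field; lra. }
assert (Dg : forall t, 0 <= t <= 1 -> is_derive g t (d t)).
{ intros t Ht. unfold g, d. rewrite <- log_deriv by auto.
  apply (is_derive_comp (PSeries e0) (fun t => x * t)).
  - apply is_derive_PSeries. eapply Rbar_lt_le_trans; [|apply CV_e0]. apply Hb; auto.
  - auto_derive; auto; ring. }
assert (Q : f 1 = g 1).
{ apply (derive_eq_open f g d 0 1); try lra; try (intros; apply Df; lra); try (intros; apply Dg; lra).
  - intros t Ht. apply (ex_derive_continuous f). eexists; apply Df; auto.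
  - intros t Ht. apply (ex_derive_continuous g). eexists; apply Dg; auto.
  - unfold f, g. rewrite !Rmult_0_r, Rplus_0_r, ln_1, PSeries_0. unfold e0. ring. }
unfold f, g in Q. rewrite !Rmult_1_r in Q. exact Q.
Qed.

Definition Hn (n : nat) (y : R) := psum (fun m => PSeries e0 (y / INR (S m))) n.

Lemma Hn_series n y : Rabs y < / 2 -> Hn n y = PSeries (fun k => e0 k * mhs [k] n) y /\ ex_pseries (fun k => e0 k * mhs [k] n) y.
Proof.
intros Hy. unfold Hn.
assert (B : forall m, Rabs (y / INR (S m)) < / 2).
{ intros m. unfold Rdiv. rewrite Rabs_mult. assert (Hm := pos_INR m).
  assert (P : 0 < / INR (S m) <= 1).
  { split; [apply Rinv_0_lt_compat; rewrite S_INR; lra|]. rewrite <- Rinv_1. apply Rinv_le_contravar; rewrite ?S_INR; lra. }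
  rewrite (Rabs_pos_eq (/ INR (S m))) by lra. assert (Q := Rabs_pos y). nra. }
assert (EQ : forall x, ex_pseries e0 x <-> ex_series (fun k => e0 k * x ^ k)).
{ intros x. unfold ex_pseries. split; apply ex_series_ext; intros; rewrite ?scal_pow; reflexivity. }
induction n as [|n [IH1 IH2]]; cbn [psum].
- split.
  + rewrite (PSeries_ext _ (fun _ => 0)) by (intros; rewrite mhs_0; ring). symmetry; apply PSeries_const_0.
  + apply CV_radius_inside. rewrite (CV_radius_ext _ (fun _ => 0)) by (intros; rewrite mhs_0; ring).
    rewrite CV_radius_const_0. exact I.
- assert (X : ex_series (fun k => e0 k * (y / INR (S n)) ^ k)).
  { apply EQ. apply CV_radius_inside. eapply Rbar_lt_le_trans; [|apply CV_e0]. apply B. }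
  assert (Y : ex_series (fun k => e0 k * mhs [k] n * y ^ k)).
  { revert IH2. unfold ex_pseries. apply ex_series_ext; intros; rewrite ?scal_pow; reflexivity. }
  assert (E : forall k, e0 k * mhs [k] (S n) * y ^ k = e0 k * mhs [k] n * y ^ k + e0 k * (y / INR (S n)) ^ k).
  { intros k. rewrite mhs_S. cbn [mhs]. unfold Rdiv. rewrite Rpow_mult_distr, pow_inv. ring. }
  split.
  + rewrite IH1. unfold PSeries. rewrite <- Series_plus by auto. apply Series_ext; intros k. symmetry; apply E.
  + apply (ex_series_ext (fun k => e0 k * mhs [k] n * y ^ k + e0 k * (y / INR (S n)) ^ k)).
    * intros k. rewrite <- E, scal_pow; reflexivity.
    * apply (ex_series_plus (V := R_NormedModule)); auto.
Qed.

Lemma Hn_lim y : Rabs y < / 4 -> is_lim_seq (fun n => Hn n y) (PSeries ee y).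
Proof.
intros Hy. set (M := Series (fun k => 2 * (2 * Rabs y) ^ k)).
assert (Q := Rabs_pos y).
assert (XM : ex_series (fun k => 2 * (2 * Rabs y) ^ k)).
{ apply (ex_series_scal_l (V := R_NormedModule) 2 (fun k => (2 * Rabs y) ^ k)). apply ex_series_geom. rewrite Rabs_pos_eq; lra. }
assert (B : forall n, Rabs (PSeries ee y - Hn n y) <= (zeta 2 - mhs [2%nat] n) * M).
{ intros n. destruct (Hn_series n y ltac:(lra)) as [E1 E2]. rewrite E1. destruct (zeta_tail 2 n ltac:(lia)) as [T _].
  assert (X1 : ex_series (fun k => ee k * y ^ k)).
  { assert (X : ex_pseries ee y) by (apply CV_radius_inside; eapply Rbar_lt_le_trans; [|apply CV_ee]; simpl; lra).
    revert X. apply ex_series_ext; intros; rewrite ?scal_pow; reflexivity. }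
  assert (X2 : ex_series (fun k => e0 k * mhs [k] n * y ^ k)).
  { revert E2. apply ex_series_ext; intros; rewrite ?scal_pow; reflexivity. }
  unfold PSeries. rewrite <- Series_minus by auto. unfold M. rewrite <- Series_scal_l.
  apply Rabs_Series_le.
  - intros k. rewrite Rpow_mult_distr, RPow_abs.
    replace (ee k * y ^ k - e0 k * mhs [k] n * y ^ k) with (e0 k * (zeta k - mhs [k] n) * y ^ k) by (unfold ee; ring).
    rewrite !Rabs_mult.
    assert (B := e0_bound k). assert (P := Rabs_pos (e0 k)). assert (P2 := Rabs_pos (y ^ k)).
    assert (L : Rabs (e0 k) * Rabs (zeta k - mhs [k] n) <= (zeta 2 - mhs [2%nat] n) * (2 * 2 ^ k)).
    { destruct (Nat.le_gt_cases 2 k) as [Hk|Hk].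
      - destruct (zeta_tail k n Hk) as [A1 A2]. rewrite (Rabs_pos_eq (zeta k - mhs [k] n)) by lra.
        rewrite (Rmult_comm (zeta 2 - _)). apply Rmult_le_compat; lra.
      - assert (E : e0 k = 0). { destruct k as [|[|k]]; [reflexivity|unfold e0; simpl; field|exfalso; lia]. }
        rewrite E, Rabs_R0, Rmult_0_l. apply Rmult_le_pos; [lra|]. assert (0 < 2 ^ k) by (apply pow_lt; lra). lra. }
    apply Rle_trans with ((zeta 2 - mhs [2%nat] n) * (2 * 2 ^ k) * Rabs (y ^ k)); [apply Rmult_le_compat_r; auto|apply Req_le; ring].
  - apply (ex_series_scal_l (V := R_NormedModule)); auto. }
apply is_lim_seq_spec. intros eps.
assert (L : is_lim_seq (fun n => (zeta 2 - mhs [2%nat] n) * M) 0).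
{ replace (Finite 0) with (Finite ((zeta 2 - zeta 2) * M)) by (f_equal; ring).
  apply is_lim_seq_mult'; [apply is_lim_seq_minus'; [apply is_lim_seq_const|apply zeta_lim; lia]|apply is_lim_seq_const]. }
apply is_lim_seq_spec in L. destruct (L eps) as [N HN]. exists N; intros n Hn'. specialize (HN n Hn'). specialize (B n).
rewrite Rabs_minus_sym. rewrite Rminus_0_r in HN. apply Rabs_def2 in HN. lra.
Qed.

(** Each factor contributes (1+2x)/(1+x)^2 with x = y/m, whose logarithm is the power series with
    coefficients [e0]. *)
Lemma pr_exp n y : Rabs y < / 4 -> pr n (2 * y) * pr n 0 = pr n y ^ 2 * exp (Hn n y).
Proof.
intros Hy. induction n as [|n IH]; [unfold Hn; simpl; rewrite exp_0; ring|].
unfold Hn in *; cbn [psum pr].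
assert (Hk := pos_INR n). assert (Hy' := Rabs_def2 _ _ Hy).
set (x := y / INR (S n)) in *.
assert (Bx : Rabs x < / 2).
{ unfold x, Rdiv. rewrite Rabs_mult.
  assert (P : 0 < / INR (S n) <= 1).
  { split; [apply Rinv_0_lt_compat; rewrite S_INR; lra|]. rewrite <- Rinv_1. apply Rinv_le_contravar; rewrite ?S_INR; lra. }
  rewrite (Rabs_pos_eq (/ INR (S n))) by lra. assert (Q := Rabs_pos y). nra. }
rewrite exp_plus, <- log_series by auto. apply Rabs_def2 in Bx.
assert (E : exp (ln (1 + 2 * x) - 2 * ln (1 + x)) * ((1 + x) * (1 + x)) = 1 + 2 * x).
{ rewrite <- (exp_ln (1 + x)) at 2 3 by lra. rewrite <- !exp_plus.
  replace (ln (1 + 2 * x) - 2 * ln (1 + x) + (ln (1 + x) + ln (1 + x))) with (ln (1 + 2 * x)) by ring. apply exp_ln; lra. }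
assert (E1 : INR n + 1 + 2 * y = INR (S n) * (1 + 2 * x)) by (unfold x; rewrite S_INR; field; lra).
assert (E2 : INR n + 1 + y = INR (S n) * (1 + x)) by (unfold x; rewrite S_INR; field; lra).
rewrite E1, E2. replace (INR n + 1 + 0) with (INR (S n)) by (rewrite S_INR; ring).
replace (pr n (2 * y) * (INR (S n) * (1 + 2 * x)) * (pr n 0 * INR (S n))) with
 (pr n (2 * y) * pr n 0 * (INR (S n) * INR (S n)) * (1 + 2 * x)) by ring.
set (q := exp (ln (1 + 2 * x) - 2 * ln (1 + x))) in *. rewrite IH, <- E. ring.
Qed.

(** The quotients of finite products tend to 1/Gq by the asymptotics of Gamma, and to the
    exponential of minus the power series of [ee] by [pr_exp] and [Hn_lim]. *)
Theorem Gq_exp y : Rabs y < / 4 -> Gq y = exp (PSeries ee y).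
Proof.
intros Hy. assert (Hy' := Rabs_def2 _ _ Hy).
assert (L1 := Gq_lim y ltac:(lra)).
assert (L2 : is_lim_seq (fun n => pr (S n) y ^ 2 / (pr (S n) (2 * y) * pr (S n) 0)) (/ exp (PSeries ee y))).
{ rewrite <- exp_Ropp. apply (is_lim_seq_ext (fun n => exp (- Hn (S n) y))).
  - intros n. rewrite pr_exp, exp_Ropp by auto.
    assert (P3 := pr_pos (S n) y ltac:(lra)). field. split; [apply Rgt_not_eq, exp_pos|lra].
  - apply (is_lim_seq_continuous exp (fun n => - Hn (S n) y)).
    + apply derivable_continuous_pt, derivable_pt_exp.
    + apply is_lim_seq_incr_1 with (u := fun n => - Hn n y).
      apply (is_lim_seq_opp (fun n => Hn n y) (PSeries ee y)). apply Hn_lim; auto. }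
apply is_lim_seq_unique in L1. apply is_lim_seq_unique in L2. rewrite L1 in L2. injection L2; intros E.
rewrite <- (Rinv_inv (Gq y)), E, Rinv_inv; reflexivity.
Qed.

(** * Taylor expansion of the summand at integers *)

Definition quarter (f : nat -> R) := Rbar_le (/ 4) (CV_radius f).

Lemma quarter_CV f y : quarter f -> Rabs y < / 4 -> Rbar_lt (Rabs y) (CV_radius f).
Proof. intros H Hy. eapply Rbar_lt_le_trans; [|exact H]. exact Hy. Qed.

Lemma quarter_nrm f K : (forall n, nrm f n <= K) -> quarter f.
Proof.
intros H. unfold quarter. apply (CV_pow_bound f K 4); [lra|]. intros k.
eapply Rle_trans; [apply nrm_bound|]. rewrite (Rmult_comm K). apply Rmult_le_compat_l; [apply pow_le; lra|]. apply H.
Qed.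

Lemma quarter_bq k : quarter (bq k).
Proof. apply (quarter_nrm _ (5 / 2 * (/ 2) ^ k)). apply nrm_bq. Qed.

Lemma quarter_rs s k : (1 <= k)%nat -> quarter (rs s k).
Proof. intros Hk. apply (quarter_nrm _ ((4 / 3) ^ s * (5 / 2 * (/ 2) ^ k))). intros n; apply nrm_rs; auto. Qed.

Lemma quarter_ee : quarter ee.
Proof. unfold quarter. eapply Rbar_le_trans; [|apply CV_ee]. simpl; lra. Qed.

Lemma PSeries_lmul c d f y : quarter f -> Rabs y < / 4 -> PSeries (lmul c d f) y = (c + d * y) * PSeries f y.
Proof.
intros Hf Hy. assert (R := quarter_CV f y Hf Hy).
transitivity (PSeries (PS_plus (PS_scal c f) (PS_scal d (PS_incr_1 f))) y).
- apply PSeries_ext; intros [|j]; unfold lmul, PS_plus, PS_scal, PS_incr_1, plus, scal; simpl; unfold mult, zero; simpl; ring.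
- rewrite PSeries_plus, !PSeries_scal, PSeries_incr_1; [ring| |].
  + apply ex_pseries_scal; [apply Rmult_comm|apply CV_radius_inside; auto].
  + apply ex_pseries_scal; [apply Rmult_comm|]. apply ex_pseries_incr_1, CV_radius_inside; auto.
Qed.

Lemma PSeries_ldiv c d f y : c <> 0 -> quarter (ldiv c d f) -> Rabs y < / 4 -> PSeries f y = (c + d * y) * PSeries (ldiv c d f) y.
Proof.
intros Hc Hf Hy. rewrite <- PSeries_lmul by auto. apply PSeries_ext; intros j; symmetry; apply lmul_ldiv; auto.
Qed.

Lemma PSeries_bq k y : Rabs y < / 4 -> PSeries (bq k) y = pr k y ^ 2 / pr (2 * k) (2 * y).
Proof.
intros Hy. assert (Hy' := Rabs_def2 _ _ Hy). induction k as [|k IH].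
- simpl. rewrite (PSeries_ext _ (PS_plus (PS_scal 1 ps_one) (fun _ => 0))).
  2: intros j; unfold PS_plus, PS_scal, plus, scal; simpl; unfold mult; simpl; eqR; ring.
  rewrite PSeries_plus, PSeries_scal, PSeries_const_0.
  2,3: apply CV_radius_inside. 3: rewrite CV_radius_const_0; exact I.
  2: rewrite CV_radius_scal by lra; apply quarter_CV; [apply (quarter_bq 0)|auto].
  replace (PSeries ps_one y) with 1; [field|]. rewrite PSeries_decr_1.
  + rewrite (PSeries_ext _ (fun _ => 0)) by reflexivity. rewrite PSeries_const_0. simpl; ring.
  + apply CV_radius_inside, quarter_CV; [apply (quarter_bq 0)|auto].
- assert (Hk := pos_INR k). assert (P := PSeries_ldiv (2 * (2 * INR k + 1)) 4 (lmul (INR k + 1) 1 (bq k)) y ltac:(lra) (quarter_bq (S k)) Hy).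
  change (ldiv (2 * (2 * INR k + 1)) 4 (lmul (INR k + 1) 1 (bq k))) with (bq (S k)) in P.
  rewrite PSeries_lmul in P by (auto using quarter_bq). rewrite IH in P.
  replace (2 * S k)%nat with (S (S (2 * k))) by lia. cbn [pr].
  assert (P1 := pr_pos k y ltac:(lra)). assert (P2 := pr_pos (2 * k) (2 * y) ltac:(lra)).
  rewrite !S_INR, !mult_INR. replace (INR 2) with 2 by (simpl; ring).
  apply (Rmult_eq_reg_l (2 * (2 * INR k + 1) + 4 * y)); [|lra]. rewrite <- P. field. repeat split; lra.
Qed.

Lemma PSeries_rs s k y : (1 <= k)%nat -> Rabs y < / 4 -> PSeries (rs s k) y = / (INR k + y) ^ s * (pr k y ^ 2 / pr (2 * k) (2 * y)).
Proof.
intros Hk Hy. assert (Hy' := Rabs_def2 _ _ Hy). assert (Hk' := le_INR _ _ Hk). simpl in Hk'. induction s as [|s IH].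
- cbn [rs]. rewrite PSeries_bq by auto. simpl pow. field. apply Rgt_not_eq, pr_pos; lra.
- assert (P := PSeries_ldiv (INR k) 1 (rs s k) y ltac:(lra) (quarter_rs (S s) k Hk) Hy).
  change (ldiv (INR k) 1 (rs s k)) with (rs (S s) k) in P. rewrite IH in P.
  apply (Rmult_eq_reg_l (INR k + 1 * y)); [|lra]. rewrite <- P. simpl ((INR k + y) ^ S s).
  assert (P2 := pr_pos (2 * k) (2 * y) ltac:(lra)). field. repeat split; try lra. apply pow_nonzero; lra.
Qed.

Definition ephi (f : nat -> R) (y : R) := exp (PSeries ee y) * PSeries f y.

Lemma summand_ephi s k y : (1 <= k)%nat -> Rabs y < / 4 -> summand s (INR k + y) = ephi (rs s k) y.
Proof.
intros Hk Hy. assert (Hy' := Rabs_def2 _ _ Hy). rewrite summand_pr by (auto; lra). unfold ephi.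
rewrite <- Gq_exp, PSeries_rs by auto. ring.
Qed.

(* (e^E f)' = e^E (E' f + f'). *)
Definition eop (f : nat -> R) : nat -> R := PS_plus (PS_mult (PS_derive ee) f) (PS_derive f).

(** Beyond the radius of convergence the terms do not tend to 0. This recovers the radius for Cauchy
    products, whose convergence is known point by point. *)
Lemma quarter_of_ex f : (forall y, 0 < y < / 4 -> ex_pseries f y) -> quarter f.
Proof.
intros H. unfold quarter. apply Rbar_not_lt_le. intros C.
assert (P : exists r, 0 < r < / 4 /\ Rbar_lt (CV_radius f) r).
{ assert (G := CV_radius_ge_0 f). destruct (CV_radius f) as [r| |]; simpl in *; try contradiction.
  exists ((r + / 4) / 2). lra. }
destruct P as (r & Hr & Cr).
apply (CV_disk_outside f r); [rewrite Rabs_pos_eq by lra; auto|].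
assert (E := H r Hr). apply ex_series_lim_0 in E. revert E; apply is_lim_seq_ext; intros n. apply scal_pow.
Qed.

Lemma quarter_derive f : quarter f -> quarter (PS_derive f).
Proof. unfold quarter. rewrite CV_radius_derive; auto. Qed.

Lemma quarter_eop f : quarter f -> quarter (eop f).
Proof.
intros Hf. apply quarter_of_ex. intros y Hy. assert (Ay : Rabs y < / 4) by (rewrite Rabs_pos_eq; lra).
apply ex_pseries_plus.
- apply ex_pseries_mult; apply quarter_CV; auto using quarter_derive, quarter_ee.
- apply CV_radius_inside, quarter_CV; auto using quarter_derive.
Qed.

Lemma ephi_derive f y : quarter f -> Rabs y < / 4 -> is_derive (ephi f) y (ephi (eop f) y).
Proof.
intros Hf Hy.
assert (D1 := is_derive_PSeries f y (quarter_CV f y Hf Hy)).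
assert (D2 := is_derive_PSeries ee y (quarter_CV ee y quarter_ee Hy)).
assert (D3 : is_derive (fun t => exp (PSeries ee t)) y (PSeries (PS_derive ee) y * exp (PSeries ee y))).
{ apply (is_derive_comp exp (PSeries ee)); [apply is_derive_exp|exact D2]. }
unfold ephi, eop. rewrite PSeries_plus, PSeries_mult.
- assert (D := is_derive_mult _ _ y _ _ D3 D1 Rmult_comm).
  replace (exp (PSeries ee y) * (PSeries (PS_derive ee) y * PSeries f y + PSeries (PS_derive f) y)) with
    (plus (mult (PSeries (PS_derive ee) y * exp (PSeries ee y)) (PSeries f y)) (mult (exp (PSeries ee y)) (PSeries (PS_derive f) y))); auto.
  unfold plus, mult; simpl; ring.
- apply quarter_CV; auto using quarter_derive, quarter_ee.
- apply quarter_CV; auto.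
- apply ex_pseries_mult; apply quarter_CV; auto using quarter_derive, quarter_ee.
- apply CV_radius_inside, quarter_CV; auto using quarter_derive.
Qed.

Fixpoint eopn (n : nat) (f : nat -> R) : nat -> R := match n with O => f | S n' => eop (eopn n' f) end.

Lemma quarter_eopn n f : quarter f -> quarter (eopn n f).
Proof. intros H; induction n; simpl; auto using quarter_eop. Qed.

Lemma ephi_derive_n g c f n : quarter f -> (forall y, Rabs y < / 4 -> g (c + y) = ephi f y) ->
  forall y, Rabs y < / 4 -> is_derive_n g n (c + y) (ephi (eopn n f) y).
Proof.
intros Hf Hg. induction n as [|n IH]; intros y Hy; [apply Hg; auto|].
cbn [is_derive_n eopn].
apply (is_derive_ext_loc (fun x => ephi (eopn n f) (x - c))).
- assert (He : 0 < / 4 - Rabs y) by lra. exists (mkposreal _ He). intros x Hx.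
  change (Rabs (x - (c + y)) < / 4 - Rabs y) in Hx.
  assert (Hz : Rabs (x - c) < / 4).
  { replace (x - c) with ((x - (c + y)) + y) by ring. eapply Rle_lt_trans; [apply Rabs_triang|]. lra. }
  symmetry. apply is_derive_n_unique. specialize (IH (x - c) Hz). assert (Z : forall u v : R, u + (v - u) = v) by (intros; ring). rewrite Z in IH. exact IH.
- assert (D := ephi_derive (eopn n f) y (quarter_eopn n f Hf) Hy).
  replace (ephi (eop (eopn n f)) y) with (scal 1 (ephi (eop (eopn n f)) y)) by (unfold scal; simpl; unfold mult; simpl; eqR; ring).
  apply (is_derive_comp (ephi (eopn n f)) (fun x => x - c)).
  + replace (c + y - c) with y by ring. exact D.
  + auto_derive; auto.
Qed.

Lemma ephi_0 f : ephi f 0 = f O.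
Proof. unfold ephi. rewrite !PSeries_0. replace (ee 0) with 0 by (unfold ee, e0; ring). rewrite exp_0; ring. Qed.

(* Coefficients of Gamma(1+y)^2 / Gamma(1+2y) up to y^5; only these are meaningful. *)
Definition gexpo (k : nat) : R :=
  match k with
  | 0%nat => 1 | 1%nat => 0 | 2%nat => - zeta 2 | 3%nat => 2 * zeta 3
  | 4%nat => - (7 / 2) * zeta 4 + zeta 2 * zeta 2 / 2 | 5%nat => 6 * zeta 5 - 2 * zeta 2 * zeta 3 | _ => 0
  end.

Lemma eop_0 f : eop f 0 = f 1%nat.
Proof. unfold eop, PS_plus, PS_mult, PS_derive, plus, ee, e0; simpl. field. Qed.
Lemma eop_1 f : eop f 1 = 2 * f 2%nat + -2 * zeta 2 * f O.
Proof. unfold eop, PS_plus, PS_mult, PS_derive, plus, ee, e0; simpl. field. Qed.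
Lemma eop_2 f : eop f 2 = 3 * f 3%nat + -2 * zeta 2 * f 1%nat + 6 * zeta 3 * f O.
Proof. unfold eop, PS_plus, PS_mult, PS_derive, plus, ee, e0; simpl. field. Qed.
Lemma eop_3 f : eop f 3 = 4 * f 4%nat + -2 * zeta 2 * f 2%nat + 6 * zeta 3 * f 1%nat + -14 * zeta 4 * f O.
Proof. unfold eop, PS_plus, PS_mult, PS_derive, plus, ee, e0; simpl. field. Qed.
Lemma eop_4 f : eop f 4 = 5 * f 5%nat + -2 * zeta 2 * f 3%nat + 6 * zeta 3 * f 2%nat + -14 * zeta 4 * f 1%nat + 30 * zeta 5 * f O.
Proof. unfold eop, PS_plus, PS_mult, PS_derive, plus, ee, e0; simpl. field. Qed.

(** Both sides are n! times the coefficient of y^n in e^E f, once by differentiating n times and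
    once as a Cauchy product; compared for each n <= 5 separately. *)
Lemma eopn_coef n f : (n <= 5)%nat -> eopn n f O = INR (fact n) * psum (fun j => gexpo (n - j) * f j) (S n).
Proof.
intros Hn. destruct n as [|[|[|[|[|[|n]]]]]]; [..|lia]; cbn [eopn psum Nat.sub];
  repeat rewrite ?eop_0, ?eop_1, ?eop_2, ?eop_3, ?eop_4; unfold gexpo; simpl; field.
Qed.

Theorem is_A_V m n : (n <= 5)%nat ->
  is_A (m + 2) n (INR (fact n) * psum (fun j => gexpo (n - j) * ((-1) ^ j * 2 ^ (m + j) * lsum V (Vwords m j))) (S n)).
Proof.
intros Hn. exists (fun k => eopn n (rs (m + 2) k) O). split.
- intros k Hk. rewrite <- ephi_0. rewrite <- (Rplus_0_r (INR k)).
  apply ephi_derive_n; [apply quarter_rs; auto| |rewrite Rabs_R0; lra].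
  intros y Hy; apply summand_ephi; auto.
- apply (is_series_ext (fun k => INR (fact n) * psum (fun j => gexpo (n - j) * fam (m + 2) (S k) j) (S n))).
  { intros k. rewrite eopn_coef by auto. reflexivity. }
  apply (is_series_scal (V := R_NormedModule) (INR (fact n)) (fun k => psum (fun j => gexpo (n - j) * fam (m + 2) (S k) j) (S n))).
  assert (G : forall N, is_series (fun k => psum (fun j => gexpo (n - j) * fam (m + 2) (S k) j) N)
    (psum (fun j => gexpo (n - j) * ((-1) ^ j * 2 ^ (m + j) * lsum V (Vwords m j))) N)); [|apply G].
  clear Hn. induction N as [|N IH]; cbn [psum].
  + assert (E := is_series_scal (V := R_NormedModule) 0 _ _ (is_series_geom 0 ltac:(rewrite Rabs_R0; lra))).
    match type of E with is_series _ ?l => replace l with 0 in E by (unfold scal; simpl; unfold mult; simpl; eqR; ring) end.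
    revert E; apply is_series_ext; intros; unfold scal; simpl; unfold mult; simpl; eqR; ring.
  + apply (is_series_plus (V := R_NormedModule)); auto.
    apply (is_series_scal (V := R_NormedModule) (gexpo (n - N)) (fun k => fam (m + 2) (S k) N)).
    (* The family vanishes at k = 0, so the sum from k = 1 is the full sum of [fam_series]. *)
    apply (is_series_incr_1 (V := R_NormedModule) (fun k => fam (m + 2) k N)).
    match goal with |- is_series _ ?l => replace l with ((-1) ^ N * 2 ^ (m + N) * lsum V (Vwords m N)) end; [apply fam_series|].
    unfold plus; simpl; eqR; ring.
Qed.

(** * Polynomials with rational coefficients *)

(* Variables are positive numbers; a monomial is a decreasing list of variables. *)
Definition mono := list positive.
Definition pol := list (mono * Q).

Section Eval.
Variable rho : positive -> R.

Definition meval (m : mono) : R := fold_right (fun v r => rho v * r) 1 m.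
Definition peval (p : pol) : R := lsum (fun t => Q2R (snd t) * meval (fst t)) p.

(* Lexicographic with the largest variable first; this order is compatible with multiplication. *)
Fixpoint mcmp (m m' : mono) : comparison :=
  match m, m' with
  | [], [] => Eq | [], _ => Lt | _, [] => Gt
  | v :: n, v' :: n' => match Pos.compare v v' with Eq => mcmp n n' | c => c end
  end.

Lemma mcmp_eq m m' : mcmp m m' = Eq -> m = m'.
Proof.
revert m'; induction m as [|v m IH]; intros [|v' m']; simpl; try discriminate; auto.
destruct (Pos.compare_spec v v') as [->| |]; try discriminate. intros H; f_equal; auto.
Qed.

Definition pcons (m : mono) (c : Q) (p : pol) : pol := if Qeq_bool c 0 then p else (m, c) :: p.

Lemma pcons_eval m c p : peval (pcons m c p) = Q2R c * meval m + peval p.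
Proof.
unfold pcons. destruct (Qeq_bool c 0) eqn:E; [|reflexivity].
apply Qeq_bool_eq, Qeq_eqR in E. rewrite E, RMicromega.Q2R_0. ring.
Qed.

Fixpoint padd (p q : pol) : pol :=
  match p with
  | [] => q
  | (m, c) :: p' =>
    (fix aux (q : pol) := match q with
     | [] => p
     | (m', c') :: q' =>
       match mcmp m m' with
       | Eq => pcons m (Qred (c + c')) (padd p' q')
       | Gt => (m, c) :: padd p' q
       | Lt => (m', c') :: aux q'
       end end) q
  end.

Lemma Q2R_red c : Q2R (Qred c) = Q2R c.
Proof. apply Qeq_eqR, Qred_correct. Qed.

Lemma peval_cons m c p : peval ((m, c) :: p) = Q2R c * meval m + peval p.
Proof. reflexivity. Qed.

Lemma padd_eval p q : peval (padd p q) = peval p + peval q.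
Proof.
revert q; induction p as [|[m c] p IH]; intros q; [unfold peval; simpl; ring|].
induction q as [|[m' c'] q IHq]; [cbn [padd]; unfold peval at 3; simpl lsum; ring|].
cbn [padd] in *. destruct (mcmp m m') eqn:E.
- apply mcmp_eq in E; subst. rewrite pcons_eval, IH, Q2R_red, Q2R_plus, !peval_cons. ring.
- rewrite (peval_cons m' c' (_ q)), IHq, !peval_cons. ring.
- rewrite (peval_cons m c (padd _ _)), IH, !peval_cons. ring.
Qed.

Fixpoint mmul (m n : mono) : mono :=
  match m with
  | [] => n
  | v :: m' =>
    (fix aux (n : mono) := match n with
     | [] => m
     | v' :: n' => if Pos.ltb v v' then v' :: aux n' else v :: mmul m' n
     end) n
  end.

Lemma mmul_eval m n : meval (mmul m n) = meval m * meval n.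
Proof.
revert n; induction m as [|v m IH]; intros n; [simpl; ring|].
induction n as [|v' n IHn]; [simpl; ring|].
cbn [mmul] in *. destruct (Pos.ltb v v').
- cbn [meval fold_right] in *. unfold meval in *. rewrite IHn. simpl. ring.
- cbn [meval fold_right] in *. unfold meval in *. rewrite IH. simpl. ring.
Qed.

Definition pmono (m : mono) (c : Q) (p : pol) : pol := map (fun t => (mmul m (fst t), Qred (c * snd t))) p.

Lemma pmono_eval m c p : peval (pmono m c p) = Q2R c * meval m * peval p.
Proof.
induction p as [|[n d] p IH]; [unfold peval; simpl; ring|].
cbn [pmono map fst snd]. rewrite !peval_cons. fold (pmono m c p). rewrite IH, mmul_eval, Q2R_red, Q2R_mult. ring.
Qed.

Definition pmul (p q : pol) : pol := fold_right (fun t r => padd (pmono (fst t) (snd t) q) r) [] p.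

Lemma pmul_eval p q : peval (pmul p q) = peval p * peval q.
Proof.
induction p as [|[m c] p IH]; [unfold peval; simpl; ring|].
cbn [pmul fold_right fst snd]. fold (pmul p q). rewrite padd_eval, pmono_eval, IH, peval_cons. ring.
Qed.

Definition pconst (c : Q) : pol := pcons [] (Qred c) [].
Definition pvar (v : positive) : pol := [([v], 1%Q)].
Definition pscale (c : Q) (p : pol) : pol := if Qeq_bool c 0 then [] else pmono [] c p.

Lemma pconst_eval c : peval (pconst c) = Q2R c.
Proof. unfold pconst. rewrite pcons_eval, Q2R_red. unfold peval; simpl; ring. Qed.

Lemma pvar_eval v : peval (pvar v) = rho v.
Proof. unfold pvar, peval; simpl. unfold Q2R; simpl. field. Qed.

Lemma pscale_eval c p : peval (pscale c p) = Q2R c * peval p.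
Proof.
unfold pscale. destruct (Qeq_bool c 0) eqn:E; [|rewrite pmono_eval; simpl; ring].
apply Qeq_bool_eq, Qeq_eqR in E. rewrite E, RMicromega.Q2R_0. unfold peval; simpl; ring.
Qed.

Definition popp (p : pol) : pol := pscale (-1) p.

Lemma popp_eval p : peval (popp p) = - peval p.
Proof. unfold popp. rewrite pscale_eval. unfold Q2R; simpl. field. Qed.

Fixpoint ppow (p : pol) (n : nat) : pol := match n with O => pconst 1 | S k => pmul p (ppow p k) end.

Lemma ppow_eval p n : peval (ppow p n) = peval p ^ n.
Proof. induction n as [|n IH]; cbn [ppow pow]; [rewrite pconst_eval; unfold Q2R; simpl; field|rewrite pmul_eval, IH; ring]. Qed.

Definition msub (v : positive) (q : pol) (m : mono) : pol :=
  fold_right (fun x r => if Pos.eqb x v then pmul q r else pmono [x] 1 r) (pconst 1) m.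

Definition psub (v : positive) (q : pol) (p : pol) : pol :=
  if existsb (fun t => existsb (Pos.eqb v) (fst t)) p
  then fold_right (fun t r => padd (pscale (snd t) (msub v q (fst t))) r) [] p else p.

Lemma Q2R_1 : Q2R 1 = 1.
Proof. unfold Q2R; simpl; field. Qed.

Lemma msub_eval v q m : peval q = rho v -> peval (msub v q m) = meval m.
Proof.
intros H; induction m as [|x m IH]; [change (peval (pconst 1) = 1); rewrite pconst_eval; apply Q2R_1|].
cbn [msub fold_right]. fold (msub v q m). destruct (Pos.eqb_spec x v) as [->|_].
- rewrite pmul_eval, IH, H. reflexivity.
- rewrite pmono_eval, IH, Q2R_1. simpl; ring.
Qed.

Lemma psub_eval v q p : peval q = rho v -> peval (psub v q p) = peval p.
Proof.
intros H; unfold psub. match goal with |- context [if ?b then _ else _] => destruct b end; auto.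
induction p as [|[m c] p IH]; [reflexivity|]. cbn [fold_right fst snd]. rewrite padd_eval, pscale_eval, msub_eval, IH by auto.
rewrite peval_cons; reflexivity.
Qed.

Fixpoint mdel (v : positive) (m : mono) : option mono :=
  match m with
  | [] => None
  | x :: n => if Pos.eqb x v then Some n else match mdel v n with Some k => Some (x :: k) | None => None end
  end.

Fixpoint pdel (v : positive) (p : pol) : option pol :=
  match p with
  | [] => Some []
  | (m, c) :: q => match mdel v m, pdel v q with Some n, Some r => Some ((n, c) :: r) | _, _ => None end
  end.

Lemma mdel_eval v m n : mdel v m = Some n -> meval m = rho v * meval n.
Proof.
revert n; induction m as [|x m IH]; intros n; simpl; [discriminate|].
destruct (Pos.eqb_spec x v) as [->|_]; [intros [= ->]; reflexivity|].
destruct (mdel v m) as [k|]; [|discriminate]. intros [= <-]. rewrite (IH k) by auto. simpl; ring.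
Qed.

Lemma pdel_eval v p q : pdel v p = Some q -> peval p = rho v * peval q.
Proof.
revert q; induction p as [|[m c] p IH]; intros q; simpl; [intros [= <-]; unfold peval; simpl; ring|].
destruct (mdel v m) as [n|] eqn:E; [|discriminate]. destruct (pdel v p) as [r|]; [|discriminate]. intros [= <-].
rewrite !peval_cons, (IH r), (mdel_eval v m n) by auto. ring.
Qed.

(* Cancels common factors [v]; at most [k] of them. *)
Fixpoint pcancel (k : nat) (v : positive) (p : pol) : pol :=
  match k, p with
  | S k', _ :: _ => match pdel v p with Some q => pcancel k' v q | None => p end
  | _, _ => p
  end.

Lemma pcancel_eval k v p : rho v <> 0 -> peval p = 0 -> peval (pcancel k v p) = 0.
Proof.
intros Hv; revert p; induction k as [|k IH]; intros p H; [exact H|]. destruct p as [|t p]; [exact H|].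
cbn [pcancel]. destruct (pdel v (t :: p)) as [q|] eqn:E; [|exact H]. apply IH.
apply pdel_eval in E. rewrite H in E. symmetry in E. apply Rmult_integral in E. tauto.
Qed.

Definition table := PositiveMap.t pol.

(* A table rewrites eliminated variables into the remaining ones. *)
Definition sound (T : table) := forall v q, PositiveMap.find v T = Some q -> peval q = rho v.

Definition lookup (T : table) (v : positive) : pol := match PositiveMap.find v T with Some q => q | None => pvar v end.

Lemma lookup_eval T v : sound T -> peval (lookup T v) = rho v.
Proof. intros H; unfold lookup. destruct (PositiveMap.find v T) eqn:E; [apply H; auto|apply pvar_eval]. Qed.

(** Substituting into the earlier entries as well keeps the table reduced, so that one lookup per
    variable suffices. *)
Definition assign (v : positive) (q : pol) (T : table) : table := PositiveMap.add v q (PositiveMap.map (psub v q) T).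

Lemma assign_sound v q T : sound T -> peval q = rho v -> sound (assign v q T).
Proof.
intros HT Hq w r. unfold assign. destruct (Pos.eq_dec w v) as [->|N].
- rewrite PositiveMap.gss. intros [= <-]; auto.
- rewrite PositiveMap.gso by auto. unfold PositiveMap.map. rewrite PositiveMap.gmapi.
  destruct (PositiveMap.find w T) as [s|] eqn:E; simpl; [|discriminate]. intros [= <-].
  rewrite psub_eval by auto. apply HT; auto.
Qed.

Variable unknown : positive -> bool.

Fixpoint pick (p : pol) : option (positive * Q) :=
  match p with
  | [] => None
  | ([v], c) :: q => if unknown v then Some (v, c) else pick q
  | _ :: q => pick q
  end.

Definition coef (v : positive) (p : pol) : Q :=
  fold_right (fun t c => match mcmp (fst t) [v] with Eq => snd t | _ => c end) 0%Q p.

Definition solve (v : positive) (c : Q) (p : pol) (T : table) : table :=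
  if Qeq_bool c 0 then T else assign v (padd (pvar v) (pscale (- / c) p)) T.

(** As [p] has value 0, the polynomial v - p/c has the value of v; with c the coefficient of v in
    [p], this expresses v by the other variables. *)
Lemma solve_sound v c p T : sound T -> peval p = 0 -> sound (solve v c p T).
Proof.
intros HT Hp. unfold solve. destruct (Qeq_bool c 0); auto. apply assign_sound; auto.
rewrite padd_eval, pscale_eval, pvar_eval, Hp. ring.
Qed.

End Eval.

(* Combinations of the rows, found by linear algebra, in which LS and LT cancel and, after rewriting in a and b,
   only words beginning with a remain. *)
Definition cert7_abbabbb : list Z := [0;-3174368800;3174368800;0;-737347400;2437021400;0;9392012784;7094938992;0;1534591074;-648442074;0;
13736607946;7867197263;0;2174538137;765584683;0;1642701840;2464483740;0;9942048072;15640637076;0;13407694636;5415980753;0;4036036619;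
1238211721;0;-2095098330;-1630876380;0;7867736808;11208435480;0;-6061346476;-5374175156;0;4596622444;5402917688;0;-320367030;
-4447501410;0;-403474002;-9516529404;0;0;0;0;0;0;0;0;0;0;0;0;0;0;0;0;0;0;0;0;0;0;0;0;0;0;0;0;0;0;0;0;0;0;0;0;
0;0;0;0;0;0;0;0;0;0;0;0;0;0;-4846916756;4846916756;-3174368800;3174368800;0;0;2152498547;-2152498547;7601041450;-7601041450;0;
0;2223426716;-2223426716;6332460697;-6332460697;0;0;-8112048263;8112048263;-2260036687;2260036687;0;0;2804599318;-2804599318;
6511318346;-6511318346;0;0;-5354850400;5354850400;-2412047351;2412047351;0;0;-3526389907;3526389907;-3218643158;3218643158;0;0;
8362150402;-8362150402;4345088363;-4345088363;0;0;0;0;0;0;0;0;0;0;0;0;0;0;0;0;0;0;0;0;0;0;0;0;0;0;0;0;0;0;0;0;0;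
0;0;0;0;0;0;0;0;0;0;0;0;0;0;0;0;0;0;0;1269747520;8517387866;-1269747520;-8517387866;-2624858596;7111663789;2624858596;
-7111663789;0;0;0;0;369366617;-1072315313;-369366617;1072315313;-1534379684;3404391140;1534379684;-3404391140;0;0;0;0;-2738006504;
-2021140270;2738006504;2021140270;-609988291;196006168;609988291;-196006168;0;0;0;0;-3608726815;1146843319;3608726815;-1146843319;
-3244117454;-5523183841;3244117454;5523183841;0;0;0;0;0;0;0;0;0;0;0;0;0;0;0;0;0;0;0;0;0;0;0;0;0;0;0;0;0;0;0;0;0;
0;0;0;0;0;0;0;0;0;0;0;0;0;0;0;0;0;0;0;0;0;0;0;2624858596;-2337678136;-1437691191;3570580938;-2624858596;2337678136;
1437691191;-3570580938;2942295476;-1790698337;619909929;5706005820;-2942295476;1790698337;-619909929;-5706005820;0;0;0;0;0;0;0;0;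
-2968016389;8047510;62507535;-3950445234;2968016389;-8047510;-62507535;3950445234;-2509843181;1475741114;910348746;-4440159678;2509843181;
-1475741114;-910348746;4440159678;0;0;0;0;0;0;0;0;0;0;0;0;0;0;0;0;0;0;0;0;0;0;0;0;0;0;0;0;0;0;0;0;0;0;0;0;0;0;
0;0;0;0;0;0;0;0;0;0;0;0;0;0;0;0;0;0;0;0;0;0;0;0;0;0;-2307421716;-2823715758;-310618254;-815683035;1104187389;0;0;0;
2307421716;2823715758;310618254;815683035;-1104187389;0;0;0;0;0;0;0;0;0;0;0;0;0;0;0;0;0;0;0;0;0;0;0;0;0;0;0;0;0;0;
0;0;0;0;0;0;0;0;0;0;0;0;0;0;0;0;0;0;0;0;0;0;0;0;0;0;0;0;0;0;0;0;0;0;0;0;0]%Z.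

Definition cert7_ababbbb : list Z := [0;-153652440;153652440;0;-37241760;116410680;0;-279263976;-109791816;0;-78783810;-52430046;0;
-348002754;-221128323;0;-75487221;-77675583;0;-141587760;-42595884;0;-185969160;-411924708;0;-276641004;-236415021;0;-108872463;
-106332021;0;31791042;48924396;0;-191993256;-304147032;0;144573204;143197236;0;-93448236;-161013984;0;124032630;98206986;0;174468090;
98361636;0;0;0;0;0;0;0;0;0;0;0;0;0;0;0;0;0;0;0;0;0;0;0;0;0;0;0;0;0;0;0;0;0;0;0;0;0;0;0;0;0;0;0;0;0;0;0;
0;0;0;-109819932;109819932;-153652440;153652440;0;0;4648425;-4648425;-128507754;128507754;0;0;-37916232;37916232;-198142899;
198142899;0;0;257569677;-257569677;93434481;-93434481;0;0;-37256244;37256244;-175908360;175908360;0;0;183984858;-183984858;87524091;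
-87524091;0;0;79487697;-79487697;91789914;-91789914;0;0;-68987502;68987502;-7738341;7738341;0;0;0;0;0;0;0;0;0;0;0;0;0;0;0;
0;0;0;0;0;0;0;0;0;0;0;0;0;0;0;0;0;0;0;0;0;0;0;0;0;0;0;0;0;0;0;0;0;0;0;0;0;61460976;-76056498;-61460976;
76056498;-2263224;-110225925;2263224;110225925;0;0;0;0;9396771;38216037;-9396771;-38216037;-9963450;-68670198;9963450;68670198;0;0;
0;0;80705862;52399838;-80705862;-52399838;24359461;-42904750;-24359461;42904750;0;0;0;0;26305111;17374049;-26305111;-17374049;
25495084;67481985;-25495084;-67481985;0;0;0;0;0;0;0;0;0;0;0;0;0;0;0;0;0;0;0;0;0;0;0;0;0;0;0;0;0;0;0;0;0;0;0;0;
0;0;0;0;0;0;0;0;0;0;0;0;0;0;0;0;0;0;0;0;2263224;-7766534;29655203;-20108016;-2263224;7766534;-29655203;20108016;17628468;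
35287951;-13933171;-80408232;-17628468;-35287951;13933171;80408232;0;0;0;0;0;0;0;0;36350631;-35342626;11481061;72632712;-36350631;
35342626;-11481061;-72632712;62576259;-41278880;-37986898;41722938;-62576259;41278880;37986898;-41722938;0;0;0;0;0;0;0;0;0;0;0;
0;0;0;0;0;0;0;0;0;0;0;0;0;0;0;0;0;0;0;0;0;0;0;0;0;0;0;0;0;0;0;0;0;0;0;0;0;0;0;0;0;0;0;0;0;0;0;0;0;0;
0;0;0;13102020;8477316;16329274;-3409907;17802677;-27926302;0;0;-13102020;-8477316;-16329274;3409907;-17802677;27926302;0;0;0;0;
0;0;0;0;0;0;0;0;0;0;0;0;0;0;0;0;0;0;0;0;0;0;0;0;0;0;0;0;0;0;0;0;0;0;0;0;0;0;0;0;0;0;0;0;0;0;0;0;0;0;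
0;0;0;0;0;0;0;0;0;0;0;0]%Z.

Definition cert8_abbabbbb : list Z := [0;0;17418776897164500;0;8999546011582500;13209161454373500;0;-11954263762287000;-2670847748761500;0;
-6880463191552500;-3958524531076500;0;-20744749386593100;-5763691277714700;0;-13046167911476700;-7051095181132200;0;-14408727894306900;
6668536717250100;0;9744491156231700;10155863826108000;0;-20604516704699400;-2319694270304400;0;-11147700376642500;-7061237988789600;0;
-7890475880746800;-958471117193700;0;1000467646576200;3592246056339600;0;149665652027100;2082699308606400;0;-6828861393218700;
-6526249061765400;0;-1666376063451000;-14161061578356000;0;11837783171124900;-14533260640836300;0;-14837800409605800;1267560436378500;0;
-6107473006450200;-6414344738930700;0;-1288078841976300;-4143212273544300;0;-6441127767201600;-7691867824162500;0;5256617549228100;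
-1148445633376800;0;-7843703688186300;-4209550853527800;0;113238290919600;-1980828295073100;0;5036674729145400;-14089042652572800;0;
8604203747762700;144563396689800;0;-6602992508237400;-5447729993626800;0;516109650734700;2907250626178800;0;2100395155795200;
-10996357613204700;0;11619357915696300;6541735135250700;0;2957315601438000;-5326834372368300;0;7607436066073800;2991155919572700;0;
1538767694029500;6820464043948500;0;0;0;0;0;0;0;0;0;0;0;0;0;0;0;0;0;0;0;0;0;0;0;0;0;0;0;0;0;0;0;0;0;0;0;0;0;0;
0;0;0;0;0;0;0;0;0;0;0;0;0;0;0;0;0;0;0;0;0;0;0;0;0;0;0;0;0;0;0;0;0;0;0;0;0;0;0;0;0;0;0;0;0;0;0;0;0;0;
0;0;0;0;0;0;0;0;0;0;-12560286999950670;12560286999950670;-4858489897213830;4858489897213830;0;0;14977663885738350;-14977663885738350;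
7448326239763020;-7448326239763020;0;0;7445387084898858;-7445387084898858;5652442313135670;-5652442313135670;0;0;14549620195124118;
-14549620195124118;9451895301169944;-9451895301169944;0;0;-1593243958589946;1593243958589946;117342980201724;-117342980201724;0;0;
9041894911902120;-9041894911902120;716263823694774;-716263823694774;0;0;2877999399110202;-2877999399110202;-16527026554271976;
16527026554271976;0;0;3826487330425560;-3826487330425560;9492229395351294;-9492229395351294;0;0;-7143288715055922;7143288715055922;
-5314661314529658;5314661314529658;0;0;1480537989090906;-1480537989090906;-8401967986764120;8401967986764120;0;0;2215432854396402;
-2215432854396402;-10044999369378654;10044999369378654;0;0;-1297861190037126;1297861190037126;5522547852516948;-5522547852516948;0;0;
896696080112682;-896696080112682;-9211393558962432;9211393558962432;0;0;-5163244090708932;5163244090708932;463160486162862;-463160486162862;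
0;0;-12836230750898298;12836230750898298;-6910191638510244;6910191638510244;0;0;-6872888976185616;6872888976185616;-4138177805190630;
4138177805190630;0;0;0;0;0;0;0;0;0;0;0;0;0;0;0;0;0;0;0;0;0;0;0;0;0;0;0;0;0;0;0;0;0;0;0;0;0;0;0;0;0;0;0;0;
0;0;0;0;0;0;0;0;0;0;0;0;0;0;0;0;0;0;0;0;0;0;0;0;0;0;0;0;0;0;0;0;0;0;0;0;0;0;0;0;0;0;0;0;0;0;0;0;0;0;
0;0;0;0;0;0;-1516430509612272;-4045363984895628;1516430509612272;4045363984895628;-7701797102736840;-8178212100398160;7701797102736840;
8178212100398160;0;0;0;0;-9675032968690392;12988869607812792;9675032968690392;-12988869607812792;18408983010975072;-10728573148049172;
-18408983010975072;10728573148049172;0;0;0;0;-8904696679430520;10415014630218552;8904696679430520;-10415014630218552;4541021341899396;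
1726776774769176;-4541021341899396;-1726776774769176;0;0;0;0;12228107336206668;2452202482538904;-12228107336206668;-2452202482538904;
-7201683423475296;6155205319017636;7201683423475296;-6155205319017636;0;0;0;0;-1947373617702452;-9911035004632;1947373617702452;
9911035004632;-2767554718984420;2938404989142436;2767554718984420;-2938404989142436;0;0;0;0;10619906504368764;-1022129422929168;
-10619906504368764;1022129422929168;-5849072375936268;9013074258781488;5849072375936268;-9013074258781488;0;0;0;0;12325693395534080;
-6183249702351800;-12325693395534080;6183249702351800;-1918756696937480;7591551447244892;1918756696937480;-7591551447244892;0;0;0;0;
590932384088928;-2364115086513396;-590932384088928;2364115086513396;-5534717119530000;4664945412638472;5534717119530000;-4664945412638472;0;
0;0;0;0;0;0;0;0;0;0;0;0;0;0;0;0;0;0;0;0;0;0;0;0;0;0;0;0;0;0;0;0;0;0;0;0;0;0;0;0;0;0;0;0;0;0;0;0;0;0;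
0;0;0;0;0;0;0;0;0;0;0;0;0;0;0;0;0;0;0;0;0;0;0;0;0;0;0;0;0;0;0;0;0;0;0;0;0;0;0;0;0;0;0;0;0;0;0;0;0;0;
0;0;0;4621078261642104;12487063308138120;-1155718631218116;-12837454104094524;-4621078261642104;-12487063308138120;1155718631218116;
12837454104094524;1457546969164149;13953803130799755;-2533849952351559;-20192304105126153;-1457546969164149;-13953803130799755;
2533849952351559;20192304105126153;0;0;0;0;0;0;0;0;-19060384331730231;-4553384212829481;630927359725713;10461472684379991;
19060384331730231;4553384212829481;-630927359725713;-10461472684379991;-15660431971810047;-4509077433174609;5061515177212521;6977483042140143;
15660431971810047;4509077433174609;-5061515177212521;-6977483042140143;0;0;0;0;0;0;0;0;-722026637228202;-9470195624650810;
-5347398176267354;10845759659655726;722026637228202;9470195624650810;5347398176267354;-10845759659655726;-2676342013455033;-11652213605264567;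
-2869912021996345;13685393274737853;2676342013455033;11652213605264567;2869912021996345;-13685393274737853;0;0;0;0;0;0;0;0;
9364849993973763;-2792030693955839;-8773106097106489;4969451804492973;-9364849993973763;2792030693955839;8773106097106489;-4969451804492973;
11454518420987109;-3618754981563937;-7398574742469011;5697870716552187;-11454518420987109;3618754981563937;7398574742469011;-5697870716552187;
0;0;0;0;0;0;0;0;0;0;0;0;0;0;0;0;0;0;0;0;0;0;0;0;0;0;0;0;0;0;0;0;0;0;0;0;0;0;0;0;0;0;0;0;0;0;0;0;0;0;
0;0;0;0;0;0;0;0;0;0;0;0;0;0;0;0;0;0;0;0;0;0;0;0;0;0;0;0;0;0;0;0;0;0;0;0;0;0;0;0;0;0;0;0;0;0;0;0;0;0;
0;0;0;0;0;0;0;0;0;0;0;0;379107627403068;-4620953865247380;-135966714732136;-1074984198092912;415673419094968;2876557697180504;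
2146239720453372;6287877525225756;-379107627403068;4620953865247380;135966714732136;1074984198092912;-415673419094968;-2876557697180504;
-2146239720453372;-6287877525225756;1919467047950436;5232113685016008;3180340053671072;4352068102140400;-1143364083893276;2925642862556780;
-4286377721976552;-9451966386766428;-1919467047950436;-5232113685016008;-3180340053671072;-4352068102140400;1143364083893276;-2925642862556780;
4286377721976552;9451966386766428;0;0;0;0;0;0;0;0;0;0;0;0;0;0;0;0;4793121176514300;-1241700131950092;5628006298792748;
-1064435731151156;2306912887504912;-4247578460136580;-9516610616105112;2656862788495020;-4793121176514300;1241700131950092;-5628006298792748;
1064435731151156;-2306912887504912;4247578460136580;9516610616105112;-2656862788495020;-1388348308091784;-1108672326426516;0;0;0;0;0;0;
1388348308091784;1108672326426516;0;0;0;0;0;0;0;0;0;0;0;0;0;0;0;0;0;0;0;0;0;0;0;0;0;0;0;0;0;0;0;0;0;0;0;0;0;0;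
0;0;0;0;0;0;0;0;0;0;0;0;0;0;0;0;0;0;0;0;0;0;0;0;0;0;0;0;0;0;0;0;0;0;0;0;0;0;0;0;0;0;0;0;0;0;0;0;0;0;
0;0;0;0;0;0;0;0;0;0;0;0;0;0;0;0;0;0;0;0;0;0;0;0;0;0;0;0;0;0;0;0;0;0;0;0;0;0;0;0;0;0;0;0;0;0;0;0;0;0;
0;0;0;0;0;0;0;0;0;0;0;0;0;0;0;0;0;0;0;0;0;0;0;0;0;0;0;0;0;0;0;0;0;0;0;0;0;0;0;0;0;0;0;0;0;0;0;0;0;0;
0;0;0;0;0;0;0;0;0;0;0;0;0;0;0;0;0;0;0;0;0;0;0;0;0;0;0;0;0;0;0;0;0;0;0;0;0;0;0;0;0;0;0;0;0;0;0;0;0;0;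
0;0;0;0;0;0;0;0;0;0;0;0;0;0;0;0;0;0;0;0;0;0;0;0;0;0;0;0;0;0;0;0;0;0;0;0;0;0;0;0;0;0;0;0;0;0;0;0;0;0;
0;0;0;0;0;0]%Z.

Definition cert8_ababbbbb : list Z := [0;0;248625694053000;0;-179642324921400;34491684565800;0;-861081009525000;-17287991542800;0;
-231422001030000;592589411785800;0;-1266504889902120;-42807125754360;0;-250110106927560;881631978242400;0;-291202046764200;1060620903159840;
0;903963839050800;1077095698248240;0;-1397291999954400;-75944395307880;0;-169524247469940;995278023230040;0;270098730213840;
1209094795351080;0;1152179664245280;808880560588980;0;715866776220420;1233819275337000;0;1136070908244360;361027428272280;0;
1050965522937000;-168799722757380;0;102022599844440;-1305375889843080;0;-1244446170438240;-129830071151880;0;-53330165446140;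
896507573781600;0;644059063682100;1081239206430240;0;1061176716725400;312705062295120;0;1124644695057180;1012965560267760;0;
987831197775180;-97041007936620;0;863539610076000;-459044076629160;0;-351892508010120;-1465963700384700;0;1324760985890100;654666662327040;
0;665569962915660;-613743185733480;0;520142733382140;-678205151836740;0;-618500888854200;-1314647523747360;0;216102844744380;
-728618972435640;0;-687428339542560;-841053156785820;0;-558674860075200;-55554802645320;0;196846017944400;788597028964800;0;0;0;0;0;0;
0;0;0;0;0;0;0;0;0;0;0;0;0;0;0;0;0;0;0;0;0;0;0;0;0;0;0;0;0;0;0;0;0;0;0;0;0;0;0;0;0;0;0;0;0;0;0;0;0;0;
0;0;0;0;0;0;0;0;0;0;0;0;0;0;0;0;0;0;0;0;0;0;0;0;0;0;0;0;0;0;0;0;0;0;0;0;0;0;0;0;0;0;-2580549638596620;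
2580549638596620;2331923944543620;-2331923944543620;0;0;2329218934215300;-2329218934215300;4643854887216120;-4643854887216120;0;0;
1513322270525388;-1513322270525388;2747485600475190;-2747485600475190;0;0;2798773425586188;-2798773425586188;1690250531460924;
-1690250531460924;0;0;770353089586974;-770353089586974;911547541313814;-911547541313814;0;0;1104572389215720;-1104572389215720;
442632207164694;-442632207164694;0;0;-196940384117448;196940384117448;-995286371352036;995286371352036;0;0;-64370876414700;64370876414700;
415570495265004;-415570495265004;0;0;465652412504268;-465652412504268;-781935233499318;781935233499318;0;0;-498517557525744;
498517557525744;-1263840315495330;1263840315495330;0;0;-866991277052508;866991277052508;-1576966572261114;1576966572261114;0;0;
-1245279387268686;1245279387268686;-560735837361282;560735837361282;0;0;-1144353906950268;1144353906950268;-2081405902438212;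
2081405902438212;0;0;-2130233561997522;2130233561997522;-1187462966535498;1187462966535498;0;0;-3074200218560178;3074200218560178;
-1737553653447924;1737553653447924;0;0;-2240564464050276;2240564464050276;954187057236240;-954187057236240;0;0;0;0;0;0;0;0;0;0;0;0;
0;0;0;0;0;0;0;0;0;0;0;0;0;0;0;0;0;0;0;0;0;0;0;0;0;0;0;0;0;0;0;0;0;0;0;0;0;0;0;0;0;0;0;0;0;0;0;0;0;0;
0;0;0;0;0;0;0;0;0;0;0;0;0;0;0;0;0;0;0;0;0;0;0;0;0;0;0;0;0;0;0;0;0;0;0;0;0;0;-3863678681431392;4365141095951712;
3863678681431392;-4365141095951712;-4912473583140240;4860693907031640;4912473583140240;-4860693907031640;0;0;0;0;-1685789063411502;
2045282498533812;1685789063411502;-2045282498533812;188388958887372;-391130383175952;-188388958887372;391130383175952;0;0;0;0;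
-1168074503227950;1645837162645212;1168074503227950;-1645837162645212;-316313746568349;490374144426861;316313746568349;-490374144426861;0;0;
0;0;-505474415411817;1181783405759829;505474415411817;-1181783405759829;-1419209872798281;1212072040731561;1419209872798281;
-1212072040731561;0;0;0;0;58509916540553;68184080391133;-58509916540553;-68184080391133;64675010931115;-50053235520079;-64675010931115;
50053235520079;0;0;0;0;387140077704459;-361073222674083;-387140077704459;361073222674083;-1661569861953138;1379683868252388;
1661569861953138;-1379683868252388;0;0;0;0;1030695647846215;-1018109746391935;-1030695647846215;1018109746391935;-1263756880273180;
1157317520911612;1263756880273180;-1157317520911612;0;0;0;0;-1848364409479392;1614672195721284;1848364409479392;-1614672195721284;
-2168661816732075;2113233046692147;2168661816732075;-2113233046692147;0;0;0;0;0;0;0;0;0;0;0;0;0;0;0;0;0;0;0;0;0;0;0;0;0;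
0;0;0;0;0;0;0;0;0;0;0;0;0;0;0;0;0;0;0;0;0;0;0;0;0;0;0;0;0;0;0;0;0;0;0;0;0;0;0;0;0;0;0;0;0;0;0;0;0;0;
0;0;0;0;0;0;0;0;0;0;0;0;0;0;0;0;0;0;0;0;0;0;0;0;0;0;0;0;0;2947484149884144;-2088315394459710;-2991582398923626;
1822405961768076;-2947484149884144;2088315394459710;2991582398923626;-1822405961768076;-699577183363086;-815916922654485;-370580019552429;
1547309624812182;699577183363086;815916922654485;370580019552429;-1547309624812182;0;0;0;0;0;0;0;0;-2020683840519591;-434329881169716;
521155551652488;1681546901934681;2020683840519591;434329881169716;-521155551652488;-1681546901934681;-1385421127823322;-360393527216769;
514485432284181;1187306653957848;1385421127823322;360393527216769;-514485432284181;-1187306653957848;0;0;0;0;0;0;0;0;-530321879720712;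
-1010616633935420;-269619819133744;1663707526180686;530321879720712;1010616633935420;269619819133744;-1663707526180686;2800197630747;
-1382320544005792;-554623614411530;2141965016746953;-2800197630747;1382320544005792;554623614411530;-2141965016746953;0;0;0;0;0;0;0;0;
776520642956913;-673147788892804;-778327437741584;1051847763384093;-776520642956913;673147788892804;778327437741584;-1051847763384093;
498873113040549;260867391929788;-168148553626876;-268035720206493;-498873113040549;-260867391929788;168148553626876;268035720206493;0;0;0;
0;0;0;0;0;0;0;0;0;0;0;0;0;0;0;0;0;0;0;0;0;0;0;0;0;0;0;0;0;0;0;0;0;0;0;0;0;0;0;0;0;0;0;0;0;0;0;0;0;0;
0;0;0;0;0;0;0;0;0;0;0;0;0;0;0;0;0;0;0;0;0;0;0;0;0;0;0;0;0;0;0;0;0;0;0;0;0;0;0;0;0;0;0;0;0;0;0;0;0;0;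
0;0;0;0;0;0;0;0;0;965919670357848;675533231262660;683716489628779;-1798595470613527;-1263277789357;-1403310852837791;-1189622268680268;
2086893441641406;-965919670357848;-675533231262660;-683716489628779;1798595470613527;1263277789357;1403310852837791;1189622268680268;
-2086893441641406;1948414386985896;554189518777038;-134373625371398;-853001747077660;-1106863072137556;-704940336426890;-757457615775912;
815395191417672;-1948414386985896;-554189518777038;134373625371398;853001747077660;1106863072137556;704940336426890;757457615775912;
-815395191417672;0;0;0;0;0;0;0;0;0;0;0;0;0;0;0;0;1057278982754310;-310800160021812;-6180640453517;-74538187455841;
-391788616332943;-138363727367165;-459461608024482;66692080723680;-1057278982754310;310800160021812;6180640453517;74538187455841;
391788616332943;138363727367165;459461608024482;-66692080723680;-201002188980444;-7149960445656;-60502126534740;0;0;0;0;0;201002188980444;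
7149960445656;60502126534740;0;0;0;0;0;0;0;0;0;0;0;0;0;0;0;0;0;0;0;0;0;0;0;0;0;0;0;0;0;0;0;0;0;0;0;0;0;0;0;0;
0;0;0;0;0;0;0;0;0;0;0;0;0;0;0;0;0;0;0;0;0;0;0;0;0;0;0;0;0;0;0;0;0;0;0;0;0;0;0;0;0;0;0;0;0;0;0;0;0;0;
0;0;0;0;0;0;0;0;0;0;0;0;0;0;0;0;0;0;0;0;0;0;0;0;0;0;0;0;0;0;0;0;0;0;0;0;0;0;0;0;0;0;0;0;0;0;0;0;0;0;
0;0;0;0;0;0;0;0;0;0;0;0;0;0;0;0;0;0;0;0;0;0;0;0;0;0;0;0;0;0;0;0;0;0;0;0;0;0;0;0;0;0;0;0;0;0;0;0;0;0;
0;0;0;0;0;0;0;0;0;0;0;0;0;0;0;0;0;0;0;0;0;0;0;0;0;0;0;0;0;0;0;0;0;0;0;0;0;0;0;0;0;0;0;0;0;0;0;0;0;0;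
0;0;0;0;0;0;0;0;0;0;0;0;0;0;0;0;0;0;0;0;0;0;0;0;0;0;0;0;0;0;0;0;0;0;0;0;0;0;0;0;0;0;0;0;0;0;0;0;0;0;
0;0;0]%Z.

Fixpoint eqword (u v : list bool) : bool :=
  match u, v with
  | [], [] => true
  | a :: u', b :: v' => if Bool.eqb a b then eqword u' v' else false
  | _, _ => false
  end.

Fixpoint eqlin (A B : list (Q * list bool)) : bool :=
  match A, B with
  | [], [] => true
  | (p, u) :: A', (q, v) :: B' => if Qeq_bool p q then if eqword u v then eqlin A' B' else false else false
  | _, _ => false
  end.

Lemma eqword_eq u v : eqword u v = true -> u = v.
Proof.
revert v; induction u as [|a u IH]; intros [|b v]; simpl; try discriminate; auto.
destruct (Bool.eqb a b) eqn:E; [|discriminate]. apply Bool.eqb_prop in E; subst. intros H; f_equal; auto.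
Qed.

Lemma eqlin_eval A B : eqlin A B = true ->
  lsum (fun p => Q2R (fst p) * V (snd p)) A = lsum (fun p => Q2R (fst p) * V (snd p)) B.
Proof.
revert B; induction A as [|[p u] A IH]; intros [|[q v] B]; simpl; try discriminate; auto.
destruct (Qeq_bool p q) eqn:E; [|discriminate]. destruct (eqword u v) eqn:F; [|discriminate].
intros H. apply Qeq_bool_eq, Qeq_eqR in E. apply eqword_eq in F; subst. rewrite E, (IH B H). reflexivity.
Qed.

Lemma exotic_vanish n cs L : eqlin (exotic n (cert_rows n cs)) L = true -> lsum (fun p => Q2R (fst p) * V (snd p)) L = 0.
Proof. intros H. rewrite <- (eqlin_eval _ _ H). apply exotic_relation. Qed.

(** Evaluated once and stored, so that the elimination does not expand the certificate again; the
    next lemma compares the stored list with a fresh evaluation. *)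
Definition rel7_abbabbb : list (Q * list bool) := Eval vm_compute in exotic 7 (cert_rows 7 cert7_abbabbb).

Lemma rel7_abbabbb_vanish : lsum (fun p => Q2R (fst p) * V (snd p)) rel7_abbabbb = 0.
Proof. apply (exotic_vanish 7 cert7_abbabbb). vm_cast_no_check (eq_refl true). Qed.

Definition rel7_ababbbb : list (Q * list bool) := Eval vm_compute in exotic 7 (cert_rows 7 cert7_ababbbb).

Lemma rel7_ababbbb_vanish : lsum (fun p => Q2R (fst p) * V (snd p)) rel7_ababbbb = 0.
Proof. apply (exotic_vanish 7 cert7_ababbbb). vm_cast_no_check (eq_refl true). Qed.

Definition rel8_abbabbbb : list (Q * list bool) := Eval vm_compute in exotic 8 (cert_rows 8 cert8_abbabbbb).

Lemma rel8_abbabbbb_vanish : lsum (fun p => Q2R (fst p) * V (snd p)) rel8_abbabbbb = 0.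
Proof. apply (exotic_vanish 8 cert8_abbabbbb). vm_cast_no_check (eq_refl true). Qed.

Definition rel8_ababbbbb : list (Q * list bool) := Eval vm_compute in exotic 8 (cert_rows 8 cert8_ababbbbb).

Lemma rel8_ababbbbb_vanish : lsum (fun p => Q2R (fst p) * V (snd p)) rel8_ababbbbb = 0.
Proof. apply (exotic_vanish 8 cert8_ababbbbb). vm_cast_no_check (eq_refl true). Qed.

Definition exotics := [rel7_abbabbb; rel7_ababbbb; rel8_abbabbbb; rel8_ababbbbb].

Lemma exotics_vanish i : lsum (fun p => Q2R (fst p) * V (snd p)) (nth i exotics []) = 0.
Proof.
destruct i as [|[|[|[|i]]]];
  [apply rel7_abbabbb_vanish|apply rel7_ababbbb_vanish|apply rel8_abbabbbb_vanish|apply rel8_ababbbbb_vanish|].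
destruct i; reflexivity.
Qed.

(** * The relations as polynomials *)

Fixpoint enc (w : list bool) : positive :=
  match w with [] => xH | true :: w' => xO (enc w') | false :: w' => xI (enc w') end.

Fixpoint dec (p : positive) : list bool :=
  match p with xH => [] | xO q => true :: dec q | xI q => false :: dec q end.

Lemma dec_enc w : dec (enc w) = w.
Proof. induction w as [|[|] w IH]; simpl; congruence. Qed.

(* The two low bits of a variable distinguish [V w], zeta values and the two parts of [ell w]. *)
Definition vV (w : list bool) : positive := xO (xO (enc w)).
Definition vZ (w : list bool) : positive := xO (xI (enc w)).
Definition vRe (w : list bool) : positive := xI (xO (enc w)).
Definition vIm (w : list bool) : positive := xI (xI (enc w)).

Definition val (p : positive) : R :=
  match p with
  | xO (xO q) => V (dec q) | xO (xI q) => Series (cw (wl (dec q)))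
  | xI (xO q) => Re (ell (dec q)) | xI (xI q) => Im (ell (dec q)) | _ => 0
  end.

Lemma val_V w : val (vV w) = V w.
Proof. unfold val, vV; rewrite dec_enc; auto. Qed.
Lemma val_Z w : val (vZ w) = Series (cw (wl w)).
Proof. unfold val, vZ; rewrite dec_enc; auto. Qed.
Lemma val_Re w : val (vRe w) = Re (ell w).
Proof. unfold val, vRe; rewrite dec_enc; auto. Qed.
Lemma val_Im w : val (vIm w) = Im (ell w).
Proof. unfold val, vIm; rewrite dec_enc; auto. Qed.

Notation pev := (peval val).

Definition pV (T : table) (w : list bool) : pol := match w with false :: _ => [] | [] => pconst 1 | _ => lookup T (vV w) end.

Section Sound.
Variable T : table.
Hypothesis HT : sound val T.

Lemma pV_eval w : pev (pV T w) = V w.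
Proof.
destruct w as [|[|] w]; unfold pV; [rewrite pconst_eval, Q2R_1; reflexivity|rewrite lookup_eval, val_V; auto|reflexivity].
Qed.

Definition plin (L : list (Q * list bool)) : pol := fold_right (fun t r => padd (pscale (fst t) (pV T (snd t))) r) [] L.

Lemma plin_eval L : pev (plin L) = lsum (fun t => Q2R (fst t) * V (snd t)) L.
Proof.
induction L as [|t L IH]; [reflexivity|]. cbn [plin fold_right]. fold (plin L).
rewrite padd_eval, pscale_eval, pV_eval, IH. reflexivity.
Qed.

Definition cpol := (pol * pol)%type.
Definition cev (p : cpol) : C := (pev (fst p), pev (snd p)).

Definition pell1 (W : list bool) : cpol :=
  let g := gexp (rev W) in
  (plin (map (fun t => (fst (fst t), snd t)) g), plin (map (fun t => (snd (fst t), snd t)) g)).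

Lemma pell1_eval W : cev (pell1 W) = ell W.
Proof. unfold cev, pell1, ell, gsum. cbn [fst snd]. rewrite !plin_eval, !lsum_map. reflexivity. Qed.

Definition cpmulconj (p q : cpol) : cpol :=
  (padd (pmul (fst p) (fst q)) (pmul (snd p) (snd q)),
   padd (pmul (fst p) (snd q)) (popp (pmul (snd p) (fst q)))).

Fixpoint ppell (S0 W : list bool) : cpol :=
  let a := cpmulconj (pell1 (map negb S0)) (pell1 W) in
  match W with
  | [] => a
  | x :: U => let b := ppell (x :: S0) U in (padd (fst a) (fst b), padd (snd a) (snd b))
  end.

Lemma cpmulconj_eval p q : cev (cpmulconj p q) = (Cconj (cev p) * cev q)%C.
Proof.
unfold cev, cpmulconj, Cconj, Cmult; cbn [fst snd]. rewrite !padd_eval, popp_eval, !pmul_eval. f_equal; ring.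
Qed.

Lemma ppell_eval S0 W : cev (ppell S0 W) = pell S0 W.
Proof.
revert S0; induction W as [|x U IH]; intros S0; cbn [ppell pell].
- rewrite cpmulconj_eval, !pell1_eval. rewrite Cplus_0_r. reflexivity.
- rewrite <- IH, <- (pell1_eval (map negb S0)), <- (pell1_eval (x :: U)), <- cpmulconj_eval.
  unfold cev, Cplus; cbn [fst snd]. rewrite !padd_eval. reflexivity.
Qed.

Fixpoint qpow (c : Q) (n : nat) : Q := match n with O => 1%Q | S k => (c * qpow c k)%Q end.

Lemma qpow_eval c n : Q2R (qpow c n) = Q2R c ^ n.
Proof. induction n as [|n IH]; cbn [qpow pow]; [apply Q2R_1|rewrite Q2R_mult, IH; reflexivity]. Qed.

(** [MuRe] and [MuIm] introduce the parts of a Clausen value as variables for combinations of V's.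
    [PRe] and [PIm] are the two parts of the path composition formula for a multiple zeta value; the
    imaginary part says that a combination of V's is 0. [Exo] refers to the stored certificates. *)
Inductive rel :=
| RShuf (u v : list bool) | MuRe (a : list nat) | MuIm (a : list nat) | Dist (s : nat)
| PRe (a : list nat) | PIm (a : list nat) | Stuf (a b : nat) | Exo (i : nat).

Definition admb (a : list nat) : bool := match a with [] => false | a1 :: _ => andb (Nat.leb 2 a1) (forallb (Nat.leb 1) a) end.

Lemma admb_spec a : admb a = true -> pos_index a /\ conv_index a.
Proof.
destruct a as [|a1 a]; [discriminate|]. cbn [admb]. intros H; apply andb_prop in H; destruct H as [H1 H2].
split; [|apply Nat.leb_le; auto]. apply Forall_forall. intros x Hx. rewrite forallb_forall in H2. apply Nat.leb_le; auto.
Qed.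

Definition pZ (a : list nat) : pol := lookup T (vZ (Wof a)).

Lemma pZ_eval a : admb a = true -> pev (pZ a) = mzv a.
Proof. intros H; apply admb_spec in H; destruct H. unfold pZ. rewrite lookup_eval, val_Z, mzv_series; auto. Qed.

(** Turns an inadmissible relation into the zero polynomial, so that [rpoly_eval] holds for every
    element of [rel]. *)
Definition guard (b : bool) (p : pol) : pol := if b then p else [].

Lemma guard_eval b p : (b = true -> pev p = 0) -> pev (guard b p) = 0.
Proof. destruct b; auto. Qed.

Definition rpoly (r : rel) : pol :=
  match r with
  | RShuf u v => guard (ga u && ga v) (padd (pmul (pV T u) (pV T v)) (popp (plin (map (pair 1%Q) (shuf u v)))))
  | MuRe a => padd (fst (pell1 (Wof a))) (popp (lookup T (vRe (Wof a))))
  | MuIm a => padd (snd (pell1 (Wof a))) (popp (lookup T (vIm (Wof a))))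
  | Dist s => guard (admb [s]) (padd (fst (pell1 (Wof [s])))
      (pscale (- ((1 # 2) - qpow (1 # 2) s - (3 # 2) * qpow (1 # 3) s + 3 * qpow (1 # 6) s)) (pZ [s])))
  | PRe a => guard (admb a) (padd (fst (ppell [] (Wof a))) (popp (pZ a)))
  | PIm a => guard (admb a) (snd (ppell [] (Wof a)))
  | Stuf a b => guard (admb [a] && admb [b])
      (padd (pmul (pZ [a]) (pZ [b])) (popp (padd (pZ [a; b]) (padd (pZ [b; a]) (pZ [(a + b)%nat])))))
  | Exo i => plin (nth i exotics [])
  end.

Lemma Wof_pell a : admb a = true -> RtoC (mzv a) = cev (ppell [] (Wof a)).
Proof.
intros H; apply admb_spec in H; destruct H as [H1 H2]. rewrite ppell_eval, mzv_series by auto.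
assert (W := wf_Wof a). destruct (Wof_false a H2) as (U & E). rewrite E in *. apply zeta_pell; auto.
Qed.

Lemma rpoly_eval r : pev (rpoly r) = 0.
Proof.
destruct r as [u v|a|a|s|a|a|a b|i]; cbn [rpoly].
- apply guard_eval; intros H; apply andb_prop in H; destruct H as [Hu Hv].
  rewrite padd_eval, pmul_eval, popp_eval, !pV_eval, plin_eval, lsum_map, V_shuffle by auto.
  rewrite (lsum_ext (fun x => Q2R (fst (1%Q, x)) * V (snd (1%Q, x))) V); [ring|].
  intros x _; cbn [fst snd]. rewrite Q2R_1; ring.
- rewrite padd_eval, popp_eval, lookup_eval, val_Re, <- pell1_eval by auto. unfold cev, Re; simpl; ring.
- rewrite padd_eval, popp_eval, lookup_eval, val_Im, <- pell1_eval by auto. unfold cev, Im; simpl; ring.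
- apply guard_eval; intros H. rewrite padd_eval, pscale_eval, pZ_eval by auto.
  assert (D := Re_ell_distribution s). rewrite <- pell1_eval in D. unfold cev, Re in D; cbn [fst] in D.
  apply admb_spec in H; destruct H as [_ H2]. rewrite D by exact H2. fold (zeta s).
  unfold Qminus. rewrite Q2R_opp, !Q2R_plus, !Q2R_opp, !Q2R_mult, !qpow_eval.
  unfold Q2R; cbn [Qnum Qden]. rewrite <- !pow_inv. unfold Rdiv. rewrite !Rmult_1_l, !Rinv_1. ring.
- apply guard_eval; intros H. rewrite padd_eval, popp_eval, pZ_eval by auto. assert (E := Wof_pell a H).
  apply (f_equal fst) in E. cbn [RtoC cev fst] in E. rewrite <- E. ring.
- apply guard_eval; intros H. assert (E := Wof_pell a H). apply (f_equal snd) in E. symmetry; exact E.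
- apply guard_eval; intros H; apply andb_prop in H; destruct H as [Ha Hb].
  assert (A2 : (2 <= a)%nat /\ (2 <= b)%nat) by (apply admb_spec in Ha, Hb; split; [apply Ha|apply Hb]).
  rewrite padd_eval, pmul_eval, popp_eval, !padd_eval, !pZ_eval; auto.
  + rewrite mzv_stuffle by lia. ring.
  + destruct A2. cbn [admb forallb]. repeat (apply andb_true_intro; split; auto; try (apply Nat.leb_le; lia)).
  + destruct A2. cbn [admb forallb]. repeat (apply andb_true_intro; split; auto; try (apply Nat.leb_le; lia)).
  + destruct A2. cbn [admb forallb]. repeat (apply andb_true_intro; split; auto; try (apply Nat.leb_le; lia)).
- rewrite plin_eval. apply exotics_vanish.
Qed.

End Sound.

(* Variables that occur in the theorem and are therefore never eliminated. *)
Definition kept : list positive := [vV [true]; vZ (Wof [3]); vZ (Wof [5]); vZ (Wof [7]); vZ (Wof [5; 3])]%nat.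

(** Variables of the form [xI _], the parts of the Clausen values, are never eliminated by [pick];
    V's and zeta values are, except the [kept] ones. *)
Definition unknown (v : positive) : bool :=
  match v with xO _ => negb (existsb (Pos.eqb v) kept) | _ => false end.

(** Common factors V(a) = pi/3 are cancelled first, since a relation may only determine an unknown
    after division by a power of pi. A shuffle is solved for the concatenation, which is the
    non-Lyndon word; any other relation for the first unknown that occurs as a monomial of its
    own. *)
Definition step (T : table) (r : rel) : table :=
  let p := pcancel 8 (vV [true]) (rpoly T r) in
  match r with
  | RShuf u v => solve (vV (u ++ v)) (coef (vV (u ++ v)) p) p T
  | _ => match pick unknown p with Some (v, c) => solve v c p T | None => T end
  end.

Lemma step_sound T r : sound val T -> sound val (step T r).
Proof.
intros HT. assert (H := pcancel_eval val 8 (vV [true]) (rpoly T r)). unfold step.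
assert (Hz : pev (pcancel 8 (vV [true]) (rpoly T r)) = 0).
{ apply H; [rewrite val_V, V_a; generalize PI_RGT_0; lra|apply rpoly_eval; auto]. }
destruct r; try (destruct (pick _ _) as [[v' c']|]; auto); apply solve_sound; auto.
Qed.

Definition solution (L : list rel) : table := fold_left step L (PositiveMap.empty pol).

Lemma solution_sound L : sound val (solution L).
Proof.
unfold solution. assert (H : sound val (PositiveMap.empty pol)) by (intros v q; rewrite PositiveMap.gempty; discriminate).
revert H; generalize (PositiveMap.empty pol); induction L as [|r L IH]; intros T HT; simpl; auto using step_sound.
Qed.

Fixpoint wordlt (u v : list bool) : bool :=
  match u, v with
  | _, [] => false | [], _ => true
  | true :: u', true :: v' | false :: u', false :: v' => wordlt u' v'
  | true :: _, false :: _ => true | false :: _, true :: _ => false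
  end.

Definition lyndon (w : list bool) : bool := forallb (fun i => wordlt w (skipn i w)) (List.seq 1 (length w - 1)).

Fixpoint awords (n : nat) : list (list bool) :=
  match n with O => [[]] | S k => flat_map (fun w => [true :: w; false :: w]) (awords k) end.

(* A non-Lyndon word is split after its longest Lyndon prefix. *)
Definition shuffle_rels (n : nat) : list rel :=
  flat_map (fun w => let w := true :: w in
    if lyndon w then [] else
    match filter (fun i => lyndon (firstn i w)) (rev (List.seq 1 (n - 1))) with
    | i :: _ => if ga (skipn i w) then [RShuf (firstn i w) (skipn i w)] else []
    | [] => []
    end) (awords (n - 1)).

(** The shuffles of weights 2 to 8 come first; by Radford's theorem they leave the V's of Lyndon
    words. The rest is ordered by weight, each relation being rewritten by the table so far before
    it is solved. *)
Definition relations : list rel :=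
  flat_map shuffle_rels (List.seq 2 7) ++
  [MuIm [2]; Dist 2; Dist 3; PIm [3]; MuIm [4]; Dist 4; PRe [4]; PIm [4]; PRe [2; 2]; MuIm [4; 1]; Dist 5;
   PRe [5]; PIm [5]; PRe [2; 3]; PIm [2; 3]; PRe [3; 2]; Stuf 3 2; MuIm [6]; MuRe [4; 2]; Dist 6; PRe [6];
   PIm [6]; PRe [2; 4]; PIm [2; 4]; PRe [3; 3]; PRe [4; 2]; PIm [4; 2]; Stuf 3 3; Stuf 4 2; MuRe [4; 1; 2];
   Dist 7; PRe [7]; PIm [7]; PRe [2; 5]; PIm [2; 5]; PRe [3; 4]; PIm [3; 4]; PIm [2; 1; 4]; PRe [4; 3];
   PIm [2; 2; 3]; PRe [5; 2]; PIm [5; 2]; Stuf 4 3; Stuf 5 2; Exo 0; Exo 1;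
   MuRe [6; 2]; Dist 8; PRe [8]; PIm [8]; PRe [2; 6]; PIm [2; 6]; PRe [3; 5]; PIm [2; 1; 5]; PRe [4; 4];
   PIm [4; 4]; PIm [2; 2; 4]; PIm [3; 1; 4]; PRe [5; 3]; PIm [2; 3; 3]; PIm [4; 1; 3]; PIm [2; 2; 1; 3];
   PIm [3; 1; 1; 3]; PRe [6; 2]; PIm [6; 2]; PIm [5; 1; 2]; Stuf 4 4; Stuf 6 2; Exo 2;
   Exo 3]%nat.

(** * Checking a value of [is_A] *)

Inductive expr :=
| EPi | EV (w : list bool) | EZeta (a : list nat) | ERe (a : list nat) | EIm (a : list nat) | ENum (z : Z)
| EAdd (e f : expr) | ESub (e f : expr) | EOpp (e : expr) | EMul (e f : expr) | EDiv (e f : expr) | EPow (e : expr) (n : nat).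

Fixpoint interp (e : expr) : R :=
  match e with
  | EPi => PI | EV w => V w | EZeta a => mzv a | ERe a => Re (mu a) | EIm a => Im (mu a) | ENum z => IZR z
  | EAdd e f => interp e + interp f | ESub e f => interp e - interp f | EOpp e => - interp e
  | EMul e f => interp e * interp f | EDiv e f => interp e / interp f | EPow e n => interp e ^ n
  end.

Definition constant (p : pol) : option Q := match p with [([], c)] => if Qeq_bool c 0 then None else Some c | _ => None end.

Definition lift2 (f : pol -> pol -> pol) (a b : option pol) : option pol :=
  match a, b with Some p, Some q => Some (f p q) | _, _ => None end.

Fixpoint normal (T : table) (e : expr) : option pol :=
  match e with
  | EPi => Some (pscale 3 (pV T [true]))
  | EV w => Some (pV T w)
  | EZeta a => if admb a then Some (pZ T a) else None
  | ERe a => if admb a then Some (lookup T (vRe (Wof a))) else None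
  | EIm a => if admb a then Some (lookup T (vIm (Wof a))) else None
  | ENum z => Some (pconst (inject_Z z))
  | EAdd e f => lift2 padd (normal T e) (normal T f)
  | ESub e f => lift2 (fun p q => padd p (popp q)) (normal T e) (normal T f)
  | EOpp e => option_map popp (normal T e)
  | EMul e f => lift2 pmul (normal T e) (normal T f)
  | EDiv e f => match normal T f with
                | Some q => match constant q with Some c => option_map (pscale (/ c)) (normal T e) | None => None end
                | None => None
                end
  | EPow e n => option_map (fun p => ppow p n) (normal T e)
  end.

Lemma lift2_inv f a b r : lift2 f a b = Some r -> exists p q, a = Some p /\ b = Some q /\ r = f p q.
Proof. destruct a, b; simpl; try discriminate. intros [= <-]; eauto. Qed.

Lemma option_map_inv {A B} (f : A -> B) a r : option_map f a = Some r -> exists p, a = Some p /\ r = f p.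
Proof. destruct a; simpl; [intros [= <-]; eauto|discriminate]. Qed.

Lemma normal_eval T e p : sound val T -> normal T e = Some p -> peval val p = interp e.
Proof.
intros HT; revert p; induction e as [|w|a|a|a|z|e IH f IH'|e IH f IH'|e IH|e IH f IH'|e IH f IH'|e IH n]; intros p; cbn [normal interp].
- intros [= <-]. rewrite pscale_eval. change (Q2R 3 * peval val (pV T [true]) = PI). rewrite pV_eval, V_a by auto. unfold Q2R; simpl. field.
- intros [= <-]. apply pV_eval; auto.
- destruct (admb a) eqn:E; [|discriminate]. intros [= <-]. apply pZ_eval; auto.
- destruct (admb a) eqn:E; [|discriminate]. intros [= <-]. apply admb_spec in E; destruct E.
  rewrite lookup_eval, val_Re, mu_ell by auto. reflexivity.
- destruct (admb a) eqn:E; [|discriminate]. intros [= <-]. apply admb_spec in E; destruct E.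
  rewrite lookup_eval, val_Im, mu_ell by auto. reflexivity.
- intros [= <-]. rewrite pconst_eval. unfold Q2R; simpl. field.
- intros H; apply lift2_inv in H; destruct H as (x & y & ? & ? & ->). rewrite padd_eval, (IH x), (IH' y) by auto. reflexivity.
- intros H; apply lift2_inv in H; destruct H as (x & y & ? & ? & ->). rewrite padd_eval, popp_eval, (IH x), (IH' y) by auto. reflexivity.
- intros H; apply option_map_inv in H; destruct H as (x & ? & ->). rewrite popp_eval, (IH x) by auto. reflexivity.
- intros H; apply lift2_inv in H; destruct H as (x & y & ? & ? & ->). rewrite pmul_eval, (IH x), (IH' y) by auto. reflexivity.
- destruct (normal T f) as [q|]; [|discriminate]. destruct (constant q) as [c|] eqn:E; [|discriminate].
  intros H; apply option_map_inv in H; destruct H as (x & ? & ->). rewrite pscale_eval, (IH x), <- (IH' q) by auto.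
  unfold constant in E. destruct q as [|[[|] c'] [|]]; try discriminate. destruct (Qeq_bool c' 0) eqn:Z; [discriminate|].
  injection E as <-. apply Qeq_bool_neq in Z. rewrite Q2R_inv by auto.
  rewrite peval_cons. unfold peval; simpl. rewrite Rmult_1_r, Rplus_0_r. unfold Rdiv; ring.
- intros H; apply option_map_inv in H; destruct H as (x & ? & ->). rewrite ppow_eval, (IH x) by auto. reflexivity.
Qed.

Definition esum (l : list expr) : expr := fold_right EAdd (ENum 0) l.

Definition egexpo (k : nat) : expr :=
  let z := fun a => EZeta [a] in
  match k with
  | 0%nat => ENum 1 | 2%nat => EOpp (z 2%nat) | 3%nat => EMul (ENum 2) (z 3%nat)
  | 4%nat => EAdd (EMul (EOpp (EDiv (ENum 7) (ENum 2))) (z 4%nat)) (EDiv (EMul (z 2%nat) (z 2%nat)) (ENum 2))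
  | 5%nat => ESub (EMul (ENum 6) (z 5%nat)) (EMul (EMul (ENum 2) (z 2%nat)) (z 3%nat))
  | _ => ENum 0
  end.

Lemma egexpo_eval k : interp (egexpo k) = gexpo k.
Proof. destruct k as [|[|[|[|[|[|k]]]]]]; reflexivity. Qed.

Fixpoint eterms (m n N : nat) : expr :=
  match N with
  | O => ENum 0
  | S j => EAdd (eterms m n j)
     (EMul (egexpo (n - j)) (EMul (EMul (EPow (ENum (-1)) j) (EPow (ENum 2) (m + j))) (esum (map EV (Vwords m j)))))
  end.

Lemma eterms_eval m n N :
  interp (eterms m n N) = psum (fun j => gexpo (n - j) * ((-1) ^ j * 2 ^ (m + j) * lsum V (Vwords m j))) N.
Proof.
induction N as [|N IH]; [reflexivity|]. cbn [eterms interp psum]. rewrite IH, egexpo_eval. do 3 f_equal.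
generalize (Vwords m N) as l. induction l as [|w l IHl]; [reflexivity|].
cbn [map esum fold_right interp]. unfold esum in IHl. rewrite IHl. reflexivity.
Qed.

Record claim := Claim { cs_m : nat; cs_n : nat; cs_e : expr }.

Definition claim_holds (c : claim) : Prop := is_A (cs_m c + 2) (cs_n c) (interp (cs_e c)).

Definition claim_ok (T : table) (c : claim) : bool :=
  andb (Nat.leb (cs_n c) 5)
    match normal T (ESub (EMul (ENum (Z.of_nat (fact (cs_n c)))) (eterms (cs_m c) (cs_n c) (S (cs_n c)))) (cs_e c)) with
    | Some [] => true | _ => false
    end.

Lemma claim_ok_holds T c : sound val T -> claim_ok T c = true -> claim_holds c.
Proof.
intros HT H. apply andb_prop in H; destruct H as [H1 H2]. apply Nat.leb_le in H1.
match type of H2 with match normal T ?e with _ => _ end = true => destruct (normal T e) as [[|]|] eqn:E; try discriminate end.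
apply normal_eval in E; auto. cbn [interp] in E. rewrite eterms_eval, <- INR_IZR_INZ in E.
unfold claim_holds. replace (interp (cs_e c)) with
  (INR (fact (cs_n c)) * psum (fun j => gexpo (cs_n c - j) * ((-1) ^ j * 2 ^ (cs_m c + j) * lsum V (Vwords (cs_m c) j))) (S (cs_n c))).
- apply is_A_V; auto.
- unfold peval in E; simpl lsum at 1 in E. lra.
Qed.

Fixpoint all_hold (l : list claim) : Prop :=
  match l with [] => True | [c] => claim_holds c | c :: l' => claim_holds c /\ all_hold l' end.

(** The [let] in the hypothesis makes the evaluation build the table once for all claims. *)
Lemma claims_hold l : (let T := solution relations in forallb (claim_ok T) l) = true -> all_hold l.
Proof.
intros H. assert (HT := solution_sound relations). cbv zeta in H. revert H HT. generalize (solution relations) as T; intros T H HT.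
rewrite forallb_forall in H. induction l as [|c l IH]; [exact I|].
assert (Hc : claim_holds c) by (apply (claim_ok_holds T); auto; apply H; left; auto).
destruct l as [|d l]; [exact Hc|]. split; [exact Hc|]. apply IH. intros x Hx; apply H; right; exact Hx.
Qed.

Ltac reify t :=
  match t with
  | PI => constr:(EPi)
  | zeta ?k => constr:(EZeta [k])
  | mzv ?a => constr:(EZeta a)
  | Re (mu ?a) => constr:(ERe a)
  | Im (mu ?a) => constr:(EIm a)
  | IZR ?z => constr:(ENum z)
  | ?a + ?b => let x := reify a in let y := reify b in constr:(EAdd x y)
  | ?a - ?b => let x := reify a in let y := reify b in constr:(ESub x y)
  | - ?a => let x := reify a in constr:(EOpp x)
  | ?a * ?b => let x := reify a in let y := reify b in constr:(EMul x y)
  | ?a / ?b => let x := reify a in let y := reify b in constr:(EDiv x y)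
  | ?a ^ ?n => let x := reify a in constr:(EPow x n)
  end.

(** The exponent enters as m = s - 2, the form in which [is_A_V] provides it. *)
Ltac claims g :=
  match g with
  | ?a /\ ?b => let x := claims a in let y := claims b in let z := eval cbv [app] in (x ++ y) in constr:(z)
  | is_A ?s ?n ?v => let m := eval compute in (s - 2)%nat in let e := reify v in constr:([Claim m n e])
  end.

Theorem mainTheorem6 :
  is_A 3 0 (- (2^2 * zeta 3 / 3) + 2 * PI * Im (mu [2]%nat) / 3) /\
  is_A 3 1 (- (2 * (Im (mu [2]%nat))^2)) /\
  is_A 3 2 (- (2^2 * 11 * zeta 5 / 3^2) + 2^2 * PI^2 * zeta 3 / 3^2
            + 2^3 * PI^3 * Im (mu [2]%nat) / 3^3) /\
  is_A 3 3 (- (2^3 * 3^2 * (Re (mu [4;2]%nat)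
                            + Im (mu [4]%nat) * Im (mu [2]%nat)))
            + 2^4 * (zeta 3)^2 + 2 * PI^2 * (Im (mu [2]%nat))^2
            - 6691 * PI^6 / (2^3 * 3^6 * 5 * 7)) /\
  is_A 3 4 (- (6037 * zeta 7 / 3^3) - 2^6 * 3 * Re (mu [4;1;2]%nat)
            + 2^5 * 5 * PI * Im (mu [6]%nat)
            + 2^2 * 127 * PI^2 * zeta 5 / 3^3
            - 2^6 * 3 * Im (mu [2]%nat) * Im (mu [4;1]%nat)
            - 2^4 * PI^3 * Im (mu [4]%nat) / 3^3
            - 2^5 * 3 * zeta 3 * (Im (mu [2]%nat))^2
            - 2 * 491 * PI^4 * zeta 3 / (3^4 * 5)
            + 2^2 * 67 * PI^5 * Im (mu [2]%nat) / 3^5) /\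
  is_A 3 5 (- (2^5 * 3^3 * 5 * (Re (mu [6;2]%nat)
                                + Im (mu [6]%nat) * Im (mu [2]%nat)))
            - 2^8 * 5 * mzv [5;3]%nat / 3
            + 2^5 * 5 * 19 * zeta 5 * zeta 3
            + 2^4 * 3 * 5 * PI^2 * (Re (mu [4;2]%nat)
                                    + Im (mu [4]%nat) * Im (mu [2]%nat))
            - 2^5 * 5 * PI^2 * (zeta 3)^2 / 3
            + 2 * 3 * PI^4 * (Im (mu [2]%nat))^2
            - 443 * 1231 * PI^8 / (2^4 * 3^7 * 5 * 7)) /\
  is_A 5 0 (- (19 * zeta 5 / 3) + 2 * PI * Im (mu [4]%nat)
            + PI^2 * zeta 3 / 3^2) /\
  is_A 5 1 (2^2 * 3 * Re (mu [4;2]%nat) - 2^4 * (zeta 3)^2 / 3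
            + 6691 * PI^6 / (2^4 * 3^7 * 5 * 7)) /\
  is_A 5 2 (- (1423 * zeta 7 / (2^2 * 3^2)) + 19 * PI^2 * zeta 5 / 3^2
            + 2^3 * PI^3 * Im (mu [4]%nat) / 3^2
            + 31 * PI^4 * zeta 3 / (2 * 3^3 * 5)) /\
  is_A 5 3 (- (2^2 * 3^3 * (Im (mu [4]%nat))^2)
            - 2^2 * 19 * zeta 5 * zeta 3
            - 2^2 * 3 * PI^2 * Re (mu [4;2]%nat)
            + 2^4 * PI^2 * (zeta 3)^2 / 3
            - 6691 * PI^8 / (2^4 * 3^7 * 5 * 7)) /\
  is_A 6 0 (- (2^2 * PI * Im (mu [4;1]%nat) / 3) - 2^2 * (zeta 3)^2 / 3
            + 13 * 257 * PI^6 / (2^4 * 3^7 * 5 * 7)) /\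
  is_A 6 1 (- (6037 * zeta 7 / (2^3 * 3^4)) - 2^3 * Re (mu [4;1;2]%nat)
            + 2^2 * 5 * PI * Im (mu [6]%nat) / 3
            + 61 * PI^2 * zeta 5 / (2 * 3^4)
            - 2 * PI^3 * Im (mu [4]%nat) / 3^4
            - 653 * PI^4 * zeta 3 / (2^2 * 3^5 * 5)) /\
  is_A 6 2 (- (2^4 * PI^3 * Im (mu [4;1]%nat) / 3^3)
            - 2^3 * 11 * mzv [5;3]%nat / (3^2 * 5)
            - 2^3 * 11 * zeta 5 * zeta 3 / 3^2
            + 2^2 * PI^2 * (zeta 3)^2 / 3^2
            + 3970097 * PI^8 / (2^6 * 3^9 * 5^3 * 7)) /\
  is_A 7 0 (- (17 * 29 * zeta 7 / (2^3 * 3)) + 2 * 3 * PI * Im (mu [6]%nat)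
            + PI^2 * zeta 5 / 3 + 17 * PI^4 * zeta 3 / (2^2 * 3^4 * 5)) /\
  is_A 7 1 (2^2 * 3^2 * Re (mu [6;2]%nat) + 2^5 * mzv [5;3]%nat / 3^2
            - 2^3 * 43 * zeta 5 * zeta 3 / 3^2
            + 679153 * PI^8 / (2^7 * 3^8 * 5^2 * 7)).
Proof.
match goal with |- ?g => let l := claims g in assert (H : all_hold l) end.
(* The whole elimination and the fifteen comparisons of normal forms take place in this one
   evaluation. *)
{ apply claims_hold. vm_cast_no_check (eq_refl true). }
(* [interp] takes the reified values back to the stated ones, so the two propositions are
   convertible. *)
exact H.
Qed.
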